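(* Assume that $\mathbb{F}=\mathbb{F}_{p^r}$ is finite and let $G$ be a finite index subgroup of $\Gamma=\mathcal{G}(A)$ without $p'$-torsion. Let $\Sigma_0\subset H(\ell,k)\cup\{\infty\}$ be a set of representatives $(u,v)$ of the $G$-orbits in $H(\ell,k)\cup\{\infty\}$. Let $G^{\mathrm{ab}}$ be the largest abelian quotient of $G$ and $\mathrm{Tor}(G^{\mathrm{ab}})$ its torsion subgroup. Then: (a) $\mathrm{Tor}(G^{\mathrm{ab}})$ is isomorphic to $\coprod_{(u,v)\in\Sigma_0}\tilde{G}_{u,v}$; (b) the $\mathbb{Z}$-rank of $G^{\mathrm{ab}}/\mathrm{Tor}(G^{\mathrm{ab}})$ is less than or equal to $-\chi(G)$; (c) there exist a family $\{I_{u,v}:(u,v)\in\Sigma_0\}$ of non-trivial $B$-fractional ideals and a natural isomorphism between $\mathrm{Tor}(G^{\mathrm{ab}})$ and a finite index subgroup of $\coprod_{(u,v)\in\Sigma_0}I_{u,v}$. In particular, $G^{\mathrm{ab}}$ is not finitely generated.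
   Context: Setting. $\mathbb{F}$ is a field of characteristic $\neq 2$; $\mathcal{C}$ is a smooth, projective, geometrically integral curve over $\mathbb{F}$ with function field $k$; $\ell/k$ is a quadratic field extension such that $\mathbb{F}$ is algebraically closed in $\ell$ ($\ell$ is the function field of a geometrically integral curve $\mathcal{D}$ with a $2:1$ morphism $\mathcal{D}\to\mathcal{C}$); $x\mapsto\overline{x}$ is the nontrivial element of $\mathrm{Gal}(\ell/k)$, $N(x)=x\overline{x}$, $T(x)=x+\overline{x}$. $P$ is a closed point of $\mathcal{C}$ with a unique point $Q$ of $\mathcal{D}$ above it; $A\subset k$ is the ring of functions regular outside $P$; $B$ is the integral closure of $A$ in $\ell$. On $\ell^3$ consider the hermitian form $h(x,y)=x_{-1}\overline{y_1}+x_0\overline{y_0}+x_1\overline{y_{-1}}$, coordinates ordered $(x_{-1},x_0,x_1)$. $\mathcal{G}=\mathrm{SU}(h)$, so $\mathcal{G}(k)=\{g\in\mathrm{SL}_3(\ell): h(gx,gy)=h(x,y)\}$ and $\Gamma=\mathcal{G}(A)=\mathcal{G}(k)\cap\mathrm{SL}_3(B)$. $H(\ell,k)=\{(u,v)\in\ell^2: N(u)+T(v)=0\}$; for $(u,v)\in H(\ell,k)$, $\mathrm{u}_a(u,v)=\begin{pmatrix}1&-\overline{u}&v\\0&1&u\\0&0&1\end{pmatrix}$; $\mathcal{U}_a(k)=\mathrm{u}_a(H(\ell,k))$ and $\mathcal{U}_{2a}(k)=\{\mathrm{u}_a(0,v):T(v)=0\}$. $\mathcal{B}(k)$ is the group of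 upper triangular matrices in $\mathcal{G}(k)$. $\mathrm{s}$ is the $3\times3$ matrix with $-1$ on the antidiagonal and $0$ elsewhere. $g_{u,v}=\mathrm{s}\,\mathrm{u}_a(u,v)$ and $g_\infty=\mathrm{id}$ (when $(u,v)$ stands for $\infty$). The map $z\mapsto g_z^{-1}\mathcal{B}(k)$ is a bijection $H(\ell,k)\cup\{\infty\}\to\mathcal{G}(k)/\mathcal{B}(k)$, and $\mathcal{G}(k)$ acts on $H(\ell,k)\cup\{\infty\}$ through it by left translation. For $(u,v)\in H(\ell,k)\cup\{\infty\}$, $$\tilde{G}_{u,v}:=(g_{u,v}^{-1}\mathcal{U}_a(k)g_{u,v}\cap G)/(g_{u,v}^{-1}\mathcal{U}_{2a}(k)g_{u,v}\cap G).$$ Tree. $\nu$ is the normalized discrete valuation of $k$ at $P$ and also its unique extension to $\ell$. The standard apartment is the line $\mathbb{A}_0=\mathbb{R}a^\vee$, with the linear form $a(ra^\vee)=2r$; its vertices are the $x$ with $a(x)\in\frac12\nu(\ell^* )$. $\mathcal{S}$ is the torus of matrices $\mathrm{diag}(s,1,s^{-1})$; the group $\mathcal{N}(k)$ of $k$-points of its normalizer in $\mathcal{G}$ is generated by $\mathrm{s}$ and the $\tilde a(t)=\mathrm{diag}(t,\overline{t}t^{-1},\overline{t}^{-1})$, $t\in\ell^*$, and acts on $\mathbb{A}_0$ by $\tilde a(t)\cdot x=x-\frac12\nu(t)a^\vee$, $\mathrm{s}\cdot x=-x$. Put $\mathrm{u}_{-a}=\mathrm{s}\,\mathrm{u}_a\,\mathrm{s}$,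 $\mathcal{U}_{b,x}(k)=\{\mathrm{u}_b(u,v):(u,v)\in H(\ell,k),\ \nu(v)\ge-2b(x)\}$ for $b=\pm a$, and $\mathcal{U}_x(k)=\langle\mathcal{U}_{a,x}(k),\mathcal{U}_{-a,x}(k)\rangle$. The Bruhat-Tits tree is $X=\mathcal{G}(k)\times\mathbb{A}_0/\sim$, where $(g,x)\sim(h,y)$ iff there is $n\in\mathcal{N}(k)$ with $y=n\cdot x$ and $g^{-1}hn\in\mathcal{U}_x(k)$; $\mathcal{G}(k)$ acts on it by left multiplication, without inversions. A group is without $p'$-torsion if every element of finite order has $p$-power order. $\chi(G)=\sum_v 1/\sharp\mathrm{Stab}_G(v)-\sum_e 1/\sharp\mathrm{Stab}_G(e)$, where $v$ (resp. $e$) runs through representatives of the $G$-orbits of vertices (resp. unoriented edges) of $X$; both series converge. In (c) ''natural'' is used informally; the isomorphism is one of abelian groups. *)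

(* Defs.v *)
From HB Require Import structures.
From mathcomp Require Import all_boot all_order all_algebra all_field.
From mathcomp Require Import generic_quotient ring_quotient.
From mathcomp Require Import finmap boolp classical_sets cardinality.
From mathcomp Require Import reals ereal esum ring.

Set Implicit Arguments.
Unset Strict Implicit.
Unset Printing Implicit Defensive.

Import Order.TTheory GRing.Theory Num.Theory.

Local Open Scope classical_set_scope.
Local Open Scope ring_scope.
Local Open Scope quotient_scope.

(* A smooth projective geometrically integral curve over a finite (hence
   perfect) field F is given by its function field K, with structure map
   i : F -> K; its closed points are the normalized discrete valuations of K
   that are trivial on F. *)
Section Curves.
Context (F K : fieldType) (i : {rmorphism F -> K}).

Definition algebraically_closed_in : Prop :=
  forall x, algebraicOver i x -> exists c, x = i c.

Definition in_simple_ext (t x : K) : Prop :=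
  exists p q : {poly F}, (map_poly i q).[t] != 0 /\
    x = (map_poly i p).[t] / (map_poly i q).[t].

(* K is a finite extension of F(t) for some t transcendental over F. *)
Definition function_field : Prop :=
  exists2 t : K, ~ algebraicOver i t &
  exists n (b : 'I_n -> K), forall x, exists2 c : 'I_n -> K,
    (forall j, in_simple_ext t (c j)) & x = \sum_j c j * b j.

(* The value of a place at 0 is irrelevant. *)
Record place := Place {
  place_val :> K -> int;
  placeM : forall x y, x != 0 -> y != 0 ->
    place_val (x * y) = place_val x + place_val y;
  placeD : forall x y, x != 0 -> y != 0 -> x + y != 0 ->
    Num.min (place_val x) (place_val y) <= place_val (x + y);
  place_const : forall c, c != 0 -> place_val (i c) = 0;
  place_unif : exists2 x, x != 0 & place_val x = 1 }.

Definition same_place (P Q : place) : Prop := forall x, x != 0 -> P x = Q x.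

Definition regular_at (P : place) (x : K) : Prop := x = 0 \/ 0 <= P x.

Definition regular_outside (P : place) : set K :=
  [set x | forall Q : place, ~ same_place Q P -> regular_at Q x].

End Curves.

Section Covering.
Context (F k : fieldType) (iota : {rmorphism F -> k}) (L : fieldExtType k).

Definition const_ext : {rmorphism F -> L} := in_alg L \o iota.

(* Q lies above P with ramification index e. *)
Definition lies_above (P : place iota) (Q : place const_ext) (e : nat) : Prop :=
  (0 < e)%N /\ forall x : k, x != 0 -> Q x%:A = e%:Z * P x.

Definition integral_closure (A : set k) : set L :=
  [set x | exists p : {poly k},
     [/\ p \is monic, forall j, A p`_j & root (map_poly (in_alg L) p) x]].

(* The extension to L of the normalized valuation of k at P. *)
Definition nu (R : realType) (Q : place const_ext) (e : nat) (x : L) : R :=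
  (Q x)%:~R / e%:R.

End Covering.

(* Groups are handled as subgroups of the unit group of a ring R. *)
Section Subgroups.
Context (R : unitRingType).
Implicit Types S T : set R.

Definition is_subgroup S : Prop :=
  [/\ S 1, forall x y, S x -> S y -> S (x * y)
    & forall x, S x -> x \is a GRing.unit /\ S x^-1].

Record subgroup := Subgroup { sg_set :> R -> Prop; sgP : is_subgroup sg_set }.

(* For S contained in the unit group, the subgroup generated by S. *)
Definition generated S : set R :=
  [set x | forall T, is_subgroup T -> S `<=` T -> T x].

Definition comm (x y : R) : R := x^-1 * y^-1 * x * y.

Definition commutators S : set R := [set z | exists x y, [/\ S x, S y & z = comm x y]].

Definition conjset (g : R) S : set R := [set g^-1 * x * g | x in S].

Definition finite_index_in S T : Prop :=
  S `<=` T /\ exists s : seq R, forall x, T x ->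
    exists y z, [/\ y \in s, S z & x = y * z].

Definition has_order (x : R) (n : nat) : Prop :=
  [/\ (0 < n)%N, x ^+ n = 1 & forall m, (0 < m)%N -> x ^+ m = 1 -> (n <= m)%N].

Definition no_p'_torsion (p : nat) S : Prop :=
  forall x n, S x -> has_order x n -> exists m, n = (p ^ m)%N.

Lemma subgroupI S T : is_subgroup S -> is_subgroup T -> is_subgroup (S `&` T).
Proof.
move=> [S1 SM SV] [T1 TM TV]; split=> [//|x y [Sx Tx] [Sy Ty]|x [Sx Tx]].
  by split; [apply: SM | apply: TM].
by have [? ?] := SV _ Sx; have [? ?] := TV _ Tx.
Qed.

Lemma subgroup_conj g S :
  g \is a GRing.unit -> is_subgroup S -> is_subgroup (conjset g S).
Proof.
move=> ug [S1 SM SV]; split.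
- by exists 1 => //; rewrite mulr1 mulVr.
- move=> _ _ [x Sx <-] [y Sy <-]; exists (x * y); first exact: SM.
  by rewrite !mulrA mulrK.
- move=> _ [x Sx <-]; have [ux SVx] := SV _ Sx; split.
    by rewrite !unitrMl ?unitrV.
  exists x^-1 => //; rewrite invrM ?invrM ?invrK ?unitrMl ?unitrV //.
  by rewrite mulrA.
Qed.

Lemma comm_conj g x y : g \is a GRing.unit -> x \is a GRing.unit ->
  y \is a GRing.unit ->
  comm (g^-1 * x * g) (g^-1 * y * g) = g^-1 * comm x y * g.
Proof.
move=> ug ux uy; rewrite /comm.
have V z : z \is a GRing.unit -> (g^-1 * z * g)^-1 = g^-1 * z^-1 * g.
  by move=> uz; rewrite invrM ?invrM ?invrK ?unitrMl ?unitrV // mulrA.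
by rewrite !V // !mulrA !mulrK.
Qed.

Lemma generated_min S T : is_subgroup T -> S `<=` T -> generated S `<=` T.
Proof. by move=> sT ST x; apply. Qed.

Lemma generated_subgroup S T :
  is_subgroup T -> S `<=` T -> is_subgroup (generated S).
Proof.
move=> sT ST; split.
- by move=> U [].
- by move=> x y Gx Gy U sU SU; case: (sU) => _ UM _; apply: UM; [apply: Gx|apply: Gy].
- move=> x Gx; split; first by have [_ _ TV] := sT; case: (TV x) => //; apply: Gx.
  by move=> U sU SU; have [_ _ UV] := sU; case: (UV x) => //; apply: Gx.
Qed.

Lemma subgroup_comm S x y : is_subgroup S -> S x -> S y -> S (comm x y).
Proof.
move=> [_ SM SV] Sx Sy; have [_ ?] := SV _ Sx; have [_ ?] := SV _ Sy.
by apply: (SM) => //; apply: (SM) => //; apply: (SM).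
Qed.

Lemma commutators_sub (T : subgroup) : commutators T `<=` T.
Proof. by move=> _ [x [y [Tx Ty ->]]]; apply: subgroup_comm => //; apply: sgP. Qed.

End Subgroups.

(* Given subgroups bot <= top with [top, top] <= bot, the abelian group
   top / bot, written additively. *)
Record ab_pair (R : unitRingType) := AbPair {
  ab_top : subgroup R;
  ab_bot : subgroup R;
  ab_sub : ab_bot `<=` ab_top;
  ab_comm : forall x y, ab_top x -> ab_top y -> ab_bot (comm x y) }.

Section AbQuotient.
Context (R : unitRingType) (T : ab_pair R).
Local Notation top := (ab_top T).
Local Notation bot := (ab_bot T).

Definition ab_elt := {x : R | x \in (top : set R)}.
HB.instance Definition _ := Choice.on ab_elt.

Lemma ab_eltP (x : ab_elt) : top (val x).
Proof. exact/set_mem/(valP x). Qed.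

Definition ab_Elt x (Tx : top x) : ab_elt := exist _ x (mem_set Tx).

Lemma ab_unit (x : ab_elt) : val x \is a GRing.unit.
Proof. by have [_ _ /(_ _ (ab_eltP x))[]] := sgP top. Qed.

Definition ab_rel (x y : ab_elt) : bool := `[< bot ((val x)^-1 * val y) >].

Lemma ab_rel_equiv : equiv_class_of ab_rel.
Proof.
have [b1 bM bV] := sgP bot; split.
- by move=> x; apply/asboolP; rewrite mulVr ?ab_unit.
- have sym x y : ab_rel x y -> ab_rel y x.
    move=> /asboolP/bV[_ h]; apply/asboolP.
    by move: h; rewrite invrM ?unitrV ?ab_unit // invrK.
  by move=> x y; apply/idP/idP; apply: sym.
- move=> y x z /asboolP xy /asboolP yz; apply/asboolP.
  by have := bM _ _ xy yz; rewrite mulrA mulrK ?ab_unit.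
Qed.

Canonical ab_equiv := EquivRelPack ab_rel_equiv.

Definition ab_quotient := {eq_quot ab_equiv}.
HB.instance Definition _ := Choice.on ab_quotient.
HB.instance Definition _ := EqQuotient.on ab_quotient.

Lemma ab_one_subproof : top 1. Proof. by case: (sgP top). Qed.
Lemma ab_mul_subproof (x y : ab_elt) : top (val x * val y).
Proof. by case: (sgP top) => _ tM _; apply: tM; apply: ab_eltP. Qed.
Lemma ab_inv_subproof (x : ab_elt) : top (val x)^-1.
Proof. by case: (sgP top) => _ _ /(_ _ (ab_eltP x))[]. Qed.

Definition ab_zero : ab_quotient := \pi_ab_quotient (ab_Elt ab_one_subproof).
Definition ab_add (X Y : ab_quotient) : ab_quotient :=
  \pi_ab_quotient (ab_Elt (ab_mul_subproof (repr X) (repr Y))).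
Definition ab_opp (X : ab_quotient) : ab_quotient :=
  \pi_ab_quotient (ab_Elt (ab_inv_subproof (repr X))).

Lemma ab_piP (x y : ab_elt) :
  (\pi_ab_quotient x = \pi_ab_quotient y) <-> bot ((val x)^-1 * val y).
Proof.
split=> [/eqquotP/asboolP //|h]; apply/eqquotP/asboolP; exact: h.
Qed.

Lemma ab_pi_val (x y : ab_elt) :
  val x = val y -> \pi_ab_quotient x = \pi_ab_quotient y.
Proof. by move=> /val_inj->. Qed.

Lemma ab_reprP (x : ab_elt) : bot ((val x)^-1 * val (repr (\pi_ab_quotient x))).
Proof. by apply/ab_piP; rewrite reprK. Qed.

Lemma ab_swap x y z : top x -> top y -> top z -> bot (x * y * z) -> bot (x * z * y).
Proof.
move=> tx ty tz h; have [_ bM _] := sgP bot.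
have [_ _ tV] := sgP top.
have [ux _] := tV _ tx; have [uy _] := tV _ ty; have [uz _] := tV _ tz.
have -> : x * z * y = x * y * z * comm z y.
  by rewrite /comm !mulrA mulrK ?mulrK.
by apply: (bM) => //; apply: ab_comm.
Qed.

Lemma ab_addE (x y : ab_elt) :
  ab_add (\pi_ab_quotient x) (\pi_ab_quotient y) = \pi_ab_quotient (ab_Elt (ab_mul_subproof x y)).
Proof.
have [_ bM _] := sgP bot; have [_ tM tV] := sgP top.
apply/esym/ab_piP => /=.
have := ab_reprP x; have := ab_reprP y.
set x' := repr _; set y' := repr _ => hy hx.
have := ab_eltP x; have := ab_eltP y; have := ab_eltP x'; have := ab_eltP y'.
have ux := ab_unit x; have uy := ab_unit y.
move=> ty' tx' ty tx; have [_ tyV] := tV _ ty; have [_ txV] := tV _ tx.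
rewrite invrM // !mulrA; apply: ab_swap => //; first exact: (tM).
rewrite -mulrA; apply: ab_swap => //; first exact: (tM).
rewrite !mulrA; apply: ab_swap => //; first exact: (tM).
by have := bM _ _ hy hx; rewrite !mulrA.
Qed.

Lemma ab_addC : commutative ab_add.
Proof.
move=> X Y; rewrite -[X]reprK -[Y]reprK !ab_addE; apply/ab_piP => /=.
rewrite invrM ?ab_unit // !mulrA.
by apply: (ab_comm (x := val (repr Y))); apply: ab_eltP.
Qed.

Lemma ab_addA : associative ab_add.
Proof.
elim/quotW=> x; elim/quotW=> y; elim/quotW=> z.
rewrite (ab_addE y z) (ab_addE x y) !ab_addE.
by apply: ab_pi_val; rewrite /= mulrA.
Qed.

Lemma ab_add0 : left_id ab_zero ab_add.
Proof.
move=> X; rewrite -[X]reprK /ab_zero ab_addE.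
by apply: ab_pi_val; rewrite /= mul1r.
Qed.

Lemma ab_addN : left_inverse ab_zero ab_opp ab_add.
Proof.
move=> X; rewrite -{2}[X]reprK /ab_opp /ab_zero ab_addE.
by apply: ab_pi_val; rewrite /= mulVr ?ab_unit.
Qed.

HB.instance Definition _ :=
  GRing.isZmodule.Build ab_quotient ab_addA ab_addC ab_add0 ab_addN.

End AbQuotient.

Section Abelianization.
Context (R : unitRingType) (G : subgroup R).

Definition derived_subgroup : subgroup R :=
  Subgroup (generated_subgroup (sgP G) (@commutators_sub _ G)).

Lemma derived_sub : derived_subgroup `<=` G.
Proof. exact: generated_min (sgP G) (@commutators_sub _ G). Qed.

Lemma derived_comm x y : G x -> G y -> derived_subgroup (comm x y).
Proof. by move=> Gx Gy T _; apply; exists x, y. Qed.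

Definition abelianization : zmodType :=
  ab_quotient (AbPair derived_sub derived_comm).

End Abelianization.

Section AbelianGroups.
Implicit Type V : zmodType.

Definition torsion V : {pred V} :=
  [pred x | `[< exists2 n, (0 < n)%N & x *+ n = 0 >]].

Arguments torsion : clear implicits.

Lemma torsion_zmod_closed V : zmod_closed (torsion V).
Proof.
split; first by apply/asboolP; exists 1%N.
move=> x y /asboolP[m m0 xm] /asboolP[n n0 yn]; apply/asboolP.
exists (m * n)%N; first by rewrite muln_gt0 m0.
by rewrite mulrnBl mulrnA xm mul0rn mulnC mulrnA yn mul0rn subrr.
Qed.
HB.instance Definition _ V :=
  GRing.isZmodClosed.Build V (torsion V) (torsion_zmod_closed V).

Definition Tor V := {x : V | x \in torsion V}.
HB.instance Definition _ V := SubChoice.on (Tor V).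
HB.instance Definition _ V := [SubChoice_isSubZmodule of Tor V by <:].

Definition mod_Tor V : zmodType := Quotient.quot (torsion V).

Definition z_independent V m (x : 'I_m -> V) : Prop :=
  forall c : 'I_m -> int, \sum_j x j *~ c j = 0 -> forall j, c j = 0.

Definition is_z_rank V n : Prop :=
  (exists x : 'I_n -> V, z_independent x) /\
  (forall m (x : 'I_m -> V), z_independent x -> (m <= n)%N).

Definition z_finitely_generated V : Prop :=
  exists m (x : 'I_m -> V), forall y, exists c : 'I_m -> int,
    y = \sum_j x j *~ c j.

Definition isomorphic (V W : zmodType) : Prop := exists f : {additive V -> W}, bijective f.

Definition finite_index_image (V W : zmodType) (f : V -> W) : Prop :=
  exists s : seq W, forall y, exists z x, z \in s /\ y = z + f x.

End AbelianGroups.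

Section DirectSum.
Context (I : Type) (V : I -> zmodType).

(* The coproduct of the V i: families of finite support. *)
Record dsum := Dsum {
  ds_fun :> forall i, V i;
  ds_finite : finite_set [set i | ds_fun i != 0] }.
HB.instance Definition _ := gen_eqMixin dsum.
HB.instance Definition _ := gen_choiceMixin dsum.

Lemma dsum_eq (x y : dsum) : (forall i, x i = y i) -> x = y.
Proof.
case: x y => [f hf] [g hg] /= fg.
have e : f = g by apply: functional_extensionality_dep.
by subst g; congr Dsum; apply: Prop_irrelevance.
Qed.

Lemma dsum_zero_subproof : finite_set [set i | (0 : V i) != 0].
Proof.
by rewrite (_ : [set _ | _] = set0) // -subset0 => i /=; rewrite eqxx.
Qed.

Lemma dsum_opp_subproof (x : dsum) : finite_set [set i | - x i != 0].
Proof.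
by apply: sub_finite_set (ds_finite x) => i /=; rewrite oppr_eq0.
Qed.

Lemma dsum_add_subproof (x y : dsum) : finite_set [set i | x i + y i != 0].
Proof.
apply: (@sub_finite_set _ _ ([set i | x i != 0] `|` [set i | y i != 0])).
  move=> i /=; case: (eqVneq (x i) 0) => [->|]; last by left.
  by rewrite add0r; right.
by rewrite finite_setU; split; apply: ds_finite.
Qed.

Definition dsum_zero := Dsum dsum_zero_subproof.
Definition dsum_opp x := Dsum (dsum_opp_subproof x).
Definition dsum_add x y := Dsum (dsum_add_subproof x y).

Lemma dsum_addA : associative dsum_add.
Proof. by move=> x y z; apply: dsum_eq => i; apply: addrA. Qed.
Lemma dsum_addC : commutative dsum_add.
Proof. by move=> x y; apply: dsum_eq => i; apply: addrC. Qed.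
Lemma dsum_add0 : left_id dsum_zero dsum_add.
Proof. by move=> x; apply: dsum_eq => i; apply: add0r. Qed.
Lemma dsum_addN : left_inverse dsum_zero dsum_opp dsum_add.
Proof. by move=> x; apply: dsum_eq => i; apply: addNr. Qed.

HB.instance Definition _ :=
  GRing.isZmodule.Build dsum dsum_addA dsum_addC dsum_add0 dsum_addN.

End DirectSum.

(* For B a Noetherian domain with fraction field L, the condition fi_denom is
   equivalent to finite generation over B. *)
Section FractionalIdeals.
Context (L : fieldType) (B : set L).

Record frac_ideal := FracIdeal {
  fi_set :> L -> Prop;
  fi_zero : fi_set 0;
  fi_sub : forall x y, fi_set x -> fi_set y -> fi_set (x - y);
  fi_mul : forall b x, B b -> fi_set x -> fi_set (b * x);
  fi_denom : exists d, [/\ d != 0, B d & forall x, fi_set x -> B (d * x)] }.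

Definition fi_pred (I : frac_ideal) : {pred L} := [pred x | `[< I x >]].

Lemma fi_zmod_closed I : zmod_closed (fi_pred I).
Proof.
split; first exact/asboolP/fi_zero.
by move=> x y /asboolP Ix /asboolP Iy; apply/asboolP/fi_sub.
Qed.
HB.instance Definition _ I := GRing.isZmodClosed.Build L (fi_pred I) (fi_zmod_closed I).

Definition fi_group I := {x : L | x \in fi_pred I}.
HB.instance Definition _ I := SubChoice.on (fi_group I).
HB.instance Definition _ I := [SubChoice_isSubZmodule of fi_group I by <:].

Definition nontrivial_ideal (I : frac_ideal) : Prop := exists2 x, I x & x != 0.

End FractionalIdeals.

Definition orbit_reps (R : unitRingType) (T : Type) (act : R -> T -> T -> Prop)
    (G : set R) (X S : set T) : Prop :=
  S `<=` X /\
  forall x, X x -> exists! s, S s /\ exists2 g, G g & act g s x.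

Definition mx3 (R : nzRingType) (rows : seq (seq R)) : 'M[R]_3 :=
  \matrix_(i, j) (nth [::] rows i)`_j.

(* The coordinates -1, 0, 1 are the indices 0, 1, 2 of 'I_3. *)
(* As L is a finite extension of k, 'AEnd(L) is the group of k-automorphisms
   of L; bar is meant to be the nontrivial one, L being quadratic over k. *)
Section UnitaryGroup.
Context (k : fieldType) (L : fieldExtType k) (bar : 'AEnd(L)).
Local Notation M := 'M[L]_3.

Definition norm (x : L) : L := x * bar x.
Definition trace (x : L) : L := x + bar x.

Definition herm (x y : 'cV[L]_3) : L :=
  x 0 0 * bar (y 2%R 0) + x 1 0 * bar (y 1 0) + x 2%R 0 * bar (y 0 0).

Definition SU : set M :=
  [set g | \det g = 1 /\ forall x y, herm (g *m x) (g *m y) = herm x y].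

Definition SU_over (B : set L) : set M :=
  SU `&` [set g | forall i j, B (g i j)].

Definition Borel : set M := SU `&` [set g | forall i j : 'I_3, (j < i)%N -> g i j = 0].

Definition Hset : set (L * L) := [set z | norm z.1 + trace z.2 = 0].

Definition ua (z : L * L) : M :=
  mx3 [:: [:: 1; - bar z.1; z.2];
          [:: 0; 1;         z.1];
          [:: 0; 0;         1  ]].

Definition Ua : set M := [set ua z | z in Hset].
Definition U2a : set M := [set ua (0, v) | v in [set v | trace v = 0]].

Definition smat : M :=
  mx3 [:: [:: 0; 0; -1]; [:: 0; -1; 0]; [:: -1; 0; 0]].

Definition uma (z : L * L) : M := smat * ua z * smat.

Definition ta (t : L) : M :=
  mx3 [:: [:: t; 0; 0]; [:: 0; bar t / t; 0]; [:: 0; 0; (bar t)^-1]].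

(* None is the point at infinity. *)
Definition Hinf : set (option (L * L)) :=
  [set o | if o is Some z then Hset z else True].

Definition gz (o : option (L * L)) : M := if o is Some z then smat * ua z else 1.

Definition flag (o : option (L * L)) : set M := [set (gz o)^-1 * b | b in Borel].

Definition act_H (g : M) (o o' : option (L * L)) : Prop :=
  [set g * m | m in flag o] = flag o'.

Lemma uaM z w : ua z * ua w = ua (z.1 + w.1, z.2 + w.2 - bar z.1 * w.1).
Proof.
apply/matrixP => i j; rewrite !mxE !big_ord_recl big_ord0 !mxE /= rmorphD /=.
case: i j => [[|[|[|i]]] //= hi] [[|[|[|j]]] //= hj] /=;
  rewrite ?(mul0r, mulr0, mul1r, mulr1, add0r, addr0, oppr0) //.
all: ring.
Qed.

Lemma ua0 : ua (0, 0) = 1.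
Proof.
apply/matrixP => i j; rewrite !mxE /= rmorph0 oppr0.
by case: i j => [[|[|[|i]]] //= hi] [[|[|[|j]]] //= hj] /=.
Qed.

Lemma uaK z : ua z * ua (- z.1, - z.2 - bar z.1 * z.1) = 1.
Proof.
rewrite uaM /= -ua0; congr (ua (_, _)); first by rewrite subrr.
by rewrite addrA subrr add0r mulrN opprK addNr.
Qed.

Lemma ua_unit z : ua z \is a GRing.unit.
Proof. by have /mulmx1_unit[] := uaK z. Qed.

Lemma uaV z : (ua z)^-1 = ua (- z.1, - z.2 - bar z.1 * z.1).
Proof.
by apply: (mulrI (ua_unit z)); rewrite mulrV ?ua_unit // uaK.
Qed.

Lemma smatK : smat * smat = 1.
Proof.
apply/matrixP => i j; rewrite !mxE !big_ord_recl big_ord0 !mxE /=.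
case: i j => [[|[|[|i]]] //= hi] [[|[|[|j]]] //= hj] /=;
  by rewrite ?(mul0r, mulr0, mulrNN, mulr1, add0r, addr0).
Qed.

Lemma gz_unit o : gz o \is a GRing.unit.
Proof.
case: o => [z|]; last exact: unitr1.
by rewrite /gz unitrMl ?ua_unit //; have /mulmx1_unit[] := smatK.
Qed.

End UnitaryGroup.

Section CuspGroups.
Context (k : fieldType) (L : fieldExtType k) (dimL : \dim {:L} = 2%N).
Context (bar : 'AEnd(L)).
Local Notation M := 'M[L]_3.

Lemma quadratic_involutive : involutive bar.
Proof.
move=> x; set p := minPoly 1%VS x.
have bar1 c : c \in 1%VS -> bar c = c.
  by case/vlineP=> a ->; rewrite linearZ /= rmorph1.
have p1 : forall i, bar p`_i = p`_i.
  by move=> i; apply: bar1; apply: (polyOverP (minPolyOver 1%AS x)).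
have px : p.[x] = 0 by apply/rootP; apply: root_minPoly.
have pbx : p.[bar x] = 0.
  rewrite -(rmorph0 bar) -px -horner_map; congr (_.[_]).
  by apply/polyP => i; rewrite coef_map; exact/esym/p1.
have szp : (size p <= 3)%N.
  rewrite size_minPoly ltnS.
  have := dim_Fadjoin 1%AS x; rewrite dimv1 muln1 => <-.
  by rewrite -[X in (_ <= X)%N]dimL dimvS ?subvf.
have mp : lead_coef p = 1 by apply/eqP; apply: monic_minPoly.
have [e|neq] := eqVneq (bar x) x; first by rewrite !e.
have hE y : p.[y] = p`_0 + p`_1 * y + p`_2 * y ^+ 2.
  by rewrite (horner_coef_wide _ szp) !big_ord_recl big_ord0 /=; ring.
have nz : bar x - x != 0 by rewrite subr_eq0.
have h : (bar x - x) * (p`_1 + p`_2 * (bar x + x)) = 0.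
  have e : p.[bar x] - p.[x] = 0 by rewrite pbx px subrr.
  by apply: (eq_trans _ e); rewrite !hE; ring.
have {}h : p`_1 + p`_2 * (bar x + x) = 0.
  by apply/eqP; move/eqP: h; rewrite mulf_eq0 (negPf nz).
have p2 : p`_2 != 0.
  apply/eqP => p2; move: mp h; rewrite p2 mul0r addr0 => mp p1z; move: mp.
  have -> : p = (p`_0)%:P.
    apply/polyP => -[|[|[|i]]]; rewrite coefC //=.
    by rewrite nth_default // (leq_trans szp).
  rewrite lead_coefC => p0; have /eqP := px.
  by rewrite hE p0 p1z p2 !mul0r !addr0 oner_eq0.
have h2 := congr1 bar h.
rewrite rmorphD rmorphM rmorphD rmorph0 /= !p1 in h2.
have /eqP : p`_2 * (bar (bar x) - x) = 0.
  have e : p`_1 + p`_2 * (bar (bar x) + bar x) - (p`_1 + p`_2 * (bar x + x)) = 0.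
    by rewrite h h2 subrr.
  by apply: (eq_trans _ e); ring.
by rewrite mulf_eq0 (negPf p2) subr_eq0 => /eqP.
Qed.

Lemma Hset_opp z : Hset bar z -> - z.2 - bar z.1 * z.1 = bar z.2.
Proof.
rewrite /Hset /= /norm /trace => h; apply/eqP; rewrite eq_sym -subr_eq0; apply/eqP.
by rewrite -h; ring.
Qed.

Lemma Ua_subgroup : is_subgroup (Ua bar).
Proof.
split.
- exists (0, 0); last exact: ua0.
  by rewrite /Hset /= /norm /trace !rmorph0 mulr0 !addr0.
- move=> _ _ [z hz <-] [w hw <-]; rewrite uaM.
  exists (z.1 + w.1, z.2 + w.2 - bar z.1 * w.1) => //.
  move: hz hw; rewrite /Hset /= /norm /trace => hz hw.
  rewrite rmorphB !rmorphD rmorphM /= quadratic_involutive.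
  by rewrite -[RHS](addr0 0) -{1}hz -hw; ring.
- move=> _ [z hz <-]; split; first exact: ua_unit.
  rewrite uaV Hset_opp //; exists (- z.1, bar z.2) => //.
  move: hz; rewrite /Hset /= /norm /trace quadratic_involutive rmorphN => <-.
  by ring.
Qed.

Lemma U2a_subgroup : is_subgroup (U2a bar).
Proof.
split.
- by exists 0; [rewrite /= /trace rmorph0 addr0 | exact: ua0].
- move=> _ _ [v hv <-] [w hw <-]; rewrite uaM /= rmorph0 mul0r subr0 addr0.
  exists (v + w) => //; move: hv hw; rewrite /= /trace => hv hw.
  by rewrite rmorphD -[RHS](addr0 0) -{1}hv -hw /=; ring.
- move=> _ [v hv <-]; split; first exact: ua_unit.
  rewrite uaV /= rmorph0 mul0r subr0 oppr0; exists (- v) => //.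
  by move: hv; rewrite /= /trace rmorphN -opprD => ->; rewrite oppr0.
Qed.

Lemma U2a_sub : U2a bar `<=` Ua bar.
Proof.
move=> _ [v hv <-]; exists (0, v) => //.
by rewrite /Hset /= /norm mul0r add0r.
Qed.

Lemma Ua_comm x y : Ua bar x -> Ua bar y -> U2a bar (comm x y).
Proof.
move=> ax ay.
have : Ua bar (comm x y) by apply: subgroup_comm => //; exact: Ua_subgroup.
case: ax ay => [z hz <-] [w hw <-].
rewrite /comm !uaV !uaM /=.
set A := (X in ua bar (X, _)); set B := (X in ua bar (_, X)).
have -> : A = 0 by rewrite /A; ring.
case=> -[a b] h e; exists B => //=.
have ea : a = 0 by have := congr1 (fun m : M => m 1 2%R) e; rewrite !mxE.
have eb : b = B by have := congr1 (fun m : M => m 0 2%R) e; rewrite !mxE.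
by move: h; rewrite ea eb /Hset /= /norm mul0r add0r.
Qed.

Context (G : subgroup M) (o : option (L * L)).

Definition cusp_top : subgroup M :=
  Subgroup (subgroupI (subgroup_conj (gz_unit bar o) Ua_subgroup) (sgP G)).
Definition cusp_bot : subgroup M :=
  Subgroup (subgroupI (subgroup_conj (gz_unit bar o) U2a_subgroup) (sgP G)).

Lemma cusp_sub : cusp_bot `<=` cusp_top.
Proof. by move=> _ [[x ux <-] Gx]; split=> //; exists x => //; apply: U2a_sub. Qed.

Lemma cusp_comm x y : cusp_top x -> cusp_top y -> cusp_bot (comm x y).
Proof.
move=> [[a ua <-] Gx] [[b ub <-] Gy].
split; last by apply: subgroup_comm => //; exact: sgP.
have [_ _ V] := Ua_subgroup.
exists (comm a b); first exact: Ua_comm.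
by rewrite comm_conj ?gz_unit //; [case: (V _ ua) | case: (V _ ub)].
Qed.

(* (g_o^-1 U_a(k) g_o `&` G) / (g_o^-1 U_2a(k) g_o `&` G) *)
Definition cusp_group : zmodType := ab_quotient (AbPair cusp_sub cusp_comm).

End CuspGroups.

(* The standard apartment is identified with R, the real number r standing for
   the point r a^\vee; so a takes the value 2 r at r.  In what follows, nu is
   a function L -> R whose value at 0 is irrelevant. *)
Section Tree.
Context (k : fieldType) (L : fieldExtType k) (bar : 'AEnd(L)).
Context (R : realType) (nu : L -> R).
Local Notation M := 'M[L]_3.

Definition root_a (r : R) : R := 2 * r.

Definition apt_vertex : set R :=
  [set r | exists2 t : L, t != 0 & root_a r = nu t / 2].

(* N_act n r r' states that n is in N(k) and that n maps r to r' in the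
   standard apartment; N(k) is the group generated by s and the ta t, which is
   the monoid they generate since s and ta t have inverses s and ta t^-1. *)
Inductive N_act : M -> R -> R -> Prop :=
| N_one r : N_act 1 r r
| N_s n r r' : N_act n r r' -> N_act (smat L * n) r (- r')
| N_ta t n r r' : t != 0 -> N_act n r r' ->
    N_act (ta bar t * n) r (r' - nu t / 2).

Definition nu_ge (x : L) (c : R) : Prop := x = 0 \/ c <= nu x.

Definition Uax (r : R) : set M :=
  [set ua bar z | z in [set z | Hset bar z /\ nu_ge z.2 (- 2 * root_a r)]].

Definition Umax (r : R) : set M :=
  [set uma bar z | z in [set z | Hset bar z /\ nu_ge z.2 (- 2 * - root_a r)]].

Definition Ux (r : R) : set M := generated (Uax r `|` Umax r).

Definition tree_eq (p q : M * R) : Prop :=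
  [/\ SU bar p.1, SU bar q.1 &
    exists2 n, N_act n p.2 q.2 & Ux p.2 (p.1^-1 * q.1 * n)].

Definition tree_pt (p : M * R) : set (M * R) := [set q | tree_eq p q].

Definition vertices : set (set (M * R)) :=
  [set v | exists g r, [/\ SU bar g, apt_vertex r & v = tree_pt (g, r)]].

Definition apt_edge (r r' : R) : Prop :=
  [/\ apt_vertex r, apt_vertex r', r < r' &
    forall r0, r < r0 < r' -> ~ apt_vertex r0].

(* An unoriented edge is the set of its two end points. *)
Definition edges : set (set (set (M * R))) :=
  [set e | exists g r r', [/\ SU bar g, apt_edge r r' &
     e = [set tree_pt (g, r); tree_pt (g, r')]]].

Definition move_v (g : M) (v : set (M * R)) : set (M * R) :=
  [set (g * p.1, p.2) | p in v].

Definition move_e (g : M) (e : set (set (M * R))) : set (set (M * R)) :=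
  [set move_v g v | v in e].

Definition act_v (g : M) v w : Prop := move_v g v = w.
Definition act_e (g : M) e f : Prop := move_e g e = f.

Definition stab_v (G : set M) v : set M := G `&` [set g | act_v g v v].
Definition stab_e (G : set M) e : set M := G `&` [set g | act_e g e e].

(* 1 / #S, with value 0 when S is infinite. *)
Definition inv_card (S : set M) : R := (#|` fset_set S|%:R)^-1.

(* The sums run over sets V0 and E0 of representatives of the orbits of
   vertices and edges. *)
Definition sum_v (G : set M) (V0 : set (set (M * R))) : \bar R :=
  \esum_(v in V0) (inv_card (stab_v G v))%:E.
Definition sum_e (G : set M) (E0 : set (set (set (M * R)))) : \bar R :=
  \esum_(e in E0) (inv_card (stab_e G e))%:E.

(* Meaningful when both sums are finite. *)
Definition chi (G : set M) V0 E0 : R := fine (sum_v G V0) - fine (sum_e G E0).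

End Tree.

(* Main.v *)
Require Import Defs.
From HB Require Import structures.
From mathcomp Require Import all_boot all_order all_algebra all_field.
From mathcomp Require Import generic_quotient ring_quotient.
From mathcomp Require Import finmap boolp classical_sets functions cardinality fsbigop.
From mathcomp Require Import reals ereal esum ring zify.

Set Implicit Arguments.
Unset Strict Implicit.
Unset Printing Implicit Defensive.

Import Order.TTheory GRing.Theory Num.Theory.

Local Open Scope classical_set_scope.
Local Open Scope ring_scope.

(* A vertex of the tree X with non-trivial stabilizer in G is stabilized by a
   group of exponent p, which fixes a unique isotropic line; such vertices lie on
   rays towards that line. Collapsing, for each line, the vertices attached to it
   gives a tree on whose edges G acts freely, with finitely many orbits of edges
   and of remaining vertices: the others have trivial stabilizer and carry no
   short integral vector, hence have a basis of integral vectors of bounded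
   length, and finitely many Gram matrices and residue classes occur.
   A homomorphism from G that kills all elements of order p is therefore a
   combination of integral cocycles phi_e, one for each orbit of free edges, and
   the orbits of free vertices impose independent relations on the phi_e. This
   bounds the rank by n_e - n_v; along the rays the terms of the two series for
   chi(G) cancel, so that chi(G) = n_v - n_e. Composing with multiplication by p
   shows that Tor(G^ab) has exponent p. Conversely a homomorphism to L from the
   stabilizer of a vertex of the collapsed tree extends to G. Applied to
   u_a(u, v) |-> u it shows that Tor(G^ab) is infinite.
   The groups in (a) and (c) are all countable, infinite and of exponent p, hence
   isomorphic; in (c) all the ideals may be taken to be B. *)

(** * Places *)

(** Collapsing yields a tree with free edges, so G behaves like a free product of vertex stabilizers
    and a free group; this is why homomorphisms extend from one stabilizer. No presentation of G is
    derived: homomorphisms come from primitives of cochains on the tree, which exist because any two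
    vertices have a common ancestor in the direction of a chosen end. The tree is given by cosets,
    which are awkward to compute with, so a point is identified with the balls of a norm on L^3
    compatible with h. An integral vector that is short at a vertex is isotropic, as h(s, s) is then
    an element of B with a zero at Q; transvections along it supply stabilizing elements.
    Riemann-Roch is replaced by counting over the finite field: B has many elements with a bounded
    pole at Q and none but 0 with a zero there. The first fact needs a function with a pole at P
    only, hence finiteness of the set of poles; the second needs a pole for every non-constant
    function, hence a valuation ring obtained from Zorn's lemma. *)

Section PlaceTheory.
Context (F K : fieldType) (i : {rmorphism F -> K}).
Implicit Types (v w : place i) (x y z : K).

Lemma placeMl v (x y : K) : x != 0 -> y != 0 -> v (x * y) = v x + v y.
Proof. exact: placeM. Qed.

Lemma uniformizer v : exists x : K, x != 0 /\ v x = 1.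
Proof. by have [x] := place_unif v; exists x. Qed.

Lemma place1 v : v 1 = 0.
Proof.
have e : v 1 = v 1 + v 1 by rewrite -placeMl ?oner_neq0 // mulr1.
by move: e; move: (v 1) => n; lia.
Qed.

Lemma placeV v x : x != 0 -> v x^-1 = - v x.
Proof.
move=> x0; have := placeMl v x0 (invr_neq0 x0); rewrite mulfV // place1; lia.
Qed.

Lemma placeN1 v : v (-1) = 0.
Proof.
have n0 : (-1 : K) != 0 by rewrite oppr_eq0 oner_eq0.
by have := placeMl v n0 n0; rewrite mulrNN mulr1 place1; lia.
Qed.

Lemma placeN v x : v (- x) = v x.
Proof.
have [->|x0] := eqVneq x 0; first by rewrite oppr0.
by rewrite -mulN1r placeMl ?placeN1 ?add0r // oppr_eq0 oner_eq0.
Qed.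

Lemma placeX v x n : x != 0 -> v (x ^+ n) = n%:Z * v x.
Proof.
move=> x0; elim: n => [|n IH]; first by rewrite expr0 place1 mul0r.
by rewrite exprS placeMl ?expf_neq0 // IH; lia.
Qed.

Lemma placeXz v x (n : int) : x != 0 -> v (x ^ n) = n * v x.
Proof.
move=> x0; case: n => n; first by rewrite -exprnP placeX.
by rewrite NegzE -exprnN placeV ?expf_neq0 // placeX //; lia.
Qed.

(** [v 0] is an arbitrary integer, so the convention that 0 has infinite valuation is built in
    here. *)
Definition pge v x (n : int) : Prop := x = 0 \/ n <= v x.

Lemma pge_val v x n : x != 0 -> pge v x n -> n <= v x.
Proof. by move=> x0 [/eqP|//]; rewrite (negPf x0). Qed.

Lemma pgeD v x y n : pge v x n -> pge v y n -> pge v (x + y) n.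
Proof.
move=> hx hy.
have [->|x0] := eqVneq x 0; first by rewrite add0r.
have [->|y0] := eqVneq y 0; first by rewrite addr0.
have [->|xy0] := eqVneq (x + y) 0; first by left.
right; apply: le_trans (placeD v x0 y0 xy0).
by rewrite le_min !pge_val.
Qed.

Lemma pgeN v x n : pge v x n -> pge v (- x) n.
Proof. by case=> [->|h]; [left; rewrite oppr0 | right; rewrite placeN]. Qed.

Lemma pgeB v x y n : pge v x n -> pge v y n -> pge v (x - y) n.
Proof. by move=> hx hy; apply/pgeD/pgeN. Qed.

Lemma pgeM v x y m n : pge v x m -> pge v y n -> pge v (x * y) (m + n).
Proof.
move=> hx hy.
have [->|x0] := eqVneq x 0; first by left; rewrite mul0r.
have [->|y0] := eqVneq y 0; first by left; rewrite mulr0.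
by right; rewrite placeMl // lerD // pge_val.
Qed.

Lemma pge_le v x m n : m <= n -> pge v x n -> pge v x m.
Proof. by move=> mn [->|h]; [left | right; apply: le_trans h]. Qed.

Lemma pge_sum v (J : Type) (r : seq J) (S : pred J) (f : J -> K) n :
  (forall j, S j -> pge v (f j) n) -> pge v (\sum_(j <- r | S j) f j) n.
Proof.
by move=> h; elim/big_ind: _ => //; [left | move=> x y; apply: pgeD].
Qed.

Lemma pge_const v c : pge v (i c) 0.
Proof.
have [->|c0] := eqVneq c 0; first by left; rewrite rmorph0.
by right; rewrite place_const.
Qed.

Lemma pge_scale v c x n : pge v x n -> pge v (i c * x) n.
Proof. by move=> h; rewrite -[n]add0r; apply: pgeM h; apply: pge_const. Qed.

Lemma pgeX v x m n : pge v x m -> pge v (x ^+ n) (n%:Z * m).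
Proof.
move=> h; elim: n => [|n IH]; first by right; rewrite place1 mul0r.
rewrite exprS; have -> : n.+1%:Z * m = m + n%:Z * m by lia.
exact: pgeM.
Qed.

Lemma pge_refl v x : pge v x (v x). Proof. by right. Qed.

Lemma place_dominant v x y : x != 0 -> pge v y (v x + 1) ->
  x + y != 0 /\ v (x + y) = v x.
Proof.
move=> x0 hy.
have xy0 : x + y != 0.
  apply/eqP => /(canRL (addKr x)); rewrite addr0 => e.
  case: hy => [y0|]; last by rewrite e placeN => ?; lia.
  by move: x0; rewrite -[x]opprK -e y0 oppr0 eqxx.
split=> //; apply/eqP; rewrite eq_le; apply/andP; split; last first.
  apply: pge_val => //; apply: pgeD; first exact: pge_refl.
  by apply: pge_le hy; lia.
rewrite leNgt; apply/negP => lt.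
have : pge v x (v x + 1).
  have h : pge v (x + y) (v x + 1) by right; lia.
  by rewrite -{1}(addrK y x); apply: pgeB.
by move/(pge_val x0); lia.
Qed.

(** If regularity at v implied regularity at w, units at v would be units at w, so w would be a
    multiple of v, and normalization would force equality. Hence some function is regular at one
    place with a pole at the other; the quotient of two such functions, one for each order of the
    places, works. *)
Lemma place_distinct v w : ~ same_place v w ->
  exists x, [/\ x != 0, v x < 0 & 0 < w x].
Proof.
have half v1 w1 : ~ same_place v1 w1 -> exists x, [/\ x != 0, 0 <= v1 x & w1 x < 0].
  move=> ns; apply: contrapT => h; apply: ns.
  have H x : x != 0 -> 0 <= v1 x -> 0 <= w1 x.
    by move=> x0 hx; rewrite leNgt; apply/negP => lt; apply: h; exists x.
  have H0 x : x != 0 -> v1 x = 0 -> w1 x = 0.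
    move=> x0 hx; have := H x x0; have := H x^-1 (invr_neq0 x0).
    by rewrite !placeV // hx; lia.
  have [pi [p0 p1]] := uniformizer v1.
  have wE x : x != 0 -> w1 x = v1 x * w1 pi.
    move=> x0; have /H0 : x * pi ^ (- v1 x) != 0 by rewrite mulf_neq0 // expfz_neq0.
    by rewrite !placeMl ?expfz_neq0 // !placeXz // p1; lia.
  have [t [t0 t1]] := uniformizer w1; have e := wE _ t0; rewrite t1 in e.
  have hp : 0 <= w1 pi by apply: H => //; rewrite p1.
  have e1 : w1 pi = 1 by move: e; have [?|?] := leP (v1 t) 0; nia.
  by move=> x x0; rewrite wE // e1 mulr1.
move=> ns; have [x [x0 vx wx]] := half _ _ ns.
have [y [y0 wy vy]] : exists x, [/\ x != 0, 0 <= w x & v x < 0].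
  by apply: half => s; apply: ns => z z0; rewrite s.
exists (y / x); rewrite !placeMl ?invr_eq0 // !placeV // mulf_neq0 ?invr_eq0 //.
by split=> //; lia.
Qed.

(** Induction on the number of places, with z good for the first s of them and x good for the last.
    Unless z is already good there, x is multiplied by a high power of z or, when z has a pole at
    the last place, by [z^n / (1 + z^n)]: this factor is a unit at the poles of z and has the zeros
    of [z^n]. *)
Lemma separate v (ws : nat -> place i) (s : nat) :
  (forall l, (l < s)%N -> ~ same_place v (ws l)) ->
  exists x, [/\ x != 0, v x < 0 & forall l, (l < s)%N -> 0 < ws l x].
Proof.
elim: s => [|s IH] h.
  have [pi [p0 p1]] := uniformizer v; exists pi^-1.
  by rewrite invr_eq0 placeV // p1.
have [z [z0 vz wz]] : exists x, [/\ x != 0, v x < 0 & forall l, (l < s)%N -> 0 < ws l x].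
  by apply: IH => l ls; apply: h; apply: ltnW.
have [x [x0 vx wx]] := place_distinct (h s (ltnSn s)).
(* This exponent outweighs the possible poles of x at the first s places. *)
pose n := (\sum_(l < s) `|ws l x|).+1%N.
have nP l : (l < s)%N -> 0 < n%:Z * ws l z + ws l x.
  move=> ls; have := wz l ls.
  have : (`|ws l x| <= \sum_(l < s) `|ws l x|)%N.
    by rewrite (bigD1 (Ordinal ls)) //= leq_addr.
  rewrite /n; nia.
have [gt0|le0] := ltP 0 (ws s z).
  by exists z; split=> // l; rewrite ltnS leq_eqVlt => /orP[/eqP->|/wz].
have zn0 : z ^+ n != 0 by rewrite expf_neq0.
have [e0|ne0] := eqVneq (ws s z) 0.
  exists (z ^+ n * x); rewrite mulf_neq0 // placeMl // placeX //; split=> //; first by nia.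
  move=> l; rewrite ltnS leq_eqVlt placeMl // placeX // => /orP[/eqP->|/nP //].
  by rewrite e0; lia.
have lt0 : ws s z < 0 by lia.
have big w : w z < 0 -> 1 + z ^+ n != 0 /\ w (1 + z ^+ n) = n%:Z * w z.
  move=> wz0; rewrite addrC -placeX //; apply: place_dominant => //.
  by right; rewrite place1 placeX // /n; nia.
have small w : 0 < w z -> w (1 + z ^+ n) = 0.
  move=> wz0; rewrite -(place1 w); apply: (place_dominant _ _).2; first exact: oner_neq0.
  by right; rewrite place1 placeX // /n; nia.
have [d0 vd] := big v vz; have [_ wd] := big _ lt0.
exists (z ^+ n / (1 + z ^+ n) * x).
have E w : w (z ^+ n / (1 + z ^+ n) * x) = n%:Z * w z - w (1 + z ^+ n) + w x.
  by rewrite !placeMl ?mulf_neq0 ?invr_eq0 // placeV // placeX.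
rewrite !E vd !mulf_neq0 ?invr_eq0 //; split=> //; first lia.
move=> l; rewrite ltnS leq_eqVlt E => /orP[/eqP->|ls]; first by rewrite wd; lia.
by rewrite small ?wz // subr0; apply: nP.
Qed.

(** [z^n / (z^n + 1)] is close to 1 at a pole of z and close to 0 at a zero of z. *)
Lemma weak_approx v (ws : nat -> place i) (s : nat) (N : nat) :
  (forall l, (l < s)%N -> ~ same_place v (ws l)) ->
  exists x, pge v (x - 1) N /\ forall l, (l < s)%N -> pge (ws l) x N.
Proof.
case: N => [|N] h.
  by exists 1; rewrite subrr; split=> [|l _]; [left | right; rewrite place1].
have [z [z0 vz wz]] := separate h.
have [d0 vd] : z ^+ N.+1 + 1 != 0 /\ v (z ^+ N.+1 + 1) = N.+1%:Z * v z.
  rewrite -placeX //; apply: place_dominant; first by rewrite expf_neq0.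
  by right; rewrite place1 placeX //; nia.
exists (z ^+ N.+1 / (z ^+ N.+1 + 1)); split.
  have -> : z ^+ N.+1 / (z ^+ N.+1 + 1) - 1 = - (z ^+ N.+1 + 1)^-1 by field.
  by apply: pgeN; right; rewrite placeV // vd; nia.
move=> l ls; right; rewrite placeMl ?expf_neq0 ?invr_eq0 // placeV // placeX //.
have -> : ws l (z ^+ N.+1 + 1) = 0.
  rewrite addrC -(place1 (ws l)); apply: (place_dominant _ _).2; first exact: oner_neq0.
  by right; rewrite place1 placeX //; have := wz l ls; nia.
by have := wz l ls; nia.
Qed.

End PlaceTheory.

(** * Function fields *)

Lemma pigeonhole (S T : finType) (f : S -> T) : (#|T| < #|S|)%N ->
  exists x y, x != y /\ f x = f y.
Proof.
move=> lt; apply: contrapT => h.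
have : injective f.
  move=> x y e; apply/eqP; apply: contrapT => /negP xy; apply: h; exists x, y.
  by [].
by move=> /leq_card; rewrite leqNgt lt.
Qed.

Section Evaluation.
Context (F K : fieldType) (i : {rmorphism F -> K}).

Definition ev (y : K) : {poly F} -> K := horner_eval y \o map_poly i.
HB.instance Definition _ y :=
  GRing.RMorphism.copy (ev y) (horner_eval y \o map_poly i).

Lemma evE y p : ev y p = (map_poly i p).[y]. Proof. by []. Qed.

Lemma evC y c : ev y c%:P = i c.
Proof. by rewrite evE map_polyC hornerC. Qed.

Lemma evX y : ev y 'X = y.
Proof. by rewrite evE map_polyX hornerX. Qed.

Lemma ev_coef y (p : {poly F}) n : (size p <= n)%N -> ev y p = \sum_(j < n) i p`_j * y ^+ j.
Proof.
move=> le; rewrite evE (@horner_coef_wide _ n) ?(leq_trans (size_poly _ _)) //.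
by apply: eq_bigr => j _; rewrite coef_map.
Qed.

(** Generation of K over F(t) with denominators cleared, so that only polynomials evaluated at t
    occur. *)
Definition ff_basis (t : K) (J : finType) (b : J -> K) : Prop :=
  forall x, exists h (P : J -> {poly F}),
    ev t h != 0 /\ ev t h * x = \sum_j ev t (P j) * b j.

Lemma common_denominator t (J : finType) (b : J -> K) (I : finType) (x : I -> K) :
  ff_basis t b -> exists h (P : I -> J -> {poly F}), ev t h != 0 /\
    forall a, ev t h * x a = \sum_j ev t (P a j) * b j.
Proof.
move=> bb.
have /choice[h hP] : forall a, exists h, ev t h != 0 /\
    exists P : J -> {poly F}, ev t h * x a = \sum_j ev t (P j) * b j.
  by move=> a; have [h [P [? ?]]] := bb (x a); exists h; split=> //; exists P.
have /choice[P PE] : forall a, exists P : J -> {poly F},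
    ev t (h a) * x a = \sum_j ev t (P j) * b j by move=> a; case: (hP a).
exists (\prod_a h a), (fun a j => (\prod_(c | c != a) h c) * P a j); split.
  by rewrite rmorph_prod; apply/prodf_neq0 => a _; case: (hP a).
move=> a; rewrite (bigD1 a) //= rmorphM mulrAC PE mulr_suml.
by apply: eq_bigr => j _; rewrite rmorphM /=; ring.
Qed.

Lemma function_field_basis : function_field i ->
  exists t n (b : 'I_n -> K), ff_basis t b.
Proof.
move=> [t _ [n [b hb]]]; exists t, n, b => x.
have [c hc ->] := hb x.
have /choice[p pP] : forall j, exists p, exists q, ev t q != 0 /\ c j = ev t p / ev t q.
  by move=> j; have [p [q [? ?]]] := hc j; exists p, q.
have /choice[q qP] := pP.
exists (\prod_a q a), (fun j => (\prod_(c | c != j) q c) * p j); split.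
  by rewrite rmorph_prod; apply/prodf_neq0 => a _; case: (qP a).
rewrite mulr_sumr; apply: eq_bigr => j _; have [q0 ->] := qP j.
rewrite (bigD1 j) //= !rmorphM /=.
have -> : forall u z : K, ev t (q j) * u * (ev t (p j) / ev t (q j) * z) = u * ev t (p j) * z.
  by move=> u z; field.
by [].
Qed.

End Evaluation.

Section Dependence.
Context (F : finFieldType) (K : fieldType) (i : {rmorphism F -> K}).
Context (t : K) (J : finType) (b : J -> K) (bb : ff_basis i t b).
Local Notation ev := (ev i).

(** For fixed S this is an F-space with at most [#|F| ^ (S * #|J|)] elements. After clearing a
    denominator, multiplication by an element of K raises S by a bounded amount. *)
Let lat (S : nat) (x : K) : Prop := exists P : J -> {poly F},
  (forall j, (size (P j) <= S)%N) /\ x = \sum_j ev t (P j) * b j.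

Let lat_sum S (I : Type) (r : seq I) (f : I -> K) :
  (forall a, lat S (f a)) -> lat S (\sum_(a <- r) f a).
Proof.
move=> h; elim/big_ind: _ => //.
  exists (fun _ => 0); split=> [j|]; first by rewrite size_poly0.
  by rewrite big1 // => j _; rewrite rmorph0 mul0r.
move=> _ _ [P [sP ->]] [Q [sQ ->]]; exists (fun j => P j + Q j); split=> [j|].
  by rewrite (leq_trans (size_polyD _ _)) // geq_max sP sQ.
by rewrite -big_split; apply: eq_bigr => j _; rewrite rmorphD mulrDl.
Qed.

Let lat_mulp S s (p : {poly F}) x : (size p <= s)%N -> lat S x -> lat (S + s) (ev t p * x).
Proof.
move=> sp [P [sP ->]]; exists (fun j => p * P j); split=> [j|].
  rewrite (leq_trans (size_polyMleq _ _)) // (leq_trans (leq_pred _)) //.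
  by rewrite addnC leq_add.
by rewrite mulr_sumr; apply: eq_bigr => j _; rewrite rmorphM mulrA.
Qed.

Let lat_const S c x : lat S x -> lat S (i c * x).
Proof.
move=> [P [sP ->]]; exists (fun j => c *: P j); split=> [j|].
  exact: leq_trans (size_scale_leq _ _) (sP j).
rewrite mulr_sumr; apply: eq_bigr => j _.
by rewrite -mul_polyC rmorphM /= evC mulrA.
Qed.

(** A pigeonhole in the style of Siegel's lemma replaces the degree of K over F(y): there are
    [#|F| ^ (N * #|I|)] combinations of the [x j] with coefficients of degree less than N in y, and
    up to a common factor they lie in a space of dimension about [N * ka * #|J|]. Two of them
    coincide once I has more than [ka * #|J|] elements and N is large. *)
Lemma ff_dependent (y : K) : exists n, forall (I : finType) (x : I -> K),
  (n <= #|I|)%N -> exists f : I -> {poly F},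
    (exists j, f j != 0) /\ \sum_j ev y (f j) * x j = 0.
Proof.
have [h [Y [h0 hY]]] := common_denominator (fun j => y * b j) bb.
pose ka := (size h + \sum_l \sum_j size (Y l j))%N.
have lat_h S x : lat S x -> lat (S + ka) (ev t h * x).
  by apply: lat_mulp; rewrite leq_addr.
have lat_hy S x : lat S x -> lat (S + ka) (ev t h * y * x).
  move=> [P [sP ->]]; rewrite mulr_sumr; apply: (lat_sum) => l.
  have -> : ev t h * y * (ev t (P l) * b l) = ev t (P l) * (ev t h * (y * b l)).
    by ring.
  rewrite hY mulr_sumr.
  apply: (lat_sum) => j; rewrite mulrA -rmorphM.
  exists (fun j' => if j' == j then P l * Y l j else 0); split=> [j'|]; last first.
    rewrite (bigD1 j) //= eqxx big1 ?addr0 // => j' /negPf ->.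
    by rewrite rmorph0 mul0r.
  case: eqP => _; last by rewrite size_poly0.
  rewrite (leq_trans (size_polyMleq _ _)) // (leq_trans (leq_pred _)) //.
  rewrite leq_add //; apply: leq_trans (leq_addl _ _).
  by rewrite (bigD1 l) //= (bigD1 j) //= -addnA leq_addr.
exists (#|J| * ka).+1 => I x nI.
have [h' [X [h'0 hX]]] := common_denominator x bb.
pose ka' := (\sum_l \sum_j size (X l j))%N.
have lat_x a : lat ka' (ev t h' * x a).
  exists (X a); split=> [j|//].
  by rewrite /ka' (bigD1 a) //= (bigD1 j) //= -addnA leq_addr.
(* With this N, [#|J| * (ka' + N * ka) < N * #|I|], the strict inequality that the pigeonhole
   needs. *)
pose N := (#|J| * ka').+1.
have lat_yx a m : (m <= N)%N -> lat (ka' + N * ka) (ev t h ^+ N * y ^+ m * (ev t h' * x a)).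
  move=> mN; have -> : ev t h ^+ N * y ^+ m * (ev t h' * x a) =
      ev t h ^+ (N - m) * ((ev t h * y) ^+ m * (ev t h' * x a)).
    by rewrite exprMn !mulrA -exprD subnK.
  have -> : (ka' + N * ka = ka' + m * ka + (N - m) * ka)%N.
    by rewrite -addnA -mulnDl subnKC.
  elim: (N - m)%N => [|r IH].
    rewrite addn0 mul1r; elim: m {mN} => [|m IH]; first by rewrite addn0 mul1r.
    by rewrite exprS -mulrA mulSn addnCA addnC; apply: lat_hy.
  by rewrite exprS -mulrA mulSn addnCA addnC; apply: lat_h.
pose S := (ka' + N * ka)%N.
pose value (f : {ffun I -> 'rV[F]_N}) := \sum_a ev y (rVpoly (f a)) * x a.
have /choice[g gP] : forall f, exists g : {ffun J -> 'rV[F]_S},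
    ev t h ^+ N * ev t h' * value f = \sum_j ev t (rVpoly (g j)) * b j.
  move=> f; have : lat S (ev t h ^+ N * ev t h' * value f).
    rewrite mulr_sumr; apply: (lat_sum) => a.
    rewrite (@ev_coef _ _ i y _ N) ?size_poly // mulr_suml mulr_sumr.
    apply: (lat_sum) => m.
    have -> : forall u v w z s : K, u * v * (w * z * s) = w * (u * z * (v * s)).
      by move=> *; ring.
    by apply: lat_const; apply: lat_yx; apply: ltnW.
  move=> [P [sP ->]]; exists [ffun j => poly_rV (P j)].
  by apply: eq_bigr => j _; rewrite ffunE poly_rV_K.
have [f [f' [ff' gff']]] : exists f f', f != f' /\ g f = g f'.
  apply: pigeonhole; rewrite !card_ffun !card_mx !mul1n -!expnM.
  rewrite ltn_exp2l; last exact: card_finNzRing_gt1.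
  by rewrite /S /N; nia.
exists (fun a => rVpoly (f a) - rVpoly (f' a)); split.
  apply: contrapT => hn; move/eqP: ff'; apply; apply/ffunP => a.
  apply: (can_inj rVpolyK); apply/eqP; rewrite -subr_eq0.
  by apply: contrapT => /negP h1; apply: hn; exists a.
have e : value f = value f'.
  have c0 : ev t h ^+ N * ev t h' != 0 by rewrite mulf_neq0 // expf_neq0.
  by apply: (mulfI c0); rewrite !gP gff'.
move/eqP: e; rewrite -subr_eq0 -sumrB => /eqP e0; apply: etrans e0.
by apply: eq_bigr => a _; rewrite rmorphB mulrBl.
Qed.

End Dependence.

Section Independence.
Context (F K : fieldType) (i : {rmorphism F -> K}).
Local Notation ev := (ev i).

(** If x had negative valuation, the leading term of its equation would have strictly smaller
    valuation than every other term. *)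
Lemma monic_root_pge (v : place i) (p : {poly K}) x :
  p \is monic -> root p x -> (forall m, pge v p`_m 0) -> pge v x 0.
Proof.
move=> mp /rootP px hp; have [->|x0] := eqVneq x 0; first by left.
right; rewrite leNgt; apply/negP => lt.
have sp : (0 < size p)%N by rewrite size_poly_gt0 monic_neq0.
have e : x ^+ (size p).-1 = - \sum_(m < (size p).-1) p`_m * x ^+ m.
  apply/eqP; rewrite -subr_eq0 opprK addrC; apply/eqP; rewrite -[RHS]px.
  rewrite (@horner_coef_wide _ (size p).-1.+1); last by rewrite prednK.
  by rewrite big_ord_recr /= -lead_coefE (monicP mp) mul1r.
case: (size p).-1 e => [|d] e.
  by move: (oner_neq0 K); rewrite -(expr0 x) e big_ord0 oppr0 eqxx.
have : pge v (x ^+ d.+1) (d%:Z * v x).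
  rewrite e; apply/pgeN/pge_sum => m _; rewrite -[_ * v x]add0r.
  apply: pgeM => //; right; rewrite placeX //; have := ltn_ord m.
  by rewrite ltnS => md; nia.
by move/(pge_val (expf_neq0 _ x0)); rewrite placeX //; nia.
Qed.

Lemma integral_pge (v : place i) y x :
  integralOver (ev y) x -> pge v y 0 -> pge v x 0.
Proof.
move=> [p mp px] hy; apply: monic_root_pge px _; first exact: monic_map.
move=> m; rewrite coef_map /= (ev_coef _ _ (leqnn _)); apply: pge_sum => l _.
by apply: pge_scale; have := pgeX l hy; rewrite mulr0.
Qed.

(** The leading coefficient c serves: multiplying the equation by a power of c makes it monic in
    [c x]. Constant polynomials are set apart, as they have no root. *)
Lemma integral_denominator y (p : {poly {poly F}}) x :
  (forall f, f != 0 -> ev y f != 0) -> p != 0 -> root (map_poly (ev y) p) x ->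
  exists2 c, ev y c != 0 & integralOver (ev y) (ev y c * x).
Proof.
move=> evn p0 px; set c := lead_coef p; have c0 : c != 0 by rewrite lead_coef_eq0.
have sp : (0 < size p)%N by rewrite size_poly_gt0.
exists c; first exact: evn.
case szp: (size p) sp => [//|[|d]] _.
  have pc : p = c%:P by rewrite /c lead_coefE szp; apply: size1_polyC; rewrite szp.
  move/rootP: px; rewrite pc map_polyC hornerC => /eqP.
  by rewrite (negPf (evn _ c0)).
pose r := \poly_(m < d.+1) (p`_m * c ^+ (d - m)).
have sr : (size r < d.+2)%N by rewrite ltnS size_poly.
exists ('X^(d.+1) + r).
  by rewrite monicE lead_coefDl ?size_polyXn // lead_coefXn.
apply/rootP; move/rootP: px; rewrite (@horner_coef_wide _ d.+2); last first.
  by rewrite (leq_trans (size_poly _ _)) // szp.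
rewrite (@horner_coef_wide _ d.+2); last first.
  rewrite (leq_trans (size_poly _ _)) // (leq_trans (size_polyD _ _)) //.
  by rewrite geq_max size_polyXn leqnn ltnW.
rewrite [in X in X -> _]big_ord_recr [in X in _ -> X]big_ord_recr /= !coef_map /=.
rewrite coefD coefXn eqxx coef_poly ltnn addr0 rmorph1 mul1r.
have -> : p`_d.+1 = c by rewrite /c lead_coefE szp.
move=> /(congr1 ( *%R (ev y c ^+ d))); rewrite mulr0; apply: etrans.
rewrite mulrDr; congr (_ + _); last by rewrite exprMn !exprS; ring.
rewrite mulr_sumr; apply: eq_bigr => m _.
rewrite !coef_map /= coefD coefXn coef_poly ltn_ord ltn_eqF ?ltn_ord // add0r.
rewrite rmorphM rmorphXn /= exprMn; have := ltn_ord m; rewrite ltnS => md.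
have -> : ev y c ^+ d = ev y c ^+ (d - m) * ev y c ^+ m by rewrite -exprD subnK.
by ring.
Qed.

Context (vs : nat -> place i) (s : nat) (y : K).

(** Linear independence over F in the product of the rings [O_l / (1/y)], where [O_l] is the
    valuation ring of [vs l], a pole of y. It implies independence over F[y], and so bounds the
    poles of y by the degree of K over F(y). *)
Definition indep (J : finType) (z : J -> K) : Prop :=
  (forall j l, (l < s)%N -> pge (vs l) (z j) 0) /\
  forall c : J -> F,
    (forall l, (l < s)%N -> pge (vs l) (\sum_j i (c j) * z j) (- vs l y)) ->
    forall j, c j = 0.

(** Dividing a relation by the highest power of y that occurs leaves the top coefficients modulo
    1/y, and these vanish by independence. *)
Lemma indep_poly (J : finType) (z : J -> K) (f : J -> {poly F}) :
  (forall l, (l < s)%N -> vs l y < 0) -> y != 0 ->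
  indep z -> \sum_j ev y (f j) * z j = 0 -> forall j, f j = 0.
Proof.
move=> hy y0 [zO zI] f0; apply: contrapT => /existsNP[j0 /eqP fj0].
pose n := (\max_j size (f j))%N.
have fn j : (size (f j) <= n)%N by exact: leq_bigmax.
have n0 : (0 < n)%N by apply: leq_trans (fn j0); rewrite size_poly_gt0.
have cz : forall j, (f j)`_n.-1 = 0.
  apply: zI => l ls.
  have -> : \sum_j i (f j)`_n.-1 * z j = - \sum_j \sum_(m < n.-1)
      i (f j)`_m * (y ^ (m%:Z - n.-1%:Z) * z j).
    apply/eqP; rewrite -subr_eq0 opprK -big_split /=; apply/eqP.
    apply: (mulfI (expf_neq0 n.-1 y0)); rewrite mulr0 -[RHS]f0 mulr_sumr.
    apply: eq_bigr => j _; have fn' : (size (f j) <= n.-1.+1)%N by rewrite prednK.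
    rewrite (ev_coef _ _ fn') big_ord_recr /=.
    rewrite mulrDl mulrDr addrC mulr_suml mulr_sumr; congr (_ + _); last by ring.
    apply: eq_bigr => m _; rewrite expfzDr // -exprnN -exprnP.
    move: (y ^+ m) (y ^+ n.-1) (expf_neq0 n.-1 y0) => u u' u'0; by field.
  apply/pgeN/pge_sum => j _; apply: pge_sum => m _; apply: pge_scale.
  rewrite -[X in pge _ _ X]addr0; apply: pgeM; last exact: zO.
  right; rewrite placeXz //; have := ltn_ord m; have := hy l ls.
  by move: (n.-1) (nat_of_ord m) => N M; nia.
have : (n <= n.-1)%N.
  apply/bigmax_leqP => j _; rewrite -ltnS prednK //.
  rewrite ltn_neqAle fn andbT; apply/eqP => e.
  have := cz j; rewrite -e -lead_coefE => /eqP; rewrite lead_coef_eq0 => /eqP fj.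
  by move: n0; rewrite -e fj size_poly0.
by rewrite -ltnS prednK // ltnn.
Qed.

End Independence.

(** * Residue fields *)

Section Degree.
Context (F : finFieldType) (K : fieldType) (i : {rmorphism F -> K}).
Local Notation ev := (ev i).

(** Boundedness of the degree of K over F(y), in a form that holds trivially for algebraic y. *)
Definition ff_dep : Prop := forall y : K, exists n, forall (I : finType) (x : I -> K),
  (n <= #|I|)%N -> exists f : I -> {poly F},
    (exists j, f j != 0) /\ \sum_j ev y (f j) * x j = 0.

Lemma ev_neq0 (v : place i) y f : v y < 0 -> y != 0 -> f != 0 -> ev y f != 0.
Proof.
move=> vy y0 f0; apply/eqP => e; case/eqP: f0.
have := @indep_poly _ _ i (fun _ => v) 1 y 'I_1 (fun _ => 1) (fun _ => f).
move=> /(_ _ _ _ _ ord0); apply=> //; last by rewrite big_ord1 mulr1 e.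
  split=> [_ l _|c /(_ 0%N isT)]; first by right; rewrite place1.
rewrite big_ord1 mulr1 => h j; rewrite (ord1 j); apply/eqP; apply: contrapT => /negP c0.
have ic0 : i (c 0) != 0 by rewrite fmorph_eq0.
by have := pge_val ic0 h; rewrite place_const //; lia.
Qed.

Hypothesis hd : ff_dep.

Lemma indep_bounded (vs : nat -> place i) s (y : K) : (forall l, (l < s)%N -> vs l y < 0) -> y != 0 ->
  exists n, forall (J : finType) (z : J -> K), indep vs s y z -> (#|J| < n)%N.
Proof.
move=> hy y0; have [n hn] := hd y; exists n => J z iz; rewrite ltnNge; apply/negP.
move/(hn _ z) => [f [[j fj] /(indep_poly hy y0 iz)/(_ j) /eqP]].
by rewrite (negPf fj).
Qed.

(** A family of maximal size. With y the inverse of a uniformizer, [indep] is independence in the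
    residue field, so [indep_bounded] guarantees that a maximum exists. *)
Lemma residue_basis (v : place i) : exists d (z : 'I_d -> K),
  [/\ (0 < d)%N, forall j, pge v (z j) 0,
    forall x, pge v x 0 -> exists c : 'I_d -> F, pge v (x - \sum_j i (c j) * z j) 1
  & forall c : 'I_d -> F, pge v (\sum_j i (c j) * z j) 1 -> forall j, c j = 0].
Proof.
have [pi [p0 p1]] := uniformizer v.
have y0 : pi^-1 != 0 by rewrite invr_eq0.
have vy : v pi^-1 = -1 by rewrite placeV // p1.
pose good d := exists z : 'I_d -> K, indep (fun _ => v) 1 pi^-1 z.
have [n hn] : exists n, forall (J : finType) (z : J -> K),
    indep (fun _ => v) 1 pi^-1 z -> (#|J| < n)%N.
  by apply: indep_bounded => // l _; rewrite vy.
have ex : exists d, `[< good d >].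
  exists 0%N; apply/asboolP; exists (fun _ => 0).
  by split=> [[]|c _ []].
have ub d : `[< good d >] -> (d <= n)%N.
  by move=> /asboolP[z /hn]; rewrite card_ord => /ltnW.
case: (ex_maxnP ex ub) => d /asboolP[z [zO zI]] dmax.
have hz c : pge v (\sum_j i (c j) * z j) 1 -> forall j, c j = 0.
  by move=> h; apply: zI => _ _; rewrite vy.
have hx x : pge v x 0 -> exists c : 'I_d -> F, pge v (x - \sum_j i (c j) * z j) 1.
  move=> xO; apply: contrapT => hno.
  have : (d.+1 <= d)%N; last by rewrite ltnn.
  apply: dmax; apply/asboolP.
  exists (fun j => if unlift ord0 j is Some j' then z j' else x); split.
    by move=> j l _; case: (unlift _ _) => [j'|//]; apply: (zO _ 0%N).
  move=> c /(_ 0%N isT); rewrite vy big_ord_recl unlift_none.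
  under eq_bigr do rewrite liftK.
  move=> h; have c00 : c ord0 = 0.
    apply/eqP; apply: contrapT => /negP c0; apply: hno.
    exists (fun j => - (c (lift ord0 j) / c ord0)).
    have := pge_scale (c ord0)^-1 h; rewrite mulrDr mulrA -rmorphM /= mulVf // rmorph1 mul1r.
    rewrite opprK -sumrN mulr_sumr => h1; move: h1; congr (pge v (_ + _) _).
    by apply: eq_bigr => j _; rewrite rmorphN !rmorphM /=; ring.
  move: h; rewrite c00 rmorph0 mul0r add0r opprK => /hz h j.
  by case: (unliftP ord0 j) => [j' ->|->].
exists d, z; split=> //; last by move=> j; apply: (zO j 0%N).
case: d z {zO zI dmax hz} hx => // z /(_ 1).
case=> [|c]; first by right; rewrite place1.
by rewrite big_ord0 subr0 => /(pge_val (oner_neq0 K)); rewrite place1.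
Qed.

Section Digits.
Context (v : place i) (pi : K) (d : nat) (z : 'I_d -> K).
Hypotheses (p0 : pi != 0) (p1 : v pi = 1) (zO : forall j, pge v (z j) 0).
Hypothesis z_span : forall x, pge v x 0 ->
  exists c : 'I_d -> F, pge v (x - \sum_j i (c j) * z j) 1.
Hypothesis z_free : forall c : 'I_d -> F,
  pge v (\sum_j i (c j) * z j) 1 -> forall j, c j = 0.

Let dsm (a : int) (n : nat) (c : nat -> 'I_d -> F) :=
  \sum_(m < n) \sum_j i (c m j) * (pi ^ (a + m%:Z) * z j).

Let dsmS (a : int) n c : dsm a n.+1 c =
  pi ^ a * (\sum_j i (c 0%N j) * z j) + dsm (a + 1) n (fun m => c m.+1).
Proof.
rewrite /dsm big_ord_recl /=; congr (_ + _).
  by rewrite mulr_sumr; apply: eq_bigr => j _; rewrite addr0; ring.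
apply: eq_bigr => m _; apply: eq_bigr => j _; rewrite /bump /=.
by rewrite [in LHS]PoszD [in LHS]addrA.
Qed.

Let pge_pi x (a n : int) : pge v (pi ^ a * x) (a + n) <-> pge v x n.
Proof.
have P b : pge v (pi ^ b) b by right; rewrite placeXz // p1 mulr1.
split=> [h|]; last exact: pgeM.
have := pgeM (P (- a)) h; rewrite mulrA -expfzDr // addNr mul1r.
by rewrite addrA addNr add0r.
Qed.

Let dsm_pge (a : int) n c : pge v (dsm a n c) a.
Proof.
apply: pge_sum => m _; apply: pge_sum => j _; apply: pge_scale.
apply: (pge_le (n := a + Posz m)); first by lia.
by rewrite -[X in pge _ _ X]addr0; apply: (pge_pi _ _ _).2.
Qed.

Let dsm_span n (a : int) x : pge v x a -> exists c, pge v (x - dsm a n c) (a + n%:Z).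
Proof.
elim: n a x => [|n IH] a x xa.
  by exists (fun _ _ => 0); rewrite /dsm big_ord0 subr0 addr0.
have : pge v (pi ^ (- a) * x) 0 by rewrite -(addNr a); apply/pge_pi.
move=> /z_span[c0 hc0].
have : pge v (x - pi ^ a * \sum_j i (c0 j) * z j) (a + 1).
  have := (pge_pi _ a 1).2 hc0; rewrite mulrBr mulrA -expfzDr // subrr mul1r.
  by [].
move=> /IH[c hc]; exists (fun m => if m is m'.+1 then c m' else c0).
rewrite dsmS opprD addrA; move: hc; congr (pge v _ _); lia.
Qed.

Let dsm_free n (a : int) c : pge v (dsm a n c) (a + n%:Z) ->
  forall m j, (m < n)%N -> c m j = 0.
Proof.
elim: n a c => [//|n IH] a c; rewrite dsmS => h.
have c0 : forall j, c 0%N j = 0.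
  apply: z_free; apply/(pge_pi _ a 1).
  rewrite -(addrK (dsm (a + 1) n (fun m => c m.+1)) (_ * _)).
  by apply: pgeB; [apply: pge_le h; lia | exact: dsm_pge].
move: h; rewrite big1 => [|j _]; last by rewrite c0 rmorph0 mul0r.
rewrite mulr0 add0r => h [|m] j ltmn; first exact: c0.
by apply: (IH (a + 1) (fun m => c m.+1)) => //; move: h; congr (pge v _ _); lia.
Qed.

(** The code of x lists the first n digits of its expansion in powers of the uniformizer, each
    written in the basis z of the residue field. *)
Lemma digits_separate (a : int) n : exists dl : K -> 'M[F]_(n, d), forall x x',
  pge v x a -> pge v x' a -> dl x = dl x' -> pge v (x - x') (a + n%:Z).
Proof.
have /choice[dl hdl] : forall x, exists c, pge v x a -> pge v (x - dsm a n c) (a + n%:Z).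
  move=> x; have [xa|xa] := pselect (pge v x a); last by exists (fun _ _ => 0).
  by have [c ?] := dsm_span n xa; exists c.
exists (fun x => \matrix_(m, j) dl x m j) => x x' xa xa' /matrixP e.
have -> : x - x' = (x - dsm a n (dl x)) - (x' - dsm a n (dl x')).
  have -> : dsm a n (dl x) = dsm a n (dl x'); last by ring.
  by apply: eq_bigr => m _; apply: eq_bigr => j _; have := e m j; rewrite !mxE => ->.
by apply: pgeB; apply: hdl.
Qed.

Lemma digits_indep n : exists w : 'I_n * 'I_d -> K,
  (forall m, pge v (w m) 0) /\
  forall c : 'I_n * 'I_d -> F, pge v (\sum_m i (c m) * w m) n%:Z -> forall m, c m = 0.
Proof.
exists (fun m : 'I_n * 'I_d => pi ^ (0 + Posz m.1) * z m.2); split=> [m|c h [m j]].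
  apply: (pge_le (n := 0 + Posz m.1)); first lia.
  by rewrite -[X in pge _ _ X]addr0; apply/pge_pi.
pose c' (m : nat) j := if insub m is Some m' then c (m', j) else 0.
have c'E (m' : 'I_n) j' : c' m' j' = c (m', j') by rewrite /c' valK.
rewrite -c'E; apply: (@dsm_free n 0) => //; rewrite add0r.
have -> // : dsm 0 n c' = \sum_m i (c m) * (pi ^ (0 + Posz m.1) * z m.2).
rewrite /dsm pair_big /=; apply: eq_bigr => -[m' j'] _ /=; by rewrite c'E.
Qed.

End Digits.

(* d is the degree of v: both properties hold only for the dimension of the
   residue field. *)
Definition has_degree (v : place i) (d : nat) : Prop :=
  [/\ (0 < d)%N,
   forall (a : int) n, exists dl : K -> 'M[F]_(n, d), forall x x',
     pge v x a -> pge v x' a -> dl x = dl x' -> pge v (x - x') (a + n%:Z)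
 & forall n, exists w : 'I_n * 'I_d -> K, (forall m, pge v (w m) 0) /\
     forall c : 'I_n * 'I_d -> F,
       pge v (\sum_m i (c m) * w m) n%:Z -> forall m, c m = 0].

Lemma degree_exists v : exists d, has_degree v d.
Proof.
have [d [z [d0 zO z_span z_free]]] := residue_basis v.
have [pi [p0 p1]] := uniformizer v.
exists d; split=> [//|a n|n].
  exact: (@digits_separate v pi d z).
exact: (@digits_indep v pi d z).
Qed.

End Degree.

(** * Existence of places *)

Section Existence.
Context (F K : fieldType) (i : {rmorphism F -> K}) (y : K).
Local Notation ev := (ev i).
Implicit Types a b x z : K.
Hypothesis y0 : y != 0.
Hypothesis y_nonunit : forall f, y * ev y f != 1.

(** Subrings in which y is not invertible; as in Chevalley's extension theorem, a maximal one is the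
    valuation ring of a place where y vanishes. *)
Let good (O : set K) : Prop :=
  [/\ forall c, O (i c), O y, forall a b, O a -> O b -> O (a - b),
      forall a b, O a -> O b -> O (a * b) & forall a, O a -> y * a <> 1].

Let max_good : exists O, good O /\ forall O', good O' -> O `<=` O' -> O' `<=` O.
Proof.
have gy : good (range (ev y)).
  split=> [c||_ _ [f _ <-] [g _ <-]|_ _ [f _ <-] [g _ <-]|_ [f _ <-]].
  - by exists c%:P; rewrite ?evC.
  - by exists 'X; rewrite ?evX.
  - by exists (f - g); rewrite ?rmorphB.
  - by exists (f * g); rewrite ?rmorphM.
  - exact/eqP/y_nonunit.
have [|O [[O0|gO] Omax]] := @Zorn_bigcup K [set O | O = set0 \/ good O].
- move=> C CP tot; have [[O [CO gO]]|no] := pselect (exists O, C O /\ good O); last first.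
    left; rewrite bigcup0 // => O CO; have [//|gO] := CP O CO.
    by case: no; exists O.
  right; have pick a b : (\bigcup_(X in C) X) a -> (\bigcup_(X in C) X) b ->
      exists O', [/\ C O', good O', O' a & O' b].
    move=> [A CA Aa] [B CB Bb].
    have gA : good A by have [e|//] := CP A CA; move: Aa; rewrite e.
    have gB : good B by have [e|//] := CP B CB; move: Bb; rewrite e.
    by have [AB|BA] := tot A B CA CB; [exists B | exists A]; split=> //;
      [apply: AB | apply: BA].
  have [Oc Oy _ _ _] := gO; split.
  - by move=> c; exists O.
  - by exists O.
  - by move=> a b ha hb; have [A [CA [_ _ AB _ _] Aa Ab]] := pick _ _ ha hb; exists A; auto.
  - by move=> a b ha hb; have [A [CA [_ _ _ AM _] Aa Ab]] := pick _ _ ha hb; exists A; auto.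
  - by move=> a ha; have [A [CA [_ _ _ _ AN] Aa _]] := pick _ _ ha ha; auto.
- case: (Omax (range (ev y))); last by right.
  rewrite O0; split=> // h; have : (set0 : set K) (ev y 0) by apply: h; exists 0.
  by [].
- exists O; split=> // O' gO' OO'; apply: contrapT => h.
  by apply: (Omax O'); [split | right].
Qed.

Section MaximalSubring.
Context (O : set K) (gO : good O)
  (Omax : forall O', good O' -> O `<=` O' -> O' `<=` O).

Let Oc c : O (i c). Proof. by case: gO. Qed.
Let Oy : O y. Proof. by case: gO. Qed.
Let OB a b : O a -> O b -> O (a - b). Proof. by case: gO => _ _ + _ _; apply. Qed.
Let OM a b : O a -> O b -> O (a * b). Proof. by case: gO => _ _ _ + _; apply. Qed.
Let ON a : O a -> y * a <> 1. Proof. by case: gO => _ _ _ _; apply. Qed.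
Let O1 : O 1. Proof. by rewrite -(rmorph1 i). Qed.
Let O0 : O 0. Proof. by rewrite -(rmorph0 i). Qed.
Let OD a b : O a -> O b -> O (a + b).
Proof. by move=> ha hb; rewrite -[b]opprK; apply: OB => //; rewrite -sub0r; apply: OB. Qed.
Let OX a n : O a -> O (a ^+ n).
Proof. by move=> ha; elim: n => [|n IH]; rewrite ?expr0 // exprS; apply: OM. Qed.
Let Osum (J : Type) (r : seq J) (S : pred J) f :
  (forall j, S j -> O (f j)) -> O (\sum_(j <- r | S j) f j).
Proof. by move=> h; elim/big_ind: _ => //; apply: OD. Qed.

(** The element c = 1 - y b and its powers are congruent to 1 modulo y, so adjoining 1/c does not
    make y invertible; by maximality 1/c already lies in O. *)
Let O_jacobson b : O b -> O (1 - y * b)^-1.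
Proof.
move=> hb; pose c := 1 - y * b.
have hc : O c by apply: OB => //; apply: OM.
have c0 : c != 0 by rewrite subr_eq0 eq_sym; apply/eqP/ON.
have cn n : exists2 a, O a & c ^+ n = 1 - y * a.
  elim: n => [|n [a ha e]]; first by exists 0 => //; rewrite mulr0 subr0.
  exists (a + b - y * a * b); last by rewrite exprS e /c; ring.
  by apply: OB; [apply: OD | apply: OM => //; apply: OM].
pose O' := [set x | exists n, O (x * c ^+ n)].
have OO' : O `<=` O' by move=> x hx; exists 0%N; rewrite mulr1.
have : O' c^-1 by exists 1%N; rewrite mulVf.
apply: Omax => //; split.
- by move=> d; apply: OO'.
- exact: OO'.
- move=> x z [m hx] [n hz]; exists (m + n)%N.
  have -> : (x - z) * c ^+ (m + n) = x * c ^+ m * c ^+ n - z * c ^+ n * c ^+ m.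
    by rewrite exprD; ring.
  by apply: OB; apply: OM => //; apply: OX.
- move=> x z [m hx] [n hz]; exists (m + n)%N; rewrite exprD mulrACA.
  exact: OM.
- move=> x [n hx] e; have [a ha e'] := cn n.
  apply: (ON (OD hx ha)); rewrite mulrDr mulrA e mul1r e'; ring.
Qed.

(** The relations expressing that y becomes invertible in O[x]; by maximality they exist for every x
    outside O. *)
Let rep x n : Prop := exists a : nat -> K,
  (forall l, O (a l)) /\ y * \sum_(l < n) a l * x ^+ l = 1.

Let rep_exists x : ~ O x -> exists n, rep x n.
Proof.
move=> nx; apply: contrapT => h; apply: nx.
pose O' := [set z | exists2 p : {poly K}, (forall m, O p`_m) & z = p.[x]].
have OO' : O `<=` O'.
  move=> z hz; exists z%:P; last by rewrite hornerC.
  by move=> m; rewrite coefC; case: eqP.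
have : O' x by exists 'X; [move=> m; rewrite coefX; case: eqP | rewrite hornerX].
apply: Omax => //; split.
- by move=> d; apply: OO'.
- exact: OO'.
- move=> _ _ [p hp ->] [q hq ->]; exists (p - q); last by rewrite hornerD hornerN.
  by move=> m; rewrite coefB; apply: OB.
- move=> _ _ [p hp ->] [q hq ->]; exists (p * q); last by rewrite hornerM.
  by move=> m; rewrite coefM; apply: Osum => j _; apply: OM.
- move=> _ [p hp ->] e; apply: h; exists (size p), (fun l => p`_l).
  by rewrite -horner_coef.
Qed.

(** In the relation for 1/x, the constant term is moved to the other side and divided out, 1 - y b_0
    being a unit by [O_jacobson]. This writes 1 through negative powers of x; multiplying the top
    term of the relation for x by it lowers the degree. *)
Let rep_reduce x n m : x != 0 -> (m <= n)%N -> rep x n.+1 -> rep x^-1 m.+1 -> rep x n.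
Proof.
move=> x0 mn [a [ha ea]] [b [hb eb]].
set u := (1 - y * b 0%N)^-1; have hu : O u by apply: O_jacobson.
have d0 : 1 - y * b 0%N != 0 by rewrite subr_eq0 eq_sym; apply/eqP/ON.
exists (fun l => a l + if (n - l <= m)%N then a n * y * u * b (n - l)%N else 0); split.
  by move=> l; apply: OD => //; case: ifP => // _; do 3!apply: OM => //.
rewrite -[RHS]ea; congr (_ * _); rewrite big_ord_recr /=.
under eq_bigr do rewrite mulrDl.
rewrite big_split /=; congr (_ + _).
have e1 : y * u * \sum_(l < m) b l.+1 * x^-1 ^+ l.+1 = 1.
  apply: (mulfI d0); rewrite mulr1 /u.
  transitivity (y * \sum_(l < m) b l.+1 * x^-1 ^+ l.+1).
    by move: (\sum_(_ < _) _) d0 => z d0; field.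
  rewrite -eb big_ord_recl expr0 mulr1 mulrDr [X in X - _]addrC addrK.
  by congr (_ * _); apply: eq_bigr.
rewrite (reindex_inj rev_ord_inj) /=.
transitivity (a n * x ^+ n * (y * u * \sum_(l < m) b l.+1 * x^-1 ^+ l.+1)); last first.
  by rewrite e1 mulr1.
rewrite (big_ord_widen n (fun l => b l.+1 * x^-1 ^+ l.+1) mn) !mulr_sumr.
rewrite [in RHS]big_mkcond /=.
apply: eq_bigr => l _; have ln := ltn_ord l.
have -> : (n - (n - l.+1) = l.+1)%N by rewrite subKn.
case: ifP => _; last by rewrite mul0r.
have -> : x ^+ n = x ^+ (n - l.+1) * x ^+ l.+1 by rewrite -exprD subnK.
rewrite exprVn; move: (x ^+ l.+1) (expf_neq0 l.+1 x0) (x ^+ _) => z z0 w.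
by field.
Qed.

Let O_valuation x : x != 0 -> O x \/ O x^-1.
Proof.
move=> x0; apply: contrapT => /not_orP[nx nxV].
have ex1 : exists n, `[< rep x n >].
  by have [n hn] := rep_exists nx; exists n; apply/asboolP.
have ex2 : exists n, `[< rep x^-1 n >].
  by have [n hn] := rep_exists nxV; exists n; apply/asboolP.
have nrep0 z : ~ rep z 0.
  by move=> [a [_ /eqP]]; rewrite big_ord0 mulr0 eq_sym oner_eq0.
case: (ex_minnP ex1) => -[|n] /asboolP rn nmin; first exact: nrep0 rn.
case: (ex_minnP ex2) => -[|m] /asboolP rm mmin; first exact: nrep0 rm.
have [mn|/ltnW nm] := leqP m n.
  have /nmin : `[< rep x n >] by apply/asboolP; apply: rep_reduce rm.
  by rewrite ltnn.
have /mmin : `[< rep x^-1 m >].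
  by apply/asboolP; apply: (rep_reduce _ nm rm); rewrite ?invr_eq0 // invrK.
by rewrite ltnn.
Qed.

Let unit x : Prop := [/\ x != 0, O x & O x^-1].

Let unitM a b : unit a -> unit b -> unit (a * b).
Proof.
by move=> [a0 ha ha'] [b0 hb hb']; split; rewrite ?mulf_neq0 ?invfM //; apply: OM.
Qed.

Let unitV a : unit a -> unit a^-1.
Proof. by move=> [a0 ha ha']; split; rewrite ?invr_eq0 ?invrK. Qed.

Let unit_exp a n : unit a -> unit (a ^+ n).
Proof.
move=> ha; elim: n => [|n IH]; last by rewrite exprS; apply: unitM.
by rewrite expr0; split; rewrite ?oner_eq0 ?invr1.
Qed.

Let unit_const c : c != 0 -> unit (i c).
Proof. by move=> c0; split; rewrite ?fmorph_eq0 // -fmorphV. Qed.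

Let yn_nonunit n : ~ O (y ^- n.+1).
Proof.
move=> h; apply: (ON (OM (OX n Oy) h)).
by rewrite mulrA -exprS mulfV // expf_neq0.
Qed.

Let unit_yz (n : int) : unit (y ^ n) -> n = 0.
Proof.
case: n => [[|n]|n] [_ h1 h2] //; last by case: (yn_nonunit h1).
by move: h2; rewrite -exprnP => /yn_nonunit.
Qed.

(** The exponent is the multiplicity of the root 0 of f: a polynomial with non-zero constant term
    evaluates to a unit by [O_jacobson]. *)
Let ev_unit f : f != 0 -> exists n : int, unit (ev y f / y ^ n).
Proof.
elim/poly_ind: f => [|f c IH]; first by rewrite eqxx.
have e : ev y (f * 'X + c%:P) = ev y f * y + i c by rewrite rmorphD rmorphM /= evX evC.
have hf : O (ev y f).
  rewrite (ev_coef _ _ (leqnn _)); apply: Osum => j _; apply: OM => //; exact: OX.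
move: e; have [-> e f0|c0 e _] := eqVneq c 0.
  have [|n hn] := IH; first by apply: contra f0 => /eqP ->; rewrite mul0r add0r.
  exists (n + 1); rewrite e rmorph0 addr0 expfzDr //.
  by rewrite invfM mulrACA mulfV // mulr1.
exists 0; rewrite e divr1.
have -> : ev y f * y + i c = i c * (1 - y * (- (i c^-1) * ev y f)).
  have : i c != 0 by rewrite fmorph_eq0.
  by rewrite fmorphV; move: (i c) (ev y f) => u w u0; field.
have hb : O (- i c^-1 * ev y f) by rewrite -rmorphN; apply: OM.
apply: unitM; first exact: unit_const.
split; last exact: O_jacobson.
  by rewrite subr_eq0 eq_sym; apply/eqP/ON.
by apply: OB => //; apply: OM.
Qed.

Let dominant (J : eqType) (s : seq J) (t : J -> K) : s != [::] ->
  (forall j, j \in s -> t j != 0) ->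
  exists2 j0, j0 \in s & forall j, j \in s -> O (t j / t j0).
Proof.
elim: s => [//|j1 s IH] _ ht; have t1 := ht _ (mem_head _ _).
have [->|s0] := eqVneq s [::].
  by exists j1; rewrite ?mem_head // => j; rewrite inE => /eqP ->; rewrite mulfV.
have [//|j js|j0 j0s h0] := IH; first by apply: ht; rewrite inE js orbT.
have t0 : t j0 != 0 by apply: ht; rewrite inE j0s orbT.
have [h|h] : O (t j1 / t j0) \/ O (t j0 / t j1).
  have := @O_valuation (t j1 / t j0); rewrite invf_div; apply.
  by rewrite mulf_neq0 ?invr_eq0.
  exists j0; first by rewrite inE j0s orbT.
  by move=> j; rewrite inE => /orP[/eqP ->|/h0].
exists j1; first exact: mem_head.
move=> j; rewrite inE => /orP[/eqP ->|/h0 hj]; first by rewrite mulfV.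
have -> : t j / t j1 = (t j / t j0) * (t j0 / t j1) by field; apply/andP.
exact: OM.
Qed.

(** In a vanishing sum the minimal valuation is attained twice; otherwise, after division by the
    dominant term, -1 would be a sum of non-units. *)
Let same_value (J : finType) (t : J -> K) : (exists j, t j != 0) ->
  \sum_j t j = 0 -> exists j j', [/\ j != j', t j != 0, t j' != 0 & unit (t j / t j')].
Proof.
move=> [j1 tj1] e.
have [||j0] := @dominant J [seq j <- enum J | t j != 0] t.
- by apply/eqP => s0; have : j1 \in [seq j <- enum J | t j != 0];
    [rewrite mem_filter tj1 mem_enum | rewrite s0].
- by move=> j; rewrite mem_filter => /andP[].
rewrite mem_filter => /andP[t0 _] hdom.
have hO j : O (t j / t j0).
  have [->|tj] := eqVneq (t j) 0; first by rewrite mul0r.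
  by apply: hdom; rewrite mem_filter tj mem_enum.
apply: contrapT => no.
have nonunit j : j != j0 -> t j = 0 \/ ~ O (t j / t j0)^-1.
  move=> jj0; have [->|tj] := eqVneq (t j) 0; [by left | right=> h].
  by apply: no; exists j, j0; split=> //; split; rewrite ?mulf_neq0 ?invr_eq0.
pose m x := O x /\ (x = 0 \/ ~ O x^-1).
have mD a b : m a -> m b -> m (a + b).
  suff H a' b' : m a' -> m b' -> b' != 0 -> O (a' / b') -> m (a' + b').
    move=> ma mb; have [->|a0] := eqVneq a 0; first by rewrite add0r.
    have [->|b0] := eqVneq b 0; first by rewrite addr0.
    have : O (a / b) \/ O (a / b)^-1 by apply: O_valuation; rewrite mulf_neq0 ?invr_eq0.
    by rewrite invf_div => -[h|h]; [apply: H | rewrite addrC; apply: H].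
  move=> [ha _] [hb hb'] b0 hab; split; first exact: OD.
  have [->|ab0] := eqVneq (a' + b') 0; [by left | right=> h].
  case: hb' => [/eqP|]; first by rewrite (negPf b0).
  apply; have -> : b'^-1 = (a' / b' + 1) * (a' + b')^-1 by field; apply/andP.
  by apply: OM => //; apply: OD.
have : m (\sum_(j | j != j0) t j / t j0).
  elim/big_ind: _ => //; first by split=> //; left.
  move=> j /nonunit h; split=> //; case: h => [->|]; first by left; rewrite mul0r.
  by right.
have -> : \sum_(j | j != j0) t j / t j0 = -1.
  rewrite -mulr_suml; apply: (canLR (mulfK t0)).
  by move/eqP: e; rewrite (bigD1 j0) //= addrC addr_eq0 mulN1r => /eqP.
by case=> hN1 [/eqP|]; rewrite ?oppr_eq0 ?oner_eq0 // invrN1 => /(_ hN1).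
Qed.

Hypothesis hd : exists n, forall (I : finType) (x : I -> K), (n <= #|I|)%N ->
  exists f : I -> {poly F}, (exists j, f j != 0) /\ \sum_j ev y (f j) * x j = 0.

(** Applied to a relation between powers of x over F[y], [same_value] gives two terms of equal
    value, hence a power of x that is a power of y up to a unit. The bound n on the exponent does
    not depend on x, whence the common exponent [n!] below. *)
Let root_power x : x != 0 -> forall n, (forall (I : finType) (x : I -> K),
    (n <= #|I|)%N -> exists f : I -> {poly F},
    (exists j, f j != 0) /\ \sum_j ev y (f j) * x j = 0) ->
  exists k (m : int), [/\ (0 < k)%N, (k <= n)%N & unit (x ^+ k / y ^ m)].
Proof.
move=> x0 n hn; have [|f [[j fj] e]] := hn 'I_n (fun j => x ^+ j); first by rewrite card_ord.
have nz j' : f j' != 0 -> ev y (f j') != 0.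
  by move=> /ev_unit[m [h _ _]]; apply: contra h => /eqP ->; rewrite mul0r.
have [|j1 [j2 [ne t1 t2 hu]]] := same_value _ e.
  by exists j; rewrite mulf_neq0 ?nz ?expf_neq0.
wlog lt : j1 j2 ne t1 t2 hu / (j1 < j2)%N => [W|].
  move: (ne); rewrite neq_ltn => /orP[lt|lt]; first exact: (W j1 j2).
  by apply: (W j2 j1) => //; [rewrite eq_sym | rewrite -invf_div; apply: unitV].
have f1 : f j1 != 0 by apply: contra t1 => /eqP ->; rewrite rmorph0 mul0r.
have f2 : f j2 != 0 by apply: contra t2 => /eqP ->; rewrite rmorph0 mul0r.
have [m1 u1] := ev_unit f1; have [m2 u2] := ev_unit f2.
exists (j2 - j1)%N, (m1 - m2); split; [by rewrite subn_gt0| |].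
  by rewrite (leq_trans (leq_subr _ _)) // ltnW.
have := unitM (unitM u1 (unitV u2)) (unitV hu).
have -> : x ^+ j2 = x ^+ (j2 - j1) * x ^+ j1 by rewrite -exprD subnK // ltnW.
congr unit; rewrite expfzDr // -invr_expz.
move: (nz _ f1) (nz _ f2) (expfz_neq0 m1 y0) (expfz_neq0 m2 y0) (expf_neq0 j1 x0).
move: (expf_neq0 (j2 - j1) x0).
move: (x ^+ _) (x ^+ _) (y ^ _) (y ^ _) (ev y _) (ev y _) => a b c d e1 e2 *.
by field; do ?[apply/andP; split=> //].
Qed.

(** [mu x] is the exponent m for which [x^D / y^m] is a unit; dividing by its least positive value g
    gives the normalized valuation. *)
Lemma place_exists_max : exists v : place i, 0 < v y.
Proof.
have [n hn] := hd.
have [D D0 HD] : exists2 D, (0 < D)%N & forall x, x != 0 -> exists m : int, unit (x ^+ D / y ^ m).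
  exists n`!; first exact: fact_gt0.
  move=> x x0; have [k [m [k0 kn hu]]] := root_power x0 hn.
  have kD : (k %| n`!)%N by apply: dvdn_fact; rewrite k0.
  exists (m * (n`! %/ k)%N).
  rewrite -{1}(divnK kD) mulnC exprM -exprz_exp -exprnP -expr_div_n.
  exact: unit_exp.
have /choice[mu muP] : forall x, exists m : int, x != 0 -> unit (x ^+ D / y ^ m).
  by move=> x; have [->|/HD[m hm]] := eqVneq x 0; [exists 0 | exists m].
have muE x m : x != 0 -> unit (x ^+ D / y ^ m) -> mu x = m.
  move=> x0 hm; apply/eqP; rewrite -subr_eq0; apply/eqP; apply: unit_yz.
  have := unitM hm (unitV (muP x x0)); congr unit; rewrite expfzDr // -invr_expz.
  move: (expfz_neq0 m y0) (expfz_neq0 (mu x) y0) (expf_neq0 D x0).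
  move: (y ^ _) (y ^ _) (x ^+ _) => a b c *.
  by field; do ?[apply/andP; split=> //].
have muM x z : x != 0 -> z != 0 -> mu (x * z) = mu x + mu z.
  move=> x0 z0; apply: muE; first by rewrite mulf_neq0.
  have := unitM (muP x x0) (muP z z0); congr unit; rewrite expfzDr // exprMn.
  by rewrite invfM mulrACA.
have muy : mu y = D%:Z.
  apply: muE => //; rewrite -exprnP mulfV ?expf_neq0 //.
  by split; rewrite ?oner_eq0 ?invr1.
have muO x : x != 0 -> O x <-> 0 <= mu x.
  move=> x0; have [_ h1 h2] := muP x x0; split=> [hx|hm].
    rewrite leNgt; apply/negP => lt.
    have : O (y ^ mu x).
      have -> : y ^ mu x = x ^+ D * (x ^+ D / y ^ mu x)^-1.
        rewrite invf_div mulrCA mulfV ?expf_neq0 // mulr1.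
        by [].
      by apply: OM => //; apply: OX.
    by case: (mu x) lt => // k _; apply: yn_nonunit.
  have : O (x ^+ D).
    have -> : x ^+ D = y ^ mu x * (x ^+ D / y ^ mu x).
      by rewrite mulrCA mulfV ?mulr1 // expfz_neq0.
    apply: OM => //; case: (mu x) hm => // k _; rewrite -exprnP; exact: OX.
  have [//|hV] := O_valuation x0; case: D D0 {HD muP muE muy h1 h2} => // D _ h.
  have -> : x = x ^+ D.+1 * x^-1 ^+ D by rewrite exprS exprVn mulfK // expf_neq0.
  by apply: OM => //; apply: OX.
have ex : exists g : nat, (0 < g)%N && `[< exists2 x, x != 0 & mu x = g%:Z >].
  by exists D; rewrite D0; apply/asboolP; exists y.
case: (ex_minnP ex) => g /andP[g0 /asboolP[w w0 muw]] gmin.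
have mu1 : mu 1 = 0.
  have := muM 1 1 (oner_neq0 K) (oner_neq0 K); rewrite mulr1.
  by move: (mu 1) => k; lia.
have muV x : x != 0 -> mu x^-1 = - mu x.
  move=> x0; have := muM x x^-1 x0; rewrite invr_eq0 mulfV // mu1 => /(_ x0); lia.
have muX (x : K) (k : int) : x != 0 -> mu (x ^ k) = k * mu x.
  move=> x0; have muXn j : mu (x ^+ j) = j%:Z * mu x.
    elim: j => [|j IH]; last by rewrite exprS muM ?expf_neq0 // IH; lia.
    by rewrite expr0 mul0r mu1.
  case: k => k; first by rewrite -exprnP muXn.
  by rewrite NegzE -exprnN muV ?expf_neq0 // muXn; lia.
have dvd x : x != 0 -> exists c : int, mu x = c * g%:Z.
  move=> x0; exists (mu x %/ g%:Z)%Z.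
  have := divz_eq (mu x) g%:Z; have gz : g%:Z != 0 by lia.
  have := modz_ge0 (mu x) gz; have : (mu x %% g%:Z)%Z < g%:Z by apply: ltz_pmod.
  set q := (_ %/ _)%Z; set r := (_ %% _)%Z => rg r0 e.
  have [r1|r1] := eqVneq r 0; first by rewrite e r1 addr0.
  have wq0 : w ^ (- q) != 0 by rewrite expfz_neq0.
  have /gmin : (0 < `|r|)%N && `[< exists2 x, x != 0 & mu x = `|r|%N%:Z >].
    apply/andP; split; first by lia.
    apply/asboolP; exists (x * w ^ (- q)); first by rewrite mulf_neq0.
    by rewrite muM // muX // muw; lia.
  by lia.
have /choice[v vP] : forall x, exists c : int, x != 0 -> mu x = c * g%:Z.
  by move=> x; have [->|/dvd[c hc]] := eqVneq x 0; [exists 0 | exists c].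
have vge x z : x != 0 -> z != 0 -> v x <= v z -> O (z / x).
  move=> x0 z0 le; apply/muO; first by rewrite mulf_neq0 ?invr_eq0.
  rewrite muM ?invr_eq0 // muV // !vP //; nia.
have gcan (a b : int) : a * g%:Z = b * g%:Z -> a = b by apply: mulIf; lia.
have pM x z : x != 0 -> z != 0 -> v (x * z) = v x + v z.
  by move=> x0 z0; apply: gcan; rewrite -vP ?mulf_neq0 // muM // !vP //; lia.
have pD x z : x != 0 -> z != 0 -> x + z != 0 -> Num.min (v x) (v z) <= v (x + z).
  have H a b : a != 0 -> b != 0 -> a + b != 0 -> v a <= v b -> v a <= v (a + b).
    move=> a0 b0 ab0 le; have /muO : O ((a + b) / a).
      by rewrite mulrDl mulfV //; apply: OD => //; apply: vge.
    rewrite mulf_neq0 ?invr_eq0 // muM ?invr_eq0 // muV // !vP // => /(_ isT); nia.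
  move=> x0 z0 xz0; have [le|lt] := leP (v x) (v z); first exact: H.
  by rewrite addrC; apply: H => //; [rewrite addrC | apply: ltW].
have pc c : c != 0 -> v (i c) = 0.
  move=> c0; have ic0 : i c != 0 by rewrite fmorph_eq0.
  apply: gcan; rewrite -vP // mul0r; have [_ h1 h2] := unit_const c0.
  have := (muO _ ic0).1 h1; have /muO : O (i c)^-1 by [].
  by rewrite invr_eq0 ic0 muV // => /(_ isT); lia.
have pu : exists2 x, x != 0 & v x = 1.
  by exists w => //; apply: gcan; rewrite -vP // muw mul1r.
exists (Place pM pD pc pu) => /=; have := vP _ y0; rewrite muy; nia.
Qed.

End MaximalSubring.

Lemma place_exists : (exists n, forall (I : finType) (x : I -> K), (n <= #|I|)%N ->
    exists f : I -> {poly F}, (exists j, f j != 0) /\ \sum_j ev y (f j) * x j = 0) ->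
  exists v : place i, 0 < v y.
Proof. by move=> hd; have [O [gO Omax]] := max_good; apply: (place_exists_max gO Omax hd). Qed.

End Existence.

(** * Functions regular outside a place *)

Lemma large_fiber (S T : finType) (X : {set S}) (h : S -> T) r :
  (#|T| * r < #|X|)%N -> exists Y : {set S},
    [/\ Y \subset X, (r < #|Y|)%N & forall x y, x \in Y -> y \in Y -> h x = h y].
Proof.
move=> lt; apply: contrapT => no.
have le t : (#|[set x in X | h x == t]| <= r)%N.
  rewrite leqNgt; apply/negP => gt; apply: no.
  exists [set x in X | h x == t]; split=> //.
    by apply/fintype.subsetP => x; rewrite inE => /andP[].
  by move=> x y; rewrite !inE => /andP[_ /eqP ->] /andP[_ /eqP ->].
move: lt; rewrite ltnNge => /negP; apply.
rewrite -sum1_card (partition_big h predT) //=.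
rewrite -sum_nat_const leq_sum // => t _; rewrite sum1dep_card; apply: le.
Qed.

Lemma large_multifiber (S : finType) (E : nat -> S -> S -> Prop) (N : nat -> nat) s r :
  (forall l, (l < s)%N -> exists (T : finType) (h : S -> T),
     #|T| = N l /\ forall x y, h x = h y -> E l x y) ->
  forall X : {set S}, ((\prod_(l < s) N l) * r < #|X|)%N -> exists Y : {set S},
    [/\ Y \subset X, (r < #|Y|)%N &
      forall l x y, (l < s)%N -> x \in Y -> y \in Y -> E l x y].
Proof.
elim: s r => [|s IH] r hE X.
  by rewrite big_ord0 mul1n => lt; exists X.
rewrite big_ord_recr /= -mulnA => /IH[|Y [YX ltY hY]].
  by move=> l ls; apply: hE; apply: ltnW.
have [T [h [cT hh]]] := hE s (ltnSn s); rewrite -cT in ltY.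
have [Z [ZY ltZ hZ]] := large_fiber h ltY.
exists Z; split=> //; first exact: fintype.subset_trans YX.
move=> l x y; rewrite ltnS leq_eqVlt => /orP[/eqP -> xZ yZ|ls xZ yZ].
  by apply: hh; apply: hZ.
by apply: hY => //; apply: (fintype.subsetP ZY).
Qed.

Section Affine.
Context (F : finFieldType) (K : fieldType) (i : {rmorphism F -> K}).
Hypothesis hd : ff_dep i.
Local Notation ev := (ev i).
Implicit Types (v w : place i) (x y z : K).

Lemma same_pge v w x n : same_place v w -> pge v x n -> pge w x n.
Proof.
by move=> s [->|h]; [left | have [->|x0] := eqVneq x 0; [left | right; rewrite -s]].
Qed.

(** A family independent at one pole is multiplied by a function close to 1 there and close to 0 at
    the other poles; N exceeds every pole order that could interfere. *)
Lemma local_family (vs : nat -> place i) s y (deg : nat -> nat) (l : 'I_s) :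
  (forall l, (l < s)%N -> vs l y < 0) ->
  (forall l l', (l < s)%N -> (l' < s)%N -> l <> l' -> ~ same_place (vs l) (vs l')) ->
  has_degree (vs l) (deg l) ->
  exists u : 'I_(`|vs l y|) * 'I_(deg l) -> K,
    [/\ forall m, pge (vs l) (u m) 0,
        forall m l', (l' < s)%N -> l' <> l -> pge (vs l') (u m) (- vs l' y)
      & forall c : 'I_(`|vs l y|) * 'I_(deg l) -> F,
          pge (vs l) (\sum_m i (c m) * u m) (- vs l y) -> forall m, c m = 0].
Proof.
move=> hy hdist [_ _ /(_ `|vs l y|%N)[w [wO wI]]].
pose N := (\sum_(l' < s) (`|vs l' y| + \sum_m `|vs l' (w m)|))%N.
have N1 l' : (l' < s)%N -> (`|vs l' y| <= N)%N.
  by move=> ls; rewrite /N (bigD1 (Ordinal ls)) //= -addnA leq_addr.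
have N2 l' m : (l' < s)%N -> (`|vs l' y| + `|vs l' (w m)| <= N)%N.
  move=> ls; rewrite /N (bigD1 (Ordinal ls)) //= (bigD1 m) //= !addnA.
  by rewrite -[X in (_ <= X)%N]addnA leq_addr.
have [x [x1 xs]] : exists x, pge (vs l) (x - 1) N /\
    forall k, (k < s.-1)%N -> pge (vs (bump l k)) x N.
  apply: weak_approx => k ks; apply: hdist => //.
    rewrite /bump; have := ltn_ord l; case: leqP => _; lia.
  by move/eqP; rewrite (negPf (neq_bump _ _)).
exists (fun m => x * w m); split=> [m|m l' ls nl|c h].
- have -> : x * w m = (x - 1) * w m + w m by ring.
  by apply: pgeD => //; rewrite -[0]addr0; apply: pgeM => //; apply: pge_le x1.
- have xl' : pge (vs l') x N.
    have e : l' = bump l (unbump l l') by rewrite unbumpK // inE; apply/eqP.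
    rewrite e; apply: xs; rewrite /unbump; have := ltn_ord l.
    by move: nl ls; case: (ltnP l l') => /=; lia.
  have := pgeM xl' (pge_refl (vs l') (w m)); apply: pge_le.
  by have := N2 l' m ls; lia.
- apply: wI; have := hy l (ltn_ord l); have := N1 l (ltn_ord l).
  move=> hN ly; have eN : - vs l y = `|vs l y|%N%:Z by lia.
  rewrite eN in h.
  have -> : \sum_m i (c m) * w m =
      \sum_m i (c m) * (x * w m) - \sum_m i (c m) * ((x - 1) * w m).
    by rewrite -sumrB; apply: eq_bigr => m _; ring.
  apply: pgeB => //; apply: pge_sum => m _; apply: pge_scale.
  by rewrite -[X in pge _ _ X]addr0; apply: pgeM => //; apply: pge_le x1; lia.
Qed.

Lemma multi_indep (vs : nat -> place i) s y (deg : nat -> nat) :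
  (forall l, (l < s)%N -> vs l y < 0) ->
  (forall l l', (l < s)%N -> (l' < s)%N -> l <> l' -> ~ same_place (vs l) (vs l')) ->
  (forall l, (l < s)%N -> has_degree (vs l) (deg l)) ->
  exists (J : finType) (z : J -> K),
    indep vs s y z /\ #|J| = (\sum_(l < s) `|vs l y| * deg l)%N.
Proof.
move=> hy hdist hdeg.
have H l := cid (local_family hy hdist (hdeg _ (ltn_ord l))).
pose u l := sval (H l).
exists {l : 'I_s & ('I_(`|vs l y|) * 'I_(deg l))%type}, (fun j => u (tag j) (tagged j)).
split; last first.
  rewrite card_tagged sumnE big_map big_enum /=.
  by apply: eq_bigr => l _; rewrite card_prod !card_ord.
split=> [j l ls|c hc j].
  have [uO uI _] := svalP (H (tag j)).
  have [->|/eqP ne] := eqVneq l (tag j); first exact: uO.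
  by apply: pge_le (uI _ _ ls ne); have := hy _ ls; lia.
case: j => l m; have [_ _ uF] := svalP (H l).
apply: (uF (fun m => c (Tagged _ m))).
have := hc l (ltn_ord l); rewrite (bigID (fun j => tag j == l)) /=.
set S1 := \sum_(j | _) _; set S2 := \sum_(j | _) _ => h12.
have hS2 : pge (vs l) S2 (- vs l y).
  apply: pge_sum => j ne; apply: pge_scale.
  have [_ uI _] := svalP (H (tag j)); apply: uI => // e.
  by move/eqP: ne; apply; apply/esym/val_inj.
pose T (x : 'I_s) : finType := ('I_(`|vs x y|) * 'I_(deg x))%type.
have -> : \sum_m0 i (c (Tagged T m0)) * sval (H l) m0 = S1.
  have := @sig_big_dep _ 0 (GRing.add : Monoid.com_law (0 : K)) _ _ (fun l' => l' == l)
    (fun _ _ => true) (fun l' m0 => i (c (Tagged T m0)) * u l' m0).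
  rewrite big_pred1_eq => ->; rewrite /S1; apply: eq_big => [j|j _].
    by rewrite andbT.
  by case: j.
by rewrite -(addrK S2 S1); apply: pgeB.
Qed.

(** Each pole contributes at least one element to an independent family, whose size is bounded by
    [ff_dep]; a maximal list of distinct poles is therefore complete. *)
Lemma poles_family v y : v y < 0 -> y != 0 -> exists s (vs : nat -> place i),
  [/\ vs 0%N = v, forall l, (l < s.+1)%N -> vs l y < 0,
      forall l l', (l < s.+1)%N -> (l' < s.+1)%N -> l <> l' -> ~ same_place (vs l) (vs l')
    & forall w, w y < 0 -> exists2 l, (l < s.+1)%N & same_place w (vs l)].
Proof.
move=> vy y0.
pose ok s := exists vs : nat -> place i,
  [/\ vs 0%N = v, forall l, (l < s.+1)%N -> vs l y < 0 &
      forall l l', (l < s.+1)%N -> (l' < s.+1)%N -> l <> l' -> ~ same_place (vs l) (vs l')].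
have [n hn] := hd y.
have ub s : `[< ok s >] -> (s <= n)%N.
  move=> /asboolP[vs [_ hy hdist]].
  have D l := cid (degree_exists hd (vs l)); pose deg l := sval (D l).
  have [J [z [iz cJ]]] := multi_indep hy hdist (fun l _ => svalP (D l)).
  rewrite leqNgt; apply/negP => lt; have nJ : (n <= #|J|)%N.
    rewrite cJ (leq_trans (ltnW lt)) //.
    apply: (@leq_trans (\sum_(l < s.+1) 1)); first by rewrite sum1_card card_ord.
    apply: leq_sum => l _; rewrite muln_gt0; apply/andP; split.
      by have := hy l (ltn_ord l); lia.
    by have [] := svalP (D l).
  have [f [[j fj] e]] := hn J z nJ.
  by have := indep_poly hy y0 iz e j => /eqP; rewrite (negPf fj).
have ex : exists s, `[< ok s >].
  exists 0%N; apply/asboolP; exists (fun _ => v); split=> // l l'.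
  by rewrite !ltnS !leqn0 => /eqP -> /eqP ->.
case: (ex_maxnP ex ub) => s /asboolP[vs [v0 hy hdist]] smax.
exists s, vs; split=> // w wy; apply: contrapT => no.
have : (s.+1 <= s)%N; last by rewrite ltnn.
apply: smax; apply/asboolP.
have sym v1 v2 : same_place v1 v2 -> same_place v2 v1 by move=> h x x0; rewrite h.
exists (fun l => if (l < s.+1)%N then vs l else w); split=> // [l ls|l l'].
  by case: ifP => // /hy.
case: ifP => h1; case: ifP => h2 l1 l2 ne h.
- exact: (hdist l l').
- by apply: no; exists l => //; apply: sym.
- by apply: no; exists l'.
- by move: l1 l2 ne; lia.
Qed.

Section Ring.
Context (P : place i).
Local Notation A := (regular_outside P).

Lemma regular_const c : A (i c).
Proof. by move=> v _; apply: pge_const. Qed.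

Lemma regularB x y : A x -> A y -> A (x - y).
Proof. by move=> hx hy v nv; apply: pgeB; [apply: hx | apply: hy]. Qed.

Lemma regularM x y : A x -> A y -> A (x * y).
Proof.
by move=> hx hy v nv; have := pgeM (hx v nv) (hy v nv); rewrite addr0.
Qed.

Lemma regular_ev y f : A y -> A (ev y f).
Proof.
move=> hy v nv; rewrite (ev_coef _ _ (leqnn _)); apply: pge_sum => j _.
by apply: pge_scale; have := pgeX j (hy v nv); rewrite mulr0.
Qed.

(** If x had a zero at P, then 1/x, which is transcendental because of its pole at P, would vanish
    at some place; that place is a pole of x other than P. *)
Lemma regular_no_zero x : A x -> x != 0 -> P x <= 0.
Proof.
move=> Ax x0; rewrite leNgt; apply/negP => px.
have y0 : x^-1 != 0 by rewrite invr_eq0.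
have py : P x^-1 < 0 by rewrite placeV //; lia.
have [|v vy] := @place_exists _ _ i x^-1 y0 _ (hd x^-1).
  move=> f; apply/eqP => e.
  have [/subr0_eq h|h] := eqVneq ('X * f - 1) 0; last first.
    by have := ev_neq0 py y0 h; rewrite rmorphB rmorphM rmorph1 /= evX e subrr eqxx.
  have := congr1 (fun q : {poly F} => q.[0]) h.
  by rewrite /= !hornerE => /esym/eqP; rewrite oner_eq0.
have nv : ~ same_place v P by move=> s; move: vy; rewrite s //; lia.
by move: vy; rewrite placeV //; have := pge_val x0 (Ax v nv); lia.
Qed.

Lemma common_integral (J : finType) (z : J -> K) v y : v y < 0 -> y != 0 ->
  exists2 g, ev y g != 0 & forall j, integralOver (ev y) (ev y g * z j).
Proof.
move=> vy y0.
have evn f : f != 0 -> ev y f != 0 by exact: ev_neq0 vy y0.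
have [n hn] := hd y.
have /choice[c hc] : forall j, exists c, ev y c != 0 /\ integralOver (ev y) (ev y c * z j).
  move=> j; have [|f [[l fl] e]] := hn 'I_n (fun l => z j ^+ l); first by rewrite card_ord.
  pose p := \poly_(l < n) (if insub l is Some l' then f l' else 0).
  have pE (l' : 'I_n) : p`_l' = f l' by rewrite coef_poly ltn_ord valK.
  have [||c c0 hc] := @integral_denominator _ _ i y p (z j) evn.
  - by apply: contra fl => /eqP p0; rewrite -pE p0 coef0.
  - apply/rootP; rewrite (@horner_coef_wide _ n); last first.
      by rewrite (leq_trans (size_poly _ _)) // size_poly.
    by rewrite -[RHS]e; apply: eq_bigr => l' _; rewrite coef_map /= pE.
  by exists c.
exists (\prod_j c j); first by rewrite rmorph_prod; apply/prodf_neq0 => j _; case: (hc j).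
move=> j; rewrite (bigD1 j) //= rmorphM mulrC mulrA mulrC; apply: integral_mul.
  exact: integral_id.
by rewrite mulrC; case: (hc j).
Qed.

(** Take y with a simple pole at P; its other poles are the obstacle. Among the combinations of a
    family integral over F[y] with coefficients of degree less than M, those with the same polar
    parts at the other poles still outnumber the residues at P. If no difference of these had a pole
    at P, two of them would differ by a non-zero function with a zero at P and regular elsewhere. *)
Lemma exists_pole : exists y, [/\ A y, y != 0 & P y < 0].
Proof.
have [pi [p0 p1]] := uniformizer P; pose y := pi^-1.
have y0 : y != 0 by rewrite invr_eq0.
have py : P y < 0 by rewrite placeV // p1.
have [s [vs [v0 hy hdist hall]]] := poles_family py y0.
have D l := cid (degree_exists hd (vs l)); pose deg l := sval (D l).
have hdeg l : has_degree (vs l) (deg l) by exact: svalP (D l).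
have [J [z [iz cJ]]] := multi_indep hy hdist (fun l _ => hdeg l).
have [g g0 hg] := common_integral z py y0.
pose b j := ev y g * z j.
pose C := (\sum_(l < s.+1) \sum_j `|vs l (b j)|)%N.
have bC l j : (l < s.+1)%N -> pge (vs l) (b j) (- C%:Z).
  move=> ls; right; have : (`|vs l (b j)| <= C)%N.
    by rewrite /C (bigD1 (Ordinal ls)) //= (bigD1 j) //= -addnA leq_addr.
  lia.
(* Beyond the part linear in M, fixing the polar parts at the other poles costs C per unit of
   degree; M exceeds this total cost plus the degree of P. *)
pose M := (C * (\sum_(l < s) deg l.+1) + deg 0%N).+1.
pose val (f : {ffun J -> 'rV[F]_M}) := \sum_j ev y (rVpoly (f j)) * b j.
have val_inj : injective val.
  move=> f f' e; apply/ffunP => j; apply: (can_inj rVpolyK); apply/eqP.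
  rewrite -subr_eq0; apply/eqP; move: j.
  apply: (indep_poly (f := fun j => rVpoly (f j) - rVpoly (f' j)) hy y0 iz).
  apply: (mulfI g0); rewrite mulr0 -[RHS](subrr (val f)) {2}e -sumrB mulr_sumr.
  by apply: eq_bigr => j _; rewrite rmorphB /b /=; ring.
pose n l := (`|vs l y| * M + C)%N.
have val_pge l f : (l < s.+1)%N -> pge (vs l) (val f) (- (n l)%:Z).
  move=> ls; apply: pge_sum => j _.
  have -> : - (n l)%:Z = - (`|vs l y| * M)%N%:Z + (- C%:Z) by rewrite /n; lia.
  apply: pgeM (bC l j ls); rewrite (@ev_coef _ _ i y _ M) ?size_poly //.
  apply: pge_sum => m _; apply: pge_scale; apply: pge_le (pgeX m (pge_refl _ _)).
  by have := hy l ls; have := ltn_ord m; nia.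
pose E l f f' := pge (vs l.+1) (val f - val f') 0.
have [||X [_ ltX hX]] := @large_multifiber _ E (fun l => #|F| ^ (n l.+1 * deg l.+1))%N s
    (#|F| ^ deg 0)%N _ [set: {ffun J -> 'rV[F]_M}].
- move=> l ls; have [_ /(_ (- (n l.+1)%:Z) (n l.+1))[dl hdl] _] := hdeg l.+1.
  exists 'M[F]_(n l.+1, deg l.+1), (dl \o val); split; first by rewrite card_mx.
  move=> f f' e; have := hdl _ _ (val_pge l.+1 f ls) (val_pge l.+1 f' ls) e.
  by rewrite addNr.
- rewrite cardsT card_ffun card_mx mul1n -expnM cJ.
  rewrite -expn_sum -expnD ltn_exp2l ?card_finNzRing_gt1 // big_ord_recl /=.
  rewrite mulnDr v0 big_distrr /=.
  have P1 : (1 <= `|P y|)%N by lia.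
  have d1 : (1 <= deg 0)%N by have [] := hdeg 0%N.
  have -> : (\sum_(l < s) n l.+1 * deg l.+1 =
      C * (\sum_(l < s) deg l.+1) + \sum_(l < s) M * (`|vs l.+1 y| * deg l.+1))%N.
    rewrite big_distrr -big_split /=; apply: eq_bigr => l _.
    by rewrite /n mulnDl addnC mulnA [(_ * M)%N]mulnC.
  rewrite addnAC [X in (_ < _ + X)%N](_ : _ = \sum_(l < s) M * (`|vs l.+1 y| * deg l.+1))%N //.
  rewrite ltn_add2r; apply: (@leq_trans (M * 1)%N); first by rewrite muln1.
  by rewrite leq_mul2l muln_gt0 P1 d1 orbT.
have [f0 f0X] : exists f0, f0 \in X.
  by apply/set0Pn; rewrite -card_gt0 (leq_trans _ ltX).
have regX f f' : f \in X -> f' \in X -> A (val f - val f').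
  move=> fX f'X v nv; have [vy|vy] := ltP (v y) 0.
    have [[|l] ls sl] := hall _ vy; first by rewrite v0 in sl.
    apply: (same_pge (v := vs l.+1)); last exact: hX.
    by move=> x x0; rewrite sl.
  have vv f1 : pge v (val f1) 0.
    have vy' : pge v y 0 by right.
    apply: pge_sum => j _; rewrite -[0]addr0; apply: pgeM; last first.
      exact: integral_pge (hg j) vy'.
    exact: integral_pge (integral_id _ _) vy'.
  exact: pgeB.
apply: contrapT => no.
have pos f : f \in X -> pge P (val f - val f0) 0.
  move=> fX; have [->|ne] := eqVneq (val f - val f0) 0; first by left.
  right; rewrite leNgt; apply/negP => lt; apply: no.
  by exists (val f - val f0); split=> //; apply: regX.
have [_ /(_ 0 1%N)[dl hdl] _] := hdeg 0%N.
have [|Y [YX ltY hY]] := @large_fiber _ _ X (fun f => dl (val f - val f0)) 1.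
  by rewrite card_mx mul1n muln1.
have [f fY [f' f'Y ff']] : exists2 f, f \in Y & exists2 f', f' \in Y & f != f'.
  have [f fY] : exists f, f \in Y by apply/set0Pn; rewrite -card_gt0 ltnW.
  exists f => //; have : (0 < #|Y :\ f|)%N by move: ltY; rewrite (cardsD1 f) fY; lia.
  by rewrite card_gt0 => /set0Pn[f']; rewrite !inE => /andP[ne f'Y]; exists f'; rewrite // eq_sym.
have fX := fintype.subsetP YX _ fY; have f'X := fintype.subsetP YX _ f'Y.
have := hdl (val f - val f0) (val f' - val f0); rewrite !v0.
move=> /(_ (pos _ fX) (pos _ f'X) (hY _ _ fY f'Y)).
have -> : val f - val f0 - (val f' - val f0) = val f - val f' by ring.
have ne : val f - val f' != 0.
  by rewrite subr_eq0; apply: contra ff' => /eqP/val_inj ->.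
move/(pge_val ne); have := regular_no_zero (regX _ _ fX f'X) ne.
by clear; lia.
Qed.

End Ring.
End Affine.

(* What the ring B of functions regular outside Q, with the involution bar,
   contributes to the study of the group: the lower bound of Riemann-Roch up to a
   bounded error (ar_many) and the absence of zeros at Q (ar_nozero), which gives
   the upper bound. *)
Record arithmetic (F : finFieldType) (L : fieldType) (i : {rmorphism F -> L})
    (bar : {rmorphism L -> L}) (Q : place i) (B : set L) (d : nat) : Prop := {
  ar_degree : has_degree Q d;
  ar_const : forall c, B (i c);
  ar_sub : forall x y, B x -> B y -> B (x - y);
  ar_mul : forall x y, B x -> B y -> B (x * y);
  ar_bar : forall x, B x -> B (bar x);
  ar_barK : involutive bar;
  ar_bar_const : forall c, bar (i c) = i c;
  ar_val_bar : forall x, Q (bar x) = Q x;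
  ar_nozero : forall x, B x -> x != 0 -> Q x <= 0;
  ar_many : exists C : nat, forall N : nat, exists (S : finType) (b : S -> L),
    [/\ injective b, (#|F| ^ (d * N) <= #|S|)%N &
        forall s, B (b s) /\ pge Q (b s) (- (N + C)%N%:Z)];
  ar_pole : exists y, [/\ B y, bar y = y, y != 0 & Q y < 0];
  ar_skew : exists y, [/\ B y, y != 0 & y + bar y = 0] }.

(** * The quadratic extension and the ring B *)

Section Cover.
Context (F : finFieldType) (k : fieldType) (iota : {rmorphism F -> k}).
Context (L : fieldExtType k) (bar : 'AEnd(L)) (P : place iota).
Context (Q : place (const_ext iota L)) (e : nat).
Hypotheses (hk : function_field iota) (dimL : \dim {:L} = 2%N).
Hypotheses (hbar : exists x, bar x != x) (hQ : lies_above P Q e).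
Hypothesis hQ_unique : forall (Q' : place (const_ext iota L)) (e' : nat),
  lies_above P Q' e' -> same_place Q' Q.
Local Notation A := (regular_outside P).
Local Notation B := (@integral_closure k L A).
Local Notation iL := (const_ext iota L).

Lemma ff_dep_base : ff_dep iota.
Proof.
have [t [n [b bb]]] := function_field_basis hk.
by move=> y; apply: ff_dependent bb y.
Qed.

Lemma ev_lift t f : ev iL t%:A f = (ev iota t f)%:A.
Proof. by rewrite !evE map_poly_comp; apply: (horner_map (in_alg L)). Qed.

Lemma ff_dep_ext : ff_dep iL.
Proof.
have [t [n [b bb]]] := function_field_basis hk => y.
pose v := vbasis {:L}; pose m := \dim {:L}.
apply: (@ff_dependent _ _ _ t%:A ('I_n * 'I_m)%type (fun j => (b j.1)%:A * v`_j.2)).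
move=> x; have [h [R [h0 hR]]] := common_denominator (fun l : 'I_m => coord v l x) bb.
exists h, (fun j => R j.2 j.1); rewrite ev_lift; split.
  by rewrite scaler_eq0 negb_or h0 oner_eq0.
rewrite (coord_vbasis (memvf x)) -/v mulr_sumr.
rewrite -(pair_big xpredT xpredT (fun j l => ev iL t%:A (R l j) * ((b j)%:A * v`_l))) /=.
rewrite exchange_big; apply: eq_bigr => l _.
rewrite -scalerAl mul1r scalerA hR scaler_suml; apply: eq_bigr => j _.
by rewrite ev_lift -!scalerAl !mul1r scalerA.
Qed.

Lemma bar_alg c : bar c%:A = c%:A.
Proof. by rewrite linearZ /= rmorph1. Qed.

(** An element th moved by [bar] completes 1 to a basis of L over k, and if [a + b th] is fixed then
    b = 0. *)
Lemma bar_fixed z : bar z = z -> exists c, z = c%:A.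
Proof.
move=> hz; have [th hth] := hbar.
have nth : th \notin 1%VS.
  by apply: contra hth => /vlineP[c ->]; rewrite bar_alg.
have th0 : th != 0 by apply: contra nth => /eqP ->; rewrite mem0v.
have dj : (1 :&: <[th]> = 0)%VS.
  apply/eqP; rewrite -subv0; apply/subvP => x; rewrite memv_cap memv0.
  case/andP=> /vlineP[a ->] /vlineP[c ac].
  have [c0|c0] := eqVneq c 0; first by rewrite ac c0 scale0r.
  case/negP: nth; have -> : th = (c^-1 * a) *: 1.
    by rewrite -scalerA ac scalerA mulVf // scale1r.
  by rewrite memvZ // mem1v.
have full : (1 + <[th]>)%VS = {:L}%VS.
  apply/eqP; rewrite eqEdim subvf /= dimL dimv_disjoint_sum // dimv1 dim_vline.
  by rewrite th0.
have : z \in (1 + <[th]>)%VS by rewrite full memvf.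
case/memv_addP=> _ /vlineP[a ->] [_ /vlineP[b ->] zE]; exists a.
have : b *: (bar th - th) = 0.
  apply: (addrI (a%:A + b *: th)); rewrite addr0 -zE -{2}hz zE rmorphD /= bar_alg.
  by rewrite linearZ /= scalerBr -addrA; congr (_ + _); rewrite addrC subrK.
move/eqP; rewrite scaler_eq0 subr_eq0 (negPf hth) orbF => /eqP b0.
by rewrite zE b0 scale0r addr0.
Qed.

Let bar0 x : (bar x == 0) = (x == 0). Proof. exact: fmorph_eq0. Qed.

(** The composite of Q with [bar] is a place above P with the same index, hence equals Q by
    uniqueness. *)
Lemma place_bar x : Q (bar x) = Q x.
Proof.
have [->|x0] := eqVneq x 0; first by rewrite rmorph0.
have pM y z : y != 0 -> z != 0 -> Q (bar (y * z)) = Q (bar y) + Q (bar z).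
  by move=> y0 z0; rewrite rmorphM placeMl ?bar0.
have pD y z : y != 0 -> z != 0 -> y + z != 0 ->
    Num.min (Q (bar y)) (Q (bar z)) <= Q (bar (y + z)).
  by move=> y0 z0 yz0; rewrite rmorphD placeD ?bar0 // -rmorphD bar0.
have pc c : c != 0 -> Q (bar (iL c)) = 0.
  by move=> c0; rewrite bar_alg (place_const Q).
have pu : exists2 y, y != 0 & Q (bar y) = 1.
  have [y [y0 y1]] := uniformizer Q; exists (bar y); rewrite ?bar0 //.
  by rewrite quadratic_involutive.
have := @hQ_unique (Place pM pD pc pu) e; apply=> //.
by have [e0 h] := hQ; split=> // y y0; rewrite -h //= bar_alg.
Qed.

Definition regular_pred : {pred k} := [pred x | `[< A x >]].

Lemma regular_subring_closed : subring_closed regular_pred.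
Proof.
split; first by apply/asboolP; rewrite -(rmorph1 iota); apply: regular_const.
  by move=> x y /asboolP hx /asboolP hy; apply/asboolP/regularB.
by move=> x y /asboolP hx /asboolP hy; apply/asboolP/regularM.
Qed.
HB.instance Definition _ := GRing.isSubringClosed.Build k regular_pred regular_subring_closed.

Definition regular_ring := {x : k | x \in regular_pred}.
HB.instance Definition _ := SubChoice.on regular_ring.
HB.instance Definition _ := [SubChoice_isSubComNzRing of regular_ring by <:].

(** Passing to a ring structure on A makes the stability of integral elements under ring operations
    available. *)
Lemma integral_closureP x :
  B x <-> integralOver (in_alg L \o (val : regular_ring -> k)) x.
Proof.
split=> [[p [mp Ap px]]|[q mq qx]]; last first.
  exists (map_poly val q); split; first exact: monic_map.
    by move=> j; rewrite coef_map; apply/asboolP/(valP q`_j).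
  by rewrite -map_poly_comp.
pose f j : regular_ring := exist _ p`_j (introT (asboolP _) (Ap j)).
pose q := \poly_(j < size p) f j.
have qp : map_poly val q = p.
  apply/polyP => j; rewrite coef_map coef_poly; case: ltnP => //= le.
  by rewrite nth_default.
exists q; last by rewrite map_poly_comp qp.
apply/eqP/val_inj; rewrite /= -lead_coef_map_inj ?raddf0 //; last exact: val_inj.
by rewrite qp (monicP mp).
Qed.

Lemma closureB x y : B x -> B y -> B (x - y).
Proof. by rewrite !integral_closureP; apply: integral_sub. Qed.

Lemma closureM x y : B x -> B y -> B (x * y).
Proof. by rewrite !integral_closureP; apply: integral_mul. Qed.

Lemma closure_regular c : A c -> B c%:A.
Proof.
move=> Ac; rewrite integral_closureP.
exact: (@integral_id regular_ring L (in_alg L \o val) (exist _ c (introT (asboolP _) Ac))).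
Qed.

Lemma closure_bar x : B x -> B (bar x).
Proof.
move=> [p [mp Ap /rootP px]]; exists p; split=> //; apply/rootP.
rewrite -(rmorph0 bar) -px -horner_map; congr (_.[_]).
by apply/polyP => j; rewrite !coef_map /= bar_alg.
Qed.

(** A is an intersection of valuation rings, hence integrally closed in k. *)
Lemma closure_base c : B c%:A -> A c.
Proof.
move=> [p [mp Ap px]] v nv; apply: (monic_root_pge (p := p)) => //.
  by move: px; rewrite fmorph_root.
by move=> m; apply: Ap.
Qed.

Lemma closure_ev y x : A y -> integralOver (ev iL y%:A) x -> B x.
Proof.
move=> Ay [p mp px]; exists (map_poly (ev iota y) p); split.
- exact: monic_map.
- by move=> j; rewrite coef_map; apply: regular_ev.
- rewrite -map_poly_comp; move: px; congr (root _ x); apply: eq_map_poly => f /=.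
  by rewrite ev_lift.
Qed.

Let e_gt0 : (0 < e)%N. Proof. by case: hQ. Qed.

(** The norm of x lies in A, and since [bar] preserves Q it would have a zero at P if x had one at
    Q. *)
Lemma closure_nozero x : B x -> x != 0 -> Q x <= 0.
Proof.
move=> Bx x0; have [n hn] : exists n, x * bar x = n%:A.
  by apply: bar_fixed; rewrite rmorphM /= quadratic_involutive // mulrC.
have An : A n by apply: closure_base; rewrite -hn; apply/closureM/closure_bar.
have n0 : n != 0.
  apply/eqP => n0; move/eqP: hn; rewrite n0 scale0r mulf_eq0 bar0.
  by rewrite orbb (negPf x0).
have := regular_no_zero ff_dep_base An n0.
have [_ hP] := hQ; have := hP n n0; rewrite -hn placeMl ?bar0 // place_bar.
by nia.
Qed.

(** With n the order of the pole of y at Q, there are [n * d] functions integral over F[y] and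
    independent over it. Coefficients of degree less than M, with [n * M] between N and N + n, give
    the required number of combinations while keeping the poles bounded. *)
Lemma closure_many d : has_degree Q d -> exists C : nat, forall N : nat,
  exists (S : finType) (b : S -> L),
    [/\ injective b, (#|F| ^ (d * N) <= #|S|)%N &
        forall s, B (b s) /\ pge Q (b s) (- (N + C)%N%:Z)].
Proof.
move=> [d0 _ hw]; have [y [Ay y0 Py]] := exists_pole ff_dep_base P.
have yA0 : y%:A != 0 :> L by rewrite scaler_eq0 negb_or y0 oner_eq0.
have Qy : Q y%:A < 0 by have [_ ->] := hQ; nia.
pose n := `|Q y%:A|%N; have Qn : Q y%:A = - n%:Z by rewrite /n; lia.
have n0 : (0 < n)%N by lia.
have [w [wO wI]] := hw n.
have iw : indep (fun=> Q) 1 y%:A w.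
  by split=> [j l _|c /(_ 0%N isT)]; [exact: wO | rewrite Qn opprK; apply: wI].
have [g g0 hg] := common_integral ff_dep_ext w Qy yA0.
pose b j := ev iL y%:A g * w j.
pose C := (\sum_j `|Q (b j)|)%N.
have bC j : pge Q (b j) (- C%:Z).
  right; have : (`|Q (b j)| <= C)%N by rewrite /C (bigD1 j) //= leq_addr.
  lia.
exists (n + C)%N => N; pose M := (N %/ n).+1.
have hM1 : (N <= n * M)%N by rewrite /M; have := ltn_ceil N n0; rewrite mulnC; lia.
have hM2 : (n * M <= N + n)%N.
  by rewrite /M mulnS addnC leq_add2r mulnC leq_trunc_div.
exists {ffun 'I_n * 'I_d -> 'rV[F]_M}, 
  (fun f : {ffun 'I_n * 'I_d -> 'rV[F]_M} => \sum_j ev iL y%:A (rVpoly (f j)) * b j).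
split=> [f f' ff'||f].
- apply/ffunP => j; apply: (can_inj rVpolyK); apply/eqP.
  rewrite -subr_eq0; apply/eqP; move: j.
  apply: (indep_poly (f := fun j => rVpoly (f j) - rVpoly (f' j)) _ yA0 iw) => //.
  apply: (mulfI g0); rewrite mulr0; move/eqP: ff'; rewrite -subr_eq0 -sumrB => /eqP h.
  rewrite -[RHS]h mulr_sumr; apply: eq_bigr => j _; rewrite rmorphB /b /=; ring.
- rewrite card_ffun card_mx mul1n card_prod !card_ord -expnM leq_exp2l ?card_finNzRing_gt1 //.
  by rewrite mulnA [(M * n)%N]mulnC mulnC leq_mul2r hM1 orbT.
split.
- elim/big_ind: _ => [|u u' hu hu'|j _].
  + by rewrite -(scale0r 1); apply: closure_regular; rewrite -(rmorph0 iota); apply: regular_const.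
  + rewrite -[u']opprK; apply: closureB => //; rewrite -sub0r; apply: closureB => //.
    by rewrite -(scale0r 1); apply: closure_regular; rewrite -(rmorph0 iota); apply: regular_const.
  + apply: closureM; last exact: closure_ev (hg j).
    by rewrite ev_lift; apply: closure_regular; apply: regular_ev.
apply: pge_sum => j _.
apply: (pge_le (n := - (n * M)%N%:Z + (- C%:Z))); first by lia.
apply: pgeM (bC j); rewrite (@ev_coef _ _ iL y%:A _ M) ?size_poly //.
apply: pge_sum => m _; apply: pge_scale; apply: pge_le (pgeX m (pge_refl _ _)).
by rewrite Qn; have := ltn_ord m; nia.
Qed.

Lemma cover_arithmetic : exists d, arithmetic bar Q B d.
Proof.
have [d hd] := degree_exists ff_dep_ext Q; exists d.
have [y [Ay y0 Py]] := exists_pole ff_dep_base P.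
have yA0 : y%:A != 0 :> L by rewrite scaler_eq0 negb_or y0 oner_eq0.
have Qy : Q y%:A < 0 by have [_ ->] := hQ; nia.
split=> //.
- by move=> c; apply/closure_regular/regular_const.
- exact: closureB.
- exact: closureM.
- exact: closure_bar.
- exact: quadratic_involutive.
- by move=> c; apply: bar_alg.
- exact: place_bar.
- exact: closure_nozero.
- exact: closure_many.
- by exists y%:A; split=> //; [exact: closure_regular | exact: bar_alg].
have [th hth] := hbar.
have [g g0 hg] := common_integral ff_dep_ext (fun _ : 'I_1 => th) Qy yA0.
have Bg := closure_ev Ay (hg 0).
(* The denominator is invariant under [bar], so this skew element is a multiple of [th - bar th],
   which is not zero. *)
exists (ev iL y%:A g * th - bar (ev iL y%:A g * th)); split.
- exact/closureB/closure_bar.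
- rewrite ev_lift rmorphM /= bar_alg -mulrBr mulf_neq0 //; first by rewrite -ev_lift.
  by rewrite subr_eq0 eq_sym.
- by rewrite rmorphB /= quadratic_involutive // addrC addrA subrK subrr.
Qed.

End Cover.

(** * The special unitary group *)

Section Vectors.
Context (L : fieldType).
Local Notation M := 'M[L]_3.

Definition col3 (a b c : L) : 'cV[L]_3 := \col_i nth 0 [:: a; b; c] i.

Lemma col3_eta (x : 'cV[L]_3) : x = col3 (x 0 0) (x 1 0) (x 2%R 0).
Proof.
apply/colP => j; rewrite mxE.
by case: j => [[|[|[|j]]] //= hj]; congr (x _ _); apply: val_inj.
Qed.

Lemma col3_ex (x : 'cV[L]_3) : exists a b c, x = col3 a b c.
Proof. by exists (x 0 0), (x 1 0), (x 2%R 0); apply: col3_eta. Qed.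

Lemma col3E a b c : (col3 a b c 0 0 = a) * (col3 a b c 1 0 = b) * (col3 a b c 2%R 0 = c).
Proof. by rewrite !mxE. Qed.

Lemma col3_inj a b c a' b' c' : col3 a b c = col3 a' b' c' -> [/\ a = a', b = b' & c = c'].
Proof.
move=> e; split; first by have := congr1 (fun m : 'cV[L]_3 => m 0 0) e; rewrite /= !col3E.
  by have := congr1 (fun m : 'cV[L]_3 => m 1 0) e; rewrite /= !col3E.
by have := congr1 (fun m : 'cV[L]_3 => m 2%R 0) e; rewrite /= !col3E.
Qed.

Lemma mulmx_ext (A B : M) : (forall x : 'cV_3, A *m x = B *m x) -> A = B.
Proof.
move=> h; apply/matrixP => i j.
have := congr1 (fun m : 'cV_3 => m i 0) (h (delta_mx j 0)).
by rewrite -!colE !mxE.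
Qed.

Lemma mul_col3 (A : M) a b c : A *m col3 a b c =
  col3 (A 0 0 * a + A 0 1 * b + A 0 2%R * c) (A 1 0 * a + A 1 1 * b + A 1 2%R * c)
       (A 2%R 0 * a + A 2%R 1 * b + A 2%R 2%R * c).
Proof.
apply/colP => i; rewrite !mxE !big_ord_recl big_ord0 !mxE /= addr0 addrA.
have -> : lift ord0 ord0 = 1 :> 'I_3 by apply: val_inj.
have -> : lift ord0 (lift ord0 ord0) = 2%R :> 'I_3 by apply: val_inj.
case: i => [[|[|[|i]]] //= hi]; do !congr (_ + _); congr (A _ _ * _);
  by apply: val_inj.
Qed.

Lemma det3 (A : M) : \det A =
  A 0 0 * (A 1 1 * A 2%R 2%R - A 1 2%R * A 2%R 1)
  - A 0 1 * (A 1 0 * A 2%R 2%R - A 1 2%R * A 2%R 0)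
  + A 0 2%R * (A 1 0 * A 2%R 1 - A 1 1 * A 2%R 0).
Proof.
rewrite (expand_det_row _ 0) !big_ord_recl big_ord0 /cofactor.
rewrite !(expand_det_row _ 0) !big_ord_recl !big_ord0 /cofactor !det_mx11 !mxE /=.
have [f fE] : exists f : nat -> nat -> L, forall i j, A i j = f i j.
  by exists (fun i j => A (inord i) (inord j)) => i j; rewrite !inord_val.
by rewrite !fE /bump /= !addr0; ring.
Qed.

Lemma col3B (a b c a' b' c' : L) :
  col3 a b c - col3 a' b' c' = col3 (a - a') (b - b') (c - c').
Proof. by apply/colP => -[[|[|[|n]]] //= hn]; rewrite !mxE. Qed.

Lemma mxtrace_conj (h A : M) : h \is a GRing.unit -> \tr (h * A * h^-1) = \tr A.
Proof. by move=> uh; rewrite mxtrace_mulC -[_ *m _]/(h^-1 * (h * A)) mulKr. Qed.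

End Vectors.

Ltac field3 := field; repeat (apply/andP; split); rewrite ?oppr_eq0 ?invr_eq0 ?oner_eq0 ?mulf_neq0 //.

Section SpecialUnitary.
Context (k : fieldType) (L : fieldExtType k) (bar : 'AEnd(L)).
Hypothesis barK : involutive bar.
Local Notation M := 'M[L]_3.
Implicit Types (z : L * L) (g h : M).
Local Notation ua := (ua bar).
Local Notation ta := (ta bar).
Local Notation smat := (smat L).
Local Notation SU := (SU bar).
Local Notation Hset := (Hset bar).
Local Notation herm := (herm bar).

Let bar0 x : (bar x == 0) = (x == 0). Proof. exact: fmorph_eq0. Qed.
Let barV x : bar x^-1 = (bar x)^-1. Proof. exact: fmorphV. Qed.
Let barXn x n : bar (x ^+ n) = bar x ^+ n. Proof. exact: rmorphXn. Qed.

Lemma herm3 (a b c a' b' c' : L) :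
  herm (col3 a b c) (col3 a' b' c') = a * bar c' + b * bar b' + c * bar a'.
Proof. by rewrite /herm !col3E. Qed.

Lemma hermC x y : herm x y = bar (herm y x).
Proof. by rewrite /herm !rmorphD !rmorphM /= !barK; ring. Qed.

Lemma hermDl x x' y : herm (x + x') y = herm x y + herm x' y.
Proof. by rewrite /herm !mxE; ring. Qed.

Lemma hermZl c x y : herm (c *: x) y = c * herm x y.
Proof. by rewrite /herm !mxE; ring. Qed.

Lemma hermDr x y y' : herm x (y + y') = herm x y + herm x y'.
Proof. by rewrite /herm !mxE !rmorphD; ring. Qed.

Lemma hermZr c x y : herm x (c *: y) = bar c * herm x y.
Proof. by rewrite /herm !mxE !rmorphM /=; ring. Qed.

Lemma herm_nondegenerate x : (forall y, herm x y = 0) -> x = 0.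
Proof.
have [a [b [c ->]]] := col3_ex x => h.
have := h (col3 0 0 1); have := h (col3 0 1 0); have := h (col3 1 0 0).
rewrite !herm3 !rmorph0 !rmorph1 !mulr0 !mulr1 !addr0 !add0r => -> -> ->.
by apply/colP => i; rewrite !mxE; case: i => [[|[|[|i]]] hi].
Qed.

Lemma ua_col3 z a b c :
  ua z *m col3 a b c = col3 (a - bar z.1 * b + z.2 * c) (b + z.1 * c) c.
Proof. by rewrite mul_col3 !mxE /=; congr col3; ring. Qed.

Lemma smat_col3 a b c : smat *m col3 a b c = col3 (- c) (- b) (- a).
Proof. by rewrite mul_col3 !mxE /=; congr col3; ring. Qed.

Lemma ta_col3 t a b c : ta t *m col3 a b c = col3 (t * a) (bar t / t * b) (c / bar t).
Proof. by rewrite mul_col3 !mxE /=; congr col3; ring. Qed.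

Lemma SU1 : SU 1.
Proof. by split=> [|x y]; rewrite ?det1 ?mul1mx. Qed.

Lemma SU_mul g h : SU g -> SU h -> SU (g * h).
Proof.
move=> [dg hg] [dh hh]; split; first by rewrite det_mulmx dg dh mulr1.
by move=> x y; rewrite -!mulmxA hg hh.
Qed.

Lemma SU_unit g : SU g -> g \is a GRing.unit.
Proof. by move=> [dg _]; rewrite -[_ \is a _]/(g \in unitmx) unitmxE dg unitr1. Qed.

Lemma mulmxV3 g (x : 'cV_3) : SU g -> g *m (g^-1 *m x) = x.
Proof. by move=> /SU_unit ug; rewrite mulmxA -[g *m _]/(g * _) mulrV // mul1mx. Qed.

Lemma mulVmx3 g (x : 'cV_3) : SU g -> g^-1 *m (g *m x) = x.
Proof. by move=> /SU_unit ug; rewrite mulmxA -[_ *m g]/(_ * g) mulVr // mul1mx. Qed.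

Lemma SU_inv g : SU g -> SU g^-1.
Proof.
move=> sg; have [dg hg] := sg; split; first by rewrite det_inv dg invr1.
by move=> x y; rewrite -hg !mulmxV3.
Qed.

Lemma SU_subgroup : is_subgroup SU.
Proof.
split; [exact: SU1 | exact: SU_mul |].
by move=> g sg; split; [exact: SU_unit | exact: SU_inv].
Qed.

Lemma Hset0 : Hset (0, 0).
Proof. by rewrite /Defs.Hset /= /norm /trace rmorph0 mulr0 !addr0. Qed.

Lemma HsetE u v : Hset (u, v) <-> u * bar u + v + bar v = 0.
Proof. by rewrite /Defs.Hset /= /norm /trace addrA. Qed.

Lemma SU_ua z : Hset z -> SU (ua z).
Proof.
case: z => u v /HsetE hz; split; first by rewrite det3 !mxE /=; ring.
move=> x y; have [a [b [c ->]]] := col3_ex x; have [a' [b' [c' ->]]] := col3_ex y.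
rewrite !ua_col3 !herm3 /= !rmorphD rmorphN !rmorphM /= barK.
transitivity (a * bar c' + b * bar b' + c * bar a' + c * bar c' * (u * bar u + v + bar v)).
  by ring.
by rewrite hz mulr0 addr0.
Qed.

Lemma SU_smat : SU smat.
Proof.
split; first by rewrite det3 !mxE /=; ring.
move=> x y; have [a [b [c ->]]] := col3_ex x; have [a' [b' [c' ->]]] := col3_ex y.
by rewrite !smat_col3 !herm3 !rmorphN /=; ring.
Qed.

Lemma SU_ta t : t != 0 -> SU (ta t).
Proof.
move=> t0; have t0' : bar t != 0 by rewrite bar0.
split; first by rewrite det3 !mxE /=; field3.
move=> x y; have [a [b [c ->]]] := col3_ex x; have [a' [b' [c' ->]]] := col3_ex y.
rewrite !ta_col3 !herm3 !rmorphM /= !barV barK.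
by field3.
Qed.

Lemma smatV : smat^-1 = smat.
Proof.
have us : smat \is a GRing.unit by apply: SU_unit SU_smat.
by apply: (mulrI us); rewrite mulrV // smatK.
Qed.

Lemma taM t t' : ta t * ta t' = ta (t * t').
Proof.
apply: mulmx_ext => x; have [a [b [c ->]]] := col3_ex x.
rewrite -mulmxA !ta_col3 rmorphM /= !invfM; congr col3; ring.
Qed.

Lemma ta1 : ta 1 = 1.
Proof.
apply: mulmx_ext => x; have [a [b [c ->]]] := col3_ex x.
by rewrite ta_col3 rmorph1 mul1mx !divr1 !mul1r.
Qed.

Lemma taV t : t != 0 -> (ta t)^-1 = ta t^-1.
Proof.
move=> t0; have e : ta t * ta t^-1 = 1 by rewrite taM mulfV // ta1.
by rewrite -[RHS]mul1r -(mulVr (SU_unit (SU_ta t0))) -mulrA e mulr1.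
Qed.

Lemma smat_ta t : t != 0 -> smat * ta t = ta (bar t)^-1 * smat.
Proof.
move=> t0; have t0' : bar t != 0 by rewrite bar0.
apply: mulmx_ext => x; have [a [b [c ->]]] := col3_ex x.
rewrite -!mulmxA !ta_col3 !smat_col3 ta_col3 !barV barK.
by congr col3; field3.
Qed.

(** Coordinates of [(ua z)^-1 * ua z'] for z in [Hset]; the valuation of the second one decides at
    which height the corresponding lines of the tree meet. *)
Definition zdiff z z' : L * L := (z'.1 - z.1, bar z.2 + z'.2 + bar z.1 * z'.1).

Lemma ua_div z z' : Hset z -> (ua z)^-1 * ua z' = ua (zdiff z z').
Proof.
case: z => u v /HsetE hz; rewrite uaV uaM /zdiff /=; congr (Defs.ua bar (_, _)); first by ring.
rewrite rmorphN; transitivity (bar v + z'.2 + bar u * z'.1 - (u * bar u + v + bar v)).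
  by ring.
by rewrite hz subr0.
Qed.

Lemma Hset_diff z z' : Hset z -> Hset z' -> Hset (zdiff z z').
Proof.
case: z z' => u v [u' v'] /HsetE hz /HsetE hz'; apply/HsetE.
rewrite /= !rmorphD rmorphN rmorphM /= !barK.
rewrite -[RHS](addr0 0) -{1}hz -hz'; ring.
Qed.

Definition zadd z z' : L * L := (z.1 + z'.1, z.2 + z'.2 - bar z.1 * z'.1).

Lemma Hset_add z z' : Hset z -> Hset z' -> Hset (zadd z z').
Proof.
case: z z' => u v [u' v'] /HsetE hz /HsetE hz'; apply/HsetE.
rewrite /= !rmorphB !rmorphD rmorphM /= !barK.
rewrite -[RHS](addr0 0) -{1}hz -hz'; ring.
Qed.

Lemma ua_add z z' : ua z * ua z' = ua (zadd z z').
Proof. by rewrite uaM. Qed.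

(** Coordinates of the conjugate of [ua z] by [ta t]. *)
Definition zscale t z : L * L := (bar t ^+ 2 / t * z.1, t * bar t * z.2).

Lemma Hset_scale t z : t != 0 -> Hset z -> Hset (zscale t z).
Proof.
case: z => u v t0 /HsetE hz; have t0' : bar t != 0 by rewrite bar0.
apply/HsetE; rewrite /= !rmorphM /= ?barV ?barXn !barK.
transitivity (t * bar t * (u * bar u + v + bar v)); last by rewrite hz mulr0.
by field3.
Qed.

Lemma ta_ua t z : t != 0 -> ta t * ua z = ua (zscale t z) * ta t.
Proof.
move=> t0; have t0' : bar t != 0 by rewrite bar0.
apply: mulmx_ext => x; have [a [b [c ->]]] := col3_ex x.
rewrite -!mulmxA !ta_col3 !ua_col3 ta_col3 /= !rmorphM /= ?barV ?barXn ?barK.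
by congr col3; field3.
Qed.

(** The rank-one relation, which trades s for an upper and a lower unipotent element; [iwasawa] uses
    it when the unipotent factor does not fix the point considered. *)
Lemma smat_ua u v : v != 0 -> Hset (u, v) ->
  smat * ua (u, v) = ua (u / v, v^-1) * ta (- (bar v)^-1) * uma bar (u / bar v, v^-1).
Proof.
move=> v0 /HsetE hz; have v0' : bar v != 0 by rewrite bar0.
have hv : u * bar u = - v - bar v.
  by apply/eqP; rewrite -subr_eq0 -hz; apply/eqP; ring.
apply: mulmx_ext => x; have [a [b [c ->]]] := col3_ex x.
rewrite /uma -!mulmxA !(smat_col3, ua_col3, ta_col3) /= !rmorphN !rmorphM /= ?rmorphN !barV ?barK.
congr col3.
- transitivity (a * (- v - bar v - u * bar u) / (v * bar v) - c); first by rewrite hv; field3.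
  by field3.
- transitivity (b * (bar v + u * bar u) / v - u * c); first by rewrite hv; field3.
  by field3.
- by field3.
Qed.

Lemma Hset_inv u v : v != 0 -> Hset (u, v) -> Hset (u / v, v^-1) /\ Hset (u / bar v, v^-1).
Proof.
move=> v0 /HsetE hz; have v0' : bar v != 0 by rewrite bar0.
have h : (u * bar u + v + bar v) / (v * bar v) = 0 by rewrite hz mul0r.
by split; apply/HsetE; rewrite rmorphM /= !barV ?barK; rewrite -[RHS]h;
  field3.
Qed.

(** Such a vector is orthogonal to [col3 1 0 0], and the orthogonal complement of that isotropic
    line contains no other isotropic line. *)
Lemma isotropic_last0 (x : 'cV[L]_3) : herm x x = 0 -> x 2%R 0 = 0 -> x = x 0 0 *: col3 1 0 0.
Proof.
have [a [b [c ->]]] := col3_ex x; rewrite herm3 !col3E => h c0.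
have b0 : b = 0.
  move/eqP: h; rewrite c0 rmorph0 mulr0 mul0r add0r addr0 mulf_eq0 bar0 orbb.
  by move/eqP.
rewrite c0 b0; apply/colP => i; rewrite !mxE.
by case: i => [[|[|[|i]]] hi] //=; ring.
Qed.

(** The images of the basis vectors satisfy the same hermitian relations as the basis; together with
    the determinant, these recover all entries from t and from the coordinates of the last image. *)
Lemma SU_borel g (t : L) : SU g -> g *m col3 1 0 0 = t *: col3 1 0 0 ->
  exists z, [/\ Hset z, t != 0 & g = ua z * ta t].
Proof.
move=> [dg hg] e0.
have E a b c : a *: col3 1 0 0 + b *: col3 0 1 0 + c *: col3 0 0 1 = col3 a b c :> 'cV[L]_3.
  apply/colP => i; rewrite !mxE; by case: i => [[|[|[|i]]] hi] //=; ring.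
have Z c : c *: col3 1 0 0 = col3 c 0 0 :> 'cV[L]_3.
  apply/colP => i; rewrite !mxE; by case: i => [[|[|[|i]]] hi] //=; ring.
have [p [q [r e2]]] := col3_ex (g *m col3 0 0 1).
have [x [y [w e1]]] := col3_ex (g *m col3 0 1 0).
rewrite Z in e0.
have h02 : t * bar r = 1.
  have := hg (col3 1 0 0) (col3 0 0 1); rewrite e0 e2 !herm3 !rmorph0 !rmorph1.
  by rewrite ?mulr0 ?mul0r ?mulr1 ?addr0.
have t0 : t != 0 by apply/eqP => t0; move/eqP: h02; rewrite t0 mul0r eq_sym oner_eq0.
have r0' : bar r != 0 by apply/eqP => r0; move/eqP: h02; rewrite r0 mulr0 eq_sym oner_eq0.
have r0 : r != 0 by rewrite -bar0.
have w0 : w = 0.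
  have := hg (col3 1 0 0) (col3 0 1 0); rewrite e0 e1 !herm3 !rmorph0 !rmorph1.
  rewrite !mulr0 !mul0r !addr0 => /eqP; rewrite mulf_eq0 (negPf t0) bar0 /=.
  by move/eqP.
have h22 : p * bar r + q * bar q + r * bar p = 0.
  have := hg (col3 0 0 1) (col3 0 0 1); rewrite e2 !herm3 !rmorph0 !rmorph1.
  by rewrite ?mulr0 ?mul0r ?addr0.
have h12 : x * bar r + y * bar q = 0.
  have := hg (col3 0 1 0) (col3 0 0 1); rewrite e1 e2 !herm3 w0 !rmorph0 !rmorph1.
  by rewrite ?mulr0 ?mul0r ?addr0.
have hd : t * y * r = 1.
  have col j a b c : g *m col3 (j == 0%N)%:R (j == 1%N)%:R (j == 2%N)%:R = col3 a b c ->
     [/\ g 0 (inord j) = a, g 1 (inord j) = b & g 2%R (inord j) = c] \/ (2 < j)%N.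
    case: j => [|[|[|j]]] /=; last by right.
    - rewrite mul_col3 => /col3_inj[<- <- <-]; left.
      have -> : inord 0 = 0 :> 'I_3 by apply: val_inj; rewrite /= inordK.
      by split; ring.
    - rewrite mul_col3 => /col3_inj[<- <- <-]; left.
      have -> : inord 1 = 1 :> 'I_3 by apply: val_inj; rewrite /= inordK.
      by split; ring.
    - rewrite mul_col3 => /col3_inj[<- <- <-]; left.
      have -> : inord 2 = 2%R :> 'I_3 by apply: val_inj; rewrite /= inordK.
      by split; ring.
  have i0 : inord 0 = 0 :> 'I_3 by apply: val_inj; rewrite /= inordK.
  have i1 : inord 1 = 1 :> 'I_3 by apply: val_inj; rewrite /= inordK.
  have i2 : inord 2 = 2%R :> 'I_3 by apply: val_inj; rewrite /= inordK.
  have [|//] := col 0%N _ _ _ e0; rewrite i0 => -[g00 g10 g20].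
  have [|//] := col 1%N _ _ _ e1; rewrite i1 => -[g01 g11 g21].
  have [|//] := col 2%N _ _ _ e2; rewrite i2 => -[g02 g12 g22].
  rewrite -[RHS]dg det3 g00 g10 g20 g01 g11 g21 g02 g12 g22 w0; ring.
have hr : bar t = r^-1.
  apply: (mulIf r0); rewrite mulVf // -[r in LHS]barK -rmorphM /= h02 rmorph1.
  by [].
have yE : y = bar t / t.
  by rewrite hr; apply: (mulfI (mulf_neq0 t0 r0)); rewrite mulrAC hd; field3.
exists (q / r, p / r); split=> //.
  apply/HsetE; rewrite !rmorphM /= !barV.
  transitivity ((p * bar r + q * bar q + r * bar p) / (r * bar r)); last by rewrite h22 mul0r.
  by field3.
apply: mulmx_ext => s; have [a [b [c ->]]] := col3_ex s.
rewrite -mulmxA ta_col3 ua_col3 /= hr invrK.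
rewrite -E !mulmxDr -!scalemxAr e0 e1 e2.
apply/colP => i; rewrite !mxE.
have xE : x = - (y * bar q / bar r).
  apply/eqP; rewrite -addr_eq0; apply/eqP.
  transitivity ((x * bar r + y * bar q) / bar r); last by rewrite h12 mul0r.
  by field3.
case: i => [[|[|[|i]]] hi] //=; rewrite ?w0.
- rewrite xE yE hr rmorphM /= barV; field3.
- rewrite yE hr; field3.
- field3.
Qed.

(** The image of [col3 1 0 0] is isotropic: either its last coordinate vanishes and [SU_borel]
    applies, or its coordinates give a z for which [s (ua z)^-1] brings it back to the standard
    line. *)
Lemma SU_bruhat g : SU g ->
  (exists z t, [/\ Hset z, t != 0 & g = ua z * ta t]) \/
  exists z z' t, [/\ Hset z, Hset z', t != 0 & g = ua z * smat * ua z' * ta t].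
Proof.
move=> sg; pose x := g *m col3 1 0 0.
have hx : herm x x = 0.
  by rewrite /x; have [_ ->] := sg; rewrite herm3 rmorph0 rmorph1; ring.
have [x2|x2] := eqVneq (x 2%R 0) 0.
  left; have := isotropic_last0 hx x2 => /(SU_borel sg)[z [hz t0 e]].
  by exists z, (x 0 0).
right; move: hx x2; rewrite /x; have [a [b [c e]]] := col3_ex (g *m col3 1 0 0).
rewrite e herm3 col3E => hx c0; have c0' : bar c != 0 by rewrite bar0.
pose z := (b / c, a / c).
have hz : Hset z.
  apply/HsetE; rewrite !rmorphM /= !barV.
  transitivity ((a * bar c + b * bar b + c * bar a) / (c * bar c)); last by rewrite hx mul0r.
  by field3.
have sb : SU (smat * (ua z)^-1 * g).
  by apply: SU_mul => //; apply: SU_mul; [exact: SU_smat | apply/SU_inv/SU_ua].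
have [|z' [hz' t0 eb]] := @SU_borel _ (- c) sb.
  rewrite -!mulmxA e.
  have -> : col3 a b c = ua z *m col3 0 0 c.
    by rewrite ua_col3 /z /=; congr col3; field3.
  rewrite (mulVmx3 _ (SU_ua hz)) smat_col3.
  by apply/colP => i; rewrite !mxE; case: i => [[|[|[|i]]] hi] //=; ring.
exists z, z', (- c); split=> //.
have eg : ua z * (smat * (smat * (ua z)^-1 * g)) = g.
  rewrite !mulrA -[ua z * smat * smat]mulrA smatK mulr1 mulrV ?mul1r //.
  exact/SU_unit/SU_ua.
by rewrite -eg eb !mulrA.
Qed.

End SpecialUnitary.

(** * The Bruhat-Tits tree *)

Lemma generated_conj (R : unitRingType) (S S' U : set R) u : is_subgroup U ->
  S `<=` U -> S' `<=` U -> u \is a GRing.unit ->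
  (forall x, S x -> S' (u * x * u^-1)) ->
  forall x, generated S x -> generated S' (u * x * u^-1).
Proof.
move=> sU SU S'U uu h x gx.
have [g1 gM gV] := generated_subgroup sU S'U; have [U1 UM UV] := sU.
suff [] : [set y | U y /\ generated S' (u * y * u^-1)] x by [].
apply: gx; last first.
  by move=> y Sy; split; [exact: SU | move=> T _; apply; apply: h].
split=> [|y z [Uy gy] [Uz gz]|y [Uy gy]].
- by split=> //; rewrite mulr1 mulrV.
- split; first exact: UM.
  by have := gM _ _ gy gz; rewrite !mulrA mulrVK.
- have [uy UVy] := UV _ Uy; split=> //; split=> //; have [_] := gV _ gy.
  by rewrite !invrM ?invrK ?unitrMl ?unitrV // mulrA.
Qed.

Lemma placeD_or (F K : fieldType) (i : {rmorphism F -> K}) (v : place i) (x y : K) :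
  x != 0 -> y != 0 -> x + y != 0 -> v x <= v (x + y) \/ v y <= v (x + y).
Proof.
by move=> x0 y0 xy0; have := placeD v x0 y0 xy0; rewrite ge_min => /orP.
Qed.

Section Tree.
Context (F k : fieldType) (L : fieldExtType k) (bar : 'AEnd(L)).
Context (i : {rmorphism F -> L}) (Q : place i).
Hypotheses (barK : involutive bar) (Qbar : forall x, Q (bar x) = Q x).
Local Notation M := 'M[L]_3.
Implicit Types (z : L * L) (g h n : M) (j m : int).
Local Notation ua := (ua bar).
Local Notation uma := (uma bar).
Local Notation ta := (ta bar).
Local Notation smat := (smat L).
Local Notation SU := (SU bar).
Local Notation Hset := (Hset bar).

Let bar0 x : (bar x == 0) = (x == 0). Proof. exact: fmorph_eq0. Qed.

(** Bounds are on twice the valuation because the relation N(u) + T(v) = 0 controls Q u only by half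
    of Q v. *)
Definition hge (x : L) (c : int) : Prop := x = 0 \/ c <= 2 * Q x.

Lemma hge_le x c c' : c' <= c -> hge x c -> hge x c'.
Proof. by move=> le [->|h]; [left | right; apply: le_trans h]. Qed.

Lemma hge_pge x c : hge x (2 * c) <-> pge Q x c.
Proof. by split=> -[->|h]; [left | right; lia | left | right; lia]. Qed.

Lemma pge_hge x a c : c <= 2 * a -> pge Q x a -> hge x c.
Proof. by move=> le [->|h]; [left | right; lia]. Qed.

Lemma hgeM x y a b : hge x a -> hge y b -> hge (x * y) (a + b).
Proof.
move=> [->|hx]; first by left; rewrite mul0r.
move=> [->|hy]; first by left; rewrite mulr0.
have [->|x0] := eqVneq x 0; first by left; rewrite mul0r.
have [->|y0] := eqVneq y 0; first by left; rewrite mulr0.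
by right; rewrite placeMl //; lia.
Qed.

Lemma hgeD x y c : hge x c -> hge y c -> hge (x + y) c.
Proof.
move=> [->|hx]; first by rewrite add0r.
move=> [->|hy]; first by rewrite addr0; right.
have [->|x0] := eqVneq x 0; first by rewrite add0r; right.
have [->|y0] := eqVneq y 0; first by rewrite addr0; right.
have [->|xy0] := eqVneq (x + y) 0; first by left.
right; have : Q x <= Q (x + y) \/ Q y <= Q (x + y) := placeD_or Q x0 y0 xy0.
by case; lia.
Qed.

Lemma hgeN x c : hge x c -> hge (- x) c.
Proof. by move=> [->|h]; [left; rewrite oppr0 | right; rewrite placeN]. Qed.

Lemma hge_bar x c : hge x c -> hge (bar x) c.
Proof. by move=> [->|h]; [left; rewrite rmorph0 | right; rewrite Qbar]. Qed.

Lemma hge_refl x : hge x (2 * Q x). Proof. by right. Qed.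

Lemma Hset_hge z c : Hset z -> pge Q z.2 c -> hge z.1 c.
Proof.
case: z => u v /HsetE hz /= hv; have [->|u0] := eqVneq u 0; first by left.
right; have u0' : bar u != 0 by rewrite bar0.
have e1 : u * bar u = - (v + bar v) by apply/eqP; rewrite -subr_eq0 -hz; apply/eqP; ring.
have : pge Q (u * bar u) c.
  rewrite e1; apply/pgeN/pgeD => //; case: hv => [->|]; first by left; rewrite rmorph0.
  by right; rewrite Qbar.
by move/(pge_val (mulf_neq0 u0 u0')); rewrite placeMl // Qbar; lia.
Qed.

(* The balls of the norm on L^3 attached to the point j of the apartment;
   values are doubled in order to stay in int. *)
Definition nball j m (x : 'cV[L]_3) : Prop :=
  [/\ hge (x 0 0) (m - j), hge (x 1 0) m & hge (x 2%R 0) (m + j)].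

Lemma nball3 j m a b c : nball j m (col3 a b c) <-> [/\ hge a (m - j), hge b m & hge c (m + j)].
Proof. by rewrite /nball !col3E. Qed.

Lemma nball_smat j m x : nball j m x -> nball (- j) m (smat *m x).
Proof.
have [a [b [c ->]]] := col3_ex x => /nball3[ha hb hc].
by rewrite smat_col3; apply/nball3; split; apply: hgeN => //; rewrite ?opprK.
Qed.

Lemma nball_ta j m t x : t != 0 -> nball j m x -> nball (j - 2 * Q t) m (ta t *m x).
Proof.
move=> t0; have [a [b [c ->]]] := col3_ex x => /nball3[ha hb hc].
have t0' : bar t != 0 by rewrite bar0.
rewrite ta_col3; apply/nball3; split.
- by have := hgeM (hge_refl t) ha; apply: hge_le; lia.
- by have := hgeM (hge_refl (bar t / t)) hb; apply: hge_le; rewrite placeMl ?invr_eq0 // placeV // Qbar; lia.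
- by have := hgeM hc (hge_refl (bar t)^-1); apply: hge_le; rewrite placeV // Qbar; lia.
Qed.

Lemma nball_ua j m z x : Hset z -> pge Q z.2 (- j) -> nball j m x -> nball j m (ua z *m x).
Proof.
move=> hz hj; have [a [b [c ->]]] := col3_ex x => /nball3[ha hb hc].
have hu := Hset_hge hz hj; have hv := (hge_pge _ _).2 hj.
rewrite ua_col3; apply/nball3; split=> //.
  apply: hgeD; last by have := hgeM hv hc; apply: hge_le; lia.
  apply: hgeD => //; apply: hgeN.
  by have := hgeM (hge_bar hu) hb; apply: hge_le; lia.
by apply: hgeD => //; have := hgeM hu hc; apply: hge_le; lia.
Qed.

Definition gball g j m (x : 'cV[L]_3) : Prop := nball j m (g^-1 *m x).

Lemma ua_in_ball z j : Hset z -> (forall m x, nball j m x -> nball j m (ua z *m x)) ->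
  pge Q z.2 (- j).
Proof.
move=> hz h; have /h : nball j (- j) (col3 0 0 1).
  by apply/nball3; split; [left | left | right; rewrite place1; lia].
rewrite ua_col3 => /nball3[+ _ _].
rewrite mulr0 oppr0 add0r mulr1 add0r => hv; apply/hge_pge; move: hv; apply: hge_le; lia.
Qed.

(** Since [ua z] fixes this vector, it lets the position j be read off from the balls. *)
Lemma nball_e0 j m : nball j m (col3 1 0 0) <-> m <= j.
Proof.
split=> [/nball3[[h|h] _ _]|le].
  by case/eqP: (oner_neq0 L).
  by move: h; rewrite place1; lia.
by apply/nball3; split; [right; rewrite place1; lia | left | left].
Qed.

Lemma ua_e0 z : ua z *m col3 1 0 0 = col3 1 0 0.
Proof. by rewrite ua_col3 !mulr0 subr0 !addr0. Qed.

Lemma uaV_e0 z : Hset z -> (ua z)^-1 *m col3 1 0 0 = col3 1 0 0.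
Proof. by move=> hz; rewrite -{1}(ua_e0 z) (mulVmx3 _ (SU_ua barK hz)). Qed.

Lemma gball_ua_eq z z' j j' : Hset z -> Hset z' ->
  (forall m x, gball (ua z) j m x <-> gball (ua z') j' m x) ->
  j = j' /\ pge Q (zdiff bar z z').2 (- j).
Proof.
move=> hz hz' h; have ej : j = j'.
  have E m : m <= j <-> m <= j'.
    by have := h m (col3 1 0 0); rewrite /gball !uaV_e0 // !nball_e0.
  by apply/eqP; rewrite eq_le; apply/andP; split; apply/E.
split=> //; apply: ua_in_ball; first exact: Hset_diff.
move=> m x hx; rewrite -ua_div //.
have := (h m (ua z' *m x)).2; rewrite /gball (mulVmx3 _ (SU_ua barK hz')).
by rewrite -ej mulmxA; apply.
Qed.

Context (R : realType) (nuP : L -> R) (e : nat).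
Hypotheses (e0 : (0 < e)%N) (nuE : forall x, nuP x = (Q x)%:~R / e%:R).
Implicit Types (r : R).
Local Notation N_act := (N_act bar nuP).
Local Notation Ux := (Ux bar nuP).
Local Notation tree_eq := (tree_eq bar nuP).

Let eR : e%:R != 0 :> R. Proof. by rewrite pnatr_eq0 -lt0n. Qed.

(** The vertex numbered j: the values of nu are the multiples of 1/e and a(r) = 2 r has to be half
    of one of them. *)
Definition rr j : R := j%:~R / (4 * e%:R).

Lemma rr_inj : injective rr.
Proof.
move=> j j' /(mulIf _) h; apply/eqP; rewrite -(eqr_int R); apply/eqP/h.
by rewrite invr_eq0 mulf_neq0 // pnatr_eq0.
Qed.

Lemma nu_geE x m : nu_ge nuP x (m%:~R / e%:R) <-> pge Q x m.
Proof.
rewrite /nu_ge /pge nuE ler_pM2r ?invr_gt0 ?ltr0n //.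
by rewrite ler_int.
Qed.

Lemma Uax_ua j z : Hset z -> pge Q z.2 (- j) -> Ux (rr j) (ua z).
Proof.
move=> hz hj T _; apply; left; exists z => //; split=> //.
have -> : -2 * root_a (rr j) = (- j)%:~R / e%:R.
  by rewrite /root_a /rr rmorphN; field.
exact/nu_geE.
Qed.

Lemma Umax_uma j z : Hset z -> pge Q z.2 j -> Ux (rr j) (uma z).
Proof.
move=> hz hj T _; apply; right; exists z => //; split=> //.
have -> : -2 * - root_a (rr j) = j%:~R / e%:R by rewrite /root_a /rr; field.
exact/nu_geE.
Qed.

Lemma SU_uma z : Hset z -> SU (uma z).
Proof. 
by move=> hz; apply: SU_mul; [apply: SU_mul; [exact: SU_smat | exact: SU_ua] | exact: SU_smat].
 Qed.

Lemma Ux_gen_sub r : Uax bar nuP r `|` Umax bar nuP r `<=` SU.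
Proof. by move=> _ [] [z [hz _] <-]; [apply: SU_ua | apply: SU_uma]. Qed.

Lemma Ux_subgroup r : is_subgroup (Ux r).
Proof. exact: generated_subgroup (SU_subgroup bar) (@Ux_gen_sub r). Qed.

Lemma Ux_SU r : Ux r `<=` SU.
Proof. exact: generated_min (SU_subgroup bar) (@Ux_gen_sub r). Qed.

Lemma N_act_SU n r r' : N_act n r r' -> SU n.
Proof.
elim=> [r0|n0 r0 r0' _ h|t n0 r0 r0' t0 _ h]; first exact: SU1.
  by apply: SU_mul => //; apply: SU_smat.
by apply: SU_mul => //; apply: SU_ta.
Qed.

Lemma N_act_mul n n' r r' r'' : N_act n r r' -> N_act n' r' r'' -> N_act (n' * n) r r''.
Proof.
move=> h h'; elim: h' h => [r0|n0 r0 r0' _ h|t n0 r0 r0' t0 _ h] hn.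
- by rewrite mul1r.
- by rewrite -mulrA; apply: N_s; apply: h.
- by rewrite -mulrA; apply: N_ta => //; apply: h.
Qed.

Lemma nuV t : t != 0 -> nuP t^-1 = - nuP t.
Proof. by move=> t0; rewrite !nuE placeV // rmorphN mulNr. Qed.

Lemma N_act_inv n r r' : N_act n r r' -> N_act n^-1 r' r.
Proof.
elim=> [r0|n0 r0 r0' h0 h|t n0 r0 r0' t0 h0 h].
- by rewrite invr1; apply: N_one.
- have u0 := SU_unit (N_act_SU h0); have us := SU_unit (SU_smat bar).
  rewrite invrM // (smatV bar); apply: N_act_mul h.
  by have := N_s (N_one bar nuP (- r0')); rewrite mulr1 opprK.
- have u0 := SU_unit (N_act_SU h0); have us := SU_unit (SU_ta barK t0).
  rewrite invrM // taV //; apply: N_act_mul h.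
  have tV : t^-1 != 0 by rewrite invr_eq0.
  have := N_ta tV (N_one bar nuP (r0' - nuP t / 2)); rewrite mulr1 nuV //.
  by congr N_act; ring.
Qed.

(** Conjugation by s exchanges the two root groups and changes the sign of the point; conjugation by
    [ta t] multiplies the second coordinate by the norm of t on one root group and by its inverse on
    the other. *)
Lemma N_act_conj n r r' g : N_act n r r' -> Ux r g -> Ux r' (n * g * n^-1).
Proof.
move=> h; elim: h g => [r0|n0 r0 r0' h0 IH|t n0 r0 r0' t0 h0 IH] g hg.
- by rewrite invr1 mulr1 mul1r.
- have u0 := SU_unit (N_act_SU h0); have us := SU_unit (SU_smat bar).
  rewrite invrM // !mulrA -(mulrA smat) -(mulrA smat).
  apply: (generated_conj (SU_subgroup bar) (@Ux_gen_sub _) (@Ux_gen_sub _) us) (IH _ hg).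
  move=> _ [] [z [hz hj] <-]; rewrite (smatV bar); [right|left]; exists z => //.
    by split=> //; move: hj; congr nu_ge; rewrite /root_a; ring.
    by split=> //; move: hj; congr nu_ge; rewrite /root_a; ring.
  by rewrite /uma !mulrA smatK mul1r -mulrA smatK mulr1.
- have u0 := SU_unit (N_act_SU h0); have us := SU_unit (SU_ta barK t0).
  rewrite invrM // !mulrA -(mulrA (ta t)) -(mulrA (ta t)).
  apply: (generated_conj (SU_subgroup bar) (@Ux_gen_sub _) (@Ux_gen_sub _) us) (IH _ hg).
  have nuM x (y : L) : x != 0 -> y != 0 -> nuP (x * y) = nuP x + nuP y.
    by move=> x0 y0; rewrite !nuE placeMl // rmorphD mulrDl.
  have t0' : bar t != 0 by rewrite bar0.
  have nub : nuP (bar t) = nuP t by rewrite !nuE Qbar.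
  have key s (v : L) c : s != 0 -> nuP (bar s) = nuP s -> bar s != 0 -> nu_ge nuP v c ->
      nu_ge nuP (s * bar s * v) (c + 2 * nuP s).
    move=> s0 hs s0' [->|hc]; first by left; rewrite mulr0.
    have [->|v0] := eqVneq v 0; first by left; rewrite mulr0.
    right; rewrite !nuM ?mulf_neq0 // hs.
    have -> : nuP s + nuP s + nuP v = nuP v + 2 * nuP s by ring.
    by rewrite lerD2r.
  move=> _ [] [z [hz hj] <-]; [left|right].
    exists (zscale bar t z); last by rewrite ta_ua // mulrK.
    split; first exact: Hset_scale.
    have := key t _ _ t0 nub t0' hj; congr nu_ge; rewrite /root_a; by field.
  have tb : (bar t)^-1 != 0 by rewrite invr_eq0.
  exists (zscale bar (bar t)^-1 z); last first.
    rewrite /uma taV // mulrA [ta t * _]mulrA.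
    have sta : ta t * smat = smat * ta (bar t)^-1.
      by rewrite smat_ta // fmorphV /= barK invrK.
    rewrite sta -!mulrA [ta _ * (ua z * _)]mulrA ta_ua // -!mulrA smat_ta ?invr_eq0 //.
    by rewrite [ta _ * (ta _ * _)]mulrA taM fmorphV /= invrK mulVf // ta1 mul1r.
  split; first exact: Hset_scale.
  have bt : bar (bar t)^-1 = t^-1 by rewrite fmorphV /= barK.
  have := key (bar t)^-1 _ _ tb _ _ hj; rewrite bt nuV // nuV // nub invr_eq0.
  by move=> /(_ erefl t0); rewrite /= bt; congr nu_ge; rewrite /root_a; field.
Qed.

(** The generators map each ball into itself, and so do their inverses, which are generators of the
    same kind. *)
Lemma Ux_nball j g : Ux (rr j) g -> forall m x, nball j m x <-> nball j m (g *m x).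
Proof.
pose T : set M := [set g | SU g /\ forall m x, nball j m x <-> nball j m (g *m x)].
have sT : is_subgroup T.
  split=> [|g1 g2 [s1 h1] [s2 h2]|g1 [s1 h1]].
  - by split=> [|m x]; [exact: SU1 | rewrite mul1mx].
  - by split=> [|m x]; [exact: SU_mul | rewrite -mulmxA -h1 -h2].
  - split; first exact: SU_unit s1.
    split=> [|m x]; first exact: SU_inv.
    by rewrite [X in _ <-> X]h1 (mulmxV3 _ s1).
move=> hg; suff [_ //] : T g; apply: hg sT _.
have one : forall g1, SU g1 -> (forall m x, nball j m x -> nball j m (g1 *m x)) ->
    (forall m x, nball j m x -> nball j m (g1^-1 *m x)) -> T g1.
  move=> g1 s1 h1 h2; split=> // m x; split; first exact: h1.
  by move/h2; rewrite (mulVmx3 _ s1).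
have inv z c : Hset z -> pge Q z.2 c -> exists z', [/\ (ua z)^-1 = ua z', Hset z' & pge Q z'.2 c].
  move=> hz hc; exists (zdiff bar z (0, 0)).
  have u0 : ua (0, 0) = 1 :> M by exact: ua0.
  split; [by rewrite -ua_div // u0 mulr1 | by apply: Hset_diff => //; exact: Hset0 |].
  by rewrite /= mulr0 !addr0; case: hc => [->|h]; [left; rewrite rmorph0 | right; rewrite Qbar].
move=> _ [] [z [hz hj] <-].
  have {}hj : pge Q z.2 (- j).
    by apply/nu_geE; move: hj; congr nu_ge; rewrite /root_a /rr rmorphN; field.
  have [z' [eV hz' hj']] := inv _ _ hz hj.
  by apply: one; [exact: SU_ua | move=> m x; apply: nball_ua | rewrite eV => m x; apply: nball_ua].
have {}hj : pge Q z.2 (- - j).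
  by rewrite opprK; apply/nu_geE; move: hj; congr nu_ge; rewrite /root_a /rr; field.
have [z' [eV hz' hj']] := inv _ _ hz hj.
have H z0 : Hset z0 -> pge Q z0.2 (- - j) -> forall m x, nball j m x -> nball j m (uma z0 *m x).
  move=> h0 h0' m x /nball_smat /(nball_ua h0 h0')/nball_smat.
  by rewrite opprK /uma !mulmxA.
apply: one; [exact: SU_uma | exact: H |].
have -> : (uma z)^-1 = uma z'; last exact: H.
have us := SU_unit (SU_smat bar); have uz := SU_unit (SU_ua barK hz).
by rewrite /uma !invrM ?unitrMl // (smatV bar) eV mulrA.
Qed.

(** Positions change by sign and by even numbers, so their parity is an invariant; this is what
    excludes inversions. *)
Lemma N_act_nball n j r' : N_act n (rr j) r' -> exists j' c,
  [/\ r' = rr j', j' = j + 2 * c & forall m x, nball j m x <-> nball j' m (n *m x)].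
Proof.
suff H : N_act n (rr j) r' -> exists j' c,
    [/\ r' = rr j', j' = j + 2 * c & forall m x, nball j m x -> nball j' m (n *m x)].
  move=> hn; have [j' [c [e1 e2 h]]] := H hn; exists j', c; split=> // m x; split; first exact: h.
  suff H' : forall n r r', N_act n r r' -> forall j j', r = rr j -> r' = rr j' ->
      forall m x, nball j m x -> nball j' m (n *m x).
    rewrite e1 in hn; have := H' _ _ _ (N_act_inv hn) _ _ erefl erefl m (n *m x).
    by rewrite (mulVmx3 _ (N_act_SU hn)).
  move=> n1 r1 r1' hn1; elim: hn1 => [r0|n0 r0 r0' h0 IH|t n0 r0 r0' t0 h0 IH] j1 j1'.
  - by move=> -> /rr_inj -> m1 x1; rewrite mul1mx.
  - move=> er er' m1 x1 hx.
    have er0 : r0' = rr (- j1') by rewrite /rr rmorphN mulNr -/(rr _) -er' opprK.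
    by have := nball_smat (IH _ _ er er0 _ _ hx); rewrite opprK mulmxA.
  - move=> er er' m1 x1 hx.
    have er0 : r0' = rr (j1' + 2 * Q t).
      apply: (addIr (- (nuP t / 2))); rewrite er' /rr nuE rmorphD rmorphM /=; field.
      by rewrite eR.
    have := nball_ta t0 (IH _ _ er er0 _ _ hx); rewrite mulmxA.
    by congr (nball _ _ _); ring.
move er: (rr j) => r hn; elim: hn j er => [r0|n0 r0 r0' h0 IH|t n0 r0 r0' t0 h0 IH] j er.
- by exists j, 0; split=> [//||m x]; [ring | rewrite mul1mx].
- have [j' [c [e1 e2 h]]] := IH _ er; exists (- j'), (- j - c); split.
  + by rewrite e1 /rr rmorphN mulNr.
  + by rewrite e2; ring.
  + by move=> m x /h/nball_smat; rewrite mulmxA.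
- have [j' [c [e1 e2 h]]] := IH _ er; exists (j' - 2 * Q t), (c - Q t); split.
  + by rewrite e1 /rr nuE rmorphB rmorphM /=; field; rewrite eR.
  + by rewrite e2; ring.
  + by move=> m x /h/(nball_ta t0); rewrite mulmxA.
Qed.

(** Both ends of an edge are treated at once. If [ua z'] fixes the point j1, it fixes the next one
    too and is absorbed on the right. Otherwise Q v is at most -j1 - 1, and by this strict
    inequality the lower unipotent produced by [smat_ua] fixes both ends. The sign d records whether
    the edge is reversed. *)
Lemma iwasawa g j : SU g -> exists z n y j' d,
  [/\ Hset z, g = ua z * n * y, d = 1 \/ d = -1,
      N_act n (rr j) (rr j') /\ N_act n (rr (j + 1)) (rr (j' + d)) &
      Ux (rr j) y /\ Ux (rr (j + 1)) y].
Proof.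
have Nta t j0 : t != 0 -> N_act (ta t) (rr j0) (rr (j0 - 2 * Q t)).
  move=> t0; have := N_ta t0 (N_one bar nuP (rr j0)); rewrite mulr1.
  by congr N_act; rewrite /rr nuE rmorphB rmorphM /=; field; rewrite eR.
have Ns j0 : N_act smat (rr j0) (rr (- j0)).
  have := N_s (N_one bar nuP (rr j0)); rewrite mulr1.
  by congr N_act; rewrite /rr rmorphN mulNr.
have U1 j0 : Ux (rr j0) 1 by case: (Ux_subgroup (rr j0)).
move=> /(SU_bruhat barK)[[z [t [hz t0 ->]]]|[z [z' [t [hz hz' t0 ->]]]]].
  exists z, (ta t), 1, (j - 2 * Q t), 1; split=> //; [by rewrite mulr1 | by left |].
  split; first exact: Nta.
  by have := Nta t (j + 1) t0; congr N_act; congr rr; ring.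
have tV : t^-1 != 0 by rewrite invr_eq0.
have t0' : bar t != 0 by rewrite bar0.
have ut := SU_unit (SU_ta barK t0).
set j1 := j - 2 * Q t.
have [hj|hj] := pselect (pge Q z'.2 (- j1)).
  exists z, (smat * ta t), ((ta t)^-1 * ua z' * ta t), (- j1), (-1); split=> //.
  - by rewrite !mulrA mulrK.
  - by right.
  - split; first by apply: N_act_mul (Ns _); apply: Nta.
    have := N_act_mul (Nta t (j + 1) t0) (Ns _); congr N_act; congr rr.
    by rewrite /j1; ring.
  - have -> : (ta t)^-1 * ua z' * ta t = ua (zscale bar t^-1 z').
      by rewrite taV // ta_ua // -mulrA taM mulVf // ta1 mulr1.
    have hp : pge Q (zscale bar t^-1 z').2 (- j).
      rewrite /= fmorphV /=; have := pgeM (pge_refl Q (t^-1 * (bar t)^-1)) hj.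
      apply: pge_le; rewrite placeMl ?invr_eq0 // !placeV // Qbar /j1; lia.
    have hH := Hset_scale barK tV hz'.
    by split; apply: Uax_ua => //; apply: pge_le hp; lia.
case: z' hz' hj => u v hz' /= hj.
have v0 : v != 0 by apply/eqP => v0; apply: hj; rewrite v0; left.
have vj : Q v < - j1 by rewrite ltNge; apply/negP => le; apply: hj; right.
have v0' : bar v != 0 by rewrite bar0.
have [hz1 hz2] := Hset_inv barK v0 hz'.
have t10 : - (bar v)^-1 != 0 by rewrite oppr_eq0 invr_eq0.
pose z2 := (u / bar v, v^-1); pose t1 := - (bar v)^-1.
have Qt1 : Q t1 = - Q v by rewrite placeN placeV // Qbar.
have umaE : (ta t)^-1 * uma z2 * ta t = uma (zscale bar (bar t) z2).
  rewrite /uma taV // !mulrA.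
  have -> : ta t^-1 * smat = smat * ta (bar t) by rewrite smat_ta // barK.
  rewrite -!mulrA; congr (_ * _); rewrite mulrA ta_ua // -!mulrA; congr (_ * _).
  by rewrite smat_ta // mulrA taM mulfV // ta1 mul1r.
exists (zadd bar z (u / v, v^-1)), (ta (t1 * t)), (uma (zscale bar (bar t) z2)), (j1 - 2 * Q t1), 1.
split=> //.
- exact: Hset_add.
- rewrite -umaE -ua_add -taM.
  transitivity (ua z * (smat * ua (u, v)) * ta t); first by rewrite !mulrA.
  by rewrite smat_ua // -/t1 -/z2 !mulrA mulrK.
- by left.
- have t1t : t1 * t != 0 by rewrite mulf_neq0.
  have QM : Q (t1 * t) = Q t1 + Q t by rewrite placeMl.
  split; first by have := Nta _ j t1t; congr N_act; congr rr; rewrite QM /j1; ring.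
  by have := Nta _ (j + 1) t1t; congr N_act; congr rr; rewrite QM /j1; ring.
- have hH : Hset (zscale bar (bar t) z2) by apply: Hset_scale.
  have hp : pge Q (zscale bar (bar t) z2).2 (j + 1).
    right; rewrite /= barK !placeMl ?mulf_neq0 ?invr_eq0 // placeV // Qbar.
    by move: vj; rewrite /j1; lia.
  by split; apply: Umax_uma => //; apply: pge_le hp; lia.
Qed.

Definition pt g j : set (M * R) := tree_pt bar nuP (g, rr j).

Lemma gball_ua_diff z z' j : Hset z -> Hset z' -> pge Q (zdiff bar z z').2 (- j) ->
  forall m x, gball (ua z) j m x <-> gball (ua z') j m x.
Proof.
move=> hz hz' hd m x; rewrite /gball.
have := Ux_nball (Uax_ua (Hset_diff barK hz hz') hd) m ((ua z')^-1 *m x).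
rewrite -ua_div // mulmxA -[_ *m (ua z')^-1]/(_ * _) mulrK; last exact/SU_unit/SU_ua.
by move=> ->.
Qed.

Lemma tree_eq_ball g h j r' : tree_eq (g, rr j) (h, r') -> exists j' c,
  [/\ r' = rr j', j' = j + 2 * c, SU g, SU h & forall m x, gball g j m x <-> gball h j' m x].
Proof.
case=> /= sg sh [n hn hu]; have [j' [c [e1 e2 hb]]] := N_act_nball hn.
exists j', c; split=> // m x; rewrite /gball.
have sn := N_act_SU hn.
have -> : g^-1 *m x = (g^-1 * h * n) *m (n^-1 *m (h^-1 *m x)).
  by rewrite -!mulmxA (mulmxV3 _ sn) (mulmxV3 _ sh).
by rewrite -(Ux_nball hu) hb (mulmxV3 _ sn).
Qed.

(** Iwasawa decompositions reduce the claim to points on the lines of [ua z] and [ua z'], where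
    equality of balls bounds [zdiff]; the remaining factors are absorbed in [Ux] by means of
    [N_act_conj]. *)
Lemma ball_tree_eq g h j j' : SU g -> SU h ->
  (forall m x, gball g j m x <-> gball h j' m x) -> tree_eq (g, rr j) (h, rr j').
Proof.
move=> sg sh hb.
have [z [n [y [j1 [_ [hz eg _ [hn _] [hy _]]]]]]] := iwasawa j sg.
have [z' [n' [y' [j1' [_ [hz' eh _ [hn' _] [hy' _]]]]]]] := iwasawa j' sh.
have sn := N_act_SU hn; have sn' := N_act_SU hn'.
have sz := SU_ua barK hz; have sz' := SU_ua barK hz'.
have sy := Ux_SU hy; have sy' := Ux_SU hy'.
have B g0 z0 n0 y0 j0 j0' : SU (ua z0) -> N_act n0 (rr j0) (rr j0') -> Ux (rr j0) y0 ->
    g0 = ua z0 * n0 * y0 -> forall m x, gball g0 j0 m x <-> gball (ua z0) j0' m x.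
  move=> s0 hn0 hy0 -> m x; rewrite /gball.
  have [j2 [c [/rr_inj e1 _ hN]]] := N_act_nball hn0; rewrite -e1 in hN.
  have u1 := SU_unit s0; have sn0 := N_act_SU hn0; have sy0 := Ux_SU hy0.
  rewrite (Ux_nball hy0) hN !invrM ?unitrMl ?(SU_unit sn0) ?(SU_unit sy0) //.
  by rewrite -!mulmxA (mulmxV3 _ sy0) (mulmxV3 _ sn0).
have [ej hd] : j1 = j1' /\ pge Q (zdiff bar z z').2 (- j1).
  apply: gball_ua_eq => // m x.
  by rewrite -(B _ _ _ _ _ _ sz hn hy eg) -(B _ _ _ _ _ _ sz' hn' hy' eh).
split=> //; exists (n'^-1 * n).
  by apply: N_act_mul hn _; rewrite ej; apply: N_act_inv.
have [_ uM uV] := Ux_subgroup (rr j).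
have -> : g^-1 * h * (n'^-1 * n) =
    y^-1 * (n^-1 * (ua (zdiff bar z z') * (n' * y' * n'^-1)) * n).
  rewrite -ua_div // eg eh !invrM ?unitrMl ?(SU_unit sn) ?(SU_unit sy) ?(SU_unit sz) //.
  by rewrite !mulrA.
apply: uM; first by case: (uV _ hy).
have := N_act_conj (N_act_inv hn); rewrite invrK; apply.
have [_ uM1 _] := Ux_subgroup (rr j1); apply: uM1.
  by apply: Uax_ua => //; apply: Hset_diff.
by rewrite ej; exact: N_act_conj hn' hy'.
Qed.

(** Points of the tree become norms on L^3: equality of equivalence classes is replaced by equality
    of balls. *)
Lemma ptP g h j j' : SU g -> SU h ->
  pt g j = pt h j' <-> forall m x, gball g j m x <-> gball h j' m x.
Proof.
move=> sg sh; split=> [e1|hb].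
  have : pt h j' (h, rr j') by apply: ball_tree_eq.
  rewrite -e1 => /tree_eq_ball[j2 [_ [/rr_inj e2 _ _ _ hb]]].
  by rewrite e2.
apply/seteqP; split=> -[h1 r1] /tree_eq_ball[j1 [_ [-> _ _ s1 hb1]]];
  by apply: ball_tree_eq => // m x; rewrite -hb1 hb.
Qed.

Lemma pt_parity g h j j' : SU h -> pt g j = pt h j' -> exists c, j' = j + 2 * c.
Proof.
move=> sh e1; have : pt h j' (h, rr j') by apply: ball_tree_eq.
by rewrite -e1 => /tree_eq_ball[j2 [c [/rr_inj -> -> _ _ _]]]; exists c.
Qed.

Lemma pt_uaP z z' j j' : Hset z -> Hset z' ->
  pt (ua z) j = pt (ua z') j' <-> j = j' /\ pge Q (zdiff bar z z').2 (- j).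
Proof.
move=> hz hz'; have sz := SU_ua barK hz; have sz' := SU_ua barK hz'; split.
  by move/(ptP _ _ sz sz'); apply: gball_ua_eq.
by case=> <- hd; apply/ptP => //; apply: gball_ua_diff.
Qed.

Lemma pt_ua_ex g j : SU g -> exists z j' d, [/\ Hset z, d = 1 \/ d = -1,
  pt g j = pt (ua z) j' & pt g (j + 1) = pt (ua z) (j' + d)].
Proof.
move=> sg; have [z [n [y [j' [d [hz eg hd [hn hn1] [hy hy1]]]]]]] := iwasawa j sg.
exists z, j', d; have sz := SU_ua barK hz.
have H j0 j0' : N_act n (rr j0) (rr j0') -> Ux (rr j0) y -> pt g j0 = pt (ua z) j0'.
  move=> hn0 hy0; apply/ptP => // m x; rewrite /gball.
  have [j2 [c [/rr_inj e1 _ hN]]] := N_act_nball hn0; rewrite -e1 in hN.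
  have sn0 := N_act_SU hn0; have sy0 := Ux_SU hy0.
  rewrite (Ux_nball hy0) hN eg !invrM ?unitrMl ?(SU_unit sn0) ?(SU_unit sy0) ?(SU_unit sz) //.
  by rewrite -!mulmxA (mulmxV3 _ sy0) (mulmxV3 _ sn0).
by split=> //; apply: H.
Qed.

Lemma apt_vertexP r : apt_vertex nuP r <-> exists j, r = rr j.
Proof.
split=> [[t t0 ht]|[j ->]].
  exists (Q t); apply: (mulfI (_ : 2 != 0 :> R)); first by rewrite pnatr_eq0.
  by move: ht; rewrite /root_a => ->; rewrite /rr nuE; field.
have [pi [p0 p1]] := uniformizer Q; exists (pi ^ j); first by rewrite expfz_neq0.
by rewrite nuE placeXz // p1 mulr1 /root_a /rr; field.
Qed.

Lemma rr_lt j j' : (rr j < rr j') = (j < j').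
Proof. by rewrite /rr ltr_pM2r ?ltr_int // invr_gt0 mulr_gt0 // ltr0n. Qed.

Lemma apt_edgeP r r' : apt_edge nuP r r' <-> exists j, r = rr j /\ r' = rr (j + 1).
Proof.
split=> [[/apt_vertexP[j ->] /apt_vertexP[j' ->]]|[j [-> ->]]].
  rewrite rr_lt => lt h; exists j; split=> //; congr rr.
  have [|le] := ltP (j + 1) j'; last by lia.
  move=> lt1; case: (h (rr (j + 1))); first by rewrite !rr_lt lt1; lia.
  by apply/apt_vertexP; exists (j + 1).
split; [by apply/apt_vertexP; exists j | by apply/apt_vertexP; exists (j + 1) | by rewrite rr_lt; lia |].
by move=> r0 /andP[h1 h2] /apt_vertexP[j0 e1]; move: h1 h2; rewrite e1 !rr_lt; lia.
Qed.

Lemma vertexP v : vertices bar nuP v <-> exists z j, Hset z /\ v = pt (ua z) j.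
Proof.
split=> [[g [r [sg /apt_vertexP[j ->] ->]]]|[z [j [hz ->]]]].
  by have [z [j' [_ [hz _ e1 _]]]] := pt_ua_ex j sg; exists z, j'.
by exists (ua z), (rr j); split=> //; [exact: SU_ua | apply/apt_vertexP; exists j].
Qed.

Lemma vertex_pt g j : SU g -> vertices bar nuP (pt g j).
Proof. by move=> sg; exists g, (rr j); split=> //; apply/apt_vertexP; exists j. Qed.

Lemma edgeP E : edges bar nuP E <-> exists z j, Hset z /\
  E = [set pt (ua z) j; pt (ua z) (j + 1)].
Proof.
split=> [[g [r [r' [sg /apt_edgeP[j [-> ->]] ->]]]]|[z [j [hz ->]]]].
  have [z [j' [d [hz hd e1 e2]]]] := pt_ua_ex j sg; exists z.
  rewrite -/(pt g j) -/(pt g (j + 1)) e1 e2; case: hd => ->; first by exists j'.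
  by exists (j' - 1); rewrite subrK setUC.
exists (ua z), (rr j), (rr (j + 1)); split=> //; first exact: SU_ua.
by apply/apt_edgeP; exists j.
Qed.

Lemma move_pt h g j : SU h -> SU g -> move_v h (pt g j) = pt (h * g) j.
Proof.
move=> sh sg; have shg := SU_mul sh sg; have uh := SU_unit sh.
have K h0 j0 m x : SU h0 -> gball (h * h0) j0 m x <-> gball h0 j0 m (h^-1 *m x).
  by move=> s0; rewrite /gball invrM ?(SU_unit s0) // mulmxA.
apply/seteqP; split=> [_ [[h1 r1] /tree_eq_ball[j1 [_ [-> _ _ s1 hb]]] <-]|[h1 r1]].
  apply: ball_tree_eq => //; first exact: SU_mul.
  by move=> m x; rewrite !K.
move=> /tree_eq_ball[j1 [_ [-> _ _ s1 hb]]]; exists (h^-1 * h1, rr j1); last first.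
  by rewrite /= mulrA mulrV // mul1r.
have s2 : SU (h^-1 * h1) by apply: SU_mul => //; apply: SU_inv.
apply: ball_tree_eq => // m x.
have e1 : h1 = h * (h^-1 * h1) by rewrite mulrA mulrV // mul1r.
have := hb m (h *m x); rewrite K // (mulVmx3 _ sh) => ->.
by rewrite [in X in X <-> _]e1 K // (mulVmx3 _ sh).
Qed.

Lemma move1 (v : set (M * R)) : move_v 1 v = v.
Proof.
by apply/seteqP; split=> [_ [[g r] h <-]|[g r] h]; [rewrite mul1r | exists (g, r); rewrite ?mul1r].
Qed.

Lemma moveM g h (v : set (M * R)) : move_v (g * h) v = move_v g (move_v h v).
Proof.
apply/seteqP; split=> [_ [[g1 r1] h1 <-]|_ [_ [[g1 r1] h1 <-] <-]].
  by exists (h * g1, r1); [exists (g1, r1) | rewrite /= mulrA].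
by exists (g1, r1); rewrite //= mulrA.
Qed.

End Tree.

(** * Groups acting on trees *)

(** The choice depends only on the set, so it is constant on orbits and on cosets and serves to pick
    representatives. *)
Lemma choose_points (T : Type) (x0 : T) :
  exists ch : set T -> T, forall (S : set T) x, S x -> S (ch S).
Proof.
have /choice[ch hch] : forall S : set T, exists y, (exists x, S x) -> S y.
  move=> S; have [[x Sx]|no] := pselect (exists x, S x); first by exists x.
  by exists x0.
by exists ch => S x Sx; apply: hch; exists x.
Qed.

Lemma sub_swap (V : zmodType) (a b c d : V) : a - c = b - d <-> b - a = d - c.
Proof.
have H (x y z w : V) : x - z = y - w -> y - x = w - z.
  move=> e; rewrite -[y](subrK w) -e -addrA [w - x]addrC addrACA subrr add0r.
  by rewrite addrC.
split=> h; first exact: H.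
by have := congr1 -%R (H _ _ _ _ h); rewrite !opprB => ->.
Qed.

Lemma sub_interchange (V : zmodType) (a b c d : V) : (a - b) - (c - d) = (a - c) - (b - d).
Proof. by rewrite opprB [in RHS]opprB addrACA [in RHS]addrACA [- b + _]addrC. Qed.

Section ParentTree.
Context (T : Type) (X : set T) (par : T -> T) (ht : T -> int).
Hypotheses (parX : forall x, X x -> X (par x)).
Hypotheses (ht_par : forall x, X x -> ht (par x) = ht x + 1).
Hypothesis merge : forall x y, X x -> X y -> exists n m, iter n par x = iter m par y.

Lemma iterX n x : X x -> X (iter n par x).
Proof. by move=> Xx; elim: n => //= n; apply: parX. Qed.

Lemma ht_iter n x : X x -> ht (iter n par x) = ht x + n%:Z.
Proof.
move=> Xx; elim: n => [|n IH] /=; first by rewrite addr0.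
by rewrite ht_par ?IH; [lia | apply: iterX].
Qed.

(** The potential at x is the sum of t on the way up from x0 to a common ancestor minus the sum on
    the way up from x. Heights show that the difference of the two numbers of steps is the same for
    every common ancestor, so the choice of the ancestor does not matter. *)
Lemma parent_potential (V : zmodType) (t : T -> V) :
  exists tau : T -> V, forall x, X x -> tau (par x) - tau x = t x.
Proof.
have [[x0 X0]|no] := pselect (exists x, X x); last first.
  by exists (fun _ => 0) => x Xx; case: no; exists x.
pose P x n := \sum_(l < n) t (iter l par x).
have PD x n m : P x (n + m)%N = P x n + P (iter n par x) m.
  rewrite /P big_split_ord /=; congr (_ + _); apply: eq_bigr => l _ /=.
  by rewrite addnC iterD.
have /choice[nm hnm] : forall x, exists nm : nat * nat, X x -> iter nm.1 par x = iter nm.2 par x0.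
  move=> x; have [Xx|nX] := pselect (X x); last by exists (0%N, 0%N).
  by have [n [m e]] := merge Xx X0; exists (n, m).
pose tau x := P x0 (nm x).2 - P x (nm x).1.
have ind x n m n' m' : X x -> iter n par x = iter m par x0 ->
    iter n' par x = iter m' par x0 -> P x0 m - P x n = P x0 m' - P x n'.
  move=> Xx; wlog le : n m n' m' / (n <= n')%N => [W|] e e'.
    by have [le|/ltnW le] := leqP n n'; [apply: W | apply/esym/W].
  have h1 := congr1 ht e; have h2 := congr1 ht e'; rewrite !ht_iter // in h1 h2.
  have [d en] : exists d, n' = (n + d)%N by exists (n' - n)%N; rewrite subnKC.
  have em : m' = (m + d)%N by lia.
  by rewrite en em !PD e; lazymatch goal with |- ?a - ?b = _ =>
    rewrite opprD addrACA subrr addr0 end.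
exists tau => x Xx; have e := hnm x Xx.
have -> : tau x = P x0 (nm x).2.+1 - P x (nm x).1.+1 by apply: ind => //=; rewrite e.
have -> : tau (par x) = P x0 (nm x).2.+1 - P (par x) (nm x).1.
  by apply: ind; [exact: parX | exact/hnm/parX | rewrite -iterSr /= e].
have -> : P x (nm x).1.+1 = t x + P (par x) (nm x).1 by rewrite -add1n PD /P big_ord1.
by rewrite sub_interchange subrr sub0r opprB addrK.
Qed.

Lemma parent_connected (V : Type) (tau : T -> V) :
  (forall x, X x -> tau (par x) = tau x) -> forall x y, X x -> X y -> tau x = tau y.
Proof.
move=> h; have H n x : X x -> tau (iter n par x) = tau x.
  by move=> Xx; elim: n => //= n <-; apply/h/iterX.
by move=> x y Xx Xy; have [n [m e]] := merge Xx Xy; rewrite -(H n x) // e H.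
Qed.

End ParentTree.

(* A group G acting on a tree T, and the tree obtained by collapsing the fibres
   of cls, on whose edges G acts freely. *)
Section TreeAction.
Context (Rg : unitRingType) (G : subgroup Rg) (T W : Type) (X : set T) (x0 : T).
Context (act : Rg -> T -> T) (actW : Rg -> W -> W) (cls : T -> W) (adj : T -> T -> Prop).
Hypothesis X0 : X x0.
Hypotheses (act1 : forall x, act 1 x = x)
  (actM : forall g h x, act (g * h) x = act g (act h x))
  (actW1 : forall w, actW 1 w = w)
  (actWM : forall g h w, actW (g * h) w = actW g (actW h w)).
Hypotheses (actX : forall g x, G g -> X x -> X (act g x))
  (adjX : forall x y, adj x y -> X x /\ X y)
  (adjC : forall x y, adj x y -> adj y x)
  (adjG : forall g x y, G g -> adj x y -> adj (act g x) (act g y))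
  (clsG : forall g x, G g -> X x -> cls (act g x) = actW g (cls x)).
Hypothesis pot : forall (V : zmodType) (t : T -> T -> V),
  (forall x y, t y x = - t x y) ->
  exists tau : T -> V, forall x y, adj x y -> tau y - tau x = t x y.
Hypothesis conn : forall (V : zmodType) (tau : T -> V),
  (forall x y, adj x y -> tau x = tau y) -> forall x y, X x -> X y -> tau x = tau y.
Hypothesis fib : forall (V : zmodType) (tau : T -> V),
  (forall x y, adj x y -> cls x = cls y -> tau x = tau y) ->
  forall x y, X x -> X y -> cls x = cls y -> tau x = tau y.
Hypothesis free : forall x y g, adj x y -> cls x <> cls y -> G g ->
  act g x = x -> act g y = y -> g = 1.
Hypothesis noinv : forall x y g, adj x y -> G g -> act g x = y -> act g y = x -> False.

Let G1 : G 1. Proof. by case: (sgP G). Qed.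
Let GM g h : G g -> G h -> G (g * h). Proof. by case: (sgP G) => _ + _; apply. Qed.
Let GV g : G g -> G g^-1. Proof. by case: (sgP G) => _ _ V /V[]. Qed.
Let GU g : G g -> g \is a GRing.unit. Proof. by case: (sgP G) => _ _ V /V[]. Qed.
Let actK g x : G g -> act g^-1 (act g x) = x.
Proof. by move=> gg; rewrite -actM mulVr ?act1 // GU. Qed.
Let actWK g x : G g -> actW g^-1 (actW g x) = x.
Proof. by move=> gg; rewrite -actWM mulVr ?actW1 // GU. Qed.

Definition hom_on (H : set Rg) (V : zmodType) (f : Rg -> V) : Prop :=
  forall g h, H g -> H h -> f (g * h) = f g + f h.

Lemma hom_on1 (V : zmodType) (f : Rg -> V) : hom_on G f -> f 1 = 0.
Proof. by move=> hf; apply: (addrI (f 1)); rewrite -hf // mulr1 addr0. Qed.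

Lemma hom_onV (V : zmodType) (f : Rg -> V) g : hom_on G f -> G g -> f g^-1 = - f g.
Proof.
move=> hf gg; have := hf _ _ (GV gg) gg; rewrite mulVr ?GU // hom_on1 //.
by move/esym/eqP; rewrite addr_eq0 => /eqP.
Qed.

Let orbW w : set W := [set w' | exists2 g, G g & w' = actW g w].

Let orbW_act g w : G g -> orbW (actW g w) = orbW w.
Proof.
move=> gg; apply/seteqP; split=> _ [h gh ->].
  by exists (h * g); [apply: GM | rewrite actWM].
by exists (h * g^-1); [apply/GM/GV | rewrite actWM actWK].
Qed.

Let orbW_refl w : orbW w w. Proof. by exists 1. Qed.

(** The element [gam w] carries the chosen representative of the orbit to w; it is determined up to
    the stabilizer, on which f vanishes. *)
Lemma equivariant_potential (V : zmodType) (f : Rg -> V) : hom_on G f ->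
  (forall g x, G g -> X x -> actW g (cls x) = cls x -> f g = 0) ->
  exists tau : W -> V, forall g x, G g -> X x -> tau (actW g (cls x)) = f g + tau (cls x).
Proof.
move=> hf f0; have [ch hch] := choose_points (cls x0).
pose r w := ch (orbW w).
have /choice[gam hgam] : forall w, exists g, G g /\ w = actW g (r w).
  move=> w; have [g gg e] := hch _ _ (orbW_refl w); exists g^-1; split; first exact: GV.
  by rewrite /r e actWK.
exists (fun w => f (gam w)) => g x gg Xx.
have [ga ea] := hgam (actW g (cls x)); have [gb eb] := hgam (cls x).
set a := gam _ in ga ea *; set b := gam _ in gb eb *.
rewrite /r (orbW_act _ gg) -/(r _) in ea.
have er : cls (act b^-1 x) = r (cls x) by rewrite clsG //; [rewrite -[RHS](actWK _ gb) -eb | exact: GV].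
have : f (a^-1 * (g * b)) = 0.
  apply: (f0 _ (act b^-1 x)); [by do ?[apply: GM || apply: GV] | by apply/actX => //; apply: GV |].
  rewrite er !actWM -eb ea actWK //.
rewrite (hf _ _ (GV ga) (GM gg gb)) (hf _ _ gg gb) (hom_onV hf ga).
by move/eqP; rewrite addrC subr_eq0 => /eqP <-.
Qed.

Definition uncollapsed x y : Prop := adj x y /\ cls x <> cls y.

Let uncollapsedG g x y : G g -> uncollapsed x y -> uncollapsed (act g x) (act g y).
Proof.
move=> gg [h ne]; split; first exact: adjG.
have [Xx Xy] := adjX h; rewrite !clsG // => /(congr1 (actW g^-1)).
by rewrite !actWK.
Qed.

Section FiniteEdges.
Context (n : nat) (ex ey : 'I_n -> T).
Hypothesis he : forall j, uncollapsed (ex j) (ey j).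
Hypothesis cover : forall x y, uncollapsed x y -> exists j g, G g /\
  ((x = act g (ex j) /\ y = act g (ey j)) \/ (x = act g (ey j) /\ y = act g (ex j))).
Hypothesis uniq : forall j l g, G g ->
  (act g (ex j) = ex l /\ act g (ey j) = ey l) \/
  (act g (ex j) = ey l /\ act g (ey j) = ex l) -> j = l.

Let pos j x y : Prop := exists g, [/\ G g, x = act g (ex j) & y = act g (ey j)].

(** The indicator cochain of the j-th orbit of uncollapsed edges, signed by orientation. *)
Let t j x y : int := if `[< pos j x y >] then 1 else if `[< pos j y x >] then -1 else 0.

Let pos_excl j x y : pos j x y -> pos j y x -> False.
Proof.
move=> [g [gg -> ->]] [h [gh e1 e2]]; have [ha _] := he j.
apply: (noinv (g := g^-1 * h) ha); first by apply: GM => //; apply: GV.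
  by rewrite actM -e1 actK.
by rewrite actM -e2 actK.
Qed.

Let t_anti j x y : t j y x = - t j x y.
Proof.
rewrite /t; have [h1|h1] := pselect (pos j y x); have [h2|h2] := pselect (pos j x y).
- by case: (pos_excl h1 h2).
- by rewrite (asboolT h1) (asboolF h2) opprK.
- by rewrite (asboolT h2) (asboolF h1).
- by rewrite (asboolF h1) (asboolF h2) oppr0.
Qed.

Let posG j g x y : G g -> pos j (act g x) (act g y) <-> pos j x y.
Proof.
move=> gg; split=> -[h [gh e1 e2]].
  exists (g^-1 * h); split; [by apply: GM => //; apply: GV | |].
    by rewrite actM -e1 actK.
  by rewrite actM -e2 actK.
by exists (g * h); rewrite !actM e1 e2; split=> //; apply: GM.
Qed.

Let tG j g x y : G g -> t j (act g x) (act g y) = t j x y.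
Proof.
move=> gg; rewrite /t; have E a b := asbool_equiv_eq (posG j a b gg).
by rewrite !E.
Qed.

Let pos_free j x y : pos j x y -> uncollapsed x y.
Proof. by move=> [g [gg -> ->]]; apply: uncollapsedG. Qed.

Let t0 j x y : cls x = cls y -> t j x y = 0.
Proof.
move=> e; rewrite /t; case: asboolP => [/pos_free[]//|_].
by case: asboolP => // /pos_free[_]; rewrite e.
Qed.

Let t_pos j l g : G g -> t j (act g (ex l)) (act g (ey l)) = (j == l)%:R.
Proof.
move=> gg; rewrite tG // /t; have [<-|ne] := eqVneq j l.
  by case: asboolP => // -[]; exists 1; rewrite !act1.
case: asboolP => [[h [gh e1 e2]]|_].
  by case/eqP: ne; apply: (uniq gh); left.
case: asboolP => // -[h [gh e1 e2]].
by case/eqP: ne; apply: (uniq gh); right.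
Qed.

(** [phi j g] counts, with signs, the edges of the j-th orbit crossed on the way from x0 to
    [act g x0]. A function D with invariant differences that is constant on the fibres is recovered
    by adding up its differences on this way. This is applied to the equivariant potential of f,
    whose differences are the coefficients m, and to invariant functions D, which give relations. *)
Lemma tree_cocycles : exists phi : 'I_n -> Rg -> int,
  [/\ forall j, hom_on G (phi j),
   forall (V : zmodType) (f : Rg -> V), hom_on G f ->
     (forall g x, G g -> X x -> actW g (cls x) = cls x -> f g = 0) ->
     exists m : 'I_n -> V, forall g, G g -> f g = \sum_j m j *~ phi j g
   & forall D : T -> int, (forall g x, G g -> X x -> D (act g x) = D x) ->
     (forall x y, adj x y -> cls x = cls y -> D x = D y) ->
     forall g, G g -> \sum_j (D (ey j) - D (ex j)) * phi j g = 0].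
Proof.
have /choice[tau htau] : forall j, exists tau : T -> int,
    forall x y, adj x y -> tau y - tau x = t j x y.
  by move=> j; apply: pot => x y; apply: t_anti.
pose phi j g := tau j (act g x0) - tau j x0.
have phiE j g x : G g -> X x -> tau j (act g x) - tau j x = phi j g.
  move=> gg Xx; apply: (conn (tau := fun x => tau j (act g x) - tau j x)) => // y z yz.
  by apply/sub_swap; rewrite !htau ?tG //; apply: adjG.
have dec (V : zmodType) (D : T -> V) :
    (forall g x y, G g -> adj x y -> D (act g y) - D (act g x) = D y - D x) ->
    (forall x y, adj x y -> cls x = cls y -> D x = D y) ->
    forall g, G g -> D (act g x0) - D x0 = \sum_j (D (ey j) - D (ex j)) *~ phi j g.
  move=> DG Dcls g gg.
  pose E x := D x - \sum_j (D (ey j) - D (ex j)) *~ tau j x.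
  have : E (act g x0) = E x0.
    apply: conn => //; last exact: actX.
    move=> x y xy; apply/sub_swap.
    have -> : \sum_j (D (ey j) - D (ex j)) *~ tau j y - \sum_j (D (ey j) - D (ex j)) *~ tau j x
        = \sum_j (D (ey j) - D (ex j)) *~ t j x y.
      by rewrite -sumrB; apply: eq_bigr => j _; rewrite -(htau j _ _ xy) mulrzBr.
    have [ec|nc] := pselect (cls x = cls y).
      rewrite (Dcls _ _ xy ec) subrr big1 // => j _; by rewrite t0 // mulr0z.
    have [//|j [h [gh [[-> ->]|[-> ->]]]]] := @cover x y.
      rewrite (bigD1 j) //= t_pos // eqxx mulr1z big1 ?addr0 => [|l /negPf nl].
        by rewrite DG //; case: (he j).
      by rewrite t_pos // nl mulr0z.
    rewrite (bigD1 j) //= t_anti t_pos // eqxx mulrN1z opprB big1 ?addr0 => [|l /negPf nl].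
      by rewrite DG //; apply: adjC; case: (he j).
    by rewrite t_anti t_pos // nl oppr0 mulr0z.
  move=> /esym/sub_swap ->; rewrite -sumrB; apply: eq_bigr => j _.
  by rewrite /phi mulrzBr.
exists phi; split=> [j g h gg gh|V f hf f0|D DG Dcls g gg].
- rewrite -(phiE j g (act h x0)) // ?actM; last exact: actX.
  by rewrite -actM /phi addrA subrK.
- have [ta hta] := equivariant_potential hf f0.
  have taG g x : G g -> X x -> ta (cls (act g x)) = f g + ta (cls x).
    by move=> gg Xx; rewrite clsG // hta.
  exists (fun j => ta (cls (ey j)) - ta (cls (ex j))) => g gg.
  have := dec V (ta \o cls) _ _ g gg; rewrite /= taG // addrK; apply.
    move=> h x y gh xy; have [Xx Xy] := adjX xy; rewrite !taG //.
    by rewrite opprD addrACA subrr add0r.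
  by move=> x y _ ->.
- have := dec _ D _ Dcls g gg; rewrite DG // subrr => dE.
  apply: etrans (esym (dE _)) => [|h x y gh xy].
    by apply: eq_bigr => j _; rewrite mulrzz.
  by have [Xx Xy] := adjX xy; rewrite !DG.
Qed.

End FiniteEdges.

(** As for an induced module, psi0 defines a cocycle sig with values in the functions on W supported
    on the orbit of [cls x0]. Freeness on uncollapsed edges makes sig a coboundary there;
    integrating the difference between the two orientations over the tree gives tau, and sig minus
    the coboundary of tau no longer depends on the point, hence is a homomorphism. *)
Lemma stabilizer_extension (V : zmodType) (psi0 : Rg -> V) :
  hom_on [set g | G g /\ actW g (cls x0) = cls x0] psi0 ->
  exists psi : Rg -> V, hom_on G psi /\
    forall g, G g -> actW g (cls x0) = cls x0 -> psi g = psi0 g.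
Proof.
set w0 := cls x0; set H := [set g | _] => hpsi.
have H1 : H 1 by split; rewrite ?actW1.
have HM g h : H g -> H h -> H (g * h).
  by move=> [gg eg] [gh eh]; split; [apply: GM | rewrite actWM eh].
have HV g : H g -> H g^-1.
  by move=> [gg eg]; split; [apply: GV | rewrite -{1}eg actWK].
have psi1 : psi0 1 = 0 by apply: (addrI (psi0 1)); rewrite -hpsi // mulr1 addr0.
pose coset g : set Rg := [set h | exists2 k, H k & h = g * k].
have [ch hch] := choose_points (1 : Rg).
have coset_refl g : coset g g by exists 1; rewrite ?mulr1.
(* A function with [s (g k) = s g + psi0 k] for k in H; it need not be a homomorphism. *)
pose r g := ch (coset g); pose s g := psi0 ((r g)^-1 * g).
have sM g k : G g -> H k -> s (g * k) = s g + psi0 k.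
  move=> gg Hk; have uk : k \is a GRing.unit by apply: GU; case: Hk.
  have er : r (g * k) = r g.
    rewrite /r; congr ch; apply/seteqP; split=> _ [h Hh ->].
      by exists (k * h); [apply: HM | rewrite mulrA].
    by exists (k^-1 * h); [apply/HM => //; apply: HV | rewrite mulrA mulrK].
  rewrite /s er mulrA hpsi //.
  have [h Hh eh] := hch _ _ (coset_refl g); rewrite /r eh.
  have uh : h \is a GRing.unit by apply: GU; case: Hh.
  have -> : (g * h)^-1 * g = h^-1 by rewrite (invrM (GU gg) uh) mulrVK // GU.
  exact: HV.
pose inorb w := exists a, G a /\ w = actW a w0.
have /choice[al hal] : forall w, exists a, inorb w -> G a /\ w = actW a w0.
  by move=> w; have [[a h]|no] := pselect (inorb w); [exists a | exists 1].
pose sig g w : V := if `[< inorb w >] then s (g * al w) - s (al w) else 0.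
have sigE g a : G g -> G a -> sig g (actW a w0) = s (g * a) - s a.
  move=> gg ga; have io : inorb (actW a w0) by exists a.
  have [gb eb] := hal _ io; rewrite /sig asboolT //.
  set b := al _ in gb eb *; have ub := GU gb.
  have Hk : H (b^-1 * a) by split; [apply/GM => //; apply: GV | rewrite actWM eb actWK].
  have -> : a = b * (b^-1 * a) by rewrite mulrA mulrV // mul1r.
  by rewrite mulrA (sM _ _ (GM gg gb) Hk) (sM _ _ gb Hk) opprD addrACA subrr addr0.
have sig0 g w : ~ inorb w -> sig g w = 0 by move=> h; rewrite /sig asboolF.
have sigM g h w : G g -> G h -> sig (g * h) w = sig g (actW h w) + sig h w.
  move=> gg gh; have [[a [ga ->]]|no] := pselect (inorb w).
    by rewrite -actWM (sigE _ _ (GM gg gh) ga) (sigE _ _ gg (GM gh ga)) (sigE _ _ gh ga) mulrA addrA subrK.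
  rewrite !sig0 ?addr0 // => -[a [ga e]]; apply: no; exists (h^-1 * a).
  by split; [apply/GM => //; apply: GV | rewrite actWM -e actWK].
pose actE g (p : T * T) := (act g p.1, act g p.2).
have actEM g h p : actE (g * h) p = actE g (actE h p) by rewrite /actE !actM.
have actEK g p : G g -> actE g^-1 (actE g p) = p.
  by move=> gg; rewrite /actE /= !actK //; case: p.
pose orbE p : set (T * T) := [set q | exists2 g, G g & q = actE g p].
have orbE_act g p : G g -> orbE (actE g p) = orbE p.
  move=> gg; apply/seteqP; split=> _ [h gh ->].
    by exists (h * g); [apply: GM | rewrite actEM].
  by exists (h * g^-1); [apply/GM/GV | rewrite actEM actEK].
have [chE hchE] := choose_points (x0, x0).
have orbE_refl p : orbE p p by exists 1; rewrite // /actE !act1; case: p.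
pose rE p := chE (orbE p).
have /choice[ge hge] : forall p, exists g, G g /\ p = actE g (rE p).
  move=> p; have [g gg e] := hchE _ _ (orbE_refl p); exists g^-1; split; first exact: GV.
  by rewrite /rE e actEK.
(* A primitive of sig on oriented uncollapsed edges: by freeness the translate [ge p] from the
   representative is unique. *)
pose S p : V := let w := cls (rE p).1 in if `[< inorb w >] then s (ge p * al w) else 0.
have SG g x y : G g -> uncollapsed x y ->
    S (act g x, act g y) - S (x, y) = sig g (cls x).
  move=> gg fxy; pose p := (x, y); rewrite -[(act g x, act g y)]/(actE g p) -/p.
  have rr : rE (actE g p) = rE p by rewrite /rE orbE_act.
  have [gp ep] := hge p; have [gp' ep'] := hge (actE g p); rewrite rr in ep'.
  have fr : uncollapsed (rE p).1 (rE p).2.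
    have -> : rE p = actE (ge p)^-1 p by rewrite -{1}(actEK _ (rE p) gp) -ep.
    by apply: uncollapsedG => //; apply: GV.
  have [ar nr] := fr; have [Xr _] := adjX ar.
  have eg : ge (actE g p) = g * ge p.
    have ug := GU gg; have up := GU gp; have up' := GU gp'.
    have k1 : actE ((g * ge p)^-1 * ge (actE g p)) (rE p) = rE p.
      have e0 : actE g p = actE (g * ge p) (rE p) by rewrite actEM -ep.
      by rewrite actEM -ep' e0 (actEK _ _ (GM gg gp)).
    have := free ar nr (_ : G ((g * ge p)^-1 * ge (actE g p))).
    move=> /(_ (GM (GV (GM gg gp)) gp') (congr1 fst k1) (congr1 snd k1)) e1.
    by rewrite -[LHS]mul1r -(mulrV (GU (GM gg gp))) -mulrA e1 mulr1.
  have ec : cls x = actW (ge p) (cls (rE p).1).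
    rewrite -(clsG gp Xr); have ex1 : x = act (ge p) (rE p).1 by exact: (congr1 fst ep).
    by rewrite [in LHS]ex1.
  rewrite /S rr eg; have [io|no] := pselect (inorb (cls (rE p).1)).
    have [ga ea] := hal _ io; rewrite !asboolT // ec [in RHS]ea -actWM (sigE _ _ gg (GM gp ga)).
    by rewrite mulrA.
  rewrite asboolF // subr0 sig0 // => -[a [ga e]]; apply: no; exists ((ge p)^-1 * a).
  by split; [apply/GM => //; apply: GV | rewrite actWM -e ec actWK].
have fC x y : uncollapsed x y -> uncollapsed y x by move=> [h ne]; split; [exact: adjC | move/esym].
pose t x y : V := if `[< uncollapsed x y >] then S (y, x) - S (x, y) else 0.
have [tau htau] : exists tau : T -> V, forall x y, adj x y -> tau y - tau x = t x y.
  apply: pot => x y; rewrite /t; case: asboolP => h; case: asboolP => h' //.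
  - by rewrite opprB.
  - by case: h'; apply: fC.
  - by case: h; apply: fC.
  - by rewrite oppr0.
have tau_fib x y : X x -> X y -> cls x = cls y -> tau x = tau y.
  apply: fib => {}x {}y xy e; apply/eqP; rewrite eq_sym -subr_eq0 htau // /t asboolF //.
  by case.
(* By the choice of t, along an edge sig and the coboundary of tau change by the same amount. *)
pose ka g x := sig g (cls x) - (tau (act g x) - tau x).
have kaE g x y : G g -> X x -> X y -> ka g x = ka g y.
  move=> gg; apply: conn => {}x {}y xy; have [Xx Xy] := adjX xy.
  apply/sub_swap; rewrite sub_interchange.
  have agxy := adjG gg xy; rewrite !htau // /t.
  case: (asboolP (uncollapsed x y)) => fxy; last first.
    have ec : cls x = cls y by apply: contrapT => nc; apply: fxy.
    by rewrite asboolF ?subrr ?ec ?subrr // => -[_]; rewrite !clsG // ec.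
  rewrite asboolT; last exact: uncollapsedG.
  by rewrite [RHS]sub_interchange !SG //; apply: fC.
exists (fun g => ka g x0); split=> [g h gg gh|g gg eg].
  rewrite (kaE g x0 (act h x0)) //; last exact: actX.
  by rewrite /ka clsG // sigM // actM [in RHS]addrACA -opprD addrA subrK.
have /(congr1 (fun z => z - s 1)) := sM 1 g G1 (conj gg eg); rewrite mul1r [s 1 + _]addrC addrK => <-.
rewrite -[X in s X - _](mulr1 g) -(sigE _ _ gg G1) actW1 /ka (tau_fib (act g x0) x0) ?subrr ?subr0 //; first exact: actX.
by rewrite clsG.
Qed.

End TreeAction.

(** * Short integral vectors *)

Lemma half_up (j : int) : exists c : int, j <= 2 * c /\ 2 * c <= j + 1.
Proof.
have [n [->|->]] : exists n : nat, j = n%:Z \/ j = - n%:Z.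
  by exists `|j|%N; lia.
- by exists (Posz (uphalf n)); lia.
- by exists (- Posz (n./2)); lia.
Qed.

(** A non-zero cross product of two of the vectors is the equation of a plane that contains all of
    them or misses a third one; if all cross products vanish, the vectors are proportional to one of
    them. *)
Lemma nonplanar (L : fieldType) (S : finType) (X : {set S}) (y : S -> 'cV[L]_3) :
  (exists a b c, (a, b, c) != (0, 0, 0) /\
     forall s, s \in X -> a * y s 0 0 + b * y s 1 0 + c * y s 2%R 0 = 0) \/
  exists s1 s2 s3, [/\ s1 \in X, s2 \in X, s3 \in X &
    \det (\matrix_(a, b) (nth (y s1) [:: y s1; y s2; y s3] b) a 0) != 0].
Proof.
set T := (X in _ \/ X); have [|no] := pselect T; [by right | left].
pose cr s t := (y s 1 0 * y t 2%R 0 - y s 2%R 0 * y t 1 0,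
                y s 2%R 0 * y t 0 0 - y s 0 0 * y t 2%R 0,
                y s 0 0 * y t 1 0 - y s 1 0 * y t 0 0).
have [[s [t [sX tX cn]]]|nc] := pselect (exists s t, [/\ s \in X, t \in X & cr s t != (0, 0, 0)]).
  exists (cr s t).1.1, (cr s t).1.2, (cr s t).2; split; first by case: (cr s t) cn => -[].
  move=> u uX; apply: contrapT => /eqP nz; apply: no; exists s, t, u; split => //.
  by apply: contraNN nz => /eqP <-; apply/eqP; rewrite det3 !mxE /= /cr; ring.
have c0 s t : s \in X -> t \in X -> cr s t = (0, 0, 0).
  by move=> sX tX; apply: contrapT => /eqP h; apply: nc; exists s, t.
have [[s [sX nz]]|al0] := pselect (exists s, s \in X /\ y s != 0); last first.
  exists 1, 0, 0; split; first by rewrite !xpair_eqE oner_eq0.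
  move=> s sX; have -> : y s = 0 by apply: contrapT => /eqP h; apply: al0; exists s.
  by rewrite !mxE !mulr0 !addr0.
have [p0 p1] : (y s 0 0 != 0) || (y s 1 0 != 0) || (y s 2%R 0 != 0) /\ True.
  split=> //; apply: contraNT nz; rewrite !negb_or !negbK => /andP[/andP[/eqP a0 /eqP b0] /eqP c00].
  rewrite (col3_eta (y s)) a0 b0 c00; apply/eqP/colP => a; rewrite !mxE.
  by case: a => -[|[|[|a]]].
have E t : t \in X -> [/\ y s 1 0 * y t 2%R 0 = y s 2%R 0 * y t 1 0,
   y s 2%R 0 * y t 0 0 = y s 0 0 * y t 2%R 0 & y s 0 0 * y t 1 0 = y s 1 0 * y t 0 0].
  by move=> tX; have [/subr0_eq -> /subr0_eq -> /subr0_eq ->] := c0 s t sX tX.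
have [e1|n1] := eqVneq (y s 1 0) 0.
  have [e0|n0] := eqVneq (y s 0 0) 0.
    exists 1, 0, 0; split; first by rewrite !xpair_eqE oner_eq0.
    move=> t tX; have [_ h _] := E t tX; rewrite e0 mul0r in h.
    move: p0; rewrite e1 e0 eqxx /= => n2; rewrite mul1r !mul0r !addr0.
    by apply/eqP; move/eqP: h; rewrite mulf_eq0 (negPf n2).
  exists 0, 1, 0; split; first by rewrite !xpair_eqE oner_eq0 /= andbF.
  move=> t tX; have [_ _ h] := E t tX; rewrite e1 mul0r in h.
  rewrite mul1r !mul0r add0r addr0; apply/eqP; move/eqP: h.
  by rewrite mulf_eq0 (negPf n0).
exists (y s 1 0), (- y s 0 0), 0; split; first by rewrite !xpair_eqE negb_and negb_and n1.
by move=> t tX; have [_ _ h] := E t tX; rewrite mul0r addr0 mulNr h subrr.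
Qed.

Section Arithmetic.
Context (F : finFieldType) (k : fieldType) (L : fieldExtType k) (bar : 'AEnd(L)).
Context (i : {rmorphism F -> L}) (Q : place i) (B : set L) (d : nat).
Hypothesis ar : arithmetic bar Q B d.
Local Notation M := 'M[L]_3.
Local Notation q := #|F|.

Let barK : involutive bar. Proof. exact: ar_barK ar. Qed.
Let Qbar x : Q (bar x) = Q x. Proof. exact: (ar_val_bar ar). Qed.

Lemma ring0 : B 0. Proof. by rewrite -(rmorph0 i); exact: (ar_const ar 0). Qed.
Lemma ring1 : B 1. Proof. by rewrite -(rmorph1 i); exact: (ar_const ar 1). Qed.
Lemma ringB x y : B x -> B y -> B (x - y). Proof. exact: (ar_sub ar). Qed.
Lemma ringN x : B x -> B (- x). Proof. by rewrite -sub0r; apply: ringB ring0. Qed.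
Lemma ringD x y : B x -> B y -> B (x + y).
Proof. by move=> hx hy; rewrite -[y]opprK; apply/ringB/ringN. Qed.
Lemma ringM x y : B x -> B y -> B (x * y). Proof. exact: (ar_mul ar). Qed.
Lemma ring_bar x : B x -> B (bar x). Proof. exact: (ar_bar ar). Qed.
Lemma ring_sum (I : Type) (r : seq I) (f : I -> L) :
  (forall a, B (f a)) -> B (\sum_(a <- r) f a).
Proof. by move=> h; elim/big_ind: _ => // [|x y]; [exact: ring0 | exact: ringD]. Qed.
Lemma ring_half : B 2^-1.
Proof.
have -> : 2^-1 = i (2^-1) :> L by rewrite fmorphV rmorph_nat.
exact: (ar_const ar _).
Qed.

Lemma ring_nozero x (n : int) : 0 < n -> B x -> pge Q x n -> x = 0.
Proof.
move=> n0 Bx [//|h]; have [//|x0] := eqVneq x 0.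
have h1 : n <= Q x := h; have h2 : Q x <= 0 := ar_nozero ar Bx x0.
by move: h1 h2 n0; clear; lia.
Qed.

Lemma card_q : (1 < q)%N. Proof. exact: finNzRing_gt1. Qed.
Lemma deg_gt0 : (0 < d)%N. Proof. by case: (ar_degree ar). Qed.

(** An upper bound of Riemann-Roch type: two elements with the same m + 1 digits from order -m on
    differ by an element of B with a zero at Q. *)
Lemma ring_code (m : nat) : exists dl : L -> 'M[F]_(m.+1, d), forall x y, B x -> B y ->
  pge Q x (- m%:Z) -> pge Q y (- m%:Z) -> dl x = dl y -> x = y.
Proof.
have [_ h _] := ar_degree ar; have [dl hdl] := h (- m%:Z) m.+1.
exists dl => x y Bx By hx hy e; apply/eqP; rewrite -subr_eq0; apply/eqP.
apply: (@ring_nozero _ 1); [by [] | exact: ringB | ].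
by have := hdl _ _ hx hy e; congr (pge Q _ _); lia.
Qed.

(** The number of classes modulo D is bounded in terms of m alone. For incongruent t_a, the elements
    [t_a + D b_s], with b_s from [ar_many], are distinct and have poles of order at most N + C + m,
    of which [ring_code] allows few; the factor depending on N cancels. *)
Lemma residues (m : nat) : exists n (r : L -> L -> 'I_n.+1), forall D x y,
  D != 0 -> pge Q D (- m%:Z) -> B D -> B x -> B y -> r D x = r D y ->
  exists2 c, B c & x - y = D * c.
Proof.
have [C hC] := ar_many ar.
pose cong D x y := exists2 c, B c & x - y = D * c.
have bound D n (t : 'I_n -> L) : D != 0 -> pge Q D (- m%:Z) -> B D ->
    (forall a, B (t a)) -> (forall a b, cong D (t a) (t b) -> a = b) ->
    (n <= q ^ ((C + m).+1 * d))%N.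
  move=> D0 hD BD Bt it.
  have [N hN] : exists N : nat, forall a, pge Q (t a) (- (N + C + m)%N%:Z).
    exists (\sum_a `|Q (t a)|)%N => a; right; rewrite (bigD1 a) //=; move: (\sum_(_ | _) _)%N => s.
    by clear; lia.
  have [S [b [ib cb hb]]] := hC N.
  have [dl hdl] := ring_code (N + C + m).
  pose f (p : 'I_n * S) := t p.1 + D * b p.2.
  have Bf p : B (f p) by apply: ringD (ringM _ _) => //; case: (hb p.2).
  have Pf p : pge Q (f p) (- (N + C + m)%N%:Z).
    apply: pgeD => //; have [_ h] := hb p.2; have := pgeM hD h; apply: pge_le; clear; lia.
  have fi : injective f.
    move=> [a s] [a' s'] e; have ea : a = a'.
      apply: it; exists (b s' - b s); first by apply: ringB; case: (hb s) (hb s') => ? _ [].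
      rewrite /f /= in e; rewrite mulrBr; apply/eqP; rewrite subr_eq -addrA addrC -addrA.
      by rewrite [- _ + _]addrC -e addrK.
    by move: e; rewrite /f ea /= => /addrI /(mulfI D0)/ib ->.
  have inj : injective (dl \o f) by move=> p p' e; apply: fi; apply: hdl e.
  have := leq_card _ inj; rewrite card_prod card_ord card_mx => h.
  have : (n * q ^ (d * N) <= q ^ ((C + m).+1 * d) * q ^ (d * N))%N.
    rewrite -expnD (leq_trans _ (leq_trans h _)) //; first by rewrite leq_mul2l cb orbT.
    by rewrite leq_pexp2l ?(ltnW card_q) //; nia.
  by rewrite leq_pmul2r // expn_gt0 (ltnW card_q).
set K := (q ^ _)%N in bound; exists K.
suff H D : exists r : L -> 'I_K.+1, forall x y, D != 0 -> pge Q D (- m%:Z) -> B D ->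
    B x -> B y -> r x = r y -> cong D x y.
  by have /choice[r hr] := H; exists r => D x y *; apply: (hr D).
have [[D0 [hD BD]]|no] := pselect (D != 0 /\ pge Q D (- m%:Z) /\ B D); last first.
  by exists (fun _ => ord0) => *; case: no.
pose fam n := exists t : 'I_n -> L, (forall a, B (t a)) /\ forall a b, cong D (t a) (t b) -> a = b.
have f0 : exists n, `[< fam n >].
  by exists 0%N; apply/asboolP; exists (fun _ => 0); split=> [|[]//] a; apply: ring0.
have fK n : `[< fam n >] -> (n <= K)%N by move=> /asboolP[t [h1 h2]]; apply: bound h2.
case: (ex_maxnP f0 fK) => n /asboolP[t [Bt it]] nmax.
have sym x y : cong D x y -> cong D y x.
  by move=> [c Bc e]; exists (- c); [exact: ringN | rewrite mulrN -e opprB].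
have tr x y z : cong D x y -> cong D y z -> cong D x z.
  move=> [c Bc e] [c' Bc' e']; exists (c + c'); first exact: ringD.
  by rewrite mulrDr -e -e' addrA subrK.
have rep x : B x -> exists a, cong D x (t a).
  move=> Bx; apply: contrapT => nx; have := nmax n.+1; rewrite ltnn => /(_ _)/notF; apply.
  apply/asboolP; exists (fun a => if unlift ord0 a is Some b then t b else x); split=> [a|a b].
    by case: unliftP => [b _|_].
  case: unliftP => [a' ->|->]; case: unliftP => [b' ->|->] //.
  - by move=> /it ->.
  - by move=> /sym h; case: nx; exists a'.
  - by move=> h; case: nx; exists b'.
have nK : (n <= K)%N by apply: fK; apply/asboolP; exists t.
have /choice[r hr] : forall x, exists a : 'I_K.+1, B x -> exists b : 'I_n, val a = val b /\ cong D x (t b).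
  move=> x; have [Bx|nB] := pselect (B x); last by exists ord0.
  have [b hb] := rep x Bx; exists (widen_ord (leqW nK) b) => _; by exists b.
exists r => x y _ _ _ Bx By e; have [a [ea ha]] := hr _ Bx; have [b [eb hb]] := hr _ By.
have ab : a = b by apply: val_inj; rewrite -ea -eb e.
by rewrite -ab in hb; apply: tr ha (sym _ _ hb).
Qed.

Lemma narrow (S : finType) (X : {set S}) (f : S -> L) (a : int) (n r : nat) :
  (forall s t, s \in X -> t \in X -> pge Q (f s - f t) a) ->
  (q ^ (d * n) * r < #|X|)%N ->
  exists Y : {set S}, [/\ Y \subset X, (r < #|Y|)%N &
    forall s t, s \in Y -> t \in Y -> pge Q (f s - f t) (a + n%:Z)].
Proof.
move=> hX lt; have /card_gt0P[s0 s0X] : (0 < #|X|)%N by apply: leq_ltn_trans lt.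
have [_ h _] := ar_degree ar; have [dl hdl] := h a n.
have lt' : (#|{: 'M[F]_(n, d)}| * r < #|X|)%N by rewrite card_mx mulnC [(n * d)%N]mulnC mulnC.
have [Y [YX rY hY]] := @large_fiber _ _ X (fun s => dl (f s - f s0)) r lt'.
exists Y; split=> // s t sY tY; have sX := fintype.subsetP YX _ sY; have tX := fintype.subsetP YX _ tY.
have := hdl _ _ (hX _ _ sX s0X) (hX _ _ tX s0X) (hY _ _ sY tY).
by congr (pge Q _ _); rewrite opprB addrA subrK.
Qed.

Hypothesis two : (2 : L) != 0.

(** As 2 is invertible, an element is determined by its symmetric and skew parts, so one of them
    takes at least the square root of the number of values; this is why 2N appears for 2^N elements.
    A skew factor y turns symmetric elements into skew ones. *)
Lemma skew_many : exists C : nat, forall N : nat, exists w : seq L,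
  [/\ uniq w, (2 ^ N <= size w)%N &
      forall x, x \in w -> [/\ B x, x + bar x = 0 & pge Q x (- (2 * N + C)%N%:Z)]].
Proof.
have [C hC] := ar_many ar; have [y [By y0 sy]] := ar_skew ar.
exists (C + `|Q y|)%N => N; have [S [b [ib cb hb]]] := hC (2 * N)%N.
pose t1 s : L := y * (b s + bar (b s)); pose t2 s : L := b s - bar (b s).
have ht : injective (fun s => (t1 s, t2 s)).
  move=> s s' [/(mulfI y0) e1 e2]; apply: ib; apply: (mulfI two).
  have E x : 2 * x = (x + bar x) + (x - bar x) by ring.
  by rewrite !E e1 -/(t2 s) e2.
have byb : bar y = - y by apply/eqP; rewrite -addr_eq0 addrC sy.
have pb s : pge Q (bar (b s)) (- (2 * N + C)%N%:Z).
  by case: (hb s) => _ [->|h]; [rewrite rmorph0; left | right; rewrite Qbar].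
pose w1 : seq L := undup (map t1 (enum S)); pose w2 : seq L := undup (map t2 (enum S)).
have le : ((2 ^ N) ^ 2 <= size w1 * size w2)%N.
  have := @uniq_leq_size _ (map (fun s => (t1 s, t2 s)) (enum S)) (allpairs pair w1 w2).
  rewrite map_inj_uniq // enum_uniq size_map size_allpairs -cardE => /(_ isT) h.
  apply: leq_trans (h _) => [|_ /mapP[s sS ->]].
    apply: leq_trans cb; rewrite -expnM mulnC.
    apply: leq_trans (leq_pexp2l _ (leq_pmull _ deg_gt0)); last by rewrite ltnW ?card_q.
    by case: (2 * N)%N => // n; rewrite leq_exp2r ?card_q.
  by apply/allpairsP; exists (t1 s, t2 s); rewrite !mem_undup; split=> //; apply: map_f.
have [h|h] : (2 ^ N <= size w1)%N \/ (2 ^ N <= size w2)%N.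
  have [|l1] := leqP (2 ^ N) (size w1); [by left | have [|l2] := leqP (2 ^ N) (size w2); first by right].
  by have := leq_ltn_trans le (ltn_mul l1 l2); rewrite mulnn ltnn.
- exists w1; split; [exact: undup_uniq | by [] |] => x; rewrite mem_undup => /mapP[s _ ->].
  have [Bs ps] := hb s; split.
  + by apply/ringM/ringD/ring_bar.
  + by rewrite /t1 rmorphM rmorphD /= barK byb; ring.
  + have := pgeM (pge_refl Q y) (pgeD ps (pb s)); apply: pge_le.
    by clear; lia.
- exists w2; split; [exact: undup_uniq | by [] |] => x; rewrite mem_undup => /mapP[s _ ->].
  have [Bs ps] := hb s; split.
  + exact/ringB/ring_bar.
  + by rewrite /t2 rmorphB /= barK; ring.
  + have := pgeB ps (pb s); apply: pge_le; clear; lia.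
Qed.

End Arithmetic.

Section ShortVectors.
Context (F : finFieldType) (k : fieldType) (L : fieldExtType k) (bar : 'AEnd(L)).
Context (i : {rmorphism F -> L}) (Q : place i) (B : set L) (d : nat).
Hypothesis ar : arithmetic bar Q B d.
Local Notation M := 'M[L]_3.
Local Notation ua := (ua bar).
Local Notation Hset := (Hset bar).
Local Notation q := #|F|.
Local Notation hge := (hge Q).
Local Notation nball := (nball Q).

Let barK : involutive bar. Proof. exact: ar_barK ar. Qed.
Let Qbar x : Q (bar x) = Q x. Proof. exact: (ar_val_bar ar). Qed.

Let narrow_half (S : finType) (X : {set S}) (f : S -> L) (N C : nat) (w : int) r :
  (forall s t, s \in X -> t \in X -> hge (f s - f t) (- (2 * N%:Z) + w)) ->
  (q ^ (d * (N + C)) * r < #|X|)%N ->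
  exists Y : {set S}, [/\ Y \subset X, (r < #|Y|)%N &
    forall s t, s \in Y -> t \in Y -> hge (f s - f t) (2 * C%:Z + w)].
Proof.
move=> h lt; have [c [c1 c2]] := half_up w.
have [s t sX tX|Y [YX rY hY]] := narrow ar (f := f) (a := - N%:Z + c) _ lt.
  by case: (h s t sX tX) => [->|]; [left | right; lia].
exists Y; split=> // s t sY tY; case: (hY s t sY tY) => [->|]; first by left.
by move=> h1; right; have h2 : - N%:Z + c + (N + C)%N%:Z <= Q (f s - f t) := h1; lia.
Qed.

(** Comparison of two coefficients by weighted valuation, 0 having the largest; it selects the pivot
    in the equation of a plane. *)
Let dom (x : L) (wx : int) (y : L) (wy : int) : Prop :=
  y = 0 \/ x != 0 /\ 2 * Q x + wx <= 2 * Q y + wy.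

Let dom_total x wx y wy : dom x wx y wy \/ dom y wy x wx.
Proof.
have [->|x0] := eqVneq x 0; first by right; left.
have [->|y0] := eqVneq y 0; first by left; left.
have [h|h] : 2 * Q x + wx <= 2 * Q y + wy \/ 2 * Q y + wy <= 2 * Q x + wx by lia.
  by left; right.
by right; right.
Qed.

Let dom_trans x wx y wy z wz : dom x wx y wy -> dom y wy z wz -> dom x wx z wz.
Proof.
move=> h1 [->|[y0 h2]]; first by left.
case: h1 => [y0'|[x0 h1]]; first by rewrite y0' eqxx in y0.
by right; split=> //; lia.
Qed.

Let dom_hge (l m u : L) (a wl wm : int) :
  dom l wl m wm -> l != 0 -> hge u (a + wm) -> hge (m / l * u) (a + wl).
Proof.
move=> [->|[_ le]] l0 hu; first by left; rewrite !mul0r.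
have [->|m0] := eqVneq m 0; first by left; rewrite !mul0r.
have h3 : hge (m / l) (2 * Q m - 2 * Q l).
  by right; rewrite placeMl ?invr_eq0 // placeV // mulrDr mulrN.
by have := hgeM h3 hu; apply: hge_le; move: le; move: (Q m) (Q l); clear; lia.
Qed.

(** The pivot has minimal weighted valuation, so bounds on g and h pass to f through the equation:
    in a plane two pigeonholes suffice instead of three. *)
Let plane_bound1 (S : finType) (Y : {set S}) (f g h : S -> L) (l m n : L) (w1 w2 w3 : int) (N C : nat) :
  dom l w1 m w2 -> dom l w1 n w3 -> l != 0 ->
  (forall s t, s \in Y -> t \in Y ->
     [/\ hge (g s - g t) (- (2 * N%:Z) + w2), hge (h s - h t) (- (2 * N%:Z) + w3) &
       l * (f s - f t) + m * (g s - g t) + n * (h s - h t) = 0]) ->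
  (q ^ (d * (N + C)) * (q ^ (d * (N + C)) * 1) < #|Y|)%N ->
  exists s t, [/\ s \in Y, t \in Y, s != t & [/\ hge (f s - f t) (2 * C%:Z + w1),
    hge (g s - g t) (2 * C%:Z + w2) & hge (h s - h t) (2 * C%:Z + w3)]].
Proof.
move=> d2 d3 l0 hY lt.
have [s t sY tY|Y1 [Y1Y lt1 h1]] := narrow_half (f := g) (N := N) (w := w2) _ lt.
  by case: (hY s t sY tY).
have [s t sY tY|Y2 [Y2Y lt2 h2]] := narrow_half (f := h) (N := N) (w := w3) _ lt1.
  by case: (hY s t (fintype.subsetP Y1Y _ sY) (fintype.subsetP Y1Y _ tY)).
have [s [t [sY tY nst]]] : exists s t, [/\ s \in Y2, t \in Y2 & s != t].
  by move/card_gt1P: lt2 => [s [t [? ? ?]]]; exists s, t.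
have sY1 := fintype.subsetP Y2Y _ sY; have tY1 := fintype.subsetP Y2Y _ tY.
have sY0 := fintype.subsetP Y1Y _ sY1; have tY0 := fintype.subsetP Y1Y _ tY1.
exists s, t; split=> //; split; [| exact: h1 | exact: h2].
have [_ _ rel] := hY s t sY0 tY0.
have -> : f s - f t = - (m / l * (g s - g t) + n / l * (h s - h t)).
  apply: (mulfI l0); apply/eqP; rewrite -subr_eq0 -rel; apply/eqP; field.
  by [].
apply: hgeN; apply: hgeD.
  exact: dom_hge d2 l0 (h1 s t sY1 tY1).
exact: dom_hge d3 l0 (h2 s t sY tY).
Qed.

Let plane_bound (S : finType) (Y : {set S}) (f g h : S -> L) (l m n : L) (w1 w2 w3 : int) (N C : nat) :
  (l, m, n) != (0, 0, 0) ->
  (forall s t, s \in Y -> t \in Y ->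
     [/\ hge (f s - f t) (- (2 * N%:Z) + w1), hge (g s - g t) (- (2 * N%:Z) + w2),
        hge (h s - h t) (- (2 * N%:Z) + w3) &
       l * (f s - f t) + m * (g s - g t) + n * (h s - h t) = 0]) ->
  (q ^ (d * (N + C)) * (q ^ (d * (N + C)) * 1) < #|Y|)%N ->
  exists s t, [/\ s \in Y, t \in Y, s != t & [/\ hge (f s - f t) (2 * C%:Z + w1),
    hge (g s - g t) (2 * C%:Z + w2) & hge (h s - h t) (2 * C%:Z + w3)]].
Proof.
move=> nz hY lt.
have domN0 x wx y wy z wz : (x, y, z) != (0, 0, 0) -> dom x wx y wy -> dom x wx z wz -> x != 0.
  move=> nz3 h1 h2; apply: contraNneq nz3 => x0; move: h1 h2; rewrite /dom x0 eqxx.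
  by case=> [->|[]//]; case=> [->|[]//].
have c1 : dom l w1 m w2 -> dom l w1 n w3 -> exists s t, [/\ s \in Y, t \in Y, s != t &
    [/\ hge (f s - f t) (2 * C%:Z + w1),
    hge (g s - g t) (2 * C%:Z + w2) & hge (h s - h t) (2 * C%:Z + w3)]].
  move=> h1 h2; apply: (plane_bound1 h1 h2 (domN0 _ _ _ _ _ _ nz h1 h2) _ lt) => s t sY tY.
  by case: (hY s t sY tY).
have c2 : dom m w2 l w1 -> dom m w2 n w3 -> exists s t, [/\ s \in Y, t \in Y, s != t &
    [/\ hge (f s - f t) (2 * C%:Z + w1),
    hge (g s - g t) (2 * C%:Z + w2) & hge (h s - h t) (2 * C%:Z + w3)]].
  move=> h1 h2; have nz' : (m, l, n) != (0, 0, 0) by move: nz; rewrite !xpair_eqE [(l == 0) && _]andbC.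
  have [s t sY tY|s [t [? ? ? [? ? ?]]]] := plane_bound1 (f := g) (g := f) (h := h) h1 h2 (domN0 _ _ _ _ _ _ nz' h1 h2) _ lt.
    by case: (hY s t sY tY) => ? ? ? e; split=> //; rewrite -e; ring.
  by exists s, t.
have c3 : dom n w3 l w1 -> dom n w3 m w2 -> exists s t, [/\ s \in Y, t \in Y, s != t &
    [/\ hge (f s - f t) (2 * C%:Z + w1),
    hge (g s - g t) (2 * C%:Z + w2) & hge (h s - h t) (2 * C%:Z + w3)]].
  move=> h1 h2; have nz' : (n, l, m) != (0, 0, 0).
    by move: nz; rewrite !xpair_eqE; case: (l == 0); case: (m == 0); case: (n == 0).
  have [s t sY tY|s [t [? ? ? [? ? ?]]]] := plane_bound1 (f := h) (g := f) (h := g) h1 h2 (domN0 _ _ _ _ _ _ nz' h1 h2) _ lt.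
    by case: (hY s t sY tY) => ? ? ? e; split=> //; rewrite -e; ring.
  by exists s, t.
have [h12|h21] := dom_total l w1 m w2.
  have [h13|h31] := dom_total l w1 n w3; first exact: c1.
  by apply: c3 => //; apply: dom_trans h12.
have [h23|h32] := dom_total m w2 n w3; first exact: c2.
by apply: c3 => //; apply: dom_trans h21.
Qed.

Definition intv (s : 'cV[L]_3) : Prop := forall a, B (s a 0).

(** Narrowing three coordinates uses at most 3N' - 3N + 3C + 1 of 3N' digits, and a plane then
    allows only 2(N + C') more; this N is the least with 3N - 3C - 1 > 2(N + C'). *)
Let shortC (C C' : nat) := (3 * C + 2 * C' + 2)%N.

(* In a large ball there are too many integral vectors for them to lie in a
   plane. *)
Lemma short_basis (C' : nat) : exists N : nat, forall z j, Hset z ->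
  (forall s, intv s -> s != 0 -> ~ nball j (2 * C'%:Z) ((ua z)^-1 *m s)) ->
  exists S : M, [/\ forall a b, B (S a b), \det S != 0 &
    forall b, nball j (- (2 * N%:Z)) ((ua z)^-1 *m col b S)].
Proof.
have [C hC] := ar_many ar; exists (shortC C C') => z j hz shallow; set N := shortC C C'.
have [z' ez] : exists z', (ua z)^-1 = ua z' by rewrite uaV; eexists.
rewrite ez in shallow *; case: z' ez shallow => u v ez shallow.
have [c2 [c2l c2r]] := half_up j; have [c0 [c0l c0r]] := half_up (- j).
(* Large enough for the three digit counts below to be natural numbers and for the shifts by u and v
   not to enlarge the poles. *)
pose N' := (N + `|c2| + `|c0| + 2 * `|Q u| + `|Q v|)%N.
have [S [b [ib cb hb]]] := hC N'.
pose x (s : S * S * S) := col3 (b s.1.1) (b s.1.2) (b s.2).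
pose y s := ua (u, v) *m x s.
have yE s : y s = col3 (b s.1.1 - bar u * b s.1.2 + v * b s.2) (b s.1.2 + u * b s.2) (b s.2).
  by rewrite /y /x ua_col3.
have [n2 e2] : exists n2 : nat, n2%:Z = - N%:Z + c2 + (N' + C)%N%:Z.
  by exists (absz (- N%:Z + c2 + (N' + C)%N%:Z)); rewrite /N'; clear; lia.
have [n1 e1] : exists n1 : nat, n1%:Z = - N%:Z + (N' + C)%N%:Z.
  by exists (absz (- N%:Z + (N' + C)%N%:Z)); rewrite /N'; clear; lia.
have [n0 e0] : exists n0 : nat, n0%:Z = - N%:Z + c0 + (N' + C)%N%:Z.
  by exists (absz (- N%:Z + c0 + (N' + C)%N%:Z)); rewrite /N'; clear; lia.
pose r := (q ^ (d * (N + C')) * (q ^ (d * (N + C')) * 1))%N.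
have q1 := card_q F; have d1 := deg_gt0 ar.
have lt : (q ^ (d * n2) * (q ^ (d * n1) * (q ^ (d * n0) * r)) < #|(finset.setT : {set S * S * S})|)%N.
  rewrite cardsT !card_prod.
  apply: (@leq_trans (q ^ (d * N') * q ^ (d * N') * q ^ (d * N'))); last by rewrite !leq_mul.
  rewrite /r muln1 -!expnD ltn_exp2l // -!mulnDr ltn_pmul2l //.
  move: e2 e1 e0 c2l c2r c0l c0r; rewrite /N /shortC; clear; lia.
have pd s t : [/\ pge Q (b s.1.1 - b t.1.1) (- (N' + C)%N%:Z),
    pge Q (b s.1.2 - b t.1.2) (- (N' + C)%N%:Z) & pge Q (b s.2 - b t.2) (- (N' + C)%N%:Z)].
  by split; apply: pgeB; [case: (hb s.1.1) | case: (hb t.1.1) | case: (hb s.1.2)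
    | case: (hb t.1.2) | case: (hb s.2) | case: (hb t.2)].
have [s t _ _|Y2 [_ lt2 h2]] := narrow ar (f := fun s => b s.2) (a := - (N' + C)%N%:Z) _ lt.
  by case: (pd s t).
have p2 s t : s \in Y2 -> t \in Y2 -> pge Q (b s.2 - b t.2) (- N%:Z + c2).
  by move=> sY tY; have := h2 s t sY tY; apply: pge_le; move: e2; clear; lia.
have [s t sY tY|Y1 [Y12 lt1 h1]] := narrow ar (f := fun s => b s.1.2 + u * b s.2) (a := - (N' + C)%N%:Z) _ lt2.
  have -> : b s.1.2 + u * b s.2 - (b t.1.2 + u * b t.2) = (b s.1.2 - b t.1.2) + u * (b s.2 - b t.2).
    by ring.
  apply: pgeD; first by case: (pd s t).
  have := pgeM (pge_refl Q u) (p2 s t sY tY); apply: pge_le; rewrite /N'; clear; lia.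
have p1 s t : s \in Y1 -> t \in Y1 -> pge Q ((b s.1.2 - b t.1.2) + u * (b s.2 - b t.2)) (- N%:Z).
  move=> sY tY; have := h1 s t sY tY.
  have -> : b s.1.2 + u * b s.2 - (b t.1.2 + u * b t.2) = (b s.1.2 - b t.1.2) + u * (b s.2 - b t.2).
    by ring.
  by apply: pge_le; move: e1; clear; lia.
have [s t sY tY|Y0 [Y01 lt0 h0]] := narrow ar
    (f := fun s => b s.1.1 - bar u * b s.1.2 + v * b s.2) (a := - (N' + C)%N%:Z) _ lt1.
  have sY2 := fintype.subsetP Y12 _ sY; have tY2 := fintype.subsetP Y12 _ tY.
  have -> : b s.1.1 - bar u * b s.1.2 + v * b s.2 - (b t.1.1 - bar u * b t.1.2 + v * b t.2)
     = (b s.1.1 - b t.1.1) + - (bar u * ((b s.1.2 - b t.1.2) + u * (b s.2 - b t.2)))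
       + bar u * u * (b s.2 - b t.2) + v * (b s.2 - b t.2) by ring.
  apply: pgeD; [apply: pgeD; [apply: pgeD|]|].
  - by case: (pd s t).
  - have := pgeM (pge_refl Q (bar u)) (p1 s t sY tY); rewrite Qbar => /pgeN; apply: pge_le.
    by rewrite /N'; clear; lia.
  - have := pgeM (pgeM (pge_refl Q (bar u)) (pge_refl Q u)) (p2 s t sY2 tY2).
    by rewrite Qbar; apply: pge_le; rewrite /N'; clear; lia.
  - have := pgeM (pge_refl Q v) (p2 s t sY2 tY2); apply: pge_le; rewrite /N'; clear; lia.
have Y02 s : s \in Y0 -> s \in Y1 /\ s \in Y2.
  move=> sY; have sY1 := fintype.subsetP Y01 _ sY.
  by split=> //; apply: (fintype.subsetP Y12).
have yd s t : y s - y t = ua (u, v) *m (x s - x t) by rewrite mulmxBr.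
have ydE s t : y s - y t = col3 (b s.1.1 - bar u * b s.1.2 + v * b s.2 - (b t.1.1 - bar u * b t.1.2 + v * b t.2))
    (b s.1.2 + u * b s.2 - (b t.1.2 + u * b t.2)) (b s.2 - b t.2).
  by rewrite !yE col3B.
have ball s t : s \in Y0 -> t \in Y0 -> nball j (- (2 * N%:Z)) (y s - y t).
  move=> sY tY; have [sY1 sY2] := Y02 s sY; have [tY1 tY2] := Y02 t tY.
  rewrite ydE nball3; split.
  - by apply: (pge_hge _ (h0 s t sY tY)); move: e0 c0l; clear; lia.
  - by apply: (pge_hge _ (h1 s t sY1 tY1)); move: e1; clear; lia.
  - by apply: (pge_hge _ (h2 s t sY2 tY2)); move: e2 c2l; clear; lia.
have ix : injective x.
  by move=> [[s1 s2] s3] [[t1 t2] t3] /col3_inj[/ib /= -> /ib /= -> /ib /= ->].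
have ixd s t : intv (x s - x t).
  have Bb s' : B (b s') by case: (hb s').
  by move=> [[|[|[|a]]] //= ha]; rewrite /x col3B mxE /=; apply: (ringB ar).
have [t0 t0Y] : exists t, t \in Y0 by apply/card_gt0P; apply: leq_ltn_trans lt0.
have [[l [m [n [nz rel]]]]|[s1 [s2 [s3 [sY1 sY2 sY3 dn]]]]] := nonplanar Y0 (fun s => y s - y t0).
  have [s t sY tY|s [t [sY tY nst [b1 b2 b3]]]] :=
      plane_bound (Y := Y0) (f := fun s => y s 0 0) (g := fun s => y s 1 0) (h := fun s => y s 2%R 0)
      (w1 := - j) (w2 := 0) (w3 := j) (N := N) nz _ lt0.
    have [b1 b2 b3] := ball s t sY tY.
    have E a : (y s - y t) a 0 = y s a 0 - y t a 0 by rewrite !mxE.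
    rewrite !E in b1 b2 b3; split=> //; first by rewrite addr0.
    have := rel s sY; have := rel t tY.
    have E0 s' a : (y s' - y t0) a 0 = y s' a 0 - y t0 a 0 by rewrite !mxE.
    rewrite !E0 => r1 r2; rewrite -[RHS](subrr 0) -{1}r2 -r1; ring.
  case: (shallow (x s - x t)); first exact: ixd.
    by rewrite subr_eq0 (inj_eq ix).
  have E a : (y s - y t) a 0 = y s a 0 - y t a 0 by rewrite !mxE.
  by rewrite -yd; split; rewrite E // -[2 * _]addr0.
pose sl (c : 'I_3) := nth s1 [:: s1; s2; s3] c.
have slY c : sl c \in Y0 by case: c => -[|[|[|c]]].
exists (\matrix_(a, c) (x (sl c) - x t0) a 0).
have colE c : col c (\matrix_(a, c) (x (sl c) - x t0) a 0) = x (sl c) - x t0.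
  by apply/colP => a; rewrite mxE [LHS]mxE.
split.
- by move=> a c; rewrite mxE; apply: ixd.
- apply: contraNneq dn => d0.
  have -> : \matrix_(a, c) (nth (y s1 - y t0) [:: y s1 - y t0; y s2 - y t0; y s3 - y t0] c) a 0 =
     ua (u, v) *m (\matrix_(a, c) (x (sl c) - x t0) a 0).
    apply/matrixP => a c; transitivity ((y (sl c) - y t0) a 0).
      by rewrite [LHS]mxE; case: c => -[|[|[|c]]].
    rewrite yd -colE [LHS]mxE [RHS]mxE; apply: eq_bigr => b' _.
    by congr (_ * _); rewrite [LHS]mxE.
  by rewrite det_mulmx d0 mulr0.
- by move=> c; rewrite colE -yd; apply: ball.
Qed.

End ShortVectors.

(** * Parents and balls *)

Section Parents.
Context (F k : fieldType) (L : fieldExtType k) (bar : 'AEnd(L)).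
Context (i : {rmorphism F -> L}) (Q : place i).
Context (R : realType) (nuP : L -> R) (e : nat).
Hypotheses (barK : involutive bar) (Qbar : forall x, Q (bar x) = Q x).
Hypotheses (e0 : (0 < e)%N) (nuE : forall x, nuP x = (Q x)%:~R / e%:R).
Local Notation M := 'M[L]_3.
Local Notation vertex := (set (M * R)).
Implicit Types (z : L * L) (g h : M) (j m n : int) (v w : vertex) (x y : 'cV[L]_3).
Local Notation ua := (ua bar).
Local Notation ta := (ta bar).
Local Notation smat := (smat L).
Local Notation SU := (SU bar).
Local Notation Hset := (Hset bar).
Local Notation herm := (herm bar).
Local Notation pt := (pt bar nuP e).
Local Notation X := (vertices bar nuP).
Local Notation ptP := (ptP barK Qbar e0 nuE).
Local Notation pt_uaP := (pt_uaP barK Qbar e0 nuE).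
Local Notation vertexP := (vertexP barK Qbar e0 nuE).
Local Notation pt_ua_ex := (pt_ua_ex barK Qbar e0 nuE).
Local Notation move_pt := (move_pt barK Qbar e0 nuE).
Local Notation hge := (hge Q).
Local Notation nball := (nball Q).
Local Notation gball := (gball Q).
Local Notation E0 := (col3 (1 : L) 0 0).

Lemma move_vertex g v : SU g -> X v -> X (move_v g v).
Proof.
move=> sg /vertexP[z [j [hz ->]]]; rewrite move_pt //; last exact: SU_ua.
by apply: (vertex_pt e0 nuE); apply: SU_mul => //; apply: SU_ua.
Qed.

Lemma moveK g v : SU g -> move_v g^-1 (move_v g v) = v.
Proof. by move=> sg; rewrite -moveM mulVr ?move1 // (SU_unit sg). Qed.

Lemma moveVK g v : SU g -> move_v g (move_v g^-1 v) = v.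
Proof. by move=> sg; rewrite -moveM mulrV ?move1 // (SU_unit sg). Qed.

(** The tree is a union of lines with a common end; these are the line z and the height j of v,
    where z is determined only up to the condition in [pt_uaP]. *)
Definition coord v : L * L * int := xget ((0, 0), 0) [set c | Hset c.1 /\ v = pt (ua c.1) c.2].

Lemma coordP v : X v -> Hset (coord v).1 /\ v = pt (ua (coord v).1) (coord v).2.
Proof.
move=> /vertexP[z [j [hz ->]]].
by apply: (@xgetPex _ ((0, 0), 0) [set c | Hset c.1 /\ _ = pt (ua c.1) c.2]); exists (z, j).
Qed.

Lemma coord_pt z j : Hset z ->
  (coord (pt (ua z) j)).2 = j /\ pge Q (zdiff bar z (coord (pt (ua z) j)).1).2 (- j).
Proof.
move=> hz; have Xz : X (pt (ua z) j) by apply/vertexP; exists z, j.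
by have [hc ec] := coordP Xz; have [<- ?] := (pt_uaP _ _ hz hc).1 ec.
Qed.

(** A Busemann function for the end fixed by the upper triangular matrices. *)
Definition ht v : int := (coord v).2.

(* The neighbour of v on the ray towards the fixed point of the upper triangular
   matrices. *)
Definition par0 v : vertex := pt (ua (coord v).1) ((coord v).2 + 1).

Lemma ht_pt z j : Hset z -> ht (pt (ua z) j) = j.
Proof. by move=> hz; case: (coord_pt j hz). Qed.

Lemma par0_pt z j : Hset z -> par0 (pt (ua z) j) = pt (ua z) (j + 1).
Proof.
move=> hz; have [e1 hd] := coord_pt j hz; rewrite /par0 e1.
have Xz : X (pt (ua z) j) by apply/vertexP; exists z, j.
have [hc _] := coordP Xz; apply/esym/(pt_uaP _ _ hz hc).2; split=> //.
by apply: pge_le hd; clear; lia.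
Qed.

Lemma par0X v : X v -> X (par0 v).
Proof. by move=> /vertexP[z [j [hz ->]]]; rewrite par0_pt //; apply/vertexP; exists z, (j + 1). Qed.

Lemma ht_par0 v : X v -> ht (par0 v) = ht v + 1.
Proof. by move=> /vertexP[z [j [hz ->]]]; rewrite par0_pt // !ht_pt. Qed.

Lemma iter_par0 z j (n : nat) : Hset z -> iter n par0 (pt (ua z) j) = pt (ua z) (j + n%:Z).
Proof.
move=> hz; elim: n => [|n IH] /=; first by rewrite addr0.
by rewrite IH par0_pt //; congr pt; lia.
Qed.

(** High enough on the two lines, the condition of [pt_uaP] on [zdiff] holds. *)
Lemma merge0 v w : X v -> X w -> exists n m : nat, iter n par0 v = iter m par0 w.
Proof.
move=> /vertexP[z [j [hz ->]]] /vertexP[z' [j' [hz' ->]]].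
pose N := (`|j| + `|j'| + `|Q (zdiff bar z z').2|)%N.
exists (absz (N%:Z - j)), (absz (N%:Z - j')); rewrite !iter_par0 //.
apply/(pt_uaP _ _ hz hz'); split; first by rewrite /N; lia.
by right; rewrite /N; lia.
Qed.

Lemma pt_ta g j t : SU g -> t != 0 -> pt (g * ta t) j = pt g (j - 2 * Q t).
Proof.
move=> sg t0; have st := SU_ta barK t0.
apply/(ptP _ _ (SU_mul sg st) sg) => m x; rewrite /gball invrM ?(SU_unit sg) ?(SU_unit st) //.
rewrite -mulmxA; set y := g^-1 *m x; split=> h.
  have := nball_ta Qbar t0 h.
  by rewrite (mulmxV3 _ st).
have t0' : t^-1 != 0 by rewrite invr_eq0.
have := nball_ta Qbar t0' h; rewrite -taV // placeV //.
by congr nball; lia.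
Qed.

(** Such a matrix is [ua w * ta t]: the first factor permutes the lines and keeps heights, the
    second one shifts heights by a constant, and both commute with one step up. *)
Lemma par0_borel b t v : SU b -> b *m E0 = t *: E0 -> X v ->
  par0 (move_v b v) = move_v b (par0 v).
Proof.
move=> sb eb /vertexP[z [j [hz ->]]]; have [w [hw t0 ->]] := SU_borel barK sb eb.
have sw := SU_ua barK hw; have st := SU_ta barK t0; have sz := SU_ua barK hz.
have swt := SU_mul sw st; have hz' := Hset_scale barK t0 hz; have hs := Hset_add barK hw hz'.
rewrite par0_pt // !move_pt //.
have E j' : pt (ua w * ta t * ua z) j' = pt (ua (zadd bar w (zscale bar t z))) (j' - 2 * Q t).
  by rewrite -mulrA ta_ua // mulrA ua_add pt_ta //; apply: SU_ua.
by rewrite !E par0_pt //; congr pt; lia.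
Qed.

Definition adj v w : Prop := [/\ X v, X w & w = par0 v \/ v = par0 w].

Lemma adjP v w : adj v w <-> exists z j, Hset z /\
  ((v = pt (ua z) j /\ w = pt (ua z) (j + 1)) \/ (w = pt (ua z) j /\ v = pt (ua z) (j + 1))).
Proof.
split=> [[Xv Xw [ew|ev]]|[z [j [hz h]]]].
- by have [hz ->] := coordP Xv; do 2 eexists; split; [exact: hz | left].
- by have [hz ->] := coordP Xw; do 2 eexists; split; [exact: hz | right].
have X1 j' : X (pt (ua z) j') by apply/vertexP; exists z, j'.
by case: h => -[-> ->]; split; [| | left; rewrite par0_pt | | | right; rewrite par0_pt].
Qed.

Lemma adj_sym v w : adj v w -> adj w v.
Proof. by case=> Xv Xw [|] h; split=> //; [right | left]. Qed.

Lemma adj_pt g j : SU g -> adj (pt g j) (pt g (j + 1)).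
Proof.
move=> sg; have [z [j' [d [hz hd -> ->]]]] := pt_ua_ex j sg.
apply/adjP; case: hd => ->; first by exists z, j'; split=> //; left.
by exists z, (j' - 1); split=> //; right; rewrite subrK.
Qed.

Lemma adj_move g v w : SU g -> adj v w -> adj (move_v g v) (move_v g w).
Proof.
move=> sg /adjP[z [j [hz h]]]; have sz := SU_ua barK hz.
have := adj_pt j (SU_mul sg sz) => h1.
by case: h => -[-> ->]; rewrite !move_pt //; apply: adj_sym.
Qed.

Lemma edge_adjP E : edges bar nuP E <-> exists v w, adj v w /\ E = [set v; w].
Proof.
split=> [/(edgeP barK Qbar e0 nuE)[z [j [hz ->]]]|[v [w [/adjP[z [j [hz h]]] ->]]]].
  do 2 eexists; split; last by [].
  by apply/adjP; exists z, j; split=> //; left.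
apply/(edgeP barK Qbar e0 nuE); exists z, j; split=> //.
by case: h => -[-> ->] //; rewrite setUC.
Qed.

Lemma adj_noinv g v w : SU g -> adj v w -> move_v g v = w -> False.
Proof.
move=> sg /adjP[z [j [hz h]]]; have sz := SU_ua barK hz.
by case: h => -[-> ->]; rewrite move_pt // => /(pt_parity barK Qbar e0 nuE sz)[c]; lia.
Qed.

(** One step towards the end given by the isotropic line of [h *m E0]; by [par_line] it depends on
    that line alone. *)
Definition par h v : vertex := move_v h (par0 (move_v h^-1 v)).

Lemma parX h v : SU h -> X v -> X (par h v).
Proof. by move=> sh Xv; apply: move_vertex => //; apply/par0X/move_vertex => //; apply: SU_inv. Qed.

Lemma par_line h h' t v : SU h -> SU h' -> h' *m E0 = t *: (h *m E0) -> X v -> par h' v = par h v.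
Proof.
move=> sh sh' el Xv; have shV := SU_inv sh; have shV' := SU_inv sh'.
have sb : SU (h^-1 * h') by apply: SU_mul.
have eb : (h^-1 * h') *m E0 = t *: E0.
  by rewrite -mulmxA el -scalemxAr (mulVmx3 _ sh).
have := par0_borel sb eb (move_vertex shV' Xv).
rewrite -moveM -mulrA (mulrV (SU_unit sh')) mulr1 => e1.
by rewrite /par e1 -moveM mulrA (mulrV (SU_unit sh)) mul1r.
Qed.

Lemma par_move g h v : SU g -> SU h -> move_v g (par h v) = par (g * h) (move_v g v).
Proof.
move=> sg sh; rewrite /par -!moveM invrM ?(SU_unit sg) ?(SU_unit sh) //.
by rewrite mulrVK ?(SU_unit sg).
Qed.

Lemma adj_par h v : SU h -> X v -> adj v (par h v).
Proof.
move=> sh Xv; have shV := SU_inv sh; rewrite -{1}(moveVK v sh).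
apply: adj_move => //; have Xv' := move_vertex shV Xv.
by split=> //; [exact: par0X | left].
Qed.

Lemma adj_parP h v w : SU h -> adj v w -> w = par h v \/ v = par h w.
Proof.
move=> sh vw; have shV := SU_inv sh; have [_ _] := adj_move shV vw.
by case=> h1; [left | right]; rewrite /par -h1 moveVK.
Qed.

Lemma iter_par h v (n : nat) : SU h -> iter n (par h) v = move_v h (iter n par0 (move_v h^-1 v)).
Proof. by move=> sh; elim: n => [|n IH] /=; rewrite ?moveVK // /par IH moveK. Qed.

Lemma merge_par h v w : SU h -> X v -> X w -> exists n m : nat, iter n (par h) v = iter m (par h) w.
Proof.
move=> sh Xv Xw; have shV := SU_inv sh.
have [n [m en]] := merge0 (move_vertex shV Xv) (move_vertex shV Xw).
by exists n, m; rewrite !iter_par // en.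
Qed.

Lemma par_no2 h v : SU h -> X v -> par h (par h v) = v -> False.
Proof.
move=> sh Xv; have shV := SU_inv sh; have Xv' := move_vertex shV Xv.
have := iter_par v 2 sh => /= -> e1.
have /= := ht_iter par0X ht_par0 2 Xv'.
have -> : par0 (par0 (move_v h^-1 v)) = move_v h^-1 v by rewrite -{2}e1 moveK.
by lia.
Qed.

Lemma tree_potential (V : zmodType) (t : vertex -> vertex -> V) :
  (forall v w, t w v = - t v w) ->
  exists tau : vertex -> V, forall v w, adj v w -> tau w - tau v = t v w.
Proof.
move=> ta; have [tau htau] := parent_potential par0X ht_par0 merge0 (fun v => t v (par0 v)).
exists tau => v w [Xv Xw [->|->]]; first exact: htau.
by rewrite ta -htau // opprB.
Qed.

Lemma tree_connected (V : Type) (tau : vertex -> V) :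
  (forall v w, adj v w -> tau v = tau w) -> forall v w, X v -> X w -> tau v = tau w.
Proof.
move=> h; apply: (parent_connected par0X merge0) => v Xv.
by apply: h; apply: adj_sym; split=> //; [exact: par0X | left].
Qed.

(** The ball in terms of the vertex alone; [vball_pt] shows that the representative does not
    matter. *)
Definition vball v m x : Prop := exists z j, [/\ Hset z, v = pt (ua z) j & gball (ua z) j m x].

Lemma vball_pt g j m x : SU g -> vball (pt g j) m x <-> gball g j m x.
Proof.
move=> sg; split=> [[z [j' [hz e1 hb]]]|hb].
  by apply/(((ptP _ _ sg (SU_ua barK hz)).1 e1) m x).
have [z [j' [d [hz _ e1 _]]]] := pt_ua_ex j sg; exists z, j'; split=> //.
by apply/(((ptP _ _ sg (SU_ua barK hz)).1 e1) m x).
Qed.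

Lemma vball_move g v m x : SU g -> X v -> vball (move_v g v) m (g *m x) <-> vball v m x.
Proof.
move=> sg /vertexP[z [j [hz ->]]]; have sz := SU_ua barK hz; have sgz := SU_mul sg sz.
rewrite move_pt // !vball_pt // /gball invrM ?(SU_unit sg) ?(SU_unit sz) //.
by rewrite -mulmxA (mulVmx3 _ sg).
Qed.

Lemma nball_le j m m' x : m' <= m -> nball j m x -> nball j m' x.
Proof. by move=> le [h1 h2 h3]; split; [move: h1 | move: h2 | move: h3]; apply: hge_le; lia. Qed.

Lemma vball_le v m m' x : m' <= m -> vball v m x -> vball v m' x.
Proof. by move=> le [z [j [hz -> hb]]]; exists z, j; split=> //; apply: nball_le hb. Qed.

Lemma vball_adj v w m x : adj v w -> vball v m x -> vball w (m - 1) x.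
Proof.
move=> /adjP[z [j [hz h]]]; have sz := SU_ua barK hz.
by case: h => -[-> ->]; rewrite !vball_pt // => -[h1 h2 h3]; split;
  [move: h1 | move: h2 | move: h3 | move: h1 | move: h2 | move: h3]; apply: hge_le; lia.
Qed.

Lemma vballD v m x y : vball v m x -> vball v m y -> vball v m (x + y).
Proof.
move=> [z [j [hz -> h1]]]; have sz := SU_ua barK hz; rewrite !vball_pt // => h2.
by move: h1 h2; rewrite /gball mulmxDr => -[a1 a2 a3] [b1 b2 b3]; split; rewrite mxE; apply: hgeD.
Qed.

Lemma vballZ v m a c x : hge c a -> vball v m x -> vball v (m + a) (c *: x).
Proof.
move=> hc [z [j [hz -> h1]]]; have sz := SU_ua barK hz; rewrite vball_pt //.
move: h1; rewrite /gball -scalemxAr => -[a1 a2 a3]; split; rewrite mxE;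
  [have := hgeM hc a1 | have := hgeM hc a2 | have := hgeM hc a3]; apply: hge_le; lia.
Qed.

Lemma herm_SU g x y : SU g -> herm (g *m x) (g *m y) = herm x y.
Proof. by case. Qed.

(** The form h pairs coordinates whose weights -j and j cancel. *)
Lemma herm_vball v m n x y : vball v m x -> vball v n y -> hge (herm x y) (m + n).
Proof.
move=> [z [j [hz -> h1]]]; have sz := SU_ua barK hz; rewrite vball_pt // => h2.
move: h1 h2; rewrite /gball -(herm_SU _ _ (SU_inv sz)).
move: (_ *m x) (_ *m y) => {}x {}y [a1 a2 a3] [b1 b2 b3]; rewrite /herm.
apply: hgeD; [apply: hgeD|].
- by have := hgeM a1 (hge_bar Qbar b3); apply: hge_le; lia.
- by have := hgeM a2 (hge_bar Qbar b2); apply: hge_le; lia.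
- by have := hgeM a3 (hge_bar Qbar b1); apply: hge_le; lia.
Qed.

Lemma vball_ex v x : X v -> exists m, vball v m x.
Proof.
move=> /vertexP[z [j [hz ->]]]; have sz := SU_ua barK hz; pose y := (ua z)^-1 *m x.
rewrite /vball; pose a : int := Q (y 0 0); pose b : int := Q (y 1 0); pose c : int := Q (y 2%R 0).
exists (- (`|j| + 2 * `|a| + 2 * `|b| + 2 * `|c|)%N%:Z); apply/vball_pt => //.
by rewrite /gball -/y; split; right; rewrite -?/a -?/b -?/c; lia.
Qed.

Lemma vball_line0 v m : X v -> vball v m E0 <-> m <= ht v.
Proof.
move=> /vertexP[z [j [hz ->]]]; have sz := SU_ua barK hz.
by rewrite vball_pt // /gball uaV_e0 // nball_e0 ht_pt.
Qed.

(** For the standard line, membership of its vector in the balls is measured by the height, which a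
    step towards the end raises by exactly one. *)
Lemma vball_par h v m : SU h -> X v -> vball (par h v) (m + 1) (h *m E0) <-> vball v m (h *m E0).
Proof.
move=> sh Xv; have shV := SU_inv sh; have Xv' := move_vertex shV Xv.
rewrite /par (vball_move _ _ sh (par0X Xv')) (vball_line0 _ (par0X Xv')) ht_par0 //.
rewrite -{2}(moveVK v sh) (vball_move _ _ sh Xv') (vball_line0 _ Xv').
by split; lia.
Qed.

Lemma par_surj h v : SU h -> X v -> exists2 w, X w & v = par h w.
Proof.
move=> sh Xv; have shV := SU_inv sh; have /vertexP[z [j [hz e1]]] := move_vertex shV Xv.
have sz := SU_ua barK hz; have Xz : X (pt (ua z) (j - 1)) by apply/vertexP; exists z, (j - 1).
exists (move_v h (pt (ua z) (j - 1))); first exact: move_vertex.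
by rewrite /par moveK // par0_pt // subrK -e1 moveVK.
Qed.

Lemma isotropic_line x : x != 0 -> herm x x = 0 -> exists h t, [/\ SU h, t != 0 & x = t *: (h *m E0)].
Proof.
have [a [b [c ->]]] := col3_ex x; have [->|c0] := eqVneq c 0.
  move=> x0 hx; have := isotropic_last0 hx; rewrite !col3E => /(_ erefl) ex.
  exists 1, a; split; [exact: SU1 | | by rewrite mul1mx].
  by apply: contraNneq x0 => a0; rewrite ex a0 scale0r.
move=> _; rewrite herm3 => hx; pose z := (b / c, a / c).
have bc : bar c != 0 by rewrite fmorph_eq0.
have barV (y : L) : bar y^-1 = (bar y)^-1 by exact: fmorphV.
have hz : Hset z.
  apply/HsetE; rewrite !rmorphM /= !barV.
  apply: (mulfI (mulf_neq0 c0 bc)); rewrite mulr0 -[RHS]hx; field3.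
exists (ua z * smat), (- c); split; first by apply: SU_mul (SU_smat bar); exact: SU_ua.
  by rewrite oppr_eq0.
rewrite -mulmxA smat_col3 ua_col3 !oppr0 !mulr0 subr0 add0r !mulrN1.
by apply/colP => -[[|[|[|n]]] //= hn]; rewrite !mxE /=; field.
Qed.

End Parents.

(** * Unipotent elements *)

Section Unipotents.
Context (k : fieldType) (L : fieldExtType k) (bar : 'AEnd(L)) (p : nat).
Hypotheses (barK : involutive bar) (pL : p \in [pchar L]) (p2 : (2 < p)%N).
Local Notation M := 'M[L]_3.
Implicit Types (z : L * L) (g h : M) (x y : 'cV[L]_3).
Local Notation ua := (ua bar).
Local Notation SU := (SU bar).
Local Notation Hset := (Hset bar).
Local Notation herm := (herm bar).
Local Notation E0 := (col3 (1 : L) 0 0).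

Definition isofix g x : Prop := [/\ x != 0, herm x x = 0 & g *m x = x].

(** The group is transitive on isotropic lines, so x may be taken on the standard one; the
    eigenvalue 1 then leaves only [ua z] in [SU_borel]. *)
Lemma isofix_model g x : SU g -> isofix g x -> exists h z t,
  [/\ SU h, Hset z, t != 0, x = t *: (h *m E0) & g = h * ua z * h^-1].
Proof.
move=> sg [x0 hx gx]; have [h [t [sh t0 ex]]] := isotropic_line barK x0 hx.
have shV := SU_inv sh; have sb : SU (h^-1 * g * h) by do 2?apply: SU_mul.
have eb : (h^-1 * g * h) *m E0 = 1 *: E0.
  rewrite scale1r -mulmxA -[h *m E0](scalerK t0) -ex -mulmxA -scalemxAr gx.
  by rewrite ex scalerK // (mulVmx3 _ sh).
have [z [hz _]] := SU_borel barK sb eb; rewrite ta1 mulr1 => e1.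
exists h, z, t; split=> //; rewrite -e1 !mulrA (mulrV (SU_unit sh)) mul1r.
by rewrite mulrK // (SU_unit sh).
Qed.

Lemma conj_sub1 g h : h \is a GRing.unit -> h * g * h^-1 - 1 = h * (g - 1) * h^-1.
Proof. by move=> uh; rewrite mulrBr mulr1 mulrBl mulrV. Qed.

Lemma conj_exp g h n : h \is a GRing.unit -> (h * g * h^-1) ^+ n = h * g ^+ n * h^-1.
Proof.
move=> uh; elim: n => [|n IH]; first by rewrite !expr0 mulr1 mulrV.
by rewrite !exprS IH !mulrA mulrVK.
Qed.

Lemma ua_nilpotent z : (ua z - 1) ^+ 3 = 0.
Proof.
apply: mulmx_ext => x; have [a [b [c ->]]] := col3_ex x.
have E y : (ua z - 1) *m y = ua z *m y - y by rewrite mulmxBl mul1mx.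
rewrite !exprS expr0 mulr1 -!mulmxA !E !(ua_col3, col3B) mul0mx.
by apply/colP => -[[|[|[|n]]] //= hn]; rewrite !mxE /=; ring.
Qed.

Let pM : p \in [pchar M].
Proof. by apply: (rmorph_pchar (@scalar_mx L 3)). Qed.

Lemma unipotent_exp g (m : nat) : (g - 1) ^+ (p ^ m) = g ^+ (p ^ m) - 1.
Proof.
elim: m => [|m IH]; first by rewrite !expn0 !expr1.
rewrite expnSr !exprM IH -(pFrobenius_autE pM) pFrobenius_autB_comm; last exact: commr1.
by rewrite !pFrobenius_autE expr1n.
Qed.

(** In characteristic p, [(g - 1) ^+ p = g ^+ p - 1], and the left side vanishes because p is at
    least 3. *)
Lemma isofix_order g x : SU g -> isofix g x -> (g - 1) ^+ 3 = 0 /\ g ^+ p = 1.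
Proof.
move=> sg fx; have [h [z [t [sh hz _ _ eg]]]] := isofix_model sg fx; have uh := SU_unit sh.
have e3 : (g - 1) ^+ 3 = 0.
  by rewrite eg conj_sub1 // conj_exp // ua_nilpotent mulr0 mul0r.
split=> //; apply/eqP; rewrite -subr_eq0; have := unipotent_exp g 1; rewrite expn1 => <-.
by rewrite -(subnKC p2) exprD e3 mul0r.
Qed.

(** In the model, a fixed vector with non-zero last coordinate forces u = v = 0; otherwise it is
    isotropic with last coordinate 0, hence on the standard line. *)
Lemma isofix_unique g x y : SU g -> g <> 1 -> isofix g x -> isofix g y -> exists t, y = t *: x.
Proof.
move=> sg g1 fx [y0 hy gy]; have [h [[u v] [t [sh hz t0 ex eg]]]] := isofix_model sg fx.
have [a [b [c ey]]] := col3_ex (h^-1 *m y).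
have hy' : herm (h^-1 *m y) (h^-1 *m y) = 0 by have [_ ->] := SU_inv sh.
have gy' : ua (u, v) *m (h^-1 *m y) = h^-1 *m y.
  by rewrite -{2}gy eg -!mulmxA (mulVmx3 _ sh).
move: gy' hy'; rewrite ey ua_col3 /= => /col3_inj[e1 e2 _].
have [c0|c0] := eqVneq c 0.
  move=> /isotropic_last0; rewrite !col3E => /(_ c0) e3.
  by exists (a / t); rewrite ex scalerA divfK // scalemxAr -e3 -ey (mulmxV3 _ sh).
have u0 : u = 0 by apply: (mulIf c0); rewrite mul0r; apply: (addrI b); rewrite e2 addr0.
have v0 : v = 0.
  apply: (mulIf c0); rewrite mul0r; apply: (addrI a); rewrite addr0 -[RHS]e1 u0 rmorph0.
  by rewrite mul0r subr0.
by case: g1; rewrite eg u0 v0 ua0 mulr1 mulrV // (SU_unit sh).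
Qed.

(* For N = g - 1 nilpotent, w = N^n e lies in the kernel and the image of N, and
   h(w, w) = h(w, N w') = h(g^-1 w, w') - h(w, w') = 0. *)
Lemma nilpotent_isofix g (m : nat) : SU g -> g <> 1 -> (g - 1) ^+ m = 0 ->
  exists (n : nat) b, isofix g (col b ((g - 1) ^+ n)).
Proof.
move=> sg g1 Nm; have ex : exists n, (g - 1) ^+ n == 0 by exists m; rewrite Nm.
have [n0 /eqP n0E minn0] := ex_minnP ex.
have : n0 != 0%N by apply: contraPneq n0E => ->; rewrite expr0; apply/eqP/oner_neq0.
have : n0 != 1%N.
  by apply: contraPneq n0E => ->; rewrite expr1 => /eqP; rewrite subr_eq0 => /eqP.
case: n0 n0E minn0 => [|[|n]] // n0E minn _ _.
have nz : (g - 1) ^+ n.+1 != 0 by apply/negP => /minn; rewrite ltnn.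
have [b nb] : exists b, col b ((g - 1) ^+ n.+1) != 0.
  apply: contrapT => no; case/eqP: nz; apply/matrixP => a b; rewrite [RHS]mxE.
  have c0 : col b ((g - 1) ^+ n.+1) = 0 by apply: contrapT => /eqP h; apply: no; exists b.
  by have := congr1 (fun x : 'cV_3 => x a 0) c0; rewrite !mxE.
exists n.+1, b; set x := col b _; have E (A : M) : col b A = A *m delta_mx b 0 by rewrite -colE.
have gx : g *m x = x.
  apply/eqP; rewrite -subr_eq0; apply/eqP; transitivity ((g - 1) *m x); first by rewrite mulmxBl mul1mx.
  rewrite /x E mulmxA; have -> : (g - 1) *m (g - 1) ^+ n.+1 = 0 by apply: etrans n0E; rewrite [RHS]exprS.
  by rewrite mul0mx.
split=> //; have [_ gh] := sg; pose w := col b ((g - 1) ^+ n).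
have ew : x = g *m w - w by rewrite -{2}[w]mul1mx -mulmxBl /x /w !E mulmxA exprS.
rewrite {2}ew; have -> : herm x (g *m w - w) = herm x (g *m w) - herm x w.
  by rewrite -scaleN1r hermDr hermZr rmorphN1 mulN1r.
by rewrite -{1}gx gh subrr.
Qed.

Lemma trace_isofix g x : SU g -> isofix g x -> \tr g = 3.
Proof.
move=> sg fx; have [h [z [t [sh _ _ _ ->]]]] := isofix_model sg fx.
rewrite mxtrace_conj ?(SU_unit sh) //.
by rewrite /mxtrace !big_ord_recl big_ord0 !mxE /=; ring.
Qed.

Lemma trace_ua z (A : M) :
  \tr (ua z * A) = \tr A - bar z.1 * A 1 0 + z.2 * A 2%R 0 + z.1 * A 2%R 1.
Proof.
rewrite /mxtrace !big_ord_recl !big_ord0 !addr0 !mxE !big_ord_recl !big_ord0 !mxE /=.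
have -> : lift ord0 ord0 = 1 :> 'I_3 by apply/val_inj.
have -> : lift ord0 (lift ord0 ord0) = 2%R :> 'I_3 by apply/val_inj.
have -> : ord0 = 0 :> 'I_3 by apply/val_inj.
by ring.
Qed.

(* For g = 1 + N the conditions on the traces of h, g h and g^2 h say that
   tr(N h) = tr(N^2 h) = 0, which kills the lower left entry of h. *)
Lemma isofix_common g h x y y' y'' : SU g -> SU h -> g <> 1 -> isofix g x -> isofix h y ->
  isofix (g * h) y' -> isofix (g * g * h) y'' -> h *m x = x.
Proof.
move=> sg sh g1 fx fh fgh fggh; have [a [[u v] [t [sa hz t0 ex eg]]]] := isofix_model sg fx.
have saV := SU_inv sa; have ua1 := SU_unit sa; pose h' := a^-1 * h * a.
have sh' : SU h' by do 2?apply: SU_mul.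
have tr1 (A : M) : \tr (a * A * a^-1) = \tr A.
  exact: mxtrace_conj.
have eh : h = a * h' * a^-1 by rewrite /h' !mulrA mulrV // mul1r mulrK.
have egh : g * h = a * (ua (u, v) * h') * a^-1.
  by rewrite eg eh !mulrA mulrVK.
have eggh : g * g * h = a * (ua (u, v) * ua (u, v) * h') * a^-1.
  by rewrite eg eh !mulrA !mulrVK.
have eh' : h' = a^-1 * h * a by [].
clearbody h'.
have := trace_isofix (SU_mul (SU_mul sg sg) sh) fggh; have := trace_isofix (SU_mul sg sh) fgh.
have t3 := trace_isofix sh fh; rewrite -{1}t3 -[in X in _ -> X]t3 egh eggh eh !tr1 uaM /=.
rewrite !trace_ua /= => e1 e2.
have h20 : h' 2%R 0 = 0.
  have e3 : (u * bar u) * h' 2%R 0 = 0.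
    have : 2 * (\tr h' - bar u * h' 1 0 + v * h' 2%R 0 + u * h' 2%R 1 - \tr h')
       - (\tr h' - bar (u + u) * h' 1 0 + (v + v - bar u * u) * h' 2%R 0 + (u + u) * h' 2%R 1 - \tr h') = 0.
      by rewrite e1 e2 !subrr mulr0 subr0.
    by rewrite rmorphD /= => <-; ring.
  have [u0|u0] := eqVneq u 0; last first.
    by apply/eqP; move/eqP: e3; rewrite mulf_eq0 (negPf (mulf_neq0 u0 _)) // fmorph_eq0.
  have v0 : v != 0.
    apply: contra_notN g1 => /eqP v0; rewrite eg u0 v0 ua0 mulr1 mulrV //.
  apply: (mulfI v0); rewrite mulr0; apply: (addrI (\tr h')).
  by rewrite addr0 -[RHS]e1 u0 rmorph0 !mul0r subr0 addr0.
have eE : h' *m E0 = h' 0 0 *: E0.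
  have eE' : h' *m E0 = col3 (h' 0 0) (h' 1 0) (h' 2%R 0).
    by rewrite mul_col3 !mulr0 !mulr1 !addr0.
  have iso : herm (h' *m E0) (h' *m E0) = 0 by have [_ ->] := sh'; rewrite herm3; ring.
  by have := isotropic_last0 iso; rewrite eE' !col3E; apply.
have [f3 _] := isofix_order sh fh.
have : (h' - 1) ^+ 3 = 0.
  have uaV : a^-1 \is a GRing.unit by rewrite unitrV.
  by have := conj_exp (h - 1) 3 uaV; rewrite -(conj_sub1 h uaV) invrK f3 mulr0 mul0r -eh'.
move=> /(congr1 (fun A => A *m E0)); rewrite mul0mx.
have E1 : (h' - 1) *m E0 = (h' 0 0 - 1) *: E0 by rewrite mulmxBl mul1mx eE scalerBl scale1r.
rewrite !exprS expr0 mulr1 -!mulmxA !(E1, =^~ scalemxAr, scalerA) => /eqP.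
rewrite scaler_eq0 => /orP[h1|/eqP/colP/(_ 0)/eqP]; last by rewrite !mxE /= oner_eq0.
have h1' : h' 0 0 = 1.
  by apply/eqP; rewrite -subr_eq0; move: h1; rewrite !mulf_eq0 => /orP[/orP[]|].
have hE : h *m (a *m E0) = a *m E0.
  by rewrite eh -!mulmxA (mulVmx3 _ sa) eE h1' scale1r.
have : h *m x = x by rewrite ex -scalemxAr hE.
by rewrite {1}eh -!mulmxA.
Qed.

(** Matrix of the transvection x -> x + w h(x, s) s; [rev_ord] appears because h pairs opposite
    coordinates. *)
Definition tv (s : 'cV[L]_3) (w : L) : M :=
  \matrix_(a, b) ((a == b)%:R + w * s a 0 * bar (s (rev_ord b) 0)).

Lemma tvE s w x : tv s w *m x = x + (w * herm x s) *: s.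
Proof.
apply/colP => a; rewrite !mxE /herm !big_ord_recl big_ord0 !mxE /=.
have -> : lift ord0 ord0 = 1 :> 'I_3 by apply/val_inj.
have -> : lift ord0 (lift ord0 ord0) = 2%R :> 'I_3 by apply/val_inj.
have -> : ord0 = 0 :> 'I_3 by apply/val_inj.
have -> : rev_ord 0 = 2%R :> 'I_3 by apply/val_inj.
have -> : rev_ord 1 = 1 :> 'I_3 by apply/val_inj.
have -> : rev_ord 2%R = 0 :> 'I_3 by apply/val_inj.
have -> : x a 0 = (a == 0)%:R * x 0 0 + (a == 1)%:R * x 1 0 + (a == 2%R)%:R * x 2%R 0.
  case: a => -[|[|[|a]]] //= ha; rewrite !(inE, mul0r, mul1r, add0r, addr0);
    by congr (x _ _); apply/val_inj.
by ring.
Qed.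

Lemma tvD s w w' : herm s s = 0 -> tv s (w + w') = tv s w * tv s w'.
Proof.
move=> hs; apply: mulmx_ext => x; rewrite -mulmxA !tvE hermDl hermZl hs mulr0 addr0.
by rewrite -addrA -scalerDl; congr (_ + _ *: _); ring.
Qed.

Lemma tv0 s : tv s 0 = 1.
Proof. by apply: mulmx_ext => x; rewrite tvE mul0r scale0r addr0 mul1mx. Qed.

Lemma tvV s w : herm s s = 0 -> tv s w * tv s (- w) = 1.
Proof. by move=> hs; rewrite -tvD // subrr tv0. Qed.

Lemma tv_fix s w : herm s s = 0 -> tv s w *m s = s.
Proof. by move=> hs; rewrite tvE hs mulr0 scale0r addr0. Qed.

Lemma tv_inj s : s != 0 -> injective (tv s).
Proof.
move=> s0 w w' e1; have [y hy] : exists y, herm y s != 0.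
  apply: contrapT => no; case/eqP: s0; apply: (@herm_nondegenerate _ _ bar) => y.
  rewrite (hermC barK); apply/eqP; rewrite fmorph_eq0; apply: contrapT => /negP h.
  by apply: no; exists y.
have := congr1 (fun A : M => A *m y) e1; rewrite /= !tvE => /addrI/eqP.
rewrite -subr_eq0 -scalerBl scaler_eq0 (negPf s0) orbF -mulrBl mulf_eq0 (negPf hy) orbF.
by rewrite subr_eq0 => /eqP.
Qed.

(** Moving the line of s to the standard one turns the transvection into an element of U_2a. *)
Lemma tv_SU s w : s != 0 -> herm s s = 0 -> w + bar w = 0 -> SU (tv s w).
Proof.
move=> s0 hs hw; have [h [t [sh t0 es]]] := isotropic_line barK s0 hs.
have -> : tv s w = h * ua (0, w * t * bar t) * h^-1.
  apply: mulmx_ext => x; rewrite tvE -!mulmxA; pose y := h^-1 *m x.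
  have ex : x = h *m y by rewrite (mulmxV3 _ sh).
  have [a [b [c ey]]] := col3_ex y; rewrite -/y {1 2}ex es hermZr.
  have [_ ->] := sh; rewrite ey herm3 ua_col3 /=.
  have -> : col3 (a - bar 0 * b + w * t * bar t * c) (b + 0 * c) c
     = col3 a b c + (w * t * bar t * c) *: E0.
    by apply/colP => -[[|[|[|n]]] //= hn]; rewrite !mxE /= ?rmorph0; ring.
  rewrite mulmxDr -scalemxAr scalerA; congr (_ + _ *: _); rewrite rmorph1 !rmorph0; ring.
apply: SU_mul; last exact: SU_inv; apply: SU_mul => //; apply: SU_ua => //.
apply/HsetE; rewrite !rmorphM /= barK mul0r add0r.
by rewrite -(mul0r (t * bar t)) -hw; ring.
Qed.

End Unipotents.

(** * Stabilizers *)

Lemma finite_set_code (T : Type) (S : set T) (U : finType) (c : T -> U) :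
  (forall x y, S x -> S y -> c x = c y -> x = y) -> finite_set S.
Proof.
move=> h; have [[x0 Sx0]|no] := pselect (exists x, S x); last first.
  by have -> : S = set0 by apply/seteqP; split=> // x Sx; case: no; exists x.
have /choice[f hf] : forall u, exists x, (exists2 y, S y & c y = u) -> S x /\ c x = u.
  by move=> u; have [[y Sy e]|no] := pselect (exists2 y, S y & c y = u); [exists y | exists x0].
apply: (@sub_finite_set _ _ (f @` setT)); last exact/finite_image/finite_finset.
by move=> x Sx; exists (c x) => //; have [|Sf ef] := hf (c x); [exists x | apply: h].
Qed.

Lemma fiber_seq (T U : eqType) (f : T -> U) (r : seq U) (w : seq T) :
  (0 < size w)%N -> (forall x, x \in w -> f x \in r) ->
  exists y, (size w <= size r * count (fun x => f x == y) w)%N.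
Proof.
elim: r w => [|y r IH] w w0 h; first by case: w w0 h => // x w _ /(_ x (mem_head _ _)).
have e0 := count_predC (fun x => f x == y) w.
have [n0|] := posnP (count (fun x => f x != y) w).
  by exists y; rewrite -e0 [count (predC _) _]n0 addn0 mulSn leq_addr.
rewrite -size_filter => w'0; have [x|y' le] := IH _ w'0.
  by rewrite mem_filter => /andP[ne /h]; rewrite inE (negPf ne).
have le' : (count (fun x => f x == y') (seq.filter (fun x => f x != y) w) <= count (fun x => f x == y') w)%N.
  by rewrite count_filter; apply: sub_count => x /andP[].
rewrite size_filter in le; move: le le' e0; rewrite [count (predC _) _](_ : _ = count (fun x => f x != y) w) //.
set a := count _ (seq.filter _ _); set b := count (fun x => f x == y') w; set c := count (fun x => f x != y) w.
set c0 := count _ w => le le' <-; have [h1|h1] := leqP c0 b; first by exists y'; rewrite -/b /=; nia.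
by exists y; rewrite -/c0 /=; nia.
Qed.

Lemma power_repeat (T : eqType) (f : nat -> T) (s : seq T) : (forall n, f n \in s) ->
  exists n m, (n < m)%N /\ f n = f m.
Proof.
move=> h; pose w := map f (iota 0 (size s).+1).
have : ~~ uniq w.
  apply/negP => uw; have := uniq_leq_size uw _; rewrite size_map size_iota => /(_ s).
  by rewrite ltnn => /(_ _)/notF; apply=> x /mapP[n _ ->].
move=> /(uniqPn (f 0%N))[n [m [nm mw]]]; rewrite size_map size_iota in mw.
by rewrite !(nth_map 0%N) ?size_iota ?(ltn_trans nm) // !nth_iota ?(ltn_trans nm) // => e; exists n, m.
Qed.

Section Group.
Context (F : finFieldType) (k : fieldType) (L : fieldExtType k) (bar : 'AEnd(L)).
Context (i : {rmorphism F -> L}) (Q : place i) (B : set L) (d : nat).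
Context (R : realType) (nuP : L -> R) (e p : nat) (G : subgroup 'M[L]_3).
Hypotheses (ar : arithmetic bar Q B d).
Hypotheses (pL : p \in [pchar L]) (p2 : (2 < p)%N).
Hypotheses (e0 : (0 < e)%N) (nuE : forall x, nuP x = (Q x)%:~R / e%:R).
Hypotheses (hfin : finite_index_in G (SU_over bar B)) (hp : no_p'_torsion p G).
Local Notation M := 'M[L]_3.
Local Notation vertex := (set (M * R)).
Implicit Types (z : L * L) (g h : M) (v w : vertex) (x y s : 'cV[L]_3).
Local Notation ua := (ua bar).
Local Notation SU := (SU bar).
Local Notation herm := (herm bar).
Local Notation Gamma := (SU_over bar B).
Local Notation X := (vertices bar nuP).
Local Notation adj := (adj bar nuP e).
Local Notation par := (par bar nuP e).
Local Notation vball := (vball bar Q nuP e).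
Local Notation E0 := (col3 (1 : L) 0 0).
Local Notation intv := (intv B).
Local Notation isofix := (isofix bar).

Let barK : involutive bar. Proof. exact: ar_barK ar. Qed.
Let Qbar (x : L) : Q (bar x) = Q x. Proof. exact: (ar_val_bar ar). Qed.

Lemma group1 : G 1. Proof. by case: (sgP G). Qed.
Lemma groupM g h : G g -> G h -> G (g * h). Proof. by case: (sgP G) => _ + _; apply. Qed.
Lemma groupV g : G g -> G g^-1. Proof. by case: (sgP G) => _ _ V /V[]. Qed.
Lemma groupX g n : G g -> G (g ^+ n).
Proof. by move=> gg; elim: n => [|n IH]; rewrite ?expr0 ?exprS; [exact: group1 | exact: groupM]. Qed.
Lemma group_Gamma g : G g -> Gamma g. Proof. by case: hfin => + _; apply. Qed.
Lemma group_SU g : G g -> SU g. Proof. by move=> /group_Gamma[]. Qed.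

Lemma int_mulmx g x : (forall a b, B (g a b)) -> intv x -> intv (g *m x).
Proof. by move=> hg hx a; rewrite mxE; apply: (ring_sum ar) => b; apply: (ringM ar). Qed.

Lemma group_int g x : G g -> intv x -> intv (g *m x).
Proof. by move=> /group_Gamma[_ hg]; apply: int_mulmx. Qed.

Lemma vball_bounded v m : X v -> exists N : nat, forall x, vball v m x ->
  forall a, pge Q (x a 0) (- N%:Z).
Proof.
move=> /(vertexP barK Qbar e0 nuE)[z [j [hz ->]]]; have sz := SU_ua barK hz.
pose N1 := (\sum_a \sum_b `|Q (ua z a b)|)%N.
exists (`|m| + `|j| + N1)%N => x; rewrite (vball_pt barK Qbar e0 nuE) // /gball => hb a.
rewrite -(mulmxV3 x sz); set y := _ *m x in hb *; rewrite mxE; apply: pge_sum => b _.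
have hy : pge Q (y b 0) (- (`|m| + `|j|)%N%:Z).
  have [h1 h2 h3] := hb.
  have H (t : L) (c : int) : hge Q t c -> - (2 * (`|m| + `|j|)%N%:Z) <= c -> pge Q t (- (`|m| + `|j|)%N%:Z).
    by move=> [->|h] le; [left | right; lia].
  have [->|[->|->]] : b = 0 \/ b = 1 \/ b = 2%R.
    by case: (b) => -[|[|[|b']]] // hb'; [left | right; left | right; right]; apply/val_inj.
  - by apply: H h1 _; lia.
  - by apply: H h2 _; lia.
  - by apply: H h3 _; lia.
have := pgeM (pge_refl Q (ua z a b)) hy; apply: pge_le.
have : (`|Q (ua z a b)| <= N1)%N.
  by rewrite /N1 (bigD1 a) //= (bigD1 b) //= -addnA leq_addr.
by move: N1 (Q _) => N1 n; clear; lia.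
Qed.

(** The columns of g are images of the basis vectors, so they lie in a fixed ball at w; their
    entries are elements of B with bounded poles. *)
Lemma transporter_finite v w : X v -> X w -> finite_set [set g | Gamma g /\ move_v g v = w].
Proof.
move=> Xv Xw.
have [m hm] : exists m : int, forall b, vball v m (delta_mx b 0).
  have H b := vball_ex barK Qbar e0 nuE (delta_mx b 0) Xv.
  have [[m0 h0] [m1 h1] [m2 h2]] : [/\ (exists m, vball v m (delta_mx 0 0)),
    (exists m, vball v m (delta_mx 1 0)) & (exists m, vball v m (delta_mx 2%R 0))] by [].
  exists (- (`|m0| + `|m1| + `|m2|)%N%:Z) => b.
  have [->|[->|->]] : b = 0 \/ b = 1 \/ b = 2%R.
    by case: (b) => -[|[|[|b']]] // hb'; [left | right; left | right; right]; apply/val_inj.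
  - by apply: (vball_le e0 _ h0); clear; lia.
  - by apply: (vball_le e0 _ h1); clear; lia.
  - by apply: (vball_le e0 _ h2); clear; lia.
have [N hN] := vball_bounded m Xw; have [dl hdl] := ring_code ar N.
have ball g b : SU g -> move_v g v = w -> forall a, pge Q (g a b) (- N%:Z).
  move=> sg ew a; have := (vball_move barK Qbar e0 nuE m (delta_mx b 0) sg Xv).2 (hm b).
  by rewrite ew => /hN/(_ a); rewrite -colE mxE.
apply: (finite_set_code (c := fun g => [ffun ab : 'I_3 * 'I_3 => dl (g ab.1 ab.2)])).
move=> g h [[sg ig] mg] [[sh ih] mh] /ffunP ec; apply/matrixP => a b; have := ec (a, b).
by rewrite !ffunE /=; apply: hdl; [exact: ig | exact: ih | exact: ball | exact: ball].
Qed.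

Lemma finite_order g v : X v -> G g -> move_v g v = v -> exists n, (0 < n)%N /\ g ^+ n = 1.
Proof.
move=> Xv gg mg; have /finite_seqP[s es] := transporter_finite Xv Xv.
have mX n : move_v (g ^+ n) v = v by elim: n => [|n IH]; rewrite ?expr0 ?move1 // exprS moveM IH.
have [n [m [nm e1]]] : exists n m, (n < m)%N /\ g ^+ n = g ^+ m.
  apply: (power_repeat (s := s)) => n.
  have : [set g | Gamma g /\ move_v g v = v] (g ^+ n) by split; [exact/group_Gamma/groupX | ].
  by rewrite es.
exists (m - n)%N; split; first by rewrite subn_gt0.
have un : g ^+ n \is a GRing.unit by rewrite unitrX // (SU_unit (group_SU gg)).
by apply: (mulrI un); rewrite -exprD subnKC ?mulr1 // ltnW.
Qed.

(** The order is a power of p, so g - 1 is nilpotent; the isotropic vector found is a column of a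
    power of g - 1, hence integral. *)
Lemma torsion_isofix g n : G g -> (0 < n)%N -> g ^+ n = 1 -> g <> 1 ->
  exists2 x, intv x & isofix g x.
Proof.
move=> gg n0 gn g1; have ex : exists n, (0 < n)%N && (g ^+ n == 1) by exists n; rewrite n0 gn eqxx.
have [m /andP[m0 /eqP gm] mmin] := ex_minnP ex.
have [l em] : exists l, m = (p ^ l)%N.
  by apply: (hp gg); split=> // j j0 gj; apply: mmin; rewrite j0 gj eqxx.
have nil : (g - 1) ^+ m = 0 by rewrite em (unipotent_exp pL) -em gm subrr.
have [j [b fx]] := nilpotent_isofix (group_SU gg) g1 nil.
exists (col b ((g - 1) ^+ j)) => // a; rewrite mxE.
have ig : forall a b, B ((g - 1) a b).
  move=> a' b'; rewrite !mxE; apply: (ringB ar); first by case: (group_Gamma gg).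
  by case: (a' == b'); [exact: (ring1 ar) | exact: (ring0 ar)].
elim: j a b {fx} => [|j IH] a b.
  by rewrite expr0 mxE; case: (a == b); [exact: (ring1 ar) | exact: (ring0 ar)].
by rewrite exprS mxE; apply: (ring_sum ar) => c; apply: (ringM ar).
Qed.

Definition nonfree v : Prop := exists g, [/\ G g, move_v g v = v & g <> 1].

Definition fixes_stab s v : Prop :=
  [/\ s != 0, herm s s = 0 & forall g, G g -> move_v g v = v -> g *m s = s].

(** Every element of the stabilizer fixes some isotropic vector, so [isofix_common] applies to a
    fixed g different from 1 and any h, through the products g h and g g h. *)
Lemma nonfree_fix v : X v -> nonfree v -> exists2 s, intv s & fixes_stab s v.
Proof.
move=> Xv [g [gg mg g1]]; have [n [n0 gn]] := finite_order Xv gg mg.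
have [s is_ fs] := torsion_isofix gg n0 gn g1; have [s0 hs gs] := fs.
have ex h : G h -> move_v h v = v -> exists y, isofix h y.
  move=> gh mh; have [->|/eqP h1] := eqVneq h 1; first by exists s; split; rewrite ?mul1mx.
  by have [m [m0 hm]] := finite_order Xv gh mh; have [y _ hy] := torsion_isofix gh m0 hm h1; exists y.
exists s => //; split=> // h gh mh.
have m1 : move_v (g * h) v = v by rewrite moveM mh.
have m2 : move_v (g * g * h) v = v by rewrite -mulrA moveM m1.
have [y fy] := ex _ gh mh; have [y' fy'] := ex _ (groupM gg gh) m1.
have [y'' fy''] := ex _ (groupM (groupM gg gg) gh) m2.
exact: (isofix_common barK pL p2 (group_SU gg) (group_SU gh) g1 fs fy fy' fy'').
Qed.

(* The eigenvalue t is a unit of B, of which only finitely many powers exist. *)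
Lemma line_stab g s (t : L) : intv s -> s != 0 -> herm s s = 0 -> G g -> g *m s = t *: s ->
  g *m s = s /\ g ^+ p = 1.
Proof.
move=> is_ s0 hs gg es; have sg := group_SU gg; have ug := SU_unit sg.
have [a sa] : exists a, s a 0 != 0.
  apply: contrapT => no; case/eqP: s0; apply/colP => a; rewrite [RHS]mxE.
  by apply: contrapT => /eqP h; apply: no; exists a.
have t0 : t != 0.
  apply: contraNneq s0 => t0; rewrite -(mulVmx3 s sg) es t0 scale0r mulmx0 //.
have eX n : g ^+ n *m s = t ^+ n *: s.
  elim: n => [|n IH]; first by rewrite !expr0 mul1mx scale1r.
  by rewrite exprSr -[_ * _]/(_ *m _) -mulmxA es -scalemxAr IH scalerA -exprS.
have eV : g^-1 *m s = t^-1 *: s by rewrite -[in RHS](mulVmx3 s sg) es -scalemxAr scalerA mulVf ?scale1r.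
have eVX n : g^-1 ^+ n *m s = t^-1 ^+ n *: s.
  elim: n => [|n IH]; first by rewrite !expr0 mul1mx scale1r.
  by rewrite exprSr -[_ * _]/(_ *m _) -mulmxA eV -scalemxAr IH scalerA -exprS.
have BX n : B (t ^+ n * s a 0).
  by have := group_int (groupX n gg) is_ a; rewrite eX mxE.
have BVX n : B (t^-1 ^+ n * s a 0).
  by have := group_int (groupX n (groupV gg)) is_ a; rewrite eVX mxE.
have Qt : Q t = 0.
  pose c : int := Q (s a 0); pose c' : int := Q t.
  have h1 n : n%:Z * c' + c <= 0.
    have nz : t ^+ n * s a 0 != 0 by rewrite mulf_neq0 ?expf_neq0.
    have : Q (t ^+ n * s a 0) <= 0 := ar_nozero ar (BX n) nz.
    by rewrite placeMl ?expf_neq0 // placeX.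
  have h2 n : - (n%:Z * c') + c <= 0.
    have tV : t^-1 != 0 by rewrite invr_eq0.
    have nz : t^-1 ^+ n * s a 0 != 0 by rewrite mulf_neq0 ?expf_neq0.
    have : Q (t^-1 ^+ n * s a 0) <= 0 := ar_nozero ar (BVX n) nz.
    by rewrite placeMl ?expf_neq0 // placeX // placeV // mulrN.
  have E (a' b' : int) : (forall n, n%:Z * b' + a' <= 0) -> (forall n, - (n%:Z * b') + a' <= 0) -> b' = 0.
    by move=> f1 f2; have := f1 `|a'|.+1; have := f2 `|a'|.+1; clear; nia.
  exact: E h1 h2.
have [dl hdl] := ring_code ar (absz (Q (s a 0))).
have [n [m [nm e1]]] : exists n m, (n < m)%N /\ dl (t ^+ n * s a 0) = dl (t ^+ m * s a 0).
  by apply: (power_repeat (s := enum {: 'M[F]_(_, d)})) => n; rewrite mem_enum.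
have pg n' : pge Q (t ^+ n' * s a 0) (- (absz (Q (s a 0)))%:Z).
  right; rewrite placeMl ?expf_neq0 // placeX // Qt mulr0 add0r.
  by have H (c : int) : - (absz c)%:Z <= c by [clear; lia]; apply: H.
have e2 := hdl _ _ (BX n) (BX m) (pg n) (pg m) e1.
have tm : t ^+ (m - n) = 1.
  have tn : t ^+ n != 0 by rewrite expf_neq0.
  by apply: (mulfI tn); rewrite -exprD subnKC ?mulr1 ?(ltnW nm) //; apply: (mulIf sa).
have mn0 : (0 < m - n)%N by rewrite subn_gt0.
have fgm : isofix (g ^+ (m - n)) s by split=> //; rewrite eX tm scale1r.
have [_ o1] := isofix_order barK pL p2 (group_SU (groupX _ gg)) fgm.
rewrite -exprM in o1; have p0 : (0 < (m - n) * p)%N by rewrite muln_gt0 mn0 ltnW // ltnW.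
have [->|/eqP g1] := eqVneq g 1; first by rewrite mul1mx expr1n.
have [x _ fx] := torsion_isofix gg p0 o1 g1.
have [g3 gp] := isofix_order barK pL p2 sg fx; split=> //.
have E1 : (g - 1) *m s = (t - 1) *: s by rewrite mulmxBl mul1mx es scalerBl scale1r.
have := congr1 (fun A : M => A *m s) g3; rewrite /= mul0mx !exprS expr0 mulr1.
rewrite -[(g - 1) * _]/(_ *m _) -[(g - 1) * _]/(_ *m _) -!mulmxA.
rewrite E1 -scalemxAr E1 scalerA -scalemxAr E1 scalerA => /eqP; rewrite scaler_eq0 (negPf s0) orbF.
rewrite !mulf_eq0 -orbA => h; have t1 : t = 1.
  by apply/eqP; rewrite -subr_eq0; case/or3P: h.
by rewrite es t1 scale1r.
Qed.

(* An element of SU(h) mapping the line of col3 1 0 0 to that of s, when s is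
   isotropic. *)
Definition toward s : M := xget 1 [set h | SU h /\ exists t, t != 0 /\ s = t *: (h *m E0)].

Lemma towardP s : s != 0 -> herm s s = 0 ->
  SU (toward s) /\ exists t, t != 0 /\ s = t *: (toward s *m E0).
Proof.
move=> s0 hs; have [h [t [sh t0 es]]] := isotropic_line barK s0 hs.
by apply: (@xgetPex _ 1 [set h | SU h /\ exists t, t != 0 /\ s = t *: (h *m E0)]); exists h; split=> //; exists t.
Qed.

Definition pars s v : vertex := par (toward s) v.

Section Toward.
Context (s : 'cV[L]_3) (s0 : s != 0) (hs : herm s s = 0).
Let st : SU (toward s). Proof. by case: (towardP s0 hs). Qed.

Lemma parsX v : X v -> X (pars s v). Proof. exact: (parX barK Qbar e0 nuE). Qed.
Lemma adj_pars v : X v -> adj v (pars s v). Proof. exact: (adj_par barK Qbar e0 nuE). Qed.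
Lemma adj_parsP v w : adj v w -> w = pars s v \/ v = pars s w.
Proof. exact: (adj_parP barK Qbar e0 nuE). Qed.
Lemma merge_pars v w : X v -> X w -> exists n m : nat, iter n (pars s) v = iter m (pars s) w.
Proof. exact: (merge_par barK Qbar e0 nuE). Qed.
Lemma pars_no2 v : X v -> pars s (pars s v) = v -> False.
Proof. exact: (par_no2 barK Qbar e0 nuE). Qed.
Lemma pars_surj v : X v -> exists2 w, X w & v = pars s w.
Proof. exact: (par_surj barK Qbar e0 nuE). Qed.

Lemma vball_unscale v m (c : L) x : c != 0 -> vball v m (c *: x) <-> vball v (m - 2 * Q c) x.
Proof.
move=> c0; split=> h.
  have cV : c^-1 != 0 by rewrite invr_eq0.
  have := vballZ barK Qbar e0 nuE (hge_refl Q c^-1) h.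
  by rewrite scalerA mulVf // scale1r placeV // mulrN.
have := vballZ barK Qbar e0 nuE (hge_refl Q c) h.
by rewrite subrK.
Qed.

Lemma vball_pars v m : X v -> vball (pars s v) (m + 1) s <-> vball v m s.
Proof.
move=> Xv; have [_ [t [t0 es]]] := towardP s0 hs; have st' := st; rewrite /pars; set h := toward s in es st' *; rewrite es.
rewrite !vball_unscale // addrAC; exact: (vball_par barK Qbar e0 nuE).
Qed.

Lemma pars_move g v : SU g -> X v -> move_v g (pars s v) = pars (g *m s) (move_v g v).
Proof.
move=> sg Xv; have [_ [t [t0 es]]] := towardP s0 hs.
have gs0 : g *m s != 0 by apply: contraNneq s0 => e1; rewrite -(mulVmx3 s sg) e1 mulmx0.
have hgs : herm (g *m s) (g *m s) = 0 by have [_ ->] := sg.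
have [st' [t' [t0' es']]] := towardP gs0 hgs.
rewrite /pars (par_move nuP e _ sg st).
apply: (par_line barK Qbar e0 nuE (t := t' / t) _ _ _ (move_vertex barK Qbar e0 nuE sg Xv)) => //.
  exact: SU_mul.
rewrite -mulmxA -[_ *m E0](scalerK t0) -es -scalemxAr [in LHS]es' scalerA mulrC.
by [].
Qed.

Lemma pars_fix g v : SU g -> X v -> g *m s = s -> move_v g v = v -> move_v g (pars s v) = pars s v.
Proof. by move=> sg Xv gs gv; rewrite pars_move // gs gv. Qed.

Lemma pars_scale c v : c != 0 -> X v -> pars (c *: s) v = pars s v.
Proof.
move=> c0 Xv; have [_ [t [t0 es]]] := towardP s0 hs.
have cs0 : c *: s != 0 by rewrite scaler_eq0 negb_or c0.
have hcs : herm (c *: s) (c *: s) = 0 by rewrite hermZl hermZr hs !mulr0.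
have [st' [t' [t0' es']]] := towardP cs0 hcs.
apply: (par_line barK Qbar e0 nuE (t := c * t / t') _ _ _ Xv) => //.
by rewrite -[LHS](scalerK t0') -es' {1}es !scalerA; congr (_ *: _); rewrite mulrC.
Qed.

End Toward.

End Group.

(** * Collapsing along isotropic lines *)

Section Group.
Context (F : finFieldType) (k : fieldType) (L : fieldExtType k) (bar : 'AEnd(L)).
Context (i : {rmorphism F -> L}) (Q : place i) (B : set L) (d : nat).
Context (R : realType) (nuP : L -> R) (e p : nat) (G : subgroup 'M[L]_3).
Hypotheses (ar : arithmetic bar Q B d).
Hypotheses (pL : p \in [pchar L]) (p2 : (2 < p)%N).
Hypotheses (e0 : (0 < e)%N) (nuE : forall x, nuP x = (Q x)%:~R / e%:R).
Hypotheses (hfin : finite_index_in G (SU_over bar B)) (hp : no_p'_torsion p G).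
Local Notation M := 'M[L]_3.
Local Notation vertex := (set (M * R)).
Implicit Types (z : L * L) (g h : M) (v w : vertex) (x y s : 'cV[L]_3).
Local Notation SU := (SU bar).
Local Notation herm := (herm bar).
Local Notation Gamma := (SU_over bar B).
Local Notation X := (vertices bar nuP).
Local Notation adj := (adj bar nuP e).
Local Notation vball := (vball bar Q nuP e).
Local Notation intv := (intv B).
Local Notation isofix := (isofix bar).

Let barK : involutive bar. Proof. exact: ar_barK ar. Qed.
Let Qbar (x : L) : Q (bar x) = Q x. Proof. exact: (ar_val_bar ar). Qed.

Local Notation nonfree := (nonfree G).
Local Notation fixes_stab := (fixes_stab bar G).
Local Notation pars := (pars bar nuP e).
Local Notation group_SU := (group_SU hfin).
Local Notation nonfree_fix := (nonfree_fix ar pL p2 e0 nuE hfin hp).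
Local Notation line_stab := (line_stab ar pL p2 hfin hp).

Definition line s : set 'cV[L]_3 := [set x | exists t, x = t *: s].

Lemma line_scale s c : c != 0 -> line (c *: s) = line s.
Proof.
move=> c0; apply/seteqP; split=> _ [t ->]; first by exists (t * c); rewrite scalerA.
by exists (t / c); rewrite scalerA divfK.
Qed.

Lemma fixes_parallel v s s' : nonfree v -> fixes_stab s v -> fixes_stab s' v ->
  exists t, t != 0 /\ s' = t *: s.
Proof.
move=> [g [gg mg g1]] [s0 hs fs] [s0' hs' fs'].
have [] := isofix_unique barK (group_SU gg) g1 (x := s) (y := s'); [by split; rewrite ?fs | by split; rewrite ?fs' |].
by move=> t es; exists t; split=> //; apply: contraNneq s0' => t0; rewrite es t0 scale0r.
Qed.

(** An element fixing v and s fixes the next vertex towards s. The stabilizer of that vertex may be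
    larger, but the element g common to both determines the isotropic line that it fixes. *)
Lemma nonfree_pars v s : X v -> nonfree v -> fixes_stab s v ->
  nonfree (pars s v) /\ fixes_stab s (pars s v).
Proof.
move=> Xv [g [gg mg g1]] [s0 hs fs]; have sg := group_SU gg.
have mg' := pars_fix ar e0 nuE s0 hs sg Xv (fs g gg mg) mg.
have nf : nonfree (pars s v) by exists g.
split=> //; split=> // h gh mh; have Xp := parsX ar e0 nuE s0 hs Xv.
have [s' _ [s0' hs' fs']] := nonfree_fix Xp nf.
have [] := isofix_unique barK sg g1 (x := s') (y := s); [by split; rewrite ?fs' | by split; rewrite ?fs |].
by move=> t ->; rewrite -scalemxAr fs'.
Qed.

Lemma iter_nonfree n v s : X v -> nonfree v -> fixes_stab s v ->
  [/\ X (iter n (pars s) v), nonfree (iter n (pars s) v) & fixes_stab s (iter n (pars s) v)].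
Proof.
move=> Xv nf fs; have [s0 hs _] := fs; elim: n => [|n [X1 nf1 fs1]] //=.
by have [? ?] := nonfree_pars X1 nf1 fs1; split=> //; apply: (parsX ar e0 nuE).
Qed.

Lemma nonfree_move g v : G g -> nonfree v -> nonfree (move_v g v).
Proof.
move=> gg [h [gh mh h1]]; have sg := group_SU gg; exists (g * h * g^-1); split.
- exact: groupM (groupM gg gh) (groupV gg).
- by rewrite -moveM mulrVK ?(SU_unit sg) // moveM mh.
- move=> e1; apply: h1; have := congr1 (fun a => g^-1 * a * g) e1; rewrite /= mulr1.
  by rewrite !mulrA mulVr ?(SU_unit sg) // mul1r mulrVK ?(SU_unit sg).
Qed.

Lemma nonfree_moveE g v : G g -> nonfree (move_v g v) <-> nonfree v.
Proof.
move=> gg; split=> [h|]; last exact: nonfree_move.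
by have := nonfree_move (groupV gg) h; rewrite (moveK _ (group_SU gg)).
Qed.

Lemma fixes_move g v s : G g -> fixes_stab s v -> fixes_stab (g *m s) (move_v g v).
Proof.
move=> gg [s0 hs fs]; have sg := group_SU gg; split.
- by apply: contraNneq s0 => e1; rewrite -(mulVmx3 s sg) e1 mulmx0.
- by have [_ ->] := sg.
move=> h gh mh; have := fs (g^-1 * h * g); rewrite !moveM mh (moveK _ sg) => e1.
have {}e1 := e1 (groupM (groupM (groupV gg) gh) gg) erefl.
by rewrite -{2}e1 -!mulmxA (mulmxV3 _ sg).
Qed.

(* A vertex with non-trivial stabilizer is sent to the isotropic line fixed by
   its stabilizer. *)
Definition cls v : vertex + set 'cV[L]_3 := if `[< nonfree v >]
  then inr [set x | herm x x = 0 /\ forall g, G g -> move_v g v = v -> g *m x = x] else inl v.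

Definition actW g (w : vertex + set 'cV[L]_3) : vertex + set 'cV[L]_3 :=
  match w with inl v => inl (move_v g v) | inr Y => inr [set g *m x | x in Y] end.

Lemma cls_free v : ~ nonfree v -> cls v = inl v.
Proof. by move=> h; rewrite /cls asboolF. Qed.

Lemma cls_line v s : nonfree v -> fixes_stab s v -> cls v = inr (line s).
Proof.
move=> nf fs; have [s0 hs h] := fs; rewrite /cls asboolT //; congr inr.
apply/seteqP; split=> [x [hx fx]|_ [t ->]].
  have [->|x0] := eqVneq x 0; first by exists 0; rewrite scale0r.
  by have [|t [_ ->]] := fixes_parallel nf fs (s' := x); [split | exists t].
by rewrite /= hermZl hermZr hs !mulr0; split=> // g gg mg; rewrite -scalemxAr h.
Qed.

Lemma cls_cases v : X v -> (~ nonfree v /\ cls v = inl v) \/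
  exists s, [/\ nonfree v, intv s, fixes_stab s v & cls v = inr (line s)].
Proof.
move=> Xv; have [nf|nf] := pselect (nonfree v); last by left; rewrite cls_free.
by right; have [s is_ fs] := nonfree_fix Xv nf; exists s; rewrite (cls_line nf fs).
Qed.

Lemma actW1 (o : vertex + set 'cV[L]_3) : actW 1 o = o.
Proof.
case: o => [v|Y] /=; first by rewrite move1.
by congr inr; apply/seteqP; split=> [_ [x Yx <-]|x Yx]; [rewrite mul1mx | exists x; rewrite ?mul1mx].
Qed.

Lemma actWM g h (o : vertex + set 'cV[L]_3) : actW (g * h) o = actW g (actW h o).
Proof.
case: o => [v|Y] /=; first by rewrite moveM.
congr inr; apply/seteqP; split=> [_ [x Yx <-]|_ [_ [x Yx <-] <-]].
  by exists (h *m x); [exists x | rewrite mulmxA].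
by exists x; rewrite // -mulmxA.
Qed.

Lemma actW_line g s : actW g (inr (line s)) = inr (line (g *m s)).
Proof.
congr inr; apply/seteqP; split=> [_ [_ [t ->] <-]|_ [t ->]].
  by exists t; rewrite -scalemxAr.
by exists (t *: s); [exists t | rewrite scalemxAr].
Qed.

Lemma clsG g v : G g -> X v -> cls (move_v g v) = actW g (cls v).
Proof.
move=> gg Xv; case: (cls_cases Xv) => [[nf ->]|[s [nf _ fs ->]]].
  by rewrite cls_free // nonfree_moveE.
by rewrite actW_line (cls_line (nonfree_move gg nf) (fixes_move gg fs)).
Qed.

Lemma line_eq s s' : s != 0 -> line s = line s' -> exists t, t != 0 /\ s = t *: s'.
Proof.
move=> s0 e1; have : line s s by exists 1; rewrite scale1r.
rewrite e1 => -[t es]; exists t; split=> //.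
by apply: contraNneq s0 => t0; rewrite es t0 scale0r.
Qed.

Lemma cls_stab g v : X v -> G g -> actW g (cls v) = cls v ->
  g ^+ p = 1 /\ forall s, nonfree v -> fixes_stab s v -> g *m s = s.
Proof.
move=> Xv gg; case: (cls_cases Xv) => [[nf ->] [mg]|[s [nf is_ fs ->]]].
  have [->|/eqP g1] := eqVneq g 1; first by rewrite expr1n; split=> // s _ _; rewrite mul1mx.
  by case: nf; exists g.
rewrite actW_line => -[e1]; have [s0 hs h] := fs.
have gs0 : g *m s != 0.
  by apply: contraNneq s0 => e2; rewrite -(mulVmx3 s (group_SU gg)) e2 mulmx0.
have [t [t0 es]] := line_eq gs0 e1; have [gs gp] := line_stab is_ s0 hs gg es.
by split=> // s' _ fs'; have [c [_ ->]] := fixes_parallel nf fs fs'; rewrite -scalemxAr gs.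
Qed.

Lemma adj_neq v w : adj v w -> v <> w.
Proof.
move=> vw e1; apply: (adj_noinv barK Qbar e0 nuE (SU1 bar) vw); rewrite move1 //.
Qed.

Lemma cls_adj v w : adj v w -> cls v = cls w -> exists s, [/\ intv s, nonfree v, nonfree w,
  fixes_stab s v & fixes_stab s w /\ (w = pars s v \/ v = pars s w)].
Proof.
move=> vw; have [Xv Xw _] := vw.
case: (cls_cases Xv) => [[_ ->]|[s [nv is_ fs ->]]]; case: (cls_cases Xw) => [[_ ->]|[s' [nw _ fs' ->]]] //.
  by move=> [/(adj_neq vw)].
have [s0 hs _] := fs; have [s0' hs' f'] := fs'; move=> [/(line_eq s0)[t [t0 es]]].
exists s; split=> //; split; last exact: (adj_parsP ar e0 nuE).
by split=> // g gg mg; rewrite es -scalemxAr f'.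
Qed.

(** A non-trivial element fixing both ends has a unique fixed isotropic line, so both ends would be
    sent to that line. *)
Lemma edge_free g v w : adj v w -> cls v <> cls w -> G g -> move_v g v = v -> move_v g w = w -> g = 1.
Proof.
move=> vw nc gg mv mw; apply: contrapT => g1; apply: nc; have [Xv Xw _] := vw.
have nv : nonfree v by exists g.
have nw : nonfree w by exists g.
have [s _ fs] := nonfree_fix Xv nv; have [s' _ fs'] := nonfree_fix Xw nw.
rewrite (cls_line nv fs) (cls_line nw fs'); congr inr.
have [s0 hs f] := fs; have [s0' hs' f'] := fs'.
have i1 : isofix g s by split; rewrite ?f.
have i2 : isofix g s' by split; rewrite ?f'.
have [t es] := isofix_unique barK (group_SU gg) g1 i1 i2.
by rewrite es line_scale //; apply: contraNneq s0' => t0; rewrite es t0 scale0r.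
Qed.

(** Two vertices with the same line lie on rays towards it; the rays meet and stay in the fibre. *)
Lemma cls_fibre (V : Type) (tau : vertex -> V) :
  (forall v w, adj v w -> cls v = cls w -> tau v = tau w) ->
  forall v w, X v -> X w -> cls v = cls w -> tau v = tau w.
Proof.
move=> h v w Xv Xw; case: (cls_cases Xv) => [[_ ->]|[s [nv is_ fs ev]]].
  by case: (cls_cases Xw) => [[_ ->] [->]|[s [_ _ _ ->]]].
case: (cls_cases Xw) => [[_ ->]|[s' [nw _ fs' ew]]]; first by rewrite ev.
rewrite ev ew => -[]; have [s0 hs _] := fs; move=> /(line_eq s0)[t [t0 es]].
have fs2 : fixes_stab s w.
  have [_ _ f'] := fs'; split=> // g gg mg; by rewrite es -scalemxAr f'.
have H u n : X u -> nonfree u -> fixes_stab s u -> tau (iter n (pars s) u) = tau u.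
  move=> Xu nu fu; elim: n => //= n <-; have [X1 n1 f1] := iter_nonfree n Xu nu fu.
  have [n2 f2] := nonfree_pars X1 n1 f1; apply/esym/h; first exact: (adj_pars ar e0 nuE).
  by rewrite (cls_line n1 f1) (cls_line n2 f2).
have [n [m e1]] := merge_pars ar e0 nuE s0 hs Xv Xw.
by rewrite -(H v n) // e1 H.
Qed.

Lemma ball_fix g v : SU g -> X v -> (forall m x, vball v m x -> vball v m (g *m x)) ->
  (forall m x, vball v m x -> vball v m (g^-1 *m x)) -> move_v g v = v.
Proof.
move=> sg Xv h1 h2; have H m x : vball (move_v g v) m x <-> vball v m x.
  rewrite -{1}(mulmxV3 x sg) (vball_move barK Qbar e0 nuE) //; split=> [/h1|/h2] //.
  by rewrite (mulmxV3 _ sg).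
have [hz ev] := coordP barK Qbar e0 nuE Xv; move: (coord _ _ _ _) hz ev => [z j] /= hz ev.
have sz := SU_ua barK hz; move: H; rewrite ev (move_pt barK Qbar e0 nuE) // => H.
apply/(ptP barK Qbar e0 nuE _ _ (SU_mul sg sz) sz) => m x.
by rewrite -!(vball_pt barK Qbar e0 nuE) //; apply: SU_mul.
Qed.

Lemma tv_Gamma s (w : L) : intv s -> s != 0 -> herm s s = 0 -> B w -> w + bar w = 0 -> Gamma (tv bar s w).
Proof.
move=> is_ s0 hs Bw sw; split; first exact: (tv_SU barK).
move=> a b; rewrite mxE; apply: (ringD ar).
  by case: (a == b); [exact: (ring1 ar) | exact: (ring0 ar)].
by apply: (ringM ar); [apply: (ringM ar) | apply: (ring_bar ar)].
Qed.

(** For s in the ball n and Q w at least -n, the vector w h(x, s) s lies in every ball that contains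
    x. *)
Lemma tv_move s (w : L) v (n : int) : s != 0 -> herm s s = 0 -> w + bar w = 0 -> X v ->
  vball v n s -> pge Q w (- n) -> move_v (tv bar s w) v = v.
Proof.
move=> s0 hs sw Xv bs hw.
have H (w' : L) : pge Q w' (- n) -> forall m x, vball v m x -> vball v m (tv bar s w' *m x).
  move=> hw' m x bx; rewrite tvE; apply: (vballD barK Qbar e0 nuE) => //.
  have hg : hge Q w' (- (2 * n)) by apply: pge_hge hw'; lia.
  have := vballZ barK Qbar e0 nuE (hgeM hg (herm_vball barK Qbar e0 nuE bx bs)) bs.
  by apply: (vball_le e0); lia.
have st := tv_SU barK s0 hs sw.
have eV : (tv bar s w)^-1 = tv bar s (- w).
  by apply: (mulrI (SU_unit st)); rewrite tvV // mulrV // (SU_unit st).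
by apply: ball_fix => //; [exact: H | rewrite eV; apply/H/pgeN].
Qed.

Hypothesis two : (2 : L) != 0.

(* Transvections along s; passing from Gamma to its subgroup G of finite index
   costs a constant factor. *)
Lemma many_stab : exists K C : nat, forall (N : nat) v s, X v -> intv s -> s != 0 -> herm s s = 0 ->
  vball v (2 * N + C)%N%:Z s -> exists l : seq M, [/\ uniq l, (2 ^ N <= K * size l)%N &
    forall g, g \in l -> [/\ G g, move_v g v = v & g *m s = s]].
Proof.
have [C hC] := skew_many ar two; have [_ [r hr]] := hfin; exists (size r), C => N v s Xv is_ s0 hs bs.
have [w [uw sw hw]] := hC N.
have /choice[f hf] : forall o : L, exists y : M, o \in w -> y \in r /\ G (y^-1 * tv bar s o).
  move=> o; case: (boolP (o \in w)) => [ow|_]; last by exists 1.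
  have [Bo so _] := hw o ow; have gt := tv_Gamma is_ s0 hs Bo so.
  have [y [z [yr gz eyz]]] := hr _ gt; exists y => _; split=> //.
  have uz : z \is a GRing.unit := SU_unit (group_SU gz).
  have ut : tv bar s o \is a GRing.unit by case: gt => /SU_unit.
  have uy : y \is a GRing.unit by rewrite -(unitrMl y uz) -eyz.
  by rewrite eyz mulKr.
have w0 : (0 < size w)%N by apply: leq_trans sw; rewrite expn_gt0.
have [|y0 le] := fiber_seq w0 (f := f) (r := r); first by move=> o /hf[].
pose w' := seq.filter (fun o => f o == y0) w; rewrite -size_filter -/w' in le.
case ew : w' => [|o0 w1]; first by move: le; rewrite ew muln0 leqNgt w0.
have ho0 : o0 \in w' by rewrite ew mem_head.
have inw' o : o \in w' -> o \in w /\ f o = y0 by rewrite mem_filter => /andP[/eqP ? ?].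
exists (map (fun o => tv bar s (o - o0)) w'); split.
- by rewrite map_inj_uniq ?filter_uniq // => o o' /(tv_inj barK s0)/addIr.
- by rewrite size_map (leq_trans sw).
move=> _ /mapP[o /inw'[ow fo] ->]; have [o0w fo0] := inw' _ ho0.
have [Bo so po] := hw o ow; have [Bo0 so0 po0] := hw _ o0w.
have sd : (o - o0) + bar (o - o0) = 0 by rewrite rmorphB /= addrACA -opprD so so0 subr0.
split.
- have [_ g1] := hf o ow; have [_ g0] := hf _ o0w; rewrite (etrans fo0 (esym fo)) in g0.
  have st0 := tv_SU barK s0 hs so0; have ut0 := SU_unit st0.
  have uy : f o \is a GRing.unit.
    have u1 : (f o)^-1 * tv bar s o0 \is a GRing.unit := SU_unit (group_SU g0).
    by move: u1; rewrite unitrMl // unitrV.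
  have := groupM (groupV g0) g1; rewrite invrM ?unitrV // invrK mulrA mulrK //.
  have -> : (tv bar s o0)^-1 = tv bar s (- o0).
    by apply: (mulrI ut0); rewrite tvV // mulrV.
  by rewrite -tvD // addrC.
- by apply: (tv_move s0 hs sd Xv bs); apply: pgeB; [exact: po | exact: po0].
- exact: tv_fix.
Qed.

Lemma herm_int s s' : intv s -> intv s' -> B (herm s s').
Proof.
by move=> is_ is'; apply: (ringD ar); [apply: (ringD ar)|]; apply: (ringM ar) => //; apply: (ring_bar ar).
Qed.

(** The value h(s, s) is an element of B with a zero at Q. *)
Lemma short_isotropic v s (m : int) : 0 < m -> intv s -> vball v m s -> herm s s = 0.
Proof.
move=> m0 is_ bs; apply: (ring_nozero ar m0 (herm_int is_ is_)).
by case: (herm_vball barK Qbar e0 nuE bs bs) => [->|h]; [left | right; lia].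
Qed.

(** The stabilizing elements of G found by [many_stab] fix s, and a non-trivial one has no other
    fixed isotropic line. *)
Lemma deep_nonfree : exists C : nat, (0 < C)%N /\ forall v s, X v -> intv s -> s != 0 ->
  vball v C%:Z s -> nonfree v /\ fixes_stab s v.
Proof.
(* Since 2^K > K, the list obtained with N = K has two elements; the extra unit makes the constant
   positive, so that s is isotropic. *)
have [K [C hC]] := many_stab; exists (2 * K + C).+1; split=> // v s Xv is_ s0 bs.
have hs : herm s s = 0 by apply: (short_isotropic _ is_ bs); lia.
have bs' : vball v (2 * K + C)%N%:Z s by apply: (vball_le e0 _ bs); lia.
have [l [ul sl hl]] := hC K v s Xv is_ s0 hs bs'.
have l2 : (1 < size l)%N.
  rewrite ltnNge; apply/negP => l1; have := leq_trans sl (leq_mul (leqnn K) l1).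
  by rewrite muln1 leqNgt ltn_expl.
have [g [gl g1]] : exists g, g \in l /\ g <> 1.
  case: l ul l2 {sl hl} => [|a [|b l]] //= /andP[]; rewrite inE negb_or => /andP[ab _] _ _.
  have [ea|/eqP na] := eqVneq a 1; last by exists a; rewrite inE eqxx.
  by exists b; rewrite !inE eqxx orbT; split=> // eb; case/eqP: ab; rewrite ea eb.
have [gg mg gs] := hl _ gl; have nf : nonfree v by exists g.
split=> //; have [s' _ [s0' hs' fs']] := nonfree_fix Xv nf.
have i1 : isofix g s' by split; rewrite ?fs'.
have i2 : isofix g s by split.
have [t es] := isofix_unique barK (group_SU gg) g1 i1 i2.
by split=> // h gh mh; rewrite es -scalemxAr fs'.
Qed.

Definition shallow (C : nat) v : Prop := forall s, intv s -> s != 0 -> ~ vball v C%:Z s.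

(** A very short integral vector stays in the ball 0 after multiplication by a power of the inverse
    uniformizer; as vectors of that ball have bounded poles, its entries have zeros at Q. *)
Lemma shallow_ex v : X v -> exists n : nat, shallow n v.
Proof.
move=> Xv; have [N hN] := vball_bounded ar pL p2 e0 nuE 0 Xv; exists (2 * N.+1)%N => s is_ s0 bs.
case/eqP: s0; have [pi [pi0 pi1]] := uniformizer Q; pose c := pi^-1 ^+ N.+1.
have piV : pi^-1 != 0 by rewrite invr_eq0.
have Qc : Q c = - N.+1%:Z by rewrite /c placeX // placeV // pi1 mulrN mulr1.
have c0 : c != 0 by rewrite expf_neq0.
have := vballZ barK Qbar e0 nuE (hge_refl Q c) bs.
have -> : (2 * N.+1)%N%:Z + 2 * Q c = 0 by rewrite Qc; lia.
move=> /hN h; apply/colP => a; rewrite [RHS]mxE; have := h a; rewrite mxE => h1.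
apply: (ring_nozero ar (n := 1)) => //; case: h1 => [/eqP|h1].
  by rewrite mulf_eq0 (negPf c0) => /eqP ->; left.
have [->|sa] := eqVneq (s a 0) 0; first by left.
have h2 : - N%:Z <= Q c + Q (s a 0) by rewrite -placeMl.
have H (b : int) : - N%:Z <= - N.+1%:Z + b -> 1 <= b by clear; lia.
by right; rewrite Qc in h2; apply: H h2.
Qed.

(** Induction on the depth. If v carries an integral vector s of depth C + n + 1, then v is one step
    towards s from some u with the same fixed line, and u is less deep: a vector of that depth at u
    would be proportional to s, hence deeper still at v. The number of steps is recorded because it
    bounds the stabilizer from below. *)
Lemma descend (C : nat) :
  (forall v s, X v -> intv s -> s != 0 -> vball v C%:Z s -> nonfree v /\ fixes_stab s v) ->
  forall v, X v -> nonfree v -> exists s u (i : nat),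
  [/\ fixes_stab s u, nonfree u, X u, shallow C.+1 u & v = iter i (pars s) u /\
    (i = 0%N \/ exists s', [/\ intv s', s' != 0 & vball v (C + i)%N%:Z s'])].
Proof.
move=> hC; suff H n v : X v -> nonfree v -> shallow (C + n).+1 v -> exists s u (i : nat),
  [/\ fixes_stab s u, nonfree u, X u, shallow C.+1 u & [/\ (i <= n)%N, v = iter i (pars s) u &
    (i = 0%N \/ exists s', [/\ intv s', s' != 0 & vball v (C + i)%N%:Z s'])]].
  move=> v Xv nf; have [n hn] := shallow_ex Xv.
  have [|s [u [j [h1 h2 h3 h4 [_ h5 h6]]]]] := H n v Xv nf; last by exists s, u, j.
  by move=> s is_ s0 bs; apply: (hn s is_ s0); apply: (vball_le e0 _ bs); lia.
elim: n v => [|n IH] v Xv nf sh.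
  have [s _ fs] := nonfree_fix Xv nf; exists s, v, 0%N; split=> //; first by rewrite -[C]addn0.
  by split=> //; left.
have [sh'|nsh] := pselect (shallow (C + n).+1 v).
  have [s [u [j [h1 h2 h3 h4 [h5 h6 h7]]]]] := IH v Xv nf sh'; exists s, u, j; split=> //.
  by split=> //; apply: leqW.
have [s [is_ s0 bs]] : exists s, [/\ intv s, s != 0 & vball v (C + n).+1%:Z s].
  by apply: contrapT => no; apply: nsh => s is_ s0 bs; apply: no; exists s.
have bC : vball v C%:Z s by apply: (vball_le e0 _ bs); lia.
have [_ fs] := hC v s Xv is_ s0 bC; have [_ hs _] := fs.
have [u Xu ev] := pars_surj ar e0 nuE s0 hs Xv.
have bu : vball u (C + n)%N%:Z s.
  apply/(vball_pars ar e0 nuE s0 hs _ Xu); rewrite -ev; move: bs; congr vball; lia.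
have bu' : vball u C%:Z s by apply: (vball_le e0 _ bu); lia.
have [nu fu] := hC u s Xu is_ s0 bu'.
have shu : shallow (C + n).+1 u.
  move=> s' is' s0' bs'; have b1 : vball u C%:Z s' by apply: (vball_le e0 _ bs'); lia.
  have [_ fs'] := hC u s' Xu is' s0' b1; have [_ hs' _] := fs'.
  have [t [t0 es]] := fixes_parallel nu fu fs'.
  apply: (sh s' is' s0'); have := (vball_pars ar e0 nuE s0' hs' (C + n).+1%:Z Xu).2 bs'.
  rewrite es (pars_scale ar e0 nuE s0 hs t0 Xu) -ev; congr vball; lia.
have [s' [u' [j [h1 h2 h3 h4 [h5 h6 h7]]]]] := IH u Xu nu shu.
have fsu : fixes_stab s' u by rewrite h6; case: (iter_nonfree j h3 h2 h1).
have [t [t0 es]] := fixes_parallel nu fu fsu.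
exists s', u', j.+1; split=> //; split=> //.
  by rewrite /= -h6 es (pars_scale ar e0 nuE s0 hs t0 Xu).
by right; exists s; split=> //; apply: (vball_le e0 _ bs); lia.
Qed.

End Group.

(** * Finiteness of the quotient *)

Section Group.
Context (F : finFieldType) (k : fieldType) (L : fieldExtType k) (bar : 'AEnd(L)).
Context (i : {rmorphism F -> L}) (Q : place i) (B : set L) (d : nat).
Context (R : realType) (nuP : L -> R) (e p : nat) (G : subgroup 'M[L]_3).
Hypotheses (ar : arithmetic bar Q B d).
Hypotheses (pL : p \in [pchar L]) (p2 : (2 < p)%N).
Hypotheses (e0 : (0 < e)%N) (nuE : forall x, nuP x = (Q x)%:~R / e%:R).
Hypotheses (hfin : finite_index_in G (SU_over bar B)) (hp : no_p'_torsion p G).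
Local Notation M := 'M[L]_3.
Local Notation vertex := (set (M * R)).
Implicit Types (z : L * L) (g h : M) (v w : vertex) (x y s : 'cV[L]_3).
Local Notation ua := (ua bar).
Local Notation SU := (SU bar).
Local Notation herm := (herm bar).
Local Notation Gamma := (SU_over bar B).
Local Notation X := (vertices bar nuP).
Local Notation adj := (adj bar nuP e).
Local Notation vball := (vball bar Q nuP e).
Local Notation E0 := (col3 (1 : L) 0 0).

Let barK : involutive bar. Proof. exact: ar_barK ar. Qed.
Let Qbar (x : L) : Q (bar x) = Q x. Proof. exact: (ar_val_bar ar). Qed.

Local Notation group_SU := (group_SU hfin).
Local Notation move_vertex := (move_vertex barK Qbar e0 nuE).
Local Notation shallow := (shallow bar Q B nuP e).

Lemma mulmx_col (S : M) x : S *m x = \sum_a x a 0 *: col a S.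
Proof. by apply/colP => a; rewrite !mxE summxE; apply: eq_bigr => b _; rewrite !mxE mulrC. Qed.

Lemma vball_sum v m (f : 'I_3 -> 'cV[L]_3) : X v ->
  (forall a, vball v m (f a)) -> vball v m (\sum_a f a).
Proof.
move=> Xv h; apply: big_ind => [|x y|a _]; [|exact: (vballD barK Qbar e0 nuE) | exact: h].
have := h 0; case=> z [j [hz -> _]]; exists z, j; split=> //.
by rewrite /gball mulmx0; split; rewrite mxE; left.
Qed.

(** Bounds on the columns of S give bounds on the basis vectors, hence on the coordinates (u, w, j)
    of the vertex; sufficiently many digits of u and w then determine it. *)
Lemma near_finite (S : M) (m : int) : \det S != 0 ->
  finite_set [set v | X v /\ forall b, vball v m (col b S)].
Proof.
move=> dS; have uS : S \in unitmx by rewrite unitmxE unitfE.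
pose c := (\sum_a \sum_b `|Q (invmx S a b)|)%N; pose c0 := (`|m| + 2 * c)%N.
have std v b : X v -> (forall b, vball v m (col b S)) -> vball v (- c0%:Z) (delta_mx b 0).
  move=> Xv h; rewrite -[delta_mx b 0](mulKVmx uS) mulmx_col; apply: vball_sum => // a.
  rewrite -colE mxE; have hc : hge Q (invmx S a b) (- (2 * c%:Z)).
    right; have : (`|Q (invmx S a b)| <= c)%N.
      by rewrite /c (bigD1 a) //= (bigD1 b) //= -addnA leq_addr.
    have H (x : int) (n : nat) : (`|x| <= n)%N -> - (2 * n%:Z) <= 2 * x by clear; lia.
    exact: H.
  have := vballZ barK Qbar e0 nuE hc (h a); apply: (vball_le e0).
  by rewrite /c0; move: (c) (m); clear; lia.
(* From order -c0 on, 3 c0 digits give precision 2 c0, so that the product of [bar u] with the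
   difference of the first coordinates still has order at least c0. *)
have [_ h3 _] := ar_degree ar; have [dl hdl] := h3 (- c0%:Z) (3 * c0)%N.
have bounds v (u w : L) (j : int) : coord bar nuP e v = (u, w, j) -> X v -> (forall b, vball v m (col b S)) ->
    [/\ `|j| <= c0%:Z, pge Q u (- c0%:Z) & pge Q w (- c0%:Z)].
  move=> ec Xv h; have := coordP barK Qbar e0 nuE Xv; rewrite ec /= => -[hz ev].
  have sz := SU_ua barK hz; have := std v 2%R Xv h; have := std v 0 Xv h.
  have -> : delta_mx 0 0 = E0 by apply/colP => -[[|[|[|a]]] //= ha]; rewrite !mxE.
  have -> : delta_mx 2%R 0 = col3 (0 : L) 0 1 by apply/colP => -[[|[|[|a]]] //= ha]; rewrite !mxE.
  rewrite ev !(vball_pt barK Qbar e0 nuE) // /gball uaV_e0 // nball_e0 => j1.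
  rewrite uaV Hset_opp //= ua_col3 /= !mulr0 subr0 !mulr1 !add0r => /nball3[h1 h2 [/eqP|h4]].
    by rewrite oner_eq0.
  rewrite place1 in h4; have {}h1 : pge Q w (- c0%:Z).
    case: h1 => [/eqP|h1]; first by rewrite fmorph_eq0 => /eqP ->; left.
    rewrite Qbar in h1; right; move: j1 h1 h4; move: (Q w) (c0) (j) => a b t; clear; lia.
  have {}h2 : pge Q u (- c0%:Z).
    case: h2 => [/eqP|h2]; first by rewrite oppr_eq0 => /eqP ->; left.
    rewrite placeN in h2; right; move: h2; move: (Q u) (c0) => a b; clear; lia.
  by split=> //; move: j1 h4; move: (c0) (j) => b t; clear; lia.
pose code v := (inord (absz ((coord bar nuP e v).2 + c0%:Z)) : 'I_(2 * c0).+1,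
  dl (coord bar nuP e v).1.1, dl (coord bar nuP e v).1.2).
apply: (finite_set_code (c := code)) => v v' [Xv hv] [Xv' hv'] [e1 e2 e3].
case ec: (coord bar nuP e v) e1 e2 e3 => [[u w] j].
case ec': (coord bar nuP e v') => [[u' w'] j'] /= e1 e2 e3.
have [j1 u1 w1] := bounds _ _ _ _ ec Xv hv; have [j2 u2 w2] := bounds _ _ _ _ ec' Xv' hv'.
have du := hdl _ _ u2 u1 (esym e2); have dw := hdl _ _ w2 w1 (esym e3).
have [hz ev] := coordP barK Qbar e0 nuE Xv; have [hz' ev'] := coordP barK Qbar e0 nuE Xv'.
rewrite ec /= in hz ev; rewrite ec' /= in hz' ev'; rewrite ev ev'.
apply/(pt_uaP barK Qbar e0 nuE _ _ hz hz'); split.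
  move: j1 j2 e1; clear; move: c0 => b j1 j2 e1.
  by have := congr1 val e1; rewrite /= !inordK; lia.
have -> : (zdiff bar (u, w) (u', w')).2 = (w' - w) + bar u * (u' - u).
  move/HsetE: hz => hz; rewrite /zdiff /=; apply/eqP; rewrite -subr_eq0 -hz; apply/eqP; ring.
apply: pgeD.
  by apply: pge_le dw; move: j1; move: (c0) (j) => b t; clear; lia.
have u1' : pge Q (bar u) (- c0%:Z) by case: u1 => [->|h]; [rewrite rmorph0; left | right; rewrite Qbar].
have := pgeM u1' du; apply: pge_le; move: j1; move: (c0) (j) => b t; clear; lia.
Qed.

Lemma det_int (n : nat) (A : 'M[L]_n) : (forall a b, B (A a b)) -> B (\det A).
Proof.
move=> hA; apply: (ring_sum ar) => s; apply: (ringM ar); last first.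
  by apply: big_ind => [|x y|a _]; [exact: (ring1 ar) | exact: (ringM ar) | exact: hA].
by case: (perm.odd_perm s); rewrite /= ?expr1 ?expr0; [apply: (ringN ar) |]; exact: (ring1 ar).
Qed.

Lemma adj_int (A : M) : (forall a b, B (A a b)) -> forall a b, B (\adj A a b).
Proof.
move=> hA a b; rewrite mxE /cofactor; apply: (ringM ar).
  rewrite -signr_odd; case: (odd _); rewrite ?expr1 ?expr0; [apply: (ringN ar) |]; exact: (ring1 ar).
by apply: det_int => c c'; rewrite !mxE.
Qed.

Let gram (S : M) a b : L := herm (col a S) (col b S).

Let herm_gram (S : M) x y : herm (S *m x) (S *m y) =
  \sum_a \sum_b x a 0 * bar (y b 0) * gram S a b.
Proof.
have E (s : 'cV[L]_3) (f : 'I_3 -> 'cV[L]_3) : herm (\sum_a f a) s = \sum_a herm (f a) s.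
  by rewrite !big_ord_recl !big_ord0 !addr0 !hermDl.
have E' (s : 'cV[L]_3) (f : 'I_3 -> 'cV[L]_3) : herm s (\sum_a f a) = \sum_a herm s (f a).
  by rewrite !big_ord_recl !big_ord0 !addr0 !hermDr.
rewrite !mulmx_col E; apply: eq_bigr => a _; rewrite E'; apply: eq_bigr => b _.
by rewrite hermZl hermZr mulrA.
Qed.

Let det_ball v (N : nat) (S : M) : X v -> (forall b, vball v (- (2 * N%:Z)) (col b S)) ->
  pge Q (\det S) (- (3 * N)%N%:Z).
Proof.
move=> Xv h; have [hz ev] := coordP barK Qbar e0 nuE Xv; move: (coord _ _ _ _) hz ev => [z j] /= hz ev.
have sz := SU_ua barK hz; pose Y : M := (ua z)^-1 *m S.
have dY : \det S = \det Y by rewrite det_mulmx; have [-> _] := SU_inv sz; rewrite mul1r.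
have hY b : [/\ hge Q (Y 0 b) (- (2 * N%:Z) - j), hge Q (Y 1 b) (- (2 * N%:Z))
    & hge Q (Y 2%R b) (- (2 * N%:Z) + j)].
  have E a : ((ua z)^-1 *m col b S) a 0 = Y a b.
    by rewrite !mxE; apply: eq_bigr => c _; rewrite !mxE.
  by have := h b; rewrite ev (vball_pt barK Qbar e0 nuE) // => -[]; rewrite !E.
suff : hge Q (\det Y) (- (6 * N%:Z)).
  rewrite dY => -[->|le]; [by left | right; move: le; move: (\det Y) => t].
  have H (a : int) : - (6 * N%:Z) <= 2 * a -> - (3 * N)%N%:Z <= a by clear; lia.
  exact: H.
have T a b c : hge Q (Y 0 a * (Y 1 b * Y 2%R c)) (- (6 * N%:Z)).
  have [h1 _ _] := hY a; have [_ h2 _] := hY b; have [_ _ h3] := hY c.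
  by have := hgeM h1 (hgeM h2 h3); apply: hge_le; move: (j); clear; lia.
rewrite det3 !mulrBr.
have M (x y z' : L) : x * (y * z') = x * (z' * y) by rewrite [y * z']mulrC.
by apply: hgeD; [apply: hgeD; [|apply: hgeN] |]; apply: hgeD; do ?apply: hgeN; apply: T.
Qed.

(* S' S^-1 preserves h as the Gram matrices agree, and is integral as S' is
   congruent to S modulo det S. *)
Let transport (S S' : M) : (forall a b, B (S a b)) -> \det S != 0 -> \det S' = \det S ->
  (forall a b, gram S' a b = gram S a b) ->
  (forall a b, exists2 c, B c & S a b - S' a b = \det S * c) ->
  exists2 g, Gamma g & g *m S = S'.
Proof.
move=> iS dS dS' gS hc; have uS : S \in unitmx by rewrite unitmxE unitfE.
have /choice[c cP] : forall ab : 'I_3 * 'I_3, exists c, B c /\ S ab.1 ab.2 - S' ab.1 ab.2 = \det S * c.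
  by move=> ab; have [c Bc ec] := hc ab.1 ab.2; exists c.
pose C : M := \matrix_(a, b) c (a, b); pose g : M := 1 - C * \adj S.
have gE : g *m S = S'.
  rewrite mulmxBl mul1mx -[C * _]/(C *m _) -mulmxA mul_adj_mx mul_mx_scalar.
  apply/matrixP => a b; rewrite !mxE; have [_ ec] := cP (a, b); rewrite -ec /=.
  by rewrite opprB addrC subrK.
exists g => //; split; last first.
  move=> a b; rewrite mxE [X in _ + X]mxE; apply: (ringB ar).
    by rewrite mxE; case: (a == b); [exact: (ring1 ar) | exact: (ring0 ar)].
  rewrite mxE; apply: (ring_sum ar) => a'; apply: (ringM ar); last exact: adj_int.
  by rewrite mxE; case: (cP (a, a')).
split; first by apply: (mulIf dS); rewrite mul1r -det_mulmx gE.
move=> x y; rewrite -[x](mulKVmx uS) -[y](mulKVmx uS) !mulmxA gE -!mulmxA !herm_gram.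
by apply: eq_bigr => a _; apply: eq_bigr => b _; rewrite gS.
Qed.

(** A shallow vertex has a short basis of integral vectors. Its determinant, its Gram matrix and its
    residues modulo the determinant take finitely many values, and two bases with the same data
    differ by an element of Gamma. This carries v close to one of finitely many fixed bases, where
    [near_finite] applies; coset representatives pass from Gamma to G. *)
Lemma finite_orbits (C : nat) : exists l : set (vertex * vertex), finite_set l /\
  forall v w, adj v w -> shallow C v -> exists g, G g /\ l (move_v g v, move_v g w).
Proof.
have [N hN] := short_basis ar C.
pose P (S : M) v := [/\ forall a b, B (S a b), \det S != 0 &
  forall b, vball v (- (2 * N%:Z)) (col b S)].
have /choice[sg hsg] : forall v, exists S, X v -> shallow C v -> P S v.
  move=> v; have [[Xv sh]|no] := pselect (X v /\ shallow C v); last first.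
    by exists 1 => Xv sh; case: no.
  have [hz ev] := coordP barK Qbar e0 nuE Xv; move: (coord _ _ _ _) hz ev => [z j] /= hz ev.
  have sz := SU_ua barK hz; have [s is_ s0 hs|S [S1 S2 S3]] := hN z j hz; last first.
    exists S => _ _; split=> // b; rewrite ev; apply/(vball_pt barK Qbar e0 nuE) => //; exact: S3.
  apply: (sh s is_ s0); rewrite ev (vball_pt barK Qbar e0 nuE) //.
  by apply: (nball_le e0 _ hs); move: (C); clear; lia.
have [dl1 hdl1] := ring_code ar (3 * N); have [dl2 hdl2] := ring_code ar (2 * N).
have [n [r hr]] := residues ar (3 * N).
pose code v := (dl1 (\det (sg v)), [ffun ab : 'I_3 * 'I_3 => dl2 (gram (sg v) ab.1 ab.2)],
  [ffun ab : 'I_3 * 'I_3 => r (\det (sg v)) (sg v ab.1 ab.2)]).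
have /choice[ta hta] : forall u, exists S : M, \det S != 0 /\
    forall v, X v -> shallow C v -> code v = u -> exists2 v', [/\ X v', shallow C v' & code v' = u] & S = sg v'.
  move=> u; have [[v' h]|no] := pselect (exists v', [/\ X v', shallow C v' & code v' = u]).
    exists (sg v'); split=> [|v _ _ _]; last by exists v'.
    by have [Xv sh _] := h; have [] := hsg v' Xv sh.
  exists 1; split; first by rewrite det1 oner_eq0.
  by move=> v Xv sh ec; case: no; exists v.
have [_ [r0 hr0]] := hfin.
(* The extra -1 leaves room for the neighbour w. *)
pose near u := [set v | X v /\ forall b, vball v (- (2 * N%:Z) - 1) (col b (ta u))].
exists (\bigcup_(y in [set` r0]) \bigcup_(u in setT)
  (fun q => (move_v y^-1 q.1, move_v y^-1 q.2)) @` (near u `*` near u)); split.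
  apply: bigcup_finite => [|y _]; first exact: finite_seq.
  apply: bigcup_finite => [|u _]; first exact: finite_finset.
  by apply: finite_image; apply: finite_setX; apply: near_finite; case: (hta u).
move=> v w vw sh; have [Xv Xw _] := vw; have [dt ht'] := hta (code v).
have [v' [Xv' sh' ec] et] := ht' v Xv sh erefl.
have [iS dS bS] := hsg v Xv sh; have [iS' dS' bS'] := hsg v' Xv' sh'.
have gb u S : X u -> P S u -> forall a b, B (gram S a b) /\ pge Q (gram S a b) (- (2 * N)%N%:Z).
  move=> Xu [S1 S2 S3] a b; split.
    by apply: (herm_int ar) => c; rewrite mxE.
  apply/hge_pge; have := herm_vball barK Qbar e0 nuE (S3 a) (S3 b).
  by congr hge; clear; lia.
have [[e1 e2] e3] : (dl1 (\det (sg v')) = dl1 (\det (sg v)) /\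
    (forall a b, dl2 (gram (sg v') a b) = dl2 (gram (sg v) a b))) /\
    (forall a b, r (\det (sg v')) (sg v' a b) = r (\det (sg v)) (sg v a b)).
  case: ec => -> /ffunP f2 /ffunP f3; split; first split=> // a b.
    by have := f2 (a, b); rewrite !ffunE.
  by move=> a b; have := f3 (a, b); rewrite !ffunE.
have ed : \det (sg v') = \det (sg v).
  by apply: hdl1 e1; [exact: det_int | exact: det_int | exact: det_ball bS' | exact: det_ball bS].
have eg a b : gram (sg v') a b = gram (sg v) a b.
  have [B1 p1] := gb v _ Xv (hsg v Xv sh) a b; have [B2 p2'] := gb v' _ Xv' (hsg v' Xv' sh') a b.
  exact: hdl2 (e2 a b).
have [ga gg eS] : exists2 g, Gamma g & g *m sg v = sg v'.
  apply: transport => // a b; apply: hr => //; [exact: det_ball bS | exact: det_int |].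
  by rewrite -e3 ed.
have sga : SU ga by case: gg.
have colE b : col b (sg v') = ga *m col b (sg v) by rewrite -eS !colE mulmxA.
have [y [z [yr gz eyz]]] := hr0 _ gg.
have uz : z \is a GRing.unit := SU_unit (group_SU gz).
have uy : y \is a GRing.unit by rewrite -(unitrMl y uz) -eyz (SU_unit sga).
have ez : z = y^-1 * ga by rewrite eyz mulKr.
exists z; split=> //; exists y => //; exists (code v) => //; exists (move_v ga v, move_v ga w).
  split; (split; first exact: move_vertex) => b /=; rewrite et colE (vball_move barK Qbar e0 nuE) //.
    by apply: (vball_le e0 _ (bS b)); clear; lia.
  exact: (vball_adj barK Qbar e0 nuE vw).
by rewrite /= ez !moveM.
Qed.

End Group.

(** * The Euler characteristic *)

Lemma finite_set_inj (T U : Type) (S : set T) (l : set U) (c : T -> U) : finite_set l ->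
  (forall x, S x -> l (c x)) -> (forall x y, S x -> S y -> c x = c y -> x = y) -> finite_set S.
Proof.
move=> fl cl h; have [[x0 Sx0]|no] := pselect (exists x, S x); last first.
  by have -> : S = set0 by apply/seteqP; split=> // x Sx; case: no; exists x.
have /choice[f hf] : forall u, exists x, (exists2 y, S y & c y = u) -> S x /\ c x = u.
  by move=> u; have [[y Sy e]|no] := pselect (exists2 y, S y & c y = u); [exists y | exists x0].
apply: (@sub_finite_set _ _ (f @` l)); last exact: finite_image.
by move=> x Sx; exists (c x); [exact: cl | have [|Sf ef] := hf (c x); [exists x | apply: h]].
Qed.

Lemma finite_uniq (T : choiceType) (S : set T) : finite_set S ->
  exists s : seq T, uniq s /\ forall x, S x <-> x \in s.
Proof.
move=> /finite_seqP[s ->]; exists (undup s); split; first exact: undup_uniq.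
by move=> x; rewrite mem_undup.
Qed.

Lemma set2_eq (T : Type) (a b c d : T) : [set a; b] = [set c; d] ->
  (a = c /\ b = d) \/ (a = d /\ b = c).
Proof.
move=> e1; have : [set c; d] a by rewrite -e1; left.
have : [set c; d] b by rewrite -e1; right.
have : [set a; b] c by rewrite e1; left.
have : [set a; b] d by rewrite e1; right.
by move=> [] h1 [] h2 [] h3 [] h4; move: h1 h2 h3 h4 => /= *; subst; auto.
Qed.

Section Sums.
Context (R : realType) (T : choiceType).
Implicit Types (S : set T) (f : T -> R).

Lemma fsum_seq S f (s : seq T) : uniq s -> (forall x, S x <-> x \in s) ->
  (\sum_(x \in S) (f x)%:E)%E = (\sum_(x <- s) f x)%:E.
Proof.
move=> us hs; have -> : S = [set` s] by apply/seteqP; split=> x /hs.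
by rewrite -fsbig_seq // sumEFin.
Qed.

Lemma esum_seq S f (s : seq T) : uniq s -> (forall x, S x <-> x \in s) ->
  (forall x, S x -> 0 <= f x) ->
  (\esum_(x in S) (f x)%:E)%E = (\sum_(x <- s) f x)%:E.
Proof.
move=> us hs f0; rewrite esum_fset; first exact: fsum_seq.
  by apply/finite_seqP; exists s; apply/seteqP; split=> x /hs.
by move=> x; rewrite inE lee_fin => /f0.
Qed.

Lemma esum_bound S f (c : R) :
  (forall s : seq T, uniq s -> (forall x, x \in s -> S x) -> \sum_(x <- s) f x <= c) ->
  (\esum_(x in S) (f x)%:E <= c%:E)%E.
Proof.
move=> h; apply: ge_ereal_sup => _ [Y [fY YS] <-]; have [s [us hs]] := finite_uniq fY.
by rewrite (fsum_seq _ us hs) lee_fin; apply: h => // x /hs/YS.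
Qed.

Lemma sum_subset (r1 r2 : seq T) f : uniq r1 -> {subset r1 <= r2} -> (forall x, 0 <= f x) ->
  \sum_(x <- r1) f x <= \sum_(x <- r2) f x.
Proof.
move=> + + f0; elim: r1 r2 => [|a r1 IH] r2 /=; first by move=> _ _; rewrite big_nil sumr_ge0.
move=> /andP[na u1] sub; have a2 : a \in r2 by apply: sub; rewrite mem_head.
rewrite big_cons (big_rem a a2) /= lerD2l; apply: IH => // b b1.
have b2 : b \in r2 by apply: sub; rewrite inE b1 orbT.
have := perm_mem (perm_to_rem a2) b; rewrite b2 inE => /esym/orP[/eqP eb|//].
by move: na; rewrite -eb b1.
Qed.

(** Each power of 1/2 occurs twice, so the sum is at most twice the geometric series. *)
Lemma half_power_sum (n : nat) : \sum_(i < n) (2%:R ^+ (i./2) : R)^-1 <= 4%:R.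
Proof.
have H m : \sum_(i < m.*2) (2%:R ^+ (i./2) : R)^-1 = 4%:R - 4%:R / 2%:R ^+ m.
  elim: m => [|m IH]; first by rewrite big_ord0 expr0 divr1 subrr.
  have n0 : 2%:R ^+ m != 0 :> R by rewrite expf_neq0 // pnatr_eq0.
  rewrite doubleS !big_ord_recr /= IH doubleK uphalf_double exprS.
  by field.
apply: (@le_trans _ _ (\sum_(i < n.*2) (2%:R ^+ (i./2) : R)^-1)).
  rewrite -addnn big_split_ord /= lerDl; apply: sumr_ge0 => i _.
  by rewrite invr_ge0 exprn_ge0 // ler0n.
by rewrite H lerBlDr lerDl divr_ge0 ?exprn_ge0 ?ler0n.
Qed.

End Sums.

Section InverseCardinal.
Context (k : fieldType) (L : fieldExtType k) (R : realType).
Local Notation M := 'M[L]_3.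
Implicit Types S : set M.

Lemma inv_card_ge0 S : 0 <= inv_card R S.
Proof. by rewrite /inv_card invr_ge0 ler0n. Qed.

Lemma inv_card_seq S (s : seq M) : uniq s -> (forall x, S x <-> x \in s) ->
  inv_card R S = (size s)%:R^-1.
Proof.
move=> us hs; have fS : finite_set S by apply/finite_seqP; exists s; apply/seteqP; split=> x /hs.
rewrite /inv_card; congr (_%:R^-1); apply: perm_size; apply: uniq_perm => //.
move=> x; apply/idP/idP; first by rewrite (in_fset_set fS) inE => /hs.
by move=> xs; rewrite (in_fset_set fS) inE; apply/hs.
Qed.

Lemma inv_card1 : inv_card R [set (1 : M)] = 1.
Proof.
rewrite (@inv_card_seq _ [:: 1]) ?invr1 // => x; rewrite inE.
by split=> [->|/eqP].
Qed.

Lemma inv_card_le S (l : seq M) (K N : nat) : finite_set S -> uniq l -> (forall x, x \in l -> S x) ->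
  (N <= K * size l)%N -> (0 < N)%N -> inv_card R S <= K%:R / N%:R.
Proof.
move=> fS ul lS le N0; have [s [us hs]] := finite_uniq fS; rewrite (inv_card_seq us hs).
have les : (size l <= size s)%N by apply: uniq_leq_size => // x /lS/hs.
have s0 : (0 < size s)%N.
  by rewrite lt0n; apply: contraTneq N0 => s0; move: les le; rewrite s0 leqn0 => /eqP ->; rewrite muln0 leqn0 => /eqP ->.
rewrite ler_pdivlMr ?ltr0n // ler_pdivrMl ?ltr0n // -natrM ler_nat mulnC.
by apply: leq_trans le _; rewrite leq_mul2l les orbT.
Qed.

Lemma inv_card_image S (f : M -> M) : finite_set S -> injective f ->
  inv_card R [set f x | x in S] = inv_card R S.
Proof.
move=> fS fi; have [s [us hs]] := finite_uniq fS; rewrite (inv_card_seq us hs).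
rewrite (@inv_card_seq _ (map f s)) ?size_map ?map_inj_uniq // => x; split.
  by move=> [y /hs ys <-]; apply: map_f.
by move=> /mapP[y /hs ys ->]; exists y.
Qed.

End InverseCardinal.

Section Group.
Context (F : finFieldType) (k : fieldType) (L : fieldExtType k) (bar : 'AEnd(L)).
Context (i : {rmorphism F -> L}) (Q : place i) (B : set L) (d : nat).
Context (R : realType) (nuP : L -> R) (e p : nat) (G : subgroup 'M[L]_3).
Hypotheses (ar : arithmetic bar Q B d).
Hypotheses (pL : p \in [pchar L]) (p2 : (2 < p)%N).
Hypotheses (e0 : (0 < e)%N) (nuE : forall x, nuP x = (Q x)%:~R / e%:R).
Hypotheses (hfin : finite_index_in G (SU_over bar B)) (hp : no_p'_torsion p G).
Local Notation M := 'M[L]_3.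
Local Notation vertex := (set (M * R)).
Implicit Types (z : L * L) (g h : M) (v w : vertex) (x y s : 'cV[L]_3).
Local Notation SU := (SU bar).
Local Notation herm := (herm bar).
Local Notation X := (vertices bar nuP).
Local Notation adj := (adj bar nuP e).
Local Notation vball := (vball bar Q nuP e).
Local Notation intv := (intv B).

Let barK : involutive bar. Proof. exact: ar_barK ar. Qed.
Let Qbar (x : L) : Q (bar x) = Q x. Proof. exact: (ar_val_bar ar). Qed.

Local Notation nonfree := (nonfree G).
Local Notation fixes_stab := (fixes_stab bar G).
Local Notation cls := (cls bar G).
Local Notation pars := (pars bar nuP e).
Local Notation group_SU := (group_SU hfin).
Local Notation move_vertex := (move_vertex barK Qbar e0 nuE).
Local Notation nonfree_fix := (nonfree_fix ar pL p2 e0 nuE hfin hp).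
Local Notation shallow := (shallow bar Q B nuP e).
Local Notation par0 := (par0 bar nuP e).
Local Notation par0X := (par0X barK Qbar e0 nuE).
Local Notation cls_line := (cls_line ar hfin).
Local Notation nonfree_pars := (nonfree_pars ar pL p2 e0 nuE hfin hp).
Local Notation clsG := (clsG ar pL p2 e0 nuE hfin hp).

Hypothesis two : (2 : L) != 0.
Context (V0 : set vertex) (Es : set (set vertex)).
Hypothesis hV0 : orbit_reps (@act_v _ L R) G X V0.
Hypothesis hEs : orbit_reps (@act_e _ L R) G (edges bar nuP) Es.

Lemma move_e2 g v w : move_e g [set v; w] = [set move_v g v; move_v g w].
Proof. by rewrite /move_e image_setU !image_set1. Qed.

Lemma move_eM g h (E : set vertex) : move_e (g * h) E = move_e g (move_e h E).
Proof.
apply/seteqP; split=> [_ [v Ev <-]|_ [_ [v Ev <-] <-]].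
  by exists (move_v h v); [exists v | rewrite moveM].
by exists v; rewrite // moveM.
Qed.

Lemma move_e1 (E : set vertex) : move_e 1 E = E.
Proof.
by apply/seteqP; split=> [_ [v Ev <-]|v Ev]; [rewrite move1 | exists v; rewrite ?move1].
Qed.

Lemma rep_v v v' g : V0 v -> V0 v' -> G g -> move_v g v = v' -> v = v'.
Proof.
move=> Vv Vv' gg ev; have [VX h] := hV0; have [s [_ us]] := h _ (VX _ Vv').
have <- : s = v by apply: us; split=> //; exists g.
by apply: us; split=> //; exists 1; [exact: group1 | exact: move1].
Qed.

Lemma rep_e (E E' : set vertex) g : Es E -> Es E' -> G g -> move_e g E = E' -> E = E'.
Proof.
move=> Vv Vv' gg ev; have [VX h] := hEs; have [s [_ us]] := h _ (VX _ Vv').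
have <- : s = E by apply: us; split=> //; exists g.
by apply: us; split=> //; exists 1; [exact: group1 | exact: move_e1].
Qed.

Definition free_edge (E : set vertex) : Prop := exists v w, [/\ adj v w, cls v <> cls w & E = [set v; w]].

Lemma free_edgeP v w : adj v w -> free_edge [set v; w] <-> cls v <> cls w.
Proof.
move=> vw; split=> [[v' [w' [vw' nc e1]]]|nc]; last by exists v, w.
by case: (set2_eq e1) => -[-> ->] // /esym.
Qed.

Lemma free_edge_move g E : G g -> free_edge E -> free_edge (move_e g E).
Proof.
move=> gg [v [w [vw nc ->]]]; have sg := group_SU gg; have [Xv Xw _] := vw.
exists (move_v g v), (move_v g w); rewrite move_e2; split=> //.
  exact: (adj_move barK Qbar e0 nuE sg vw).
rewrite !clsG // => /(congr1 (actW g^-1)); rewrite -!actWM mulVr ?(SU_unit sg) // !actW1.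
by [].
Qed.

Lemma stab_edge v w g : adj v w -> G g -> move_e g [set v; w] = [set v; w] ->
  move_v g v = v /\ move_v g w = w.
Proof.
move=> vw gg; rewrite move_e2 => e2; case: (set2_eq e2) => -[e1 e3] //.
by case: (adj_noinv barK Qbar e0 nuE (group_SU gg) vw e1).
Qed.

(** A vector of depth C + 1 at v has depth C at w and would put both ends on the same line. *)
Lemma free_edge_shallow (C : nat) v w :
  (forall v s, X v -> intv s -> s != 0 -> vball v C%:Z s -> nonfree v /\ fixes_stab s v) ->
  adj v w -> cls v <> cls w -> shallow C.+1 v.
Proof.
move=> hC vw nc s is_ s0 bs; apply: nc; have [Xv Xw _] := vw.
have bw : vball w C%:Z s.
  by have := vball_adj barK Qbar e0 nuE vw bs; congr vball; clear; lia.
have bv : vball v C%:Z s by apply: (vball_le e0 _ bs); clear; lia.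
have [nv fv] := hC v s Xv is_ s0 bv; have [nw fw] := hC w s Xw is_ s0 bw.
by rewrite (cls_line nv fv) (cls_line nw fw).
Qed.

Let adj_par0 v : X v -> adj v (par0 v).
Proof. by move=> Xv; split=> //; [exact: par0X | left]. Qed.

Let orbit_choice (C : nat) : exists (l : set (vertex * vertex)) (fr : vertex * vertex -> M),
  finite_set l /\ forall v w, adj v w -> shallow C v ->
    G (fr (v, w)) /\ l (move_v (fr (v, w)) v, move_v (fr (v, w)) w).
Proof.
have [l [fl hl]] := finite_orbits ar e0 nuE hfin C.
have /choice[fr hfr] : forall q : vertex * vertex, exists g, adj q.1 q.2 -> shallow C q.1 ->
    G g /\ l (move_v g q.1, move_v g q.2).
  move=> q; have [[a1 a2]|no] := pselect (adj q.1 q.2 /\ shallow C q.1); last first.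
    by exists 1 => a1 a2; case: no.
  by have [g hg] := hl _ _ a1 a2; exists g.
by exists l, fr; split=> // v w; apply: (hfr (v, w)).
Qed.

Let same_orbit g g' v v' : G g -> G g' -> move_v g v = move_v g' v' ->
  G (g'^-1 * g) /\ move_v (g'^-1 * g) v = v'.
Proof.
move=> gg gg' e1; split; first exact: groupM (groupV gg') gg.
by rewrite moveM e1 (moveK _ (group_SU gg')).
Qed.

Lemma free_vertices_finite : finite_set [set v | V0 v /\ ~ nonfree v].
Proof.
have [C [C0 hC]] := deep_nonfree ar pL p2 e0 nuE hfin hp two.
have [l [fr [fl hfr]]] := orbit_choice C; have [VX _] := hV0.
apply: (finite_set_inj (c := fun v => (move_v (fr (v, par0 v)) v, move_v (fr (v, par0 v)) (par0 v))) fl).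
  move=> v [Vv nf]; have Xv := VX _ Vv; have [|//] := hfr v (par0 v) (adj_par0 Xv).
  by move=> s is_ s0 bs; case: nf; case: (hC v s Xv is_ s0 bs).
have H v : V0 v -> ~ nonfree v -> G (fr (v, par0 v)).
  move=> Vv nf; have Xv := VX _ Vv; have [|//] := hfr v (par0 v) (adj_par0 Xv).
  by move=> s is_ s0 bs; case: nf; case: (hC v s Xv is_ s0 bs).
move=> v v' [Vv nf] [Vv' nf'] [e1 _]; have [gg ev] := same_orbit (H v Vv nf) (H v' Vv' nf') e1.
exact: rep_v ev.
Qed.

Lemma free_edges_finite : finite_set [set E | Es E /\ free_edge E].
Proof.
have [C [C0 hC]] := deep_nonfree ar pL p2 e0 nuE hfin hp two.
have [l [fr [fl hfr]]] := orbit_choice C.+1.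
have /choice[ch hch] : forall E : set vertex, exists q, free_edge E ->
    [/\ adj q.1 q.2, cls q.1 <> cls q.2 & E = [set q.1; q.2]].
  move=> E; have [[v [w h]]|no] := pselect (free_edge E); first by exists (v, w).
  by exists (setT, setT).
have H E : free_edge E -> G (fr (ch E)) /\ l (move_v (fr (ch E)) (ch E).1, move_v (fr (ch E)) (ch E).2).
  move=> /hch[]; case: (ch E) => v w /= vw nc _; apply: hfr => //.
  exact: (free_edge_shallow hC vw nc).
apply: (finite_set_inj (c := fun E => (move_v (fr (ch E)) (ch E).1, move_v (fr (ch E)) (ch E).2)) fl).
  by move=> E [_ /H[]].
move=> E E' [EE fE] [EE' fE'] [e1 e2]; have [g1 _] := H E fE; have [g2 _] := H E' fE'.
have [gg ev] := same_orbit g1 g2 e1; have [_ ew] := same_orbit g1 g2 e2.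
have [_ _ eE] := hch E fE; have [_ _ eE'] := hch E' fE'.
move: gg ev ew; set h := _ * _ => gg ev ew; apply: (rep_e EE EE' gg).
by rewrite [in LHS]eE move_e2 ev ew -eE'.
Qed.

Lemma pars_move_iter h s v n : SU h -> s != 0 -> herm s s = 0 -> X v ->
  move_v h (iter n (pars s) v) = iter n (pars (h *m s)) (move_v h v).
Proof.
move=> sh s0 hs Xv; have XI m : X (iter m (pars s) v).
  by elim: m => //= m; apply: (parsX ar e0 nuE).
by elim: n => //= n <-; rewrite (pars_move ar e0 nuE).
Qed.

Lemma pars_scale_iter s c v n : s != 0 -> herm s s = 0 -> c != 0 -> X v ->
  iter n (pars (c *: s)) v = iter n (pars s) v.
Proof.
move=> s0 hs c0 Xv; have XI m : X (iter m (pars s) v).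
  by elim: m => //= m; apply: (parsX ar e0 nuE).
by elim: n => //= n ->; rewrite (pars_scale ar e0 nuE).
Qed.

Let weight v : R := inv_card R (stab_v G v).

Let stab_finite v : X v -> finite_set (stab_v G v).
Proof.
move=> Xv; apply: sub_finite_set (transporter_finite ar pL p2 e0 nuE Xv Xv).
by move=> g [gg mg]; split=> //; apply: (group_Gamma hfin).
Qed.

(** The exponent is halved because [many_stab] needs depth 2N for 2^N elements up to a constant; K
    is raised by one so that the bound also covers n = 0, where only the identity is available. *)
Let weight_bound : exists K C : nat,
  (forall v s, X v -> intv s -> s != 0 -> vball v C%:Z s -> nonfree v /\ fixes_stab s v) /\
  forall v (n : nat), X v ->
    (n = 0%N \/ exists s', [/\ intv s', s' != 0 & vball v (C + n)%N%:Z s']) ->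
    weight v <= K%:R / 2%:R ^+ n./2.
Proof.
have [C1 [C10 hC1]] := deep_nonfree ar pL p2 e0 nuE hfin hp two.
have [K [C hK]] := many_stab ar pL p2 e0 nuE hfin two.
exists K.+1, (C1 + C)%N; split=> [v s Xv is_ s0 bs|v n Xv hn].
  by apply: hC1 => //; apply: (vball_le e0 _ bs); clear; lia.
have triv : weight v <= 1.
  have := @inv_card_le _ L R (stab_v G v) [:: 1] 1 1 (stab_finite Xv) erefl.
  rewrite divr1; apply=> // x; rewrite inE => /eqP ->.
  by split; [exact: group1 | exact: move1].
case: hn => [->|[s [is_ s0 bs]]].
  by rewrite expr0 divr1; apply: le_trans triv _; rewrite ler1n.
have hs : herm s s = 0 by apply: (short_isotropic ar pL p2 e0 nuE two _ is_ bs); move: C10; clear; lia.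
have bs' : vball v (2 * n./2 + C)%N%:Z s by apply: (vball_le e0 _ bs); clear; lia.
have [l [ul sl hl]] := hK n./2 v s Xv is_ s0 hs bs'.
rewrite -natrX; apply: (inv_card_le R (stab_finite Xv) ul).
- by move=> g /hl[].
- by apply: leq_trans sl _; rewrite leq_mul2r leqnSn orbT.
- by rewrite expn_gt0.
Qed.

(** By [descend], a representative is coded by the orbit of a shallow vertex, of which there are
    finitely many, and by a number of steps; for each such orbit the weights decay geometrically. *)
Lemma nonfree_sum_bound : exists c : R,
  forall s : seq vertex, uniq s -> (forall v, v \in s -> V0 v /\ nonfree v) ->
    \sum_(v <- s) weight v <= c.
Proof.
have [K [C [hC hw]]] := weight_bound; have [l [fr [fl hfr]]] := orbit_choice C.+1.
have [VX _] := hV0.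
have /choice[ch hch] : forall v, exists q : 'cV[L]_3 * vertex * nat, X v -> nonfree v ->
  [/\ fixes_stab q.1.1 q.1.2, nonfree q.1.2, X q.1.2, shallow C.+1 q.1.2 &
    v = iter q.2 (pars q.1.1) q.1.2 /\
    (q.2 = 0%N \/ exists s', [/\ intv s', s' != 0 & vball v (C + q.2)%N%:Z s'])].
  move=> v; have [[Xv nv]|no] := pselect (X v /\ nonfree v); last first.
    by exists (0, v, 0%N) => Xv nv; case: no.
  by have [s [u [n h]]] := descend ar pL p2 e0 nuE hfin hp two hC Xv nv; exists (s, u, n).
pose g v := fr ((ch v).1.2, par0 (ch v).1.2).
pose code v := (move_v (g v) (ch v).1.2, (ch v).2).
have [ls [uls hls]] := finite_uniq (finite_image fst fl).
exists ((size ls)%:R * (K%:R * 4%:R)) => s us hs.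
have hg v : V0 v -> nonfree v -> G (g v) /\ (code v).1 \in ls.
  move=> /VX Xv nv; have [_ _ Xu su _] := hch v Xv nv.
  have [gg lg] := hfr _ _ (adj_par0 Xu) su; split=> //.
  by apply/hls; eexists; first exact: lg.
(* Equal codes give an element of G carrying one starting vertex to the other, hence one fixed line
   to the other and one ray to the other. *)
have code_inj : {in s &, injective code}.
  move=> v v' /hs[Vv nv] /hs[Vv' nv'] [e1 e2]; have Xv := VX _ Vv; have Xv' := VX _ Vv'.
  have [fs nu Xu _ [ev _]] := hch v Xv nv; have [fs' nu' Xu' _ [ev' _]] := hch v' Xv' nv'.
  have [gg _] := hg v Vv nv; have [gg' _] := hg v' Vv' nv'.
  have [gh eh] := same_orbit gg gg' e1; move: gh eh; set h := _ * _ => gh eh.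
  have fh := fixes_move hfin gh fs; rewrite eh in fh.
  have [t [t0 et]] := fixes_parallel ar hfin nu' fh fs'; have [s0 hs0 _] := fs; have [hs0' hhs _] := fh.
  apply: (rep_v Vv Vv' gh); rewrite ev' et (pars_scale_iter _ hs0' hhs t0 Xu') -e2 -eh.
  by rewrite -(pars_move_iter _ (group_SU gh) s0 hs0 Xu) -ev.
pose D := (\max_(v <- s) (ch v).2).+1.
pose f (q : vertex * nat) : R := K%:R / 2%:R ^+ q.2./2.
have f0 q : 0 <= f q by rewrite divr_ge0 ?exprn_ge0 ?ler0n.
have s1 : \sum_(v <- s) weight v <= \sum_(v <- s) f (code v).
  rewrite big_seq [X in _ <= X]big_seq; apply: ler_sum => v /hs[/VX Xv nv].
  by have [_ _ _ _ [_ h]] := hch v Xv nv; apply: hw.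
apply: le_trans s1 _; rewrite -(big_map code xpredT f).
apply: (@le_trans _ _ (\sum_(q <- allpairs pair ls (iota 0 D)) f q)).
  apply: sum_subset => //; first by rewrite map_inj_in_uniq.
  move=> _ /mapP[v vs ->]; have [Vv nv] := hs v vs; have [_ cl] := hg v Vv nv.
  apply/allpairsP; exists (code v); split=> //.
  by rewrite mem_iota /= add0n ltnS /D /code /= (big_rem v vs) /= leq_max leqnn.
rewrite big_allpairs_dep /=.
apply: (@le_trans _ _ (\sum_(x <- ls) (K%:R * 4%:R))).
  have hs2 : \sum_(i <- iota 0 D) (2%:R ^+ i./2 : R)^-1 <= 4%:R.
    have := half_power_sum R D; rewrite -(big_mkord xpredT (fun i => (2%:R ^+ i./2 : R)^-1)).
    by rewrite /index_iota subn0.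
  apply: ler_sum => x _; rewrite /f /= -mulr_sumr ler_wpM2l ?ler0n //.
by rewrite big_const_seq count_predT iter_addr_0 [leRHS]mulr_natl.
Qed.

Let sv : exists f : vertex -> 'cV[L]_3, forall v, X v -> nonfree v -> fixes_stab (f v) v.
Proof.
have /choice[f hf] : forall v, exists s, X v -> nonfree v -> fixes_stab s v.
  move=> v; have [[Xv nv]|no] := pselect (X v /\ nonfree v); last by exists 0 => Xv nv; case: no.
  by have [s _ fs] := nonfree_fix Xv nv; exists s.
by exists f.
Qed.

(* A nonfree vertex has the same stabilizer as the edge starting from it in the
   direction of its cusp, and every nonfree edge arises once in this way. *)
Lemma nonfree_edges : exists phi : vertex -> set vertex,
  set_bij [set v | V0 v /\ nonfree v] [set E | Es E /\ ~ free_edge E] phi /\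
  forall v, V0 v -> nonfree v -> inv_card R (stab_e G (phi v)) = weight v.
Proof.
have [s hs] := sv; have [VX Vr] := hV0; have [EX Er] := hEs.
pose ed v := [set v; pars (s v) v].
have adv v : X v -> nonfree v -> adj v (pars (s v) v).
  by move=> Xv nv; have [s0 h0 _] := hs v Xv nv; apply: (adj_pars ar e0 nuE).
have nfe v : X v -> nonfree v -> ~ free_edge (ed v).
  move=> Xv nv /(free_edgeP (adv v Xv nv)); apply; have fs := hs v Xv nv.
  by have [n1 f1] := nonfree_pars Xv nv fs; rewrite (cls_line nv fs) (cls_line n1 f1).
have /choice[ph hph] : forall v, exists q : set vertex * M, X v -> nonfree v ->
    [/\ Es q.1, G q.2 & move_e q.2 q.1 = ed v].
  move=> v; have [[Xv nv]|no] := pselect (X v /\ nonfree v); last first.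
    by exists (set0, 1) => Xv nv; case: no.
  have [|E [[EE [g gg ge]] _]] := Er (ed v); last by exists (E, g).
  by apply/(edge_adjP barK Qbar e0 nuE); exists v, (pars (s v) v); split=> //; apply: adv.
exists (fun v => (ph v).1); split.
  split=> [v [/VX Xv nv]|v v' /set_mem[Vv nv] /set_mem[Vv' nv'] /= e1|E [EE nE]].
  - have [EE gg ge] := hph v Xv nv; split=> // fE; apply: (nfe v Xv nv).
    by rewrite -ge; apply: free_edge_move.
  - have Xv := VX _ Vv; have Xv' := VX _ Vv'.
    have [EE gg ge] := hph v Xv nv; have [EE' gg' ge'] := hph v' Xv' nv'.
    pose g := (ph v').2 * (ph v).2^-1; have gG : G g by exact: groupM gg' (groupV gg).
    have : move_e g (ed v) = ed v'.
      by rewrite -ge -ge' /g -e1 -move_eM mulrVK // (SU_unit (group_SU gg)).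
    rewrite /ed move_e2 => e2; case: (set2_eq e2) => -[ev ew]; first exact: rep_v ev.
    have fs := hs v Xv nv; have fs' := hs v' Xv' nv'; have [s0 h0 _] := fs; have [s0' h0' _] := fs'.
    have [n1 f1] := nonfree_pars Xv nv fs.
    have f2 : fixes_stab (g *m s v) v' by rewrite -ew; apply: (fixes_move hfin gG).
    have [t [t0 et]] := fixes_parallel ar hfin nv' f2 fs'; have [h2 h2' _] := f2.
    case: (pars_no2 ar e0 nuE s0' h0' Xv'); rewrite -[in RHS]ew -ev.
    rewrite (pars_move ar e0 nuE s0 h0 (group_SU gG) Xv) et.
    by rewrite (pars_scale ar e0 nuE h2 h2' t0) //; apply: move_vertex => //; apply: group_SU.
  - have /(edge_adjP barK Qbar e0 nuE)[v [w [vw eE]]] := EX _ EE.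
    have ec : cls v = cls w by apply: contrapT => nc; apply: nE; exists v, w.
    have [Xv Xw _] := vw.
    have [t [_ nv nw fv [fw hvw]]] := cls_adj ar pL p2 e0 nuE hfin hp vw ec.
    have [u [Xu nu eu fu]] : exists u, [/\ X u, nonfree u, E = [set u; pars t u] & fixes_stab t u].
      by case: hvw => e1; [exists v; rewrite -e1 | exists w; rewrite -e1 setUC].
    have [u0 [[Vu [g gg gu]] _]] := Vr u Xu.
    have nu0 : nonfree u0 by apply/(nonfree_moveE hfin u0 gg); rewrite gu.
    have Xu0 := VX _ Vu; exists u0 => //; have [EE0 gg0 ge0] := hph u0 Xu0 nu0.
    have fs := hs u0 Xu0 nu0; have [s0 h0 _] := fs.
    have f2 : fixes_stab (g *m s u0) u by rewrite -gu; apply: (fixes_move hfin gg).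
    have [c [c0 ec']] := fixes_parallel ar hfin nu f2 fu; have [h2 h2' _] := f2.
    apply: (rep_e EE0 EE (groupM gg gg0)); rewrite move_eM ge0 eu /ed move_e2 gu.
    congr [set _; _]; rewrite (pars_move ar e0 nuE s0 h0 (group_SU gg) Xu0) gu ec'.
    by rewrite (pars_scale ar e0 nuE h2 h2' c0 Xu).
move=> v /VX Xv nv; have [EE gg ge] := hph v Xv nv; have sg := group_SU gg; have ug := SU_unit sg.
have fs := hs v Xv nv; have [s0 h0 f0] := fs.
rewrite /weight -(@inv_card_image _ L R (stab_v G v) (fun h => (ph v).2^-1 * h * (ph v).2)) //; last first.
- by move=> a b /(mulIr ug)/(mulrI (_ : _ \is a GRing.unit)); apply; rewrite unitrV.
- exact: stab_finite.
congr inv_card; apply/seteqP; split=> [h [gh eh]|_ [h [gh mh] <-]].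
  exists ((ph v).2 * h * (ph v).2^-1); last first.
    by rewrite !mulrA mulVr // mul1r mulrVK.
  have gc : G ((ph v).2 * h * (ph v).2^-1) by exact: groupM (groupM gg gh) (groupV gg).
  split=> //; have [] := stab_edge (adv v Xv nv) gc _ => //.
  by rewrite -/(ed v) -ge -move_eM mulrVK // move_eM; congr move_e.
have gc : G ((ph v).2^-1 * h * (ph v).2) by exact: groupM (groupM (groupV gg) gh) gg.
split=> //; rewrite /= /act_e move_eM ge move_eM /ed move_e2 (mh : move_v h v = v).
rewrite (pars_fix ar e0 nuE s0 h0 (group_SU gh) Xv (f0 h gh mh) mh) -/(ed v) -ge.
by rewrite -move_eM mulVr // move_e1.
Qed.

Let free_weight v : ~ nonfree v -> weight v = 1.
Proof.
move=> nv; rewrite /weight; have -> : stab_v G v = [set (1 : M)]; last exact: inv_card1.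
apply/seteqP; split=> [g [gg mg]|_ ->].
  by apply: contrapT => g1; apply: nv; exists g.
by split; [exact: group1 | exact: move1].
Qed.

Let free_edge_weight E : free_edge E -> inv_card R (stab_e G E) = 1.
Proof.
move=> [v [w [vw nc ->]]]; have -> : stab_e G [set v; w] = [set (1 : M)]; last exact: inv_card1.
apply/seteqP; split=> [g [gg mg]|_ ->]; last by split; [exact: group1 | exact: move_e1].
have [mv mw] := stab_edge vw gg mg.
exact: (edge_free ar pL p2 e0 nuE hfin hp vw nc gg mv mw).
Qed.

(** c is the common contribution of nonfree vertices and nonfree edges: it is finite and cancels in
    [chi]. *)
Lemma chi_formula (vs : seq vertex) (es : seq (set vertex)) :
  uniq vs -> (forall v, [set v | V0 v /\ ~ nonfree v] v <-> v \in vs) ->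
  uniq es -> (forall E, [set E | Es E /\ free_edge E] E <-> E \in es) ->
  exists c : R, sum_v G V0 = ((size vs)%:R + c)%:E /\ sum_e G Es = ((size es)%:R + c)%:E.
Proof.
move=> uv hv ue he; pose Sn := (\esum_(v in [set v | V0 v /\ nonfree v]) (weight v)%:E)%E.
have w0 v : 0 <= weight v by apply: inv_card_ge0.
have [c eS] : exists c : R, Sn = c%:E.
  have [c hc] := nonfree_sum_bound.
  have le : (Sn <= c%:E)%E by apply: esum_bound => s us hs; apply: hc.
  have ge : (0 <= Sn)%E by apply: esum_ge0 => v _; rewrite lee_fin.
  by exists (fine Sn); rewrite fineK // ge0_fin_numE // (le_lt_trans le) // ltry.
exists c; rewrite !EFinD -eS; split.
  rewrite /sum_v (esumID nonfree); last by move=> v _; rewrite lee_fin; apply: w0.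
  rewrite addeC; congr (_ + _)%E.
  rewrite (_ : V0 `&` ~` nonfree = [set v | V0 v /\ ~ nonfree v]) //.
  rewrite (esum_seq uv hv) => [|v _]; last exact: w0.
  rewrite (eq_big_seq (fun=> 1)) => [|v /hv[_ nv]]; last exact: free_weight.
  by rewrite big_const_seq count_predT iter_addr_0.
rewrite /sum_e (esumID free_edge); last by move=> E _; rewrite lee_fin; apply: inv_card_ge0.
congr (_ + _)%E.
  rewrite (_ : Es `&` free_edge = [set E | Es E /\ free_edge E]) //.
  rewrite (esum_seq ue he) => [|E _]; last exact: inv_card_ge0.
  rewrite (eq_big_seq (fun=> 1)) => [|E /he[_ fE]]; last exact: free_edge_weight.
  by rewrite big_const_seq count_predT iter_addr_0.
have [phi [bphi wphi]] := nonfree_edges.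
rewrite (_ : Es `&` ~` free_edge = [set E | Es E /\ ~ free_edge E]) //.
rewrite (@reindex_esum R _ _ [set v | V0 v /\ nonfree v] [set E | Es E /\ ~ free_edge E]
  phi (fun E => (inv_card R (stab_e G E))%:E) bphi).
by apply: eq_esum => v [Vv nv]; rewrite wphi.
Qed.

End Group.

(** * Homomorphisms killing the elements of order p *)

(** A rational relation becomes integral after multiplication by the product of its denominators. *)
Lemma int_row_free m n (A : 'M[int]_(m, n)) : (forall c : 'rV_m, c *m A = 0 -> c = 0) ->
  row_free (map_mx intr A : 'M[rat]_(m, n)).
Proof.
move=> h; rewrite -kermx_eq0; apply/eqP/row_matrixP => a; rewrite row0.
have : row a (kermx (map_mx intr A : 'M[rat]_(m, n))) *m map_mx intr A = 0.
  by apply/sub_kermxP; rewrite row_sub.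
move: (row a _) => v vA.
pose D := \prod_b denq (v 0 b).
have D0 : D != 0 by apply/prodf_neq0 => b _; apply: denq_neq0.
pose w : 'rV[int]_m := \row_b (numq (v 0 b) * \prod_(l | l != b) denq (v 0 l)).
have ew : map_mx intr w = D%:~R *: v.
  apply/rowP => b.
  have eD : D = denq (v 0 b) * \prod_(l | l != b) denq (v 0 l) by rewrite /D (bigD1 b).
  rewrite !mxE eD !intrM [RHS]mulrAC; congr (_ * _).
  by rewrite -{3}[v 0 b]divq_num_den mulrC divfK // intr_eq0 denq_neq0.
have w0 : w = 0.
  have e0 : map_mx intr (w *m A) = 0 :> 'M[rat]_(_, _).
    by rewrite map_mxM ew -scalemxAl vA scaler0.
  apply: h; move: (w *m A) e0 => u e0; apply/rowP => b; apply/eqP; rewrite mxE.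
  by have /eqP := congr1 (fun u : 'M[rat]_(1, n) => u 0 b) e0; rewrite !mxE intr_eq0.
apply: (scalerI (_ : D%:~R != 0 :> rat)); first by rewrite intr_eq0.
by rewrite -ew w0 map_mx0 scaler0.
Qed.

Section HomOn.
Context (Rg : unitRingType) (G : subgroup Rg) (V : zmodType) (f : Rg -> V).
Hypothesis hf : hom_on G f.

Lemma hom_onX g n : G g -> f (g ^+ n) = f g *+ n.
Proof.
have [G1 GM GV] := sgP G; move=> gg; have gX l : G (g ^+ l).
  by elim: l => [|l IH]; rewrite ?expr0 ?exprS //; apply: GM.
elim: n => [|n IH]; first by rewrite expr0 mulr0n; apply: (hom_on1 hf).
by rewrite exprS hf // IH mulrS.
Qed.

Lemma hom_on_derived g : derived_subgroup G g -> f g = 0.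
Proof.
have [G1 GM GV] := sgP G; pose T : set Rg := [set g | G g /\ f g = 0].
have sT : is_subgroup T.
  split=> [|a b [ga fa] [gb fb]|a [ga fa]].
  - by split=> //; apply: (hom_on1 hf).
  - by split; [exact: GM | rewrite hf // fa fb addr0].
  by have [ua gV] := GV _ ga; split=> //; split=> //; rewrite (hom_onV hf) // fa oppr0.
move=> /(_ T sT) [] // _ [a [b [ga gb ->]]]; split; first exact: (subgroup_comm (sgP G)).
have [_ gaV] := GV _ ga; have [_ gbV] := GV _ gb.
rewrite /comm !hf ?(hom_onV hf) //; do ?[apply: (GM) => //].
by rewrite [- f a - _]addrC subrK addNr.
Qed.

End HomOn.

Section Group.
Context (F : finFieldType) (k : fieldType) (L : fieldExtType k) (bar : 'AEnd(L)).
Context (i : {rmorphism F -> L}) (Q : place i) (B : set L) (d : nat).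
Context (R : realType) (nuP : L -> R) (e p : nat) (G : subgroup 'M[L]_3).
Hypotheses (ar : arithmetic bar Q B d).
Hypotheses (pL : p \in [pchar L]) (p2 : (2 < p)%N).
Hypotheses (e0 : (0 < e)%N) (nuE : forall x, nuP x = (Q x)%:~R / e%:R).
Hypotheses (hfin : finite_index_in G (SU_over bar B)) (hp : no_p'_torsion p G).
Local Notation M := 'M[L]_3.
Local Notation vertex := (set (M * R)).
Implicit Types (z : L * L) (g h : M) (v w : vertex) (x y s : 'cV[L]_3).
Local Notation ua := (ua bar).
Local Notation Hset := (Hset bar).
Local Notation X := (vertices bar nuP).
Local Notation adj := (adj bar nuP e).
Local Notation E0 := (col3 (1 : L) 0 0).

Let barK : involutive bar. Proof. exact: ar_barK ar. Qed.
Let Qbar (x : L) : Q (bar x) = Q x. Proof. exact: (ar_val_bar ar). Qed.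

Local Notation nonfree := (nonfree G).
Local Notation fixes_stab := (fixes_stab bar G).
Local Notation cls := (cls bar G).
Local Notation group_SU := (group_SU hfin).
Local Notation move_vertex := (move_vertex barK Qbar e0 nuE).
Local Notation cls_line := (cls_line ar hfin).
Local Notation clsG := (clsG ar pL p2 e0 nuE hfin hp).
Local Notation cls_stab := (cls_stab ar pL p2 e0 nuE hfin hp).

Hypothesis two : (2 : L) != 0.

Lemma E0_neq0 : E0 != 0.
Proof.
by apply/eqP => /(congr1 (fun m : 'cV[L]_3 => m 0 0)); rewrite col3E mxE => /eqP; rewrite oner_eq0.
Qed.

(** Far enough along the standard apartment, the first basis vector is as short as desired. *)
Lemma deep_vertex : exists v, [/\ X v, nonfree v & fixes_stab E0 v].
Proof.
have [C [C0 hC]] := deep_nonfree ar pL p2 e0 nuE hfin hp two.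
have s1 := SU1 bar; have Xv : X (pt bar nuP e 1 C%:Z) by apply: (vertex_pt e0 nuE).
exists (pt bar nuP e 1 C%:Z); have [|||nf fs] := hC _ E0 Xv; last by split.
- by move=> a; rewrite mxE; case: a => [[|[|[|a]]] ha] //=; [exact: (ring1 ar) | exact: (ring0 ar) | exact: (ring0 ar)].
- exact: E0_neq0.
by apply/(vball_pt barK Qbar e0 nuE) => //; rewrite /gball invr1 mul1mx; apply/nball_e0.
Qed.

Let T0 : {v | [/\ X v, nonfree v & fixes_stab E0 v]}.
Proof. exact: cid deep_vertex. Qed.

Let v0 := sval T0.
Let Xv0 : X v0. Proof. by rewrite /v0; case: T0 => ? []. Qed.
Let nv0 : nonfree v0. Proof. by rewrite /v0; case: T0 => ? []. Qed.
Let fv0 : fixes_stab E0 v0. Proof. by rewrite /v0; case: T0 => ? []. Qed.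

Let actX g v : G g -> X v -> X (move_v g v).
Proof. by move=> gg; apply/move_vertex/group_SU. Qed.
Let adjX v w : adj v w -> X v /\ X w. Proof. by case. Qed.
Let adjG g v w : G g -> adj v w -> adj (move_v g v) (move_v g w).
Proof. by move=> gg; apply: (adj_move barK Qbar e0 nuE); apply: group_SU. Qed.
Let pot (V : zmodType) (t : vertex -> vertex -> V) : (forall v w, t w v = - t v w) ->
  exists tau : vertex -> V, forall v w, adj v w -> tau w - tau v = t v w.
Proof. exact: (tree_potential barK Qbar e0 nuE). Qed.
Let conn (V : zmodType) (tau : vertex -> V) : (forall v w, adj v w -> tau v = tau w) ->
  forall v w, X v -> X w -> tau v = tau w.
Proof. exact: (tree_connected barK Qbar e0 nuE). Qed.
Let fib (V : zmodType) (tau : vertex -> V) :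
  (forall v w, adj v w -> cls v = cls w -> tau v = tau w) ->
  forall v w, X v -> X w -> cls v = cls w -> tau v = tau w.
Proof. exact: (cls_fibre ar pL p2 e0 nuE hfin hp). Qed.
Let efree v w g : adj v w -> cls v <> cls w -> G g ->
  move_v g v = v -> move_v g w = w -> g = 1.
Proof. exact: (edge_free ar pL p2 e0 nuE hfin hp). Qed.
Let noinv v w g : adj v w -> G g -> move_v g v = w -> move_v g w = v -> False.
Proof. by move=> vw gg mv _; apply: (adj_noinv barK Qbar e0 nuE (group_SU gg) vw mv). Qed.

(** In G, the stabilizer of the line of [E0] consists of elements [ua z], on which the entry z.1 is
    additive. *)
Lemma stabilizer_hom : exists psi : M -> L, hom_on G psi /\
  forall z, Hset z -> G (ua z) -> psi (ua z) = z.1.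
Proof.
have e1 : cls v0 = inr (line E0) by apply: cls_line.
have H g : G g -> actW g (cls v0) = cls v0 -> exists z, Hset z /\ g = ua z.
  move=> gg eg; have [_ /(_ E0 nv0 fv0) gE] := cls_stab Xv0 gg eg.
  have [|z [hz _ ->]] := SU_borel barK (group_SU gg) (t := 1); first by rewrite scale1r.
  by exists z; rewrite ta1 mulr1.
have [|psi [hpsi epsi]] := @stabilizer_extension _ G vertex _ X v0 (@move_v _ L R)
  (@actW _ L R) cls adj Xv0 (@move1 _ L R) (@moveM _ L R) (@actW1 _ L R) (@actWM _ L R)
  actX adjX (fun v w => @adj_sym _ L bar R nuP e v w) adjG (fun g v => @clsG g v) pot conn fib efree L (fun g => g 1 2%R).
  move=> g h [gg eg] [gh eh]; have [z [_ ->]] := H g gg eg; have [z' [_ ->]] := H h gh eh.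
  by rewrite ua_add !mxE.
exists psi; split=> // z hz gz; rewrite epsi //; first by rewrite mxE.
by rewrite e1 actW_line ua_e0.
Qed.

Context (V0 : set vertex) (Es : set (set vertex)).
Hypothesis hV0 : orbit_reps (@act_v _ L R) G X V0.
Hypothesis hEs : orbit_reps (@act_e _ L R) G (edges bar nuP) Es.
Context (vs : seq vertex) (es : seq (set vertex)).
Hypotheses (uv : uniq vs) (hv : forall v, [set v | V0 v /\ ~ nonfree v] v <-> v \in vs).
Hypotheses (ue : uniq es) (he : forall E, [set E | Es E /\ free_edge bar nuP e G E] E <-> E \in es).

(* The rows of eps are the coboundaries of the indicator functions of the
   orbits of free vertices. *)
Lemma group_cocycles : exists (phi : 'I_(size es) -> M -> int) (eps : 'I_(size vs) -> 'I_(size es) -> int),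
  [/\ forall j, hom_on G (phi j),
   forall (V : zmodType) (f : M -> V), hom_on G f -> (forall g, G g -> g ^+ p = 1 -> f g = 0) ->
     exists m : 'I_(size es) -> V, forall g, G g -> f g = \sum_j m j *~ phi j g,
   forall c : 'I_(size vs) -> int, (forall j, \sum_a c a * eps a j = 0) -> forall a, c a = 0
   & forall a g, G g -> \sum_j eps a j * phi j g = 0].
Proof.
have [VX Vr] := hV0; have [EX Er] := hEs.
have /choice[q hq] : forall E, exists q : vertex * vertex, E \in es ->
    [/\ adj q.1 q.2, cls q.1 <> cls q.2 & E = [set q.1; q.2]].
  move=> E; case: (boolP (E \in es)) => [/he[_ [v [w [vw nc eE]]]]|_]; last by exists (set0, set0).
  by exists (v, w).
pose ed (j : 'I_(size es)) := nth set0 es j.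
have edin j : ed j \in es by apply: mem_nth.
pose ex j := (q (ed j)).1; pose ey j := (q (ed j)).2.
have hj j : adj (ex j) (ey j) /\ cls (ex j) <> cls (ey j) by case: (hq _ (edin j)).
have edE j : ed j = [set ex j; ey j] by case: (hq _ (edin j)).
have cover v w : adj v w /\ cls v <> cls w -> exists j g, G g /\
    ((v = move_v g (ex j) /\ w = move_v g (ey j)) \/ (v = move_v g (ey j) /\ w = move_v g (ex j))).
  move=> [vw nc]; have [|E [[EE [g gg ge]] _]] := Er [set v; w].
    by apply/(edge_adjP barK Qbar e0 nuE); exists v, w.
  have Ein : E \in es.
    apply/he; split=> //; have -> : E = move_e g^-1 [set v; w].
      by rewrite -ge -move_eM mulVr ?move_e1 // (SU_unit (group_SU gg)).
    by apply: (free_edge_move ar pL p2 e0 nuE hfin hp); [exact: groupV | exists v, w].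
  have lt : (index E es < size es)%N by rewrite index_mem.
  exists (Ordinal lt), g; split=> //.
  have eE : ed (Ordinal lt) = E by apply: nth_index.
  have e1 : move_e g (ed (Ordinal lt)) = [set v; w] by rewrite eE.
  move: e1; rewrite edE move_e2 => e1.
  by case: (set2_eq e1) => -[-> ->]; [left | right].
have uniq j l g : G g ->
    (move_v g (ex j) = ex l /\ move_v g (ey j) = ey l) \/
    (move_v g (ex j) = ey l /\ move_v g (ey j) = ex l) -> j = l.
  move=> gg h; apply/val_inj/eqP; rewrite -(nth_uniq set0 (ltn_ord j) (ltn_ord l) ue); apply/eqP.
  have [Ej _] := (he _).2 (edin j); have [El _] := (he _).2 (edin l).
  apply: (rep_e hEs Ej El gg); rewrite -/(ed j) -/(ed l) !edE move_e2.
  by case: h => -[-> ->] //; rewrite setUC.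
have [phi [hphi cphi rphi]] := @tree_cocycles _ G vertex _ X v0 (@move_v _ L R)
  (@actW _ L R) cls adj Xv0 (@move1 _ L R) (@moveM _ L R) (@actW1 _ L R) (@actWM _ L R)
  actX adjX (fun v w => @adj_sym _ L bar R nuP e v w) adjG (fun g v => @clsG g v) pot conn noinv
  _ ex ey hj cover uniq.
pose D (a : 'I_(size vs)) v : int := `[< exists2 g, G g & move_v g (nth set0 vs a) = v >]%:R.
have DG a g v : G g -> X v -> D a (move_v g v) = D a v.
  move=> gg Xv; congr (nat_of_bool _)%:R; apply: asbool_equiv_eq; split=> -[h gh eh].
    exists (g^-1 * h); first exact: groupM (groupV gg) gh.
    by rewrite moveM eh (moveK v (group_SU gg)).
  by exists (g * h); [exact: groupM | rewrite moveM eh].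
have vin (a : 'I_(size vs)) : nth set0 vs a \in vs by apply: mem_nth.
have Dn a v : nonfree v -> D a v = 0.
  move=> nv; rewrite /D asboolF // => -[g gg ev]; have [_ nf] := (hv _).2 (vin a).
  by apply/nf/(nonfree_moveE hfin _ gg); rewrite ev.
have Dcls a v w : adj v w -> cls v = cls w -> D a v = D a w.
  by move=> vw ec; have [s [_ nv nw _ _]] := cls_adj ar pL p2 e0 nuE hfin hp vw ec; rewrite !Dn.
exists phi, (fun a j => D a (ey j) - D a (ex j)); split=> //.
- move=> V f hf f0; apply: cphi => // g v gg Xv eg.
  by apply: f0 => //; have [] := cls_stab Xv gg eg.
(* A relation makes S constant across free edges, and it is constant on the fibres, so it is
   constant on the tree; it vanishes at v0, which is not free. *)
- move=> c hc; pose S v := \sum_a c a * D a v.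
  have Sadj v w : adj v w -> S v = S w.
    move=> vw; have [ec|nc] := pselect (cls v = cls w).
      by apply: eq_bigr => a _; rewrite (Dcls a v w).
    have [j [g [gg h]]] := cover v w (conj vw nc).
    have Se : S (ex j) = S (ey j).
      by apply/esym/eqP; rewrite -subr_eq0 /S -sumrB -[X in _ == X](hc j); apply/eqP/eq_bigr => a _; rewrite mulrBr.
    have SG u : X u -> S (move_v g u) = S u by move=> Xu; apply: eq_bigr => a _; rewrite DG.
    have [Xx Xy] := adjX (proj1 (hj j)).
    by case: h => -[-> ->]; rewrite !SG.
  have S0 v : X v -> S v = 0.
    move=> Xv; rewrite (conn Sadj Xv Xv0); apply: big1 => a _; by rewrite Dn ?mulr0.
  move=> a; have [Va _] := (hv _).2 (vin a); rewrite -[RHS](S0 _ (VX _ Va)) /S (bigD1 a) //=.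
  rewrite [X in c a * X](_ : _ = 1) ?mulr1; last first.
    by rewrite /D asboolT //; exists 1; [exact: group1 | exact: move1].
  rewrite big1 ?addr0 // => b /negP nb; rewrite /D asboolF ?mulr0 // => -[g gg eb].
  have [Vb _] := (hv _).2 (vin b); apply: nb; rewrite -val_eqE /=.
  by rewrite -(nth_uniq set0 (ltn_ord b) (ltn_ord a) uv); apply/eqP; apply: (rep_v hV0 Vb Va gg eb).
by move=> a g gg; apply: (rphi (D a)) => // [h v gh Xv|v w vw ec]; [exact: DG | exact: Dcls].
Qed.

(** f is a combination of the [phi j], and these take integer values, so they vanish on every
    element with a power in the derived subgroup. *)
Lemma torsion_killed (V : zmodType) (f : M -> V) g n : hom_on G f ->
  (forall g, G g -> g ^+ p = 1 -> f g = 0) -> G g -> (0 < n)%N ->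
  derived_subgroup G (g ^+ n) -> f g = 0.
Proof.
move=> hf f0 gg n0 dg; have [phi [eps [hphi cphi _ _]]] := group_cocycles.
have [m ->//] := cphi V f hf f0; apply: big1 => j _.
suff -> : phi j g = 0 by rewrite mulr0z.
have := hom_on_derived (hphi j) dg; rewrite (hom_onX (hphi j)) //.
by rewrite -mulr_natl => /eqP; rewrite mulf_eq0 pnatr_eq0 -leqn0 leqNgt n0 => /eqP.
Qed.

(** Over the rationals, the matrix of the relations has rank [size vs], the matrix of the values of
    the [phi j] on lifts of the independent family has rank m, and their product is zero, so the two
    ranks add up to at most [size es]. *)
Lemma rank_bound (V : zmodType) (f : M -> V) m (x : 'I_m -> V) : hom_on G f ->
  (forall g, G g -> g ^+ p = 1 -> f g = 0) -> (forall y : V, exists2 g, G g & f g = y) ->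
  z_independent x -> (m + size vs <= size es)%N.
Proof.
move=> hf f0 fs ix; have [phi [eps [hphi cphi ieps epsphi]]] := group_cocycles.
have [n hn] := cphi V f hf f0.
have /choice[g hg] : forall a, exists g, G g /\ f g = x a.
  by move=> a; have [g gg eg] := fs (x a); exists g.
pose A : 'M[int]_(size vs, size es) := \matrix_(a, j) eps a j.
pose C : 'M[int]_(size es, m) := \matrix_(j, b) phi j (g b).
have rA : row_free (map_mx intr A : 'M[rat]_(_, _)).
  apply: int_row_free => c h; apply/rowP => a; rewrite mxE.
  apply: (ieps (fun a => c 0 a)) => j; have := congr1 (fun u : 'rV_ _ => u 0 j) h; rewrite !mxE => h'.
  by rewrite -[RHS]h'; apply: eq_bigr => b _; rewrite mxE.
have rC : row_free (map_mx intr C^T : 'M[rat]_(_, _)).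
  apply: int_row_free => c h; apply/rowP => b; rewrite mxE.
  apply: (ix (fun b => c 0 b)).
  transitivity (\sum_b (\sum_j n j *~ (phi j (g b) * c 0 b))).
    apply: eq_bigr => b' _; have [gb <-] := hg b'; rewrite hn // mulrz_suml.
    by apply: eq_bigr => j _; rewrite mulrzA.
  rewrite exchange_big big1 // => j _; rewrite -mulrz_sumr.
  have := congr1 (fun u : 'rV_ _ => u 0 j) h; rewrite !mxE => h'.
  rewrite (_ : \sum_ _ _ = 0) ?mulr0z // -[RHS]h'; apply: eq_bigr => b' _.
  by rewrite !mxE mulrC.
have AC : (map_mx intr A : 'M[rat]_(_, _)) *m map_mx intr C = 0.
  rewrite -map_mxM (_ : A *m C = 0) ?map_mx0 //; apply/matrixP => a b; rewrite !mxE.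
  have [gb _] := hg b; rewrite -[RHS](epsphi a _ gb); apply: eq_bigr => j _; by rewrite !mxE.
have := mulmx0_rank_max AC; rewrite (eqP rA) addnC.
by rewrite -[\rank (map_mx _ C)]mxrank_tr map_trmx (eqP rC).
Qed.

End Group.

(** * Countable groups of prime exponent *)

Lemma additive_ex (U V : zmodType) (f : U -> V) : (forall x y, f (x - y) = f x - f y) ->
  exists g : {additive U -> V}, g =1 f.
Proof.
move=> hf; pose m := GRing.isZmodMorphism.Build U V f hf.
by pose g : {additive U -> V} := HB.pack f m; exists g.
Qed.

Lemma isomorphic_sym (U V : zmodType) : isomorphic U V -> isomorphic V U.
Proof.
move=> [f [g fK gK]]; have [h hE] : exists h : {additive V -> U}, h =1 g.
  by apply: additive_ex => x y; apply: (can_inj fK); rewrite raddfB !gK.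
by exists h; exists f => x; rewrite hE.
Qed.

Lemma isomorphic_trans (U V W : zmodType) : isomorphic U V -> isomorphic V W -> isomorphic U W.
Proof. by move=> [f bf] [g bg]; exists (g \o f); apply: bij_comp. Qed.

Lemma mod_Tor_proj (V : zmodType) : exists q : V -> mod_Tor V,
  [/\ forall x y, q (x + y) = q x + q y, forall y, exists x, q x = y &
      forall x, x \in @torsion V -> q x = 0].
Proof.
pose q (x : V) : mod_Tor V := (\pi_(Quotient.quot (@torsion V)) x)%qT.
have qD x y : q (x + y) = q x + q y by apply: Quotient.pi_add.
exists q; split=> // [y|x hx]; first by exists (repr y); rewrite /q reprK.
have -> : 0 = q 0 by apply: (addIr (q 0)); rewrite -qD !add0r.
by apply/eqP; rewrite /q -Quotient.idealrBE subr0.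
Qed.

(** Countability, and below it infinity, in forms that pass through injections. *)
Definition codable (T : Type) : Prop := exists c : T -> nat, injective c.
Definition unbounded (T : Type) : Prop := forall N, exists f : 'I_N -> T, injective f.

Lemma codable_inj (T U : Type) (f : T -> U) : injective f -> codable U -> codable T.
Proof. by move=> fI [c cI]; exists (c \o f); apply: inj_comp. Qed.

Lemma codable_count (T : Type) (U : countType) (f : T -> U) : injective f -> codable T.
Proof. by move=> fI; apply: (codable_inj fI); exists choice.pickle; apply: pcan_inj choice.pickleK. Qed.

Lemma codable_ffun (T U : Type) (S : finType) (f : T -> S -> U) :
  codable U -> (forall x y, (forall s, f x s = f y s) -> x = y) -> codable T.
Proof.
move=> [c cI] fI; apply: (@codable_count T {ffun S -> nat} (fun x => [ffun s => c (f x s)])).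
by move=> x y /ffunP h; apply: fI => s; apply: cI; have := h s; rewrite !ffunE.
Qed.

Lemma unbounded_inj (T U : Type) (f : T -> U) : injective f -> unbounded T -> unbounded U.
Proof. by move=> fI h N; have [g gI] := h N; exists (f \o g); apply: inj_comp. Qed.

Lemma unbounded_fin (T : Type) (S : finType) (f : T -> S) : injective f -> unbounded T -> False.
Proof.
move=> fI h; have [g gI] := h #|S|.+1; have := leq_card (f \o g) (inj_comp fI gI).
by rewrite card_ord ltnn.
Qed.

Section ExponentP.
Context (p : nat) (V : zmodType).
Hypotheses (pp : prime p) (pV : forall x : V, x *+ p = 0) (cV : codable V) (uV : unbounded V).

Let p0 : (0 < p)%N. Proof. exact: prime_gt0. Qed.

Lemma mulrn_mod (x : V) n : x *+ (n %% p) = x *+ n.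
Proof. by rewrite {2}(divn_eq n p) mulrnDr mulnC mulrnA pV mul0rn add0r. Qed.

Let comb (b : nat -> V) n (c : nat -> nat) : V := \sum_(j < n) b j *+ c j.
Let spn (b : nat -> V) n : set V := [set x | exists c, x = comb b n c].

Let spnM b n x m : spn b n x -> spn b n (x *+ m).
Proof.
move=> [c ->]; exists (fun j => (c j * m)%N).
by rewrite /comb -sumrMnl; apply: eq_bigr => j _; rewrite mulrnA.
Qed.

Let spnS b n x : spn b n x -> spn b n.+1 x.
Proof.
move=> [c ->]; exists (fun j => if (j < n)%N then c j else 0%N).
rewrite /comb big_ord_recr /= ltnn mulr0n addr0; apply: eq_bigr => j _.
by rewrite ltn_ord.
Qed.

Let spn_new b n : spn b n.+1 (b n).
Proof.
exists (fun j => (j == n)%N : nat); rewrite /comb big_ord_recr /= eqxx big1 ?add0r // => j _.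
by rewrite ltn_eqF ?mulr0n // ltn_ord.
Qed.

Let spn_small b n : exists x, ~ spn b n x.
Proof.
apply: contrapT => no.
have /choice[c hc] : forall x, exists c, x = comb b n c.
  by move=> x; apply: contrapT => h; apply: no; exists x.
have p1 m : (m %% p < p)%N by rewrite ltn_mod.
pose f x : {ffun 'I_n -> 'I_p} := [ffun j : 'I_n => Ordinal (p1 (c x j))].
apply: (@unbounded_fin V _ f) => // x y /ffunP h; rewrite (hc x) (hc y).
apply: eq_bigr => j _; have := congr1 val (h j); rewrite !ffunE /= => e.
by rewrite -mulrn_mod e mulrn_mod.
Qed.

(* A basis over the prime field, chosen greedily along an enumeration of V. *)
Lemma exponent_basis : exists b : nat -> V, (forall n, ~ spn b n (b n)) /\
  forall x, exists n, spn b n x.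
Proof.
have [c cI] := cV.
have /choice[nx hnx] : forall s : seq V, exists x, ~ spn (nth 0 s) (size s) x /\
    forall y, ~ spn (nth 0 s) (size s) y -> (c x <= c y)%N.
  move=> s; have [x0 nx0] := spn_small (nth 0 s) (size s).
  have ex : exists m, `[< exists x, ~ spn (nth 0 s) (size s) x /\ c x = m >].
    by exists (c x0); apply/asboolP; exists x0.
  case: (ex_minnP ex) => m /asboolP[x [nx ex']] hm; exists x; split=> // y ny.
  by rewrite ex'; apply: hm; apply/asboolP; exists y.
pose bs n := iter n (fun s => rcons s (nx s)) [::].
pose b n := nx (bs n).
have sz n : size (bs n) = n by elim: n => //= n IH; rewrite size_rcons IH.
have bE n j : (j < n)%N -> nth 0 (bs n) j = b j.
  elim: n => // n IH; rewrite ltnS leq_eqVlt /= nth_rcons sz => /orP[/eqP ->|lt].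
    by rewrite ltnn eqxx.
  by rewrite lt IH.
have combE n d : comb (nth 0 (bs n)) n d = comb b n d.
  by apply: eq_bigr => j _; rewrite bE.
have spnE n x : spn (nth 0 (bs n)) (size (bs n)) x <-> spn b n x.
  by rewrite sz; split=> -[d ->]; exists d; rewrite combE.
exists b; split=> [n|x].
  by have [h _] := hnx (bs n); move/spnE: h.
suff H n y : (c y < n)%N -> spn b n y by exists (c x).+1; apply: H.
elim: n y => {x} // n IH x; rewrite ltnS => le.
have [lt|ge] := ltnP (c x) n; first exact/spnS/IH.
have cxn : c x = n by apply/eqP; rewrite eqn_leq le.
apply: contrapT => nsx; have nx1 : ~ spn b n x by move=> /spnS.
have [h1 h2] := hnx (bs n); have := h2 x; rewrite cxn => h3.
have {}h3 : (c (b n) <= n)%N by apply: h3 => /spnE.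
apply: nsx; have [lt|ge'] := ltnP (c (b n)) n.
  by case: h1; apply/spnE; apply: IH.
have -> : x = b n; last exact: spn_new.
by apply: cI; apply/eqP; rewrite cxn eqn_leq ge' h3.
Qed.

(** Polynomials are the finitely supported sequences of coordinates in [exponent_basis]. A
    non-trivial kernel element would express the basis vector of its leading term through the
    earlier ones. *)
Lemma exponent_model : isomorphic {poly 'F_p} V.
Proof.
have [b [bfree bgen]] := exponent_basis.
have Fp : (Zp_trunc (pdiv p)).+2 = p by rewrite Fp_cast.
pose cf (q : {poly 'F_p}) (j : nat) : nat := (q`_j : 'F_p).
pose f (q : {poly 'F_p}) : V := comb b (size q) (cf q).
have fW n (q : {poly 'F_p}) : (size q <= n)%N -> f q = comb b n (cf q).
  move=> le; rewrite /f /comb (big_ord_widen n (fun j => b j *+ cf q j) le) big_mkcond.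
  by apply: eq_bigr => j _; case: ltnP => // h; rewrite /cf nth_default.
have valD (x y : 'F_p) : ((x + y)%R : nat) = ((x + y) %% p)%N.
  by transitivity ((x + y) %% (Zp_trunc (pdiv p)).+2)%N => //; congr (_ %% _)%N.
have valM (x y : 'F_p) : ((x * y)%R : nat) = ((x * y) %% p)%N.
  by transitivity ((x * y) %% (Zp_trunc (pdiv p)).+2)%N => //; congr (_ %% _)%N.
have valB (x y : 'F_p) (v : V) : v *+ (x - y)%R = v *+ x - v *+ y.
  by apply: (addIr (v *+ y)); rewrite subrK -mulrnDr -(mulrn_mod v (_ + _)) -valD subrK.
have fB : forall q r, f (q - r) = f q - f r.
  move=> q r; pose n := maxn (size (q - r)) (maxn (size q) (size r)).
  rewrite !(fW n) ?leq_max ?leqnn ?orbT // /comb -sumrB; apply: eq_bigr => j _.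
  by rewrite /cf coefB valB.
have [g gE] := additive_ex fB.
have gI : injective g.
  apply: raddf_inj => q; rewrite gE => fq0; apply/eqP; apply: contrapT => /negP q0.
  have sq : (0 < size q)%N by rewrite size_poly_gt0.
  pose a : 'F_p := lead_coef q; have a0 : a != 0 by rewrite lead_coef_eq0.
  apply: (bfree (size q).-1); set n := (size q).-1.
  have e1 : comb b n (cf q) + b n *+ a = 0.
    by rewrite -fq0 (fW n.+1) ?leqSpred // /comb big_ord_recr.
  have e2 : b n *+ a = comb b n (cf q) *+ p.-1.
    by apply: (addrI (comb b n (cf q))); rewrite e1 -mulrS prednK.
  have e3 : b n = b n *+ a *+ (a^-1 : 'F_p).
    by rewrite -mulrnA -(mulrn_mod (b n) (_ * _)) -valM mulfV.
  by rewrite e3 e2; do 2 apply: spnM; exists (cf q).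
exists g; have /choice[h hh] : forall x, exists q, g q = x.
  move=> x; have [n [c ->]] := bgen x; exists (\poly_(j < n) (c j)%:R).
  rewrite gE (fW n) ?size_poly //; apply: eq_bigr => j _.
  by rewrite /cf coef_poly ltn_ord val_Fp_nat // mulrn_mod.
by exists h => [q|x]; [apply: gI; rewrite hh | rewrite hh].
Qed.

End ExponentP.

Lemma exponent_iso p (V W : zmodType) : prime p -> (forall x : V, x *+ p = 0) ->
  (forall x : W, x *+ p = 0) -> codable V -> codable W -> unbounded V -> unbounded W ->
  isomorphic V W.
Proof.
move=> pp pV pW cV cW uV uW; apply: isomorphic_trans (exponent_model pp pW cW uW).
exact/isomorphic_sym/exponent_model.
Qed.

Section DirectSums.
Context (I : eqType) (V : I -> zmodType).

Lemma dsum_codable : codable I -> (forall j, codable (V j)) -> codable (dsum V).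
Proof.
move=> [c cI] h; have hd j : {d : V j -> nat | injective d} by exact/cid/h.
pose dc j := sval (hd j); have dI j : injective (dc j) by rewrite /dc; case: (hd j).
have /choice[l hl] : forall x : dsum V, exists l : seq (nat * nat), forall q,
    (exists j, x j != 0 /\ q = (c j, dc j (x j))) <-> q \in l.
  move=> x; have := finite_image (fun j => (c j, dc j (x j))) (ds_finite x).
  move=> /finite_uniq[l [_ hl]]; exists l => q; rewrite -hl.
  by split=> [[j [? ->]]|[j ? <-]]; exists j.
apply: (@codable_count _ (seq (nat * nat)) l) => x y e.
have H (u v : dsum V) j : l u = l v -> u j != 0 -> u j = v j.
  move=> euv uj; have : (c j, dc j (u j)) \in l u by apply/hl; exists j.
  by rewrite euv => /hl[j' [_ [/cI jj']]]; rewrite -jj' => /dI.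
apply: dsum_eq => j; have [xj|] := eqVneq (x j) 0; last exact: H.
by have [->//|/(H y x j (esym e))] := eqVneq (y j) 0.
Qed.

Lemma dsumMn (x : dsum V) n j : (x *+ n) j = x j *+ n.
Proof. by elim: n => [|n IH]; rewrite ?mulr0n // !mulrS -IH. Qed.

Lemma dsum_exponent p : (forall j (x : V j), x *+ p = 0) -> forall x : dsum V, x *+ p = 0.
Proof. by move=> h x; apply: dsum_eq => j; rewrite dsumMn h. Qed.

Lemma dsum_unbounded j : unbounded (V j) -> unbounded (dsum V).
Proof.
have fin (x : V j) : finite_set [set l | dfwith (fun l => 0 : V l) x l != 0].
  apply: (@sub_finite_set _ _ [set j]); last exact: finite_set1.
  move=> l /= h; apply/eqP; apply: contraNT h => jl; rewrite dfwith_out ?eqxx //.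
  by rewrite eq_sym.
apply: (@unbounded_inj _ _ (fun x => Dsum (fin x))) => x y /(congr1 (fun u : dsum V => u j)) /=.
by rewrite !dfwith_in.
Qed.

End DirectSums.

Section AbQuotients.
Local Open Scope quotient_scope.
Context (R : unitRingType) (T : ab_pair R).

Lemma ab_piM (x : ab_elt T) n (hx : ab_top T (val x ^+ n)) :
  \pi_(ab_quotient T) x *+ n = \pi_(ab_quotient T) (ab_Elt hx).
Proof.
have [T1 TM _] := sgP (ab_top T).
elim: n hx => [|n IH] hx; first by rewrite mulr0n; apply: ab_pi_val; rewrite /= expr0.
have hx' : ab_top T (val x ^+ n).
  by elim: {IH hx} n => [|n IH]; rewrite ?expr0 ?exprS //; apply: (TM) => //; apply: ab_eltP.
by rewrite mulrS (IH hx') [LHS]ab_addE; apply: ab_pi_val; rewrite /= exprS.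
Qed.

Lemma ab_lift (V : zmodType) (psi : R -> V) : hom_on (ab_top T) psi ->
  (forall x, ab_bot T x -> psi x = 0) ->
  exists h : {additive ab_quotient T -> V}, forall x : ab_elt T,
    h (\pi_(ab_quotient T) x) = psi (val x).
Proof.
move=> hpsi psi0; have [T1 TM TV] := sgP (ab_top T).
pose f (X : ab_quotient T) := psi (val (repr X)).
have fpi x : f (\pi_(ab_quotient T) x) = psi (val x).
  have := psi0 _ (ab_reprP x); have tx := ab_eltP x; have [_ tV] := TV _ tx.
  rewrite hpsi // ?(hom_onV hpsi) //; last exact: ab_eltP.
  by move/eqP; rewrite addrC subr_eq0 => /eqP.
have [h hE] : exists h : {additive ab_quotient T -> V}, h =1 f.
  apply: additive_ex; elim/quotW=> x; elim/quotW=> y.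
  rewrite -[- \pi_(ab_quotient T) y]/(ab_opp (\pi_(ab_quotient T) y)).
  have tr := ab_eltP (repr (\pi_(ab_quotient T) y)); have [_ tV] := TV _ tr.
  rewrite [_ + _]ab_addE !fpi /= hpsi ?(hom_onV hpsi) //; last exact: ab_eltP.
  by congr (_ - _); apply: fpi.
by exists h => x; rewrite hE fpi.
Qed.

Lemma ab_codable : codable R -> codable (ab_quotient T).
Proof.
apply: (@codable_inj _ _ (fun X : ab_quotient T => val (repr X))) => X Y /val_inj e.
by rewrite -[X]reprK -[Y]reprK e.
Qed.

End AbQuotients.

(** * The abelianization *)

Section Group.
Context (F : finFieldType) (k : fieldType) (L : fieldExtType k) (bar : 'AEnd(L)).
Context (i : {rmorphism F -> L}) (Q : place i) (B : set L) (d : nat).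
Context (R : realType) (nuP : L -> R) (e p : nat) (G : subgroup 'M[L]_3).
Hypotheses (ar : arithmetic bar Q B d).
Hypotheses (pL : p \in [pchar L]) (p2 : (2 < p)%N).
Hypotheses (e0 : (0 < e)%N) (nuE : forall x, nuP x = (Q x)%:~R / e%:R).
Hypotheses (hfin : finite_index_in G (SU_over bar B)) (hp : no_p'_torsion p G).
Local Notation M := 'M[L]_3.
Local Notation vertex := (set (M * R)).
Implicit Types (z : L * L) (g h : M) (v w : vertex) (x y s : 'cV[L]_3).
Local Notation ua := (ua bar).
Local Notation SU := (SU bar).
Local Notation Hset := (Hset bar).
Local Notation Gamma := (SU_over bar B).
Local Notation X := (vertices bar nuP).
Local Notation E0 := (col3 (1 : L) 0 0).

Let barK : involutive bar. Proof. exact: ar_barK ar. Qed.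
Let Qbar (x : L) : Q (bar x) = Q x. Proof. exact: (ar_val_bar ar). Qed.

Local Notation nonfree := (nonfree G).
Local Notation group_SU := (group_SU hfin).

Hypothesis two : (2 : L) != 0.

Lemma ua_order z : Hset z -> ua z ^+ p = 1.
Proof.
move=> hz; have [|_ ->//] := isofix_order barK pL p2 (SU_ua barK hz) (x := E0).
by split; [exact: E0_neq0 | rewrite herm3 rmorph0 rmorph1; ring | rewrite ua_e0].
Qed.

(* Pigeonhole for the cosets of G met by the unipotent elements with entries in
   B. *)
Lemma many_unipotents N : exists f : 'I_N -> L * L, injective (fun a => (f a).1) /\
  forall a, Hset (f a) /\ G (ua (f a)).
Proof.
have [_ [r hr]] := hfin; have [C hC] := ar_many ar.
have [S [b [ib cb hb]]] := hC (size r * N)%N.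
pose zz (s : S) := (b s, - (b s * bar (b s)) / 2).
have hz (s : S) : Hset (zz s).
  by apply/HsetE; rewrite rmorphM /= fmorphV rmorph_nat rmorphN rmorphM /= barK; field; exact: two.
have gz (s : S) : Gamma (ua (zz s)).
  have [Bs _] := hb s; have B1 := ring1 ar; have B0 := ring0 ar.
  have Bn : B (- (b s * bar (b s)) / 2).
    by apply: (ringM ar); [apply/(ringN ar)/(ringM ar)/(ring_bar ar) | exact: (ring_half ar)].
  split; first exact: (SU_ua barK).
  move=> a c; rewrite mxE; case: a c => [[|[|[|a]]] ha] //= [[|[|[|c]]] hc] //=.
  by apply/(ringN ar)/(ring_bar ar).
have /choice[f hf] : forall s : S, exists y : M, y \in r /\ G (y^-1 * ua (zz s)).
  move=> s; have [y [z [yr Gz eyz]]] := hr _ (gz s); exists y; split=> //.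
  have uz : z \is a GRing.unit := SU_unit (group_SU Gz).
  have ut : ua (zz s) \is a GRing.unit := ua_unit _ _.
  have uy : y \is a GRing.unit by rewrite -(unitrMl y uz) -eyz.
  by rewrite eyz mulKr.
have szw : (size r * N < size (enum S))%N.
  rewrite -cardE; apply: leq_trans cb; apply: (@leq_trans (2 ^ (size r * N))); first exact: ltn_expl.
  apply: (@leq_trans (2 ^ (d * (size r * N)))).
    by rewrite leq_exp2l // leq_pmull // (deg_gt0 ar).
  by case: (posnP (d * (size r * N))) => [->|h]; rewrite ?expn0 // leq_exp2r // card_q.
have [||y le] := @fiber_seq _ _ f r (enum S); first exact: leq_ltn_trans szw.
  by move=> s _; case: (hf s).
pose Y := seq.filter (fun o : S => f o == y) (enum S); rewrite -size_filter -/Y in le.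
have szY : (N < size Y)%N.
  have := leq_trans szw le; rewrite ltn_mul2l; by case/andP.
have [s0 Y0] : exists s0 : S, s0 \in Y.
  by clear -szY; case: Y szY => // s0 Y' _; exists s0; rewrite mem_head.
have fY (s : S) : s \in Y -> G (y^-1 * ua (zz s)).
  by rewrite mem_filter => /andP[/eqP <- _]; case: (hf s).
have uY : uniq Y by rewrite filter_uniq // enum_uniq.
pose g (a : 'I_N) := nth s0 Y a.
have gY a : g a \in Y by apply: mem_nth; apply: ltn_trans szY.
exists (fun a => zdiff bar (zz s0) (zz (g a))); split=> [a c /=|a].
  move/addIr/ib/eqP; rewrite nth_uniq // => [/eqP/val_inj//||]; exact: ltn_trans szY.
split; first exact: (Hset_diff barK).
rewrite -(ua_div _ (hz s0)); have g0 := fY _ Y0; have ga := fY _ (gY a).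
have uy : y^-1 \is a GRing.unit.
  by rewrite -(unitrMl _ (ua_unit bar (zz s0))) (SU_unit (group_SU g0)).
have := groupM (groupV g0) ga; rewrite invrM ?ua_unit // mulrA mulrVK ?invrK //.
Qed.

Local Open Scope quotient_scope.

Let T := AbPair (@derived_sub _ G) (@derived_comm _ G).
Local Notation cl x := (\pi_(ab_quotient T) x).
Local Notation Gab := (abelianization G).

Let topX (x : ab_elt T) n : ab_top T (val x ^+ n).
Proof. by apply: groupX; apply: ab_eltP. Qed.

Let cl0 (x : ab_elt T) : cl x = 0 <-> derived_subgroup G (val x).
Proof.
have -> : (cl x = 0) <-> (0 = cl x) by split=> ->.
rewrite -[0]/(ab_zero T) /ab_zero; split=> [/ab_piP|h].
  by rewrite /= invr1 mul1r.
by apply/ab_piP; rewrite /= invr1 mul1r.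
Qed.

Let clM (x y : ab_elt T) : cl x + cl y = cl (ab_Elt (ab_mul_subproof x y)).
Proof. exact: ab_addE. Qed.

(** Defined on all matrices, the format of [hom_on]; the value 0 outside G is arbitrary. *)
Let cls_of (g : M) : Gab := if pselect (G g) is left h then cl (@ab_Elt _ T g h) else 0.

Let cls_ofE (x : ab_elt T) : cls_of (val x) = cl x.
Proof.
rewrite /cls_of; case: pselect => [h|]; last by case; apply: ab_eltP.
exact: ab_pi_val.
Qed.

Let cls_ofM : hom_on G cls_of.
Proof.
move=> g h gg gh; pose x : ab_elt T := @ab_Elt _ T g gg; pose y : ab_elt T := @ab_Elt _ T h gh.
by rewrite -[g]/(val x) -[h]/(val y) !cls_ofE clM -cls_ofE.
Qed.

Let cls_of_ex (X : Gab) : exists2 g, G g & cls_of g = X.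
Proof.
exists (val (repr X)); first exact: ab_eltP.
by rewrite cls_ofE reprK.
Qed.

Lemma abelian_value : exists h : {additive Gab -> L}, forall z (gz : G (ua z)), Hset z ->
  h (cls_of (ua z)) = z.1.
Proof.
have [psi [hpsi psiE]] := stabilizer_hom ar pL p2 e0 nuE hfin hp two.
have [h hE] := @ab_lift _ T _ psi hpsi (hom_on_derived hpsi).
exists h => z gz hz; pose x : ab_elt T := @ab_Elt _ T _ gz.
by rewrite -[ua z]/(val x) cls_ofE hE /= psiE.
Qed.

(** The classes of unipotent elements are killed by p and are separated by [abelian_value]. *)
Lemma tor_unbounded : unbounded (Tor Gab).
Proof.
have [h hE] := abelian_value => N; have [f [fI hf]] := many_unipotents N.
have tor a : cls_of (ua (f a)) \in @torsion Gab.
  have [hz gz] := hf a; apply/asboolP; exists p; first exact: ltn_trans p2.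
  by rewrite -(hom_onX cls_ofM) // ua_order // (hom_on1 cls_ofM).
exists (fun a => exist (fun X => X \in @torsion Gab) _ (tor a) : Tor Gab) => a b /(congr1 val) /= /(congr1 h).
have [hz gz] := hf a; have [hz' gz'] := hf b; rewrite !hE //; exact: fI.
Qed.

(** The target of [abelian_value] has characteristic p, so with m generators this map would take at
    most p^m values, whereas the unipotent elements give arbitrarily many. *)
Lemma not_finitely_generated : ~ z_finitely_generated Gab.
Proof.
move=> [m [x hx]]; have [h hE] := abelian_value.
have p0 : (0 < p)%N by exact: ltn_trans p2.
have /choice[c hc] := hx; have p1 a : (absz (a %% p)%Z < p)%N.
  have pz : p%:Z != 0 by rewrite -lt0n in p0 *; lia.
  have := ltz_mod a pz; have := modz_ge0 a pz; lia.
pose code (X : Gab) : {ffun 'I_m -> 'I_p} := [ffun j => Ordinal (p1 (c X j))].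
have hcode X Y : code X = code Y -> h X = h Y.
  move=> /ffunP e1; rewrite (hc X) (hc Y) !raddf_sum; apply: eq_bigr => j _.
  have := congr1 val (e1 j); rewrite !ffunE /= => e2; rewrite !raddfMz.
  have red (a : int) (u : L) : u *~ a = u *~ (absz (a %% p)%Z)%:Z.
    have pz : p%:Z != 0 by rewrite -lt0n in p0 *; lia.
    rewrite {1}(divz_eq a p) mulrzDr [(_ %/ _)%Z * _]mulrC mulrzA.
    rewrite -[u *~ p]pmulrn -mulr_natr (_ : p%:R = 0) ?mulr0; last by move: pL; rewrite inE => /andP[_ /eqP].
    rewrite mul0rz add0r.
    by rewrite gez0_abs // modz_ge0.
  by rewrite red e2 -red.
have [f [fI hf]] := many_unipotents #|{ffun 'I_m -> 'I_p}|.+1.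
suff /leq_card : injective (fun a => code (cls_of (ua (f a)))) by rewrite card_ord ltnn.
move=> a b /hcode; have [hz gz] := hf a; have [hz' gz'] := hf b.
by rewrite !hE //; apply: fI.
Qed.

Context (V0 : set vertex) (Es : set (set vertex)).
Hypothesis hV0 : orbit_reps (@act_v _ L R) G X V0.
Hypothesis hEs : orbit_reps (@act_e _ L R) G (edges bar nuP) Es.

Let enumerations : exists (vs : seq vertex) (es : seq (set vertex)),
  [/\ uniq vs, forall v, [set v | V0 v /\ ~ nonfree v] v <-> v \in vs,
      uniq es & forall E, [set E | Es E /\ free_edge bar nuP e G E] E <-> E \in es].
Proof.
have [vs [uv hv]] := finite_uniq (free_vertices_finite ar pL p2 e0 nuE hfin hp two hV0).
have [es [ue he]] := finite_uniq (free_edges_finite ar pL p2 e0 nuE hfin hp two hEs).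
by exists vs, es.
Qed.

(** p times the class map kills the elements g with g^p = 1, so [torsion_killed] applies to it. *)
Lemma torsion_exponent (X : Gab) : X \in @torsion Gab -> X *+ p = 0.
Proof.
move=> /asboolP[n n0 Xn]; have [g gg eX] := cls_of_ex X; rewrite -eX.
have [vs [es [uv hv ue he]]] := enumerations.
apply: (torsion_killed ar pL p2 e0 nuE hfin hp two hV0 hEs uv hv ue he
  (f := fun g => cls_of g *+ p) _ _ gg n0) => [a b ga gb|a ga a1|].
- by rewrite cls_ofM // mulrnDl.
- by rewrite -(hom_onX cls_ofM) // a1 (hom_on1 cls_ofM).
pose x : ab_elt T := @ab_Elt _ T g gg.
rewrite -[g]/(val x) -[_ ^+ n]/(val (ab_Elt (topX x n))); apply/cl0.
by rewrite -ab_piM -cls_ofE -[val x]/g eX.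
Qed.

Lemma rank_chi : [/\ (sum_v G V0 < +oo)%E, (sum_e G Es < +oo)%E &
  exists2 n, is_z_rank (mod_Tor Gab) n & n%:R <= - chi G V0 Es].
Proof.
have [vs [es [uv hv ue he]]] := enumerations.
have [c [ev ee]] := chi_formula ar pL p2 e0 nuE hfin hp two hV0 hEs uv hv ue he.
rewrite /chi ev ee !ltry; split=> //.
have [q [qD qs q0]] := mod_Tor_proj Gab.
have bound m (x : 'I_m -> mod_Tor Gab) : z_independent x -> (m + size vs <= size es)%N.
  apply: (rank_bound ar pL p2 e0 nuE hfin hp two hV0 hEs uv hv ue he (f := q \o cls_of)).
  - by move=> a b ga gb /=; rewrite cls_ofM // qD.
  - move=> a ga a1; apply: q0; apply/asboolP; exists p; first exact: ltn_trans p2.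
    by rewrite -(hom_onX cls_ofM) // a1 (hom_on1 cls_ofM).
  - by move=> y; have [x' <-] := qs y; have [a ga <-] := cls_of_ex x'; exists a.
pose P m := `[< exists x : 'I_m -> mod_Tor Gab, z_independent x >].
have P0 : exists m, P m.
  by exists 0%N; apply/asboolP; exists (fun _ => 0) => c' _ [].
have Pb m : P m -> (m <= size es)%N by move=> /asboolP[x /bound]; apply: leq_trans; apply: leq_addr.
case: (ex_maxnP P0 Pb) => n /asboolP[x ix] hn; exists n.
  by split; [exists x | move=> m y iy; apply: hn; apply/asboolP; exists y].
have := bound n x ix; rewrite -(ler_nat R) natrD /= => le.
by rewrite opprB opprD addrACA subrr addr0 lerBrDr.
Qed.

Section Cusps.
Context (dimL : \dim {:L} = 2%N).
Local Notation cusp o := (cusp_group dimL bar G o).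

(** Triangular matrices normalize U_a and, by the last clause, U_2a; this compares a cusp in the
    orbit of infinity with the standard one. *)
Lemma borel_conj b (t : L) z : SU b -> b *m E0 = t *: E0 -> Hset z ->
  exists z', [/\ Hset z', b * ua z * b^-1 = ua z' & z.1 = 0 -> z'.1 = 0].
Proof.
move=> sb bE hz; have [z0 [hz0 t0 eb]] := SU_borel barK sb bE.
have hs := Hset_scale barK t0 hz; have [_ UM UV] := Ua_subgroup dimL bar.
have e1 : b * ua z * b^-1 = ua z0 * ua (zscale bar t z) * (ua z0)^-1.
  have ub := SU_unit sb; apply: (mulIr ub); rewrite mulrVK // [in RHS]eb eb -!mulrA (ta_ua barK) //.
  by rewrite !mulrA mulrVK ?ua_unit.
have [||z' hz' ez'] := UM (ua z0 * ua (zscale bar t z)) (ua z0)^-1.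
- by apply: UM; [exists z0 | exists (zscale bar t z)].
- by have [_ []] := UV (ua z0) (ex_intro2 _ _ z0 hz0 erefl) => z1 hz1 ez1; exists z1.
exists z'; split=> //; first by rewrite e1 ez'.
move=> w0; have := congr1 (fun m : M => m 1 2%R) ez'.
by rewrite uaV !uaM !mxE /= w0 mulr0 addr0 subrr.
Qed.

Lemma cusp_exponent o (X : cusp o) : X *+ p = 0.
Proof.
rewrite -[X]reprK; set x := repr X; have [[_ [z hz <-] ex] gx] := ab_eltP x.
have ug := gz_unit bar o; have x1 : val x ^+ p = 1.
  have := conj_exp (ua z) p (h := (gz bar o)^-1); rewrite unitrV invrK ex => -> //.
  by rewrite ua_order // mulr1 mulVr.
have hx : ab_top (AbPair (@cusp_sub _ _ dimL bar G o) (@cusp_comm _ _ dimL bar G o)) (val x ^+ p).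
  by rewrite x1; case: (sgP (cusp_top dimL bar G o)).
by rewrite (ab_piM hx); apply: ab_pi_val; rewrite /= x1.
Qed.

(** The homomorphism of [stabilizer_hom] is invariant under conjugation by G, so it descends to the
    cusp group of o and separates the conjugates of the elements of [many_unipotents]. *)
Lemma cusp_unbounded o g : G g -> act_H bar g o None -> unbounded (cusp o).
Proof.
move=> gg ho; have ug := gz_unit bar o; have sg := group_SU gg.
pose b := g * (gz bar o)^-1.
have [t bE] : exists t, SU b /\ b *m E0 = t *: E0.
  have : flag bar None b.
    rewrite -ho; exists (gz bar o)^-1 => //; exists 1; last by rewrite mulr1.
    split; first exact: SU1.
    by move=> a c; rewrite mxE; case: eqP => // ->; rewrite ltnn.
  case=> b' [sb hb]; rewrite /= invr1 mul1r => <-; exists (b' 0 0); split=> //.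
  have [b1 b2] : b' 1 0 = 0 /\ b' 2%R 0 = 0 by split; apply: hb.
  rewrite mul_col3 !mulr0 !mulr1 !addr0 b1 b2.
  by apply/colP => -[[|[|[|n]]] //= hn]; rewrite !mxE /= ?mulr1 ?mulr0.
have [sb bE'] := bE; have ub := SU_unit sb.
have eg : g = b * gz bar o by rewrite /b mulrVK.
clearbody b.
have t0 : t != 0.
  by apply: contraNneq (E0_neq0 L) => t0; rewrite -(mulVmx3 E0 sb) bE' t0 scale0r mulmx0.
have bVE : b^-1 *m E0 = t^-1 *: E0.
  by rewrite -{1}[E0](scalerK t0) -bE' -scalemxAr (mulVmx3 _ sb).
have [psi [hpsi psiE]] := stabilizer_hom ar pL p2 e0 nuE hfin hp two.
have psiJ h (x : M) : G h -> G x -> psi (h^-1 * x * h) = psi x.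
  move=> gh gx; have gV := groupV gh; rewrite !hpsi ?(hom_onV hpsi) //; last exact: groupM.
  by rewrite addrAC addNr add0r.
pose CT := AbPair (@cusp_sub _ _ dimL bar G o) (@cusp_comm _ _ dimL bar G o).
have [||h hE] := @ab_lift _ CT _ psi.
- by move=> x y [_ gx] [_ gy]; apply: hpsi.
- move=> y [[_ [v hv <-] ey] gy].
  have hz : Hset (0, v) by rewrite /Defs.Hset /= /norm mul0r add0r.
  have [z' [hz' ez' z'0]] := borel_conj sb bE' hz.
  have e1 : g * y * g^-1 = ua z'.
    rewrite -ez' -ey eg invrM // !mulrA mulrK //; congr (_ * _).
    by rewrite mulrK.
  have gV := groupV gg.
  rewrite -(psiJ g^-1 y) // invrK e1 psiE ?z'0 // -e1.
  by apply: groupM gV; apply: groupM.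
move=> N; have [f [fI hf]] := many_unipotents N.
have hc a : cusp_top dimL bar G o (g^-1 * ua (f a) * g).
  have [hz gz] := hf a; split; last exact: groupM (groupM (groupV gg) gz) gg.
  have [z' [hz' ez' _]] := borel_conj (SU_inv sb) bVE hz.
  exists (ua z'); first by exists z'.
  by rewrite -ez' invrK eg invrM // !mulrA.
exists (fun a => \pi_(ab_quotient CT) (@ab_Elt _ CT _ (hc a)) : cusp o) => a c.
move=> /(congr1 h); rewrite !hE /=; have [hz gz] := hf a; have [hz' gz'] := hf c.
by rewrite !psiJ // !psiE //; apply: fI.
Qed.

End Cusps.

End Group.

(** * Countability and conclusion *)

Section Codes.
Context (F : finFieldType) (K : fieldType) (i : {rmorphism F -> K}).

(** A denominator and coordinates, all polynomials over a finite field, determine an element. *)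
Lemma function_field_codable : function_field i -> codable K.
Proof.
move=> /function_field_basis[t [n [b hb]]].
have /choice[h hh] : forall x, exists q : {poly F} * {ffun 'I_n -> {poly F}},
    ev i t q.1 != 0 /\ ev i t q.1 * x = \sum_j ev i t (q.2 j) * b j.
  move=> x; have [q [P [q0 hq]]] := hb x; exists (q, [ffun j => P j]); split=> //.
  by rewrite hq; apply: eq_bigr => j _; rewrite ffunE.
apply: (@codable_count _ ({poly F} * {ffun 'I_n -> {poly F}})%type h) => x y e.
by have [x0 hx] := hh x; have [_ hy] := hh y; apply: (mulfI x0); rewrite hx e hy.
Qed.

End Codes.

Lemma fieldExt_codable (k : fieldType) (L : fieldExtType k) : codable k -> codable L.
Proof.
move=> ck; have H := @codable_ffun L k 'I_(\dim {:L}) (fun x j => vector.coord (vbasis {:L}) j x) ck.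
apply: H => x y e.
rewrite (coord_vbasis (memvf x)) (coord_vbasis (memvf y)).
by apply: eq_bigr => j _; rewrite e.
Qed.

Lemma matrix_codable (L : fieldType) m n : codable L -> codable 'M[L]_(m, n).
Proof.
move=> cL.
have H := @codable_ffun 'M[L]_(m, n) L ('I_m * 'I_n)%type (fun A q => A q.1 q.2) cL.
apply: H => A A' e.
by apply/matrixP => a b; apply: (e (a, b)).
Qed.

Theorem proposition7p3
  (p r : nat) (F : finFieldType) (k : fieldType) (L : fieldExtType k)
  (iota : {rmorphism F -> k}) (bar : 'AEnd(L))
  (P : place iota) (Q : place (const_ext iota L)) (e : nat)
  (R : realType) (G : subgroup 'M[L]_3)
  (Sigma0 : set (option (L * L)))
  (V0 : set (set ('M[L]_3 * R))) (E0 : set (set (set ('M[L]_3 * R))))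
  (hp : prime p) (hF : #|F| = (p ^ r)%N) (hchar : 2%N \notin [pchar F])
  (hk : function_field iota)
  (dimL : \dim {:L} = 2%N)
  (hL : algebraically_closed_in (const_ext iota L))
  (hbar : exists x, bar x != x)
  (hQ : lies_above P Q e)
  (hQ_unique : forall (Q' : place (const_ext iota L)) (e' : nat),
     lies_above P Q' e' -> same_place Q' Q) :
  let A := regular_outside P in
  let B : set L := integral_closure A in
  let Gamma := SU_over bar B in
  let nuP := nu R Q e in
  finite_index_in G Gamma ->
  no_p'_torsion p G ->
  orbit_reps (act_H bar) G (Hinf bar) Sigma0 ->
  orbit_reps (@act_v _ L R) G (vertices bar nuP) V0 ->
  orbit_reps (@act_e _ L R) G (edges bar nuP) E0 ->
  let Gab := abelianization G in
  [/\ isomorphic (Tor Gab) (dsum (fun z : Sigma0 => cusp_group dimL bar G (val z))),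
      [/\ (sum_v G V0 < +oo)%E, (sum_e G E0 < +oo)%E &
        exists2 n, is_z_rank (mod_Tor Gab) n & n%:R <= - chi G V0 E0],
      exists I : Sigma0 -> frac_ideal B,
        (forall z, nontrivial_ideal (I z)) /\
        exists f : {additive Tor Gab -> dsum (fun z => fi_group (I z))},
          injective f /\ finite_index_image f
    & ~ z_finitely_generated Gab].
Proof.
move=> A B Gamma nuP hfin hp0 hS hV hE Gab.
have [e0 _] := hQ; have [d ar] := cover_arithmetic hk dimL hbar hQ hQ_unique.
have nuE x : nuP x = (Q x)%:~R / e%:R by [].
have pF : p \in [pchar F] := card_finPcharP hF hp.
have pL : p \in [pchar L] by rewrite (fmorph_pchar (const_ext iota L)).
have p2 : (2 < p)%N.
  rewrite ltn_neqAle prime_gt1 // andbT; apply/eqP => e2.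
  by move: hchar; rewrite e2 pF.
have two : (2 : L) != 0.
  rewrite -(rmorph_nat (const_ext iota L)) fmorph_eq0; apply: contra hchar => two; by rewrite inE /= two.
have barK := ar_barK ar.
have cL : codable L by apply: fieldExt_codable; apply: function_field_codable hk.
have cM : codable 'M[L]_3 by apply: matrix_codable.
have torE (X : Tor Gab) : X *+ p = 0.
  apply: val_inj; rewrite raddfMn /=.
  by apply: (torsion_exponent ar pL p2 e0 nuE hfin hp0 two hV hE); apply: (valP X).
have torU : unbounded (Tor Gab) := tor_unbounded ar pL p2 e0 nuE hfin hp0 two.
have torC : codable (Tor Gab).
  have vI : injective (\val : Tor Gab -> Gab) by apply: eqtype.val_inj.
  by apply: (codable_inj vI); apply: ab_codable cM.
have SC : codable Sigma0.
  have vI : injective (\val : Sigma0 -> option (L * L)) by apply: eqtype.val_inj.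
  apply: (codable_inj vI).
  have [c cI] := cL.
  apply: (@codable_count _ (option (nat * nat)) (omap (fun z => (c z.1, c z.2)))).
  by move=> [[a b]|] [[a' b']|] //= [/cI -> /cI ->].
(* One infinite summand suffices, and the representative of the orbit of infinity provides it. *)
have [z0 [g gg gz0]] : exists z : Sigma0, exists2 g, G g & act_H bar g (val z) None.
  have [_ h] := hS; have [z [[Sz [g gg gz]] _]] := h None I.
  by exists (exist _ z (mem_set Sz)), g.
split.
- apply: (exponent_iso hp) => //.
  + apply: dsum_exponent => z X; apply: (cusp_exponent ar pL p2).
  + by apply: dsum_codable => // z; apply: ab_codable.
  + apply: (@dsum_unbounded _ _ z0).
    exact: (cusp_unbounded ar pL p2 e0 nuE hfin hp0 two dimL gg gz0).
- exact: (rank_chi ar pL p2 e0 nuE hfin hp0 two hV hE).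
- have B1 : B 1 := ring1 ar; have B0 : B 0 := ring0 ar.
  have Bd : exists b : L, [/\ b != 0, B b & forall x, B x -> B (b * x)].
    by exists 1; split=> // [|x Bx]; rewrite ?oner_neq0 ?mul1r.
  (* B itself, with denominator 1. *)
  pose J := FracIdeal B0 (fun x y => @ar_sub _ _ _ _ _ _ _ ar x y)
    (fun x y => @ar_mul _ _ _ _ _ _ _ ar x y) Bd.
  exists (fun=> J); split; first by move=> z; exists 1 => //; apply: oner_neq0.
  have [|||||f [f' fK f'K]] := @exponent_iso p (Tor Gab) (dsum (fun _ : Sigma0 => fi_group J)) hp torE.
  + apply: dsum_exponent => z X; apply: val_inj; rewrite raddfMn /= -mulr_natr.
    by move: pL; rewrite inE => /andP[_ /eqP ->]; rewrite mulr0.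
  + exact: torC.
  + apply: dsum_codable => // z; have vI : injective (\val : fi_group J -> L) by apply: eqtype.val_inj.
    exact: (codable_inj vI cL).
  + exact: torU.
  + apply: (@dsum_unbounded _ _ z0) => N.
    have [f [fI hf]] := many_unipotents ar hfin two N.
    have Bf a : (f a).1 \in fi_pred J.
      have [hz gz] := hf a; apply/asboolP.
      by have [_ /(_ 1 2%R)] := group_Gamma hfin gz; rewrite mxE.
    by exists (fun a => exist (fun x => x \in fi_pred J) _ (Bf a) : fi_group J) => a b /(congr1 val) /fI.
  exists f; split; first exact: can_inj fK.
  (* f is bijective, so its image has index 1. *)
  by exists [:: 0] => y; exists 0, (f' y); rewrite f'K add0r mem_head.
exact: (not_finitely_generated ar pL p2 e0 nuE hfin hp0 two).
Qed.
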